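(* Let $\mathcal Y$ be a regular Euclidean polygon with at least $4$ edges and let $(\mathcal G,\mathcal Y)$ be a simple complex of hyperbolic groups such that: (1) In any vertex group, the intersection of two different edge groups is equal to the subgroup coming from the barycenter of $\mathcal Y$ (i.e. the image of the local group of the 2-dimensional face). (2) The universal cover $B$ of $(\mathcal G,\mathcal Y)$ is a hyperbolic metric space. (3) The action of $G=\pi_1(\mathcal G,\mathcal Y)$ on $B$ is acylindrical. Let $\mathcal Y_1$ be an edge of $\mathcal Y$, $(\mathcal G,\mathcal Y_1)$ the restriction of $(\mathcal G,\mathcal Y)$ to $\mathcal Y_1$ and $H=\pi_1(\mathcal G,\mathcal Y_1)$. Then $G$ is a hyperbolic group and $H$ is a quasiconvex subgroup of $G$.
   Context: View $\mathcal Y$ as a cell complex with one 2-dimensional face $\tau$, its edges and its vertices. A simple complex of groups over $\mathcal Y$ consists of a local group $G_\sigma$ for each face $\sigma$ and injective homomorphisms (local maps) $\psi_{\sigma,\sigma'}:G_\sigma\to G_{\sigma'}$ for each $\sigma'\subsetneq\sigma$ with $\psi_{\sigma',\sigma''}\psi_{\sigma,\sigma'}=\psi_{\sigma,\sigma''}$ (all twisting elements are trivial). Its fundamental group $G=\pi_1(\mathcal G,\mathcal Y)$ is the direct limit of this system of groups. It is developable if all natural maps $G_\sigma\to G$ are injective (this is automatic under condition (1) for polygons with at least four sides). The universal cover is $B=(G\times\bigsqcup_\sigma\sigma)/\sim$ with $(gg',x)\sim(g,x)$ for $g'\in G_\sigma$, $x\in\sigma$, and, for $\sigma'\subset\sigma$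 and $x\in\sigma'$, the pair $(g,x)$ with $x$ viewed in $\sigma$ is identified with $(g,x)$ with $x$ viewed in $\sigma'$; it carries the quotient metric obtained by gluing copies of the polygon, and $G$ acts on it by isometries. ''Complex of hyperbolic groups'' means that the local groups are hyperbolic, the local maps are quasiisometric embeddings and the universal cover is hyperbolic. Acylindrical (in the sense of Martin's combination theorem): there is a constant $A>0$ such that every subset of $B$ of diameter at least $A$ has finite pointwise stabilizer in $G$. If $\mathcal Y_1$ has endpoints $v,w$, then $H=G_v*_{G_{\mathcal Y_1}}G_w$, with the natural homomorphism $H\to G$; ''$H$ is a quasiconvex subgroup of $G$'' includes that this homomorphism is injective. *)

(* Defs.v *)
From HB Require Import structures.
From Stdlib Require Import Relation_Operators.
From mathcomp Require Import all_boot all_order all_algebra.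
From mathcomp Require Import all_classical all_reals all_analysis.
Set Implicit Arguments.
Unset Strict Implicit.
Unset Printing Implicit Defensive.
Import Order.TTheory GRing.Theory Num.Theory.

Local Open Scope classical_set_scope.
Local Open Scope ring_scope.
Local Open Scope quotient_scope.

(* Distances are plain functions d : X -> X -> R, so that the same notions
   apply to word metrics and to the quotient metric of a universal cover. *)
Section CoarseGeometry.
Variable R : realType.

Definition gromov_product (X : Type) (d : X -> X -> R) (w x y : X) : R :=
  (d x w + d y w - d x y) / 2.

Definition hyperbolic_space (X : Type) (d : X -> X -> R) : Prop :=
  exists2 delta : R, 0 <= delta & forall w x y z : X,
    Num.min (gromov_product d w x y) (gromov_product d w y z) - delta
      <= gromov_product d w x z.

Definition quasi_isometric_embedding (X Y : Type)
    (dX : X -> X -> R) (dY : Y -> Y -> R) (f : X -> Y) : Prop :=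
  exists K eps : R, [/\ 1 <= K, 0 <= eps & forall x x' : X,
    K^-1 * dX x x' - eps <= dY (f x) (f x') <= K * dX x x' + eps].

Definition diameter (X : Type) (d : X -> X -> R) (A : set X) : \bar R :=
  ereal_sup [set (d p.1 p.2)%:E | p in A `*` A].

End CoarseGeometry.

Section WordMetric.
Variables (R : realType) (G : groupType).
Implicit Types (S w : seq G) (g h : G).

Definition word_eval w : G := (\prod_(s <- w) s)%g.

Definition is_word S w : bool := all (fun s => (s \in S) || (s^-1%g \in S)) w.

Definition generates S : Prop :=
  forall g, exists2 w, is_word S w & word_eval w = g.

(* The infimum is over a nonempty set, hence a minimum, if S generates G. *)
Definition word_dist S g h : R :=
  inf [set (size w)%:R | w in
        [set w | is_word S w /\ (g * word_eval w)%g = h]].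

Definition hyperbolic_group : Prop :=
  exists2 S, generates S & hyperbolic_space (word_dist S).

(* A geodesic word w from g to h labels the geodesic of the Cayley graph whose
   vertices are the g * word_eval (take i w). *)
Definition geodesic_word S g h w : Prop :=
  [/\ is_word S w, (g * word_eval w)%g = h & (size w)%:R = word_dist S g h].

Definition quasiconvex_subset S (A : set G) : Prop :=
  exists K : R, forall g h w, A g -> A h -> geodesic_word S g h w ->
    forall i, (i <= size w)%N ->
      exists2 a, A a & word_dist S (g * word_eval (take i w))%g a <= K.

End WordMetric.

Definition group_qi_embedding (R : realType) (G H : groupType) (f : G -> H) :=
  exists (S : seq G) (T : seq H), [/\ generates S, generates T &
    quasi_isometric_embedding (word_dist R S) (word_dist R T) f].

Definition quasiconvex_subgroup (R : realType) (H G : groupType)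
    (f : {multiplicative H -> G}) : Prop :=
  injective f /\
  forall S : seq G, generates S -> quasiconvex_subset R S (range f).

(* Simple complexes of groups, over an index type I of faces with the relation
   ltI s' s meaning that s' is a proper face of s. *)
Record simple_complex (I : Type) (ltI : rel I) := SimpleComplex {
  local_group :> I -> groupType;
  local_map : forall s s', ltI s' s ->
    {multiplicative local_group s -> local_group s'};
  local_map_inj : forall s s' (h : ltI s' s), injective (local_map h);
  local_map_comp : forall s s' s''
      (h : ltI s' s) (h' : ltI s'' s') (h'' : ltI s'' s) x,
    local_map h' (local_map h x) = local_map h'' x }.

Record cocone (I : Type) (ltI : rel I) (C : simple_complex ltI)
    (L : groupType) := Cocone {
  leg :> forall s, {multiplicative C s -> L};
  legE : forall s s' (h : ltI s' s) x, leg s' (local_map C h x) = leg s x }.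

Definition is_direct_limit (I : Type) (ltI : rel I) (C : simple_complex ltI)
    (L : groupType) (phi : cocone C L) : Prop :=
  forall (K : groupType) (psi : cocone C K),
    exists2 f : {multiplicative L -> K},
      forall s x, f (phi s x) = psi s x &
      forall f' : {multiplicative L -> K},
        (forall s x, f' (phi s x) = psi s x) -> f' =1 f.

Section Restriction.
Variables (I : Type) (ltI : rel I) (C : simple_complex ltI) (P : pred I).

Definition restriction : simple_complex (relpre (val : {s | P s} -> I) ltI) :=
  @SimpleComplex {s | P s} (relpre val ltI) (fun s => C (val s))
    (fun s s' h => local_map C h)
    (fun s s' h => @local_map_inj _ _ C _ _ h)
    (fun s s' s'' h h' h'' => @local_map_comp _ _ C _ _ _ h h' h'').

End Restriction.

(* The cells of an n-gon; Edge i joins Vertex i to Vertex (i + 1 mod n). *)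
Inductive face (n : nat) := Polygon | Edge of 'I_n | Vertex of 'I_n.
Arguments Polygon {n}.

Section FaceType.
Variable n : nat.

Definition face_code (s : face n) : option ('I_n + 'I_n) :=
  match s with
  | Polygon => None | Edge i => Some (inl i) | Vertex i => Some (inr i)
  end.

Definition face_decode (c : option ('I_n + 'I_n)) : face n :=
  match c with
  | None => Polygon | Some (inl i) => Edge i | Some (inr i) => Vertex i
  end.

Lemma face_codeK : cancel face_code face_decode. Proof. by case. Qed.

HB.instance Definition _ := Finite.copy (face n) (can_type face_codeK).

End FaceType.

Definition proper_face n : rel (face n) := fun s' s =>
  match s', s with
  | Edge _, Polygon | Vertex _, Polygon => true
  | Vertex j, Edge i => (j == i) || (j == ordS i)
  | _, _ => false
  end.

Definition subface n : rel (face n) := fun s' s => (s' == s) || proper_face s' s.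

Definition polygon_of_groups n := simple_complex (@proper_face n).

Section Cells.
Variables (R : realType) (n : nat) (r : R).

Definition vertex_point (j : 'I_n) : R * R :=
  (r * cos (2 * pi * j%:R / n%:R), r * sin (2 * pi * j%:R / n%:R)).

(* The closed cell s of the regular n-gon of circumradius r centred at the
   origin, as the convex hull of its vertices. *)
Definition cell (s : face n) : set (R * R) :=
  [set p | exists2 t : 'I_n -> R,
     [/\ forall j, 0 <= t j,
         forall j, ~~ subface (Vertex j) s -> t j = 0 &
         \sum_j t j = 1] &
     p = (\sum_j t j * (vertex_point j).1, \sum_j t j * (vertex_point j).2)].

(* The norm on R * R in the library is the sup norm. *)
Definition euclidean_dist (p q : R * R) : R :=
  Num.sqrt ((p.1 - q.1) ^+ 2 + (p.2 - q.2) ^+ 2).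

End Cells.

Section UniversalCover.
Variables (R : realType) (n : nat) (r : R) (C : polygon_of_groups n).
Variables (G : groupType) (phi : cocone C G).

Definition precover := (G * {s : face n & cell r s})%type.

Definition pre_point (g : G) (s : face n) (x : cell r s) : precover :=
  (g, Tagged (fun s : face n => cell r s : Type) x).

Inductive gluing : precover -> precover -> Prop :=
| GlueGroup g s (g' : C s) (x : cell r s) :
    gluing (pre_point (g * phi s g')%g x) (pre_point g x)
| GlueFace g s s' (x : cell r s) (x' : cell r s') :
    proper_face s' s -> val x = val x' ->
    gluing (pre_point g x) (pre_point g x').

Definition glued (p q : precover) : bool :=
  `[< clos_refl_sym_trans precover gluing p q >].

Lemma glued_equiv : equiv_class_of glued.
Proof.
split.
- by move=> p; apply/asboolP; exact: rst_refl.
- by move=> p q; apply/asboolP/asboolP; exact: rst_sym.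
- move=> q p t /asboolP pq /asboolP qt; apply/asboolP.
  exact: rst_trans pq qt.
Qed.

Canonical glued_equiv_rel := EquivRelPack glued_equiv.

Definition universal_cover := {eq_quot glued_equiv_rel}.

Definition cover_point (g : G) (s : face n) (x : cell r s) : universal_cover :=
  \pi_({eq_quot glued_equiv_rel}) (pre_point g x).

(* [string b c l]: some chain from b to c, each step of which moves inside a
   single copy of a cell, has total Euclidean length l. *)
Inductive string (b : universal_cover) : universal_cover -> R -> Prop :=
| StringNil : string b b 0
| StringRcons g s (x y : cell r s) l :
    string b (cover_point g x) l ->
    string b (cover_point g y) (l + euclidean_dist (val x) (val y)).

Definition cover_dist (b c : universal_cover) : R := inf [set l | string b c l].

(* Independent of the representative, as [gluing] commutes with the left
   translations of the G factor. *)
Definition cover_act (h : G) (b : universal_cover) : universal_cover :=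
  \pi_({eq_quot glued_equiv_rel}) ((h * (repr b).1)%g, (repr b).2).

Definition pointwise_stabilizer (A : set universal_cover) : set G :=
  [set h | forall b, A b -> cover_act h b = b].

Definition acylindrical_action : Prop :=
  exists2 A : R, 0 < A & forall D : set universal_cover,
    (A%:E <= diameter cover_dist D)%E -> finite_set (pointwise_stabilizer D).

(* Hyperbolicity of the universal cover is included in the notion. *)
Definition complex_of_hyperbolic_groups : Prop :=
  [/\ forall s, hyperbolic_group R (C s),
      forall s s' (h : proper_face s' s),
        group_qi_embedding R (local_map C h) &
      hyperbolic_space cover_dist].

End UniversalCover.

Arguments cover_dist {R n} r {C G} phi b c.

Definition edge_groups_intersect_in_face n (C : polygon_of_groups n) : Prop :=
  forall (v i j : 'I_n) (hi : proper_face (Vertex v) (Edge i))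
      (hj : proper_face (Vertex v) (Edge j))
      (hv : proper_face (Vertex v) Polygon),
    i <> j ->
    range (local_map C hi) `&` range (local_map C hj) = range (local_map C hv).

Definition edge_restriction n (C : polygon_of_groups n) (e : 'I_n) :=
  restriction C (fun s => subface s (Edge e)).

(* Main.v *)
From HB Require Import structures.
From Stdlib Require Import Relation_Operators.
Require Import Defs.
From mathcomp Require Import all_boot all_order all_algebra.
From mathcomp Require Import all_classical all_reals all_analysis.
From mathcomp Require Import zify ring lra.
Set Implicit Arguments.
Unset Strict Implicit.
Unset Printing Implicit Defensive.
Import Order.TTheory GRing.Theory Num.Theory.
Local Open Scope ring_scope.

(* Cutting the polygon through the interiors of two edges writes G as an amalgam of the
   groups of two complementary arcs over the subgroup M generated by the two edge groups,
   itself an amalgam over the face group; the group of an arc is an iterated amalgam of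
   vertex groups over edge groups. Both kinds of amalgams satisfy a combination theorem.
   Hyperbolicity of a graph is used in the form of a quadratic isoperimetric inequality
   with arbitrarily small constant, where areas are line integrals against pairs of
   Lipschitz functions. A loop in the Cayley graph of an amalgam is a tree of loops in the
   factors closed up by geodesics of the edge group; if long reduced words conjugate only
   finitely many elements of the edge group into it, the total length of these geodesics is
   at most linear in the length of the loop, and the inequality passes to the amalgam.
   The finiteness comes from the action on B: up to a linear distortion the distance in B
   is the word length with respect to all vertex groups, and a reduced word with respect to
   a cut is not longer than this word length. For M one uses in addition that its elements
   are geodesic words for this length (by another cut), so that the hyperbolicity of B
   bounds the reduced length of the elements of M and v M v^-1 in common; such a subgroup is
   conjugate into an edge group. *)

(** * Line integrals along walks *)

(** The number of sides enters through the cuts. In one vertex group, two edge groups that meet in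
    the face group may satisfy further relations; along an arc of at least two vertices the edge
    groups at its two ends lie on different sides of an inner edge and so generate their amalgam
    over the face group. Four sides allow cuts both of whose arcs have two vertices. Such a cut also
    shows that the local groups embed in [G]. The isoperimetric constant has to be arbitrarily small
    because a quasiisometry and the passage to an amalgam both multiply lengths by an uncontrolled
    factor [A], hence areas by [A ^ 2]. Conversely, truncated distances to two adjacent sides of a
    quadrilateral bound its area from below, which gives back the stability of quasigeodesics. Edge
    geodesics are controlled generation by generation: up to boundedly many points per side, a point
    of such a geodesic is close to an edge geodesic of the next generation. A point surviving [k]
    generations is near a coset reached by a reduced word of length [k], and the finiteness of
    conjugated elements leaves boundedly many such points. *)

Section Walks.
Variables (X : Type) (r : rel X).
Implicit Types (f g : X -> int) (x y : X) (p q : seq X).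

Definition lip (c : nat) f := forall x y, r x y -> `|f x - f y| <= c%:Z.

(* Twice the trapezoidal line integral of f dg along a walk. *)
Fixpoint circ f g x p : int :=
  if p is y :: p' then (f x + f y) * (g y - g x) + circ f g y p' else 0.

(* Hyperbolicity as a quadratic isoperimetric inequality with arbitrarily small leading
   constant; the area of a loop is replaced by its line integrals against all pairs of
   Lipschitz functions, so that no filling discs are needed. *)
Definition sq_hyperbolic := forall e c : nat, exists K : nat, forall f g,
  lip c f -> lip c g -> forall x p, path r x p -> last x p = x ->
  e%:Z * `|circ f g x p| <= (size p ^ 2 + K * size p)%N%:Z.

Definition revwalk x p := rev (belast x p).

Lemma circ_cat f g x p q :
  circ f g x (p ++ q) = circ f g x p + circ f g (last x p) q.
Proof. by elim: p x => [|y p IH] x /=; rewrite ?add0r // IH addrA. Qed.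

Lemma last_revwalk x p : last (last x p) (revwalk x p) = x.
Proof.
rewrite /revwalk; case: p => //= y p.
by rewrite rev_cons last_rcons.
Qed.

Lemma size_revwalk x p : size (revwalk x p) = size p.
Proof. by rewrite /revwalk size_rev size_belast. Qed.

Lemma circ_revwalk f g x p : circ f g (last x p) (revwalk x p) = - circ f g x p.
Proof.
elim: p x => [|y p IH] x; first by rewrite oppr0.
rewrite /revwalk /= rev_cons -cats1 circ_cat.
have -> : last (last y p) (rev (belast y p)) = y by exact: last_revwalk.
by rewrite (IH y) /=; ring.
Qed.

Lemma path_revwalk x p : symmetric r -> path r x p ->
  path r (last x p) (revwalk x p).
Proof.
move=> rS; rewrite /revwalk rev_path; apply: sub_path => u v.
by rewrite rS.
Qed.

Lemma lip_path c f x p : lip c f -> path r x p ->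
  `|f (last x p) - f x| <= (c * size p)%N%:Z.
Proof.
move=> fc; elim: p x => [|y p IH] x /=; first by move=> _; lia.
by case/andP=> /fc xy /IH; move: xy; lia.
Qed.

Lemma circ_le c f g x p (M : nat) : lip c g -> path r x p ->
  (forall q1 q2, p = q1 ++ q2 -> `|f (last x q1)| <= M%:Z) ->
  `|circ f g x p| <= (2 * M * c * size p)%N%:Z.
Proof.
move=> gc; elim: p x => [|y p IH] x /=; first by move=> *; lia.
case/andP=> xy yp fM.
have fx : `|f x| <= M%:Z by apply: (fM [::] (y :: p)).
have fy : `|f y| <= M%:Z by apply: (fM [:: y] p).
have := IH _ yp; case/(_ _)/Wrap => [q1 q2 e|[H]].
  by apply: (fM (y :: q1) q2); rewrite e.
have gxy := gc _ _ xy.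
have h : `|(f x + f y) * (g y - g x)| <= (2 * M * c)%N%:Z.
  rewrite normrM -[(2 * M * c)%N%:Z]/((2 * M)%N%:Z * c%:Z).
  by apply: ler_pM; lia.
by move: h H; lia.
Qed.

Lemma circ_shift f g x p a :
  circ (fun z => f z - a) g x p = circ f g x p - 2 * a * (g (last x p) - g x).
Proof. by elim: p x => [|y p IH] x /=; [ring | rewrite IH; ring]. Qed.

(** Around a loop, [f] may be shifted to vanish at the base point; it is then at most [c] times the
    length. This crude bound serves for short loops. *)
Lemma circ_closed_le c f g x p : lip c f -> lip c g -> path r x p ->
  last x p = x -> `|circ f g x p| <= (2 * c ^ 2 * size p ^ 2)%N%:Z.
Proof.
move=> fc gc px lx.
have := circ_shift f g x p (f x); rewrite lx subrr mulr0 subr0 => <-.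
have := @circ_le c (fun z => f z - f x) g x p (c * size p) gc px.
case/(_ _)/Wrap => [q1 q2 e|[]].
  have := lip_path fc (_ : path r x q1); rewrite e size_cat.
  by case/(_ _)/Wrap; [move: px; rewrite e cat_path => /andP[] | case; nia].
by move/le_trans; apply; nia.
Qed.

Definition near (k : nat) x y :=
  exists p, [/\ path r x p, last x p = y & (size p <= k)%N].

Lemma near_sym k x y : symmetric r -> near k x y -> near k y x.
Proof.
move=> rS [p [px <- pk]]; exists (revwalk x p).
by rewrite size_revwalk path_revwalk // last_revwalk.
Qed.

Lemma near_trans k l x y z : near k x y -> near l y z -> near (k + l) x z.
Proof.
move=> [p [px py pk]] [q [qy qz ql]]; exists (p ++ q).
by rewrite cat_path px py qy last_cat py qz size_cat leq_add.
Qed.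

Lemma near0 x : near 0 x x.
Proof. by exists [::]. Qed.

Lemma circ_two_walks c f g x p q k l : symmetric r -> lip c f -> lip c g ->
  path r x p -> path r x q -> last x p = last x q ->
  (size p <= k)%N -> (size q <= l)%N ->
  `|circ f g x p - circ f g x q| <= (2 * c ^ 2 * (k + l) ^ 2)%N%:Z.
Proof.
move=> rS fc gc px qx e pk ql.
have := @circ_closed_le c f g x (p ++ revwalk x q) fc gc.
rewrite cat_path px e path_revwalk // last_cat e last_revwalk circ_cat e.
rewrite circ_revwalk size_cat size_revwalk => /(_ isT erefl) /le_trans; apply.
by rewrite lez_nat leq_mul2l leq_exp2r // leq_add // orbT.
Qed.

(** Connecting walks between points of equal index cut the strip into loops of length at most
    [2 * k + 2]. The extra loop in [(size p).+1] compares the last connecting walk with the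
    prescribed [c1]. *)
Lemma strip c f g k p q x y c0 c1 : symmetric r -> lip c f -> lip c g ->
  size p = size q -> path r x p -> path r y q ->
  (forall i, (i <= size p)%N -> near k (nth x (x :: p) i) (nth x (y :: q) i)) ->
  path r x c0 -> last x c0 = y -> (size c0 <= k)%N ->
  path r (last x p) c1 -> last (last x p) c1 = last y q -> (size c1 <= k)%N ->
  `|circ f g x p + circ f g (last x p) c1 - circ f g y q - circ f g x c0|
    <= ((size p).+1 * (2 * c ^ 2 * (2 * k + 2) ^ 2))%N%:Z.
Proof.
move=> rS fc gc; elim: p q x y c0 => [|a p IH] [|b q] x y c0 //=.
  move=> _ _ _ _ pc0 lc0 sc0 pc1 lc1 sc1.
  have := @circ_two_walks c f g x c1 c0 k k rS fc gc pc1 pc0.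
  by rewrite lc0 lc1 => /(_ erefl sc1 sc0) /le_trans H; rewrite add0r subr0; apply: H; nia.
move=> [spq] /andP[xa ap] /andP[yb bq] nk pc0 lc0 sc0 pc1 lc1 sc1.
have [d [pd ld sd]] := nk 1%N isT; rewrite /= in pd ld.
have := IH q a b d spq ap bq _ pd ld sd pc1 lc1 sc1.
case/(_ _)/Wrap => [i ip|[H]].
  have := nk i.+1 ip; rewrite /=.
  have iq : (i < size (b :: q))%N by rewrite /= -spq.
  rewrite (set_nth_default a x (s := a :: p) ip).
  rewrite (set_nth_default a x (s := b :: q) iq). by [].
have := @circ_two_walks c f g x (a :: d) (c0 ++ [:: b]) (k + 1) (k + 1) rS fc gc.
rewrite /= xa pd cat_path pc0 /= lc0 yb ld last_cat /= circ_cat lc0 /=.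
rewrite size_cat addn1 addn1 ltnS sd ltnS sc0.
move=> /(_ isT isT erefl isT isT).
have -> : (k.+1 + k.+1 = 2 * k + 2)%N by lia.
move: H; set u := (2 * c ^ 2 * _)%N; rewrite [in X in _ -> _ -> X]mulSn.
by move: (_.+1 * u)%N => v; lia.
Qed.

End Walks.

(** * The four point condition bounds areas *)

Section Splitting.
Variables (X : Type) (r : rel X).
Hypothesis rS : symmetric r.
Implicit Types (x y : X) (p q : seq X).

Lemma revwalk_cat x p q :
  revwalk x (p ++ q) = revwalk (last x p) q ++ revwalk x p.
Proof. by rewrite /revwalk belast_cat rev_cat. Qed.

Lemma nth_last_take x p i : (i <= size p)%N ->
  nth x (x :: p) i = last x (take i p).
Proof.
by elim: p x i => [|y p IH] x [|i] //= ip; rewrite (set_nth_default y) // IH.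
Qed.

Lemma path_take_last x p i : path r x p ->
  path r x (take i p) /\ path r (last x (take i p)) (drop i p).
Proof. by rewrite -{1}(cat_take_drop i p) cat_path => /andP[]. Qed.

Lemma split_walk3 f g x p a b : path r x p -> (a + b <= size p)%N ->
  exists m, [/\ path r (last x (take a p)) m,
    last (last x (take a p)) m = last (last x p) (take b (revwalk x p)),
    size m = (size p - a - b)%N &
    circ f g x p = circ f g x (take a p) + circ f g (last x (take a p)) m
                   - circ f g (last x p) (take b (revwalk x p))].
Proof.
move=> px ab.
pose m := take (size p - a - b) (drop a p); pose p3 := drop (size p - a - b) (drop a p).
have pE : p = (take a p ++ m) ++ p3 by rewrite -catA cat_take_drop cat_take_drop.
have s3 : size p3 = b by rewrite !size_drop; lia.
have rE : take b (revwalk x p) = revwalk (last x (take a p ++ m)) p3.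
  by rewrite {1}pE revwalk_cat take_size_cat // size_revwalk.
have lE : last x p = last (last x (take a p ++ m)) p3 by rewrite {1}pE last_cat.
exists m; split.
- by move: px; rewrite {1}pE !cat_path => /andP[/andP[]].
- by rewrite rE lE last_revwalk last_cat.
- by rewrite size_takel // size_drop; lia.
- by rewrite rE lE circ_revwalk {1}pE !circ_cat last_cat; ring.
Qed.

(* The complement of the three corner strips is a closed walk of bounded length. *)
Lemma triangle_of_strips c f g x p q t a b e k c0 sx sy sz :
  let y := last x p in let z := last x q in
  let B := (2 * c ^ 2 * (2 * k + 2) ^ 2)%N in
  lip r c f -> lip r c g -> path r x p -> path r x q -> path r y t -> last y t = z ->
  (a + b <= size p)%N -> (a + e <= size q)%N -> (b + e <= size t)%N ->
  (size p <= a + b + c0 + 2)%N -> (size q <= a + e + c0 + 2)%N ->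
  (size t <= b + e + c0 + 2)%N ->
  path r (last x (take a p)) sx -> (size sx <= k)%N ->
  last (last x (take a p)) sx = last x (take a q) ->
  `|circ f g x (take a p) + circ f g (last x (take a p)) sx - circ f g x (take a q)|
    <= (a.+1 * B)%N%:Z ->
  path r (last y (take b (revwalk x p))) sy -> (size sy <= k)%N ->
  last (last y (take b (revwalk x p))) sy = last y (take b t) ->
  `|circ f g y (take b (revwalk x p)) + circ f g (last y (take b (revwalk x p))) sy
    - circ f g y (take b t)| <= (b.+1 * B)%N%:Z ->
  path r (last z (take e (revwalk x q))) sz -> (size sz <= k)%N ->
  last (last z (take e (revwalk x q))) sz = last z (take e (revwalk y t)) ->
  `|circ f g z (take e (revwalk x q)) + circ f g (last z (take e (revwalk x q))) sz
    - circ f g z (take e (revwalk y t))| <= (e.+1 * B)%N%:Z ->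
  `|circ f g x p + circ f g y t - circ f g x q|
    <= ((2 * (2 * k + 2) ^ 2 * 3 + 2 * ((2 * (c0 + 2) + k) + ((c0 + 2) + 2 * k)) ^ 2)
        * c ^ 2 * (size p + size q + size t).+1)%N%:Z.
Proof.
move=> y z B fc gc pp pq pt yz sp1 sq1 st1 sp2 sq2 st2.
move=> psx ssx lsx hx psy ssy lsy hy psz ssz lsz hz.
have [mp [pmp lmp smp cmp]] := split_walk3 f g pp sp1.
have [mq [pmq lmq smq cmq]] := split_walk3 f g pq sq1.
have [mt [pmt lmt smt cmt]] := split_walk3 f g pt st1.
rewrite -/y -/z ?yz in lmp lmq lmt cmp cmq cmt.
have hm := @circ_two_walks _ r c f g (last x (take a p)) (mp ++ sy ++ mt) (sx ++ mq ++ sz)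
  (2 * (c0 + 2) + k) ((c0 + 2) + 2 * k) rS fc gc.
rewrite !cat_path pmp lmp psy lsy pmt psx lsx pmq lmq psz !last_cat lmp lsy lmt in hm.
rewrite lsx lmq lsz !size_cat !circ_cat lmp lsy lsx lmq in hm.
have {}hm := hm isT isT erefl.
have s1 : (size mp + (size sy + size mt) <= 2 * (c0 + 2) + k)%N.
  by clear - smp smt ssy sp2 st2; lia.
have s2 : (size sx + (size mq + size sz) <= c0 + 2 + 2 * k)%N.
  by clear - ssx smq ssz sq2; lia.
have {}hm := hm s1 s2.
rewrite cmp cmq cmt.
rewrite {}/B in hx hy hz.
have E : forall s, (2 * c ^ 2 * s ^ 2 = c ^ 2 * (2 * s ^ 2))%N by move=> s; rewrite -mulnA mulnCA.
rewrite !E in hx hy hz hm.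
move: hx hy hz hm; set A := (2 * (2 * k + 2) ^ 2)%N; set D := (2 * (_ + _) ^ 2)%N; set C := (c ^ 2)%N.
move=> hx hy hz hm.
suff hab : (a.+1 * (C * A) + b.+1 * (C * A) + e.+1 * (C * A) + C * D
  <= (A * 3 + D) * C * (size p + size q + size t).+1)%N.
  move: hx hy hz hm hab; move: (a.+1 * _)%N (b.+1 * _)%N (e.+1 * _)%N (C * D)%N (_ * _.+1)%N.
  by clear; lia.
clear - sp1 sq1 st1.
rewrite -2!mulnDl.
have : ((a.+1 + b.+1 + e.+1) * (C * A) <= (3 * (size p + size q + size t).+1) * (C * A))%N.
  by rewrite leq_mul2r; apply/orP; right; lia.
by move: (size p + size q + size t)%N => s; nia.
Qed.

End Splitting.

Section Polygons.
Variables (X : Type) (r : rel X).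
Hypothesis rS : symmetric r.
Variables (w : X -> X -> seq X) (c0 K : nat).
Hypothesis w_path : forall x y, path r x (w x y).
Hypothesis w_last : forall x y, last x (w x y) = y.
Hypothesis w_size : forall x p, path r x p -> (size (w x (last x p)) <= size p + c0)%N.
Hypothesis triangle : forall c f g x y z, lip r c f -> lip r c g ->
  `|circ f g x (w x y) + circ f g y (w y z) - circ f g x (w x z)|
    <= (K * c ^ 2 * (size (w x y) + size (w x z) + size (w y z)).+1)%N%:Z.

(** Triangulation from the base point: each of the [j] arcs of length at most [s] is replaced by its
    chord, and a triangle with apex [x] is cut off. The last term accounts for the loop [w x x], of
    length at most [c0]. *)
Lemma polygon_bound c f g j x p s L : lip r c f -> lip r c g ->
  path r x p -> (size p <= j * s)%N -> (size p <= L)%N ->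
  `|circ f g x p - circ f g x (w x (last x p))|
  <= (j * (2 * c ^ 2 * (2 * s + c0) ^ 2 + K * c ^ 2 * (3 * L + 3 * c0).+1)
      + 2 * c ^ 2 * c0 ^ 2)%N%:Z.
Proof.
move=> fc gc; elim: j p => [|j IH] p px pj pL.
  have -> : p = [::] by apply: size0nil; clear - pj; lia.
  have := @circ_two_walks _ r c f g x [::] (w x x) 0 c0 rS fc gc isT (w_path _ _).
  rewrite w_last; move/(_ erefl isT).
  by case/(_ _)/Wrap; [have := @w_size x [::] isT | case; rewrite add0n].
pose y := last x (take (j * s) p); pose q := drop (j * s) p.
have [p1 p2] := path_take_last (j * s) px.
have sq : (size q <= s)%N by rewrite size_drop; clear - pj; lia.
have sq' : (size q <= L)%N by rewrite size_drop; clear - pL; lia.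
have st : (size (take (j * s) p) <= L)%N by rewrite size_take_min; clear - pL; lia.
have st' : (size (take (j * s) p) <= j * s)%N by rewrite size_take_min geq_minl.
have zE : last y q = last x p by rewrite -last_cat cat_take_drop.
have h1 := IH _ p1 st' st.
have s2 := w_size p2; rewrite -/y -/q zE in s2.
have h2 := @circ_two_walks _ r c f g y q (w y (last x p)) s (s + c0) rS fc gc p2 (w_path _ _).
rewrite w_last zE in h2.
have {}h2 := h2 erefl sq (leq_trans s2 (leq_add sq (leqnn _))).
have h3 := triangle x y (last x p) fc gc.
have s1 := w_size p1; have s3 := w_size px; rewrite -/y in s1.
have s4 : (size (w x y) + size (w x (last x p)) + size (w y (last x p)) <= 3 * L + 3 * c0)%N.
  by clear - s1 s2 s3 st sq' pL; lia.
have h4 : (K * c ^ 2 * (size (w x y) + size (w x (last x p)) + size (w y (last x p))).+1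
     <= K * c ^ 2 * (3 * L + 3 * c0).+1)%N by rewrite leq_mul2l ltnS s4 orbT.
have -> : circ f g x p = circ f g x (take (j * s) p) + circ f g y q.
  by rewrite -circ_cat cat_take_drop.
move: h1 h2 h3 h4; rewrite -/y.
rewrite [in X in _ -> _ -> _ -> _ -> X]mulSn.
have -> : (s + (s + c0) = 2 * s + c0)%N by rewrite addnA mul2n addnn.
move: (2 * c ^ 2 * _ ^ 2)%N (K * _ * _.+1)%N (K * _ * _.+1)%N (2 * _ * _)%N => A B B' D.
by move: (j * _)%N => J; clear; lia.
Qed.

(* Cutting a loop of length L into m arcs gives m short loops of length 2L/m, of
   area O(L^2/m), and m geodesic triangles of area O(L). *)
Lemma polygon_sq_hyperbolic : sq_hyperbolic r.
Proof.
move=> e c; pose C := (c ^ 2)%N.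
(* The [m] short loops of length about [2 * L / m] have total area about [8 * C * L ^ 2 / m] by the
   crude bound, so this [m] brings [e] times it below [L ^ 2]. [M] collects the rounding errors. *)
pose m := (8 * e * C).+1; pose M := (2 * m + m * c0)%N.
exists (M + M ^ 2 + (e * m * K * C * (4 + 3 * c0) + 4 * e * C * c0 ^ 2))%N.
move=> f g fc gc x0 p0 pp0 lp0.
pose L := size p0; pose s := (L %/ m).+1.
have hms : (L <= m * s)%N by rewrite mulnC ltnW // ltn_ceil.
have hms' : (m * s <= L + m)%N by rewrite /s mulnS addnC leq_add2r mulnC leq_divM.
have h1 := polygon_bound fc gc pp0 hms (leqnn _).
have h2 := circ_closed_le fc gc (w_path x0 x0) (w_last x0 x0).
have h3 : (size (w x0 x0) <= c0)%N by have := @w_size x0 [::] isT.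
case: (posnP L) => [/size0nil ->|L0]; first by rewrite normr0 mulr0.
rewrite lp0 -/L in h1.
have h2' : (2 * c ^ 2 * size (w x0 x0) ^ 2 <= 2 * C * c0 ^ 2)%N.
  by rewrite leq_mul2l leq_exp2r // h3 orbT.
have h5 : (e * (m * (2 * C * (2 * s + c0) ^ 2)) <= L ^ 2 + L * M + M ^ 2)%N.
  have a1 : ((2 * (m * s) + m * c0) ^ 2 <= (2 * L + M) ^ 2)%N.
    by rewrite leq_exp2r // /M; clear - hms'; move: (m * s)%N hms' => ms; lia.
  have ab : (2 * e * C * (2 * (m * s) + m * c0) ^ 2 <= 2 * e * C * (2 * L + M) ^ 2)%N.
    by rewrite leq_mul2l a1 orbT.
  rewrite -(leq_pmul2l (m := m)) //.
  have -> : (m * (e * (m * (2 * C * (2 * s + c0) ^ 2))) = 2 * e * C * (2 * (m * s) + m * c0) ^ 2)%N.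
    by clear; ring.
  apply: (leq_trans ab).
  have -> : (2 * e * C * (2 * L + M) ^ 2 = (8 * e * C) * (L ^ 2 + L * M) + 2 * e * C * M ^ 2)%N.
    by clear; ring.
  rewrite [leqRHS]mulnDr leq_add //; first by rewrite leq_mul2r /m leqnSn orbT.
  rewrite leq_mul2r; apply/orP; right; rewrite /m -!mulnA.
  by clear; move: (e * C)%N => u; lia.
have h6 : (K * C * (3 * L + 3 * c0).+1 <= K * C * ((4 + 3 * c0) * L))%N.
  rewrite leq_mul2l; apply/orP; right.
  have : (c0 <= c0 * L)%N by apply: leq_pmulr.
  by rewrite mulnDl -mulnA; move: (c0 * L)%N => u; clear - L0; lia.
have h7 : (e * (m * (2 * C * (2 * s + c0) ^ 2 + K * C * (3 * L + 3 * c0).+1)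
    + 2 * C * c0 ^ 2 + 2 * C * c0 ^ 2)
  <= L ^ 2 + (M + M ^ 2 + (e * m * K * C * (4 + 3 * c0) + 4 * e * C * c0 ^ 2)) * L)%N.
  have a1 : (e * (m * (K * C * (3 * L + 3 * c0).+1)) <= e * m * K * C * (4 + 3 * c0) * L)%N.
    by rewrite -!mulnA leq_mul2l leq_mul2l !mulnA; move: h6; rewrite !mulnA => ->; rewrite !orbT.
  have a2 : (4 * e * C * c0 ^ 2 <= 4 * e * C * c0 ^ 2 * L)%N by apply: leq_pmulr.
  have a3 : (M ^ 2 <= M ^ 2 * L)%N by apply: leq_pmulr.
  have a4 : (e * (2 * C * c0 ^ 2) + e * (2 * C * c0 ^ 2) = 4 * e * C * c0 ^ 2)%N by clear; ring.
  have d1 A B D : (e * (m * (A + B) + D + D) = e * (m * A) + e * (m * B) + (e * D + e * D))%N.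
    by clear; ring.
  have d2 U V : ((M + M ^ 2 + (U + V)) * L = L * M + M ^ 2 * L + (U * L + V * L))%N.
    by clear; ring.
  rewrite d1 d2 a4; move: h5 a1 a2 a3.
  move: (e * (m * _))%N (e * (m * _))%N (4 * _ * _ * _)%N (4 * _ * _ * _ * L)%N (M ^ 2 * L)%N.
  by move: (e * _ * _ * _ * _ * L)%N (M ^ 2)%N (L * M)%N (L ^ 2)%N; clear; lia.
rewrite -/L; apply: le_trans (_ : (e%:Z * (_ + _ + _)%N%:Z <= _)); last first.
  by rewrite -PoszM lez_nat; exact: h7.
apply: ler_wpM2l => //.
have abs_le (a b : int) (A B D : nat) : `|a - b| <= (A + D)%N%:Z -> `|b| <= B%:Z ->
    (B <= D)%N -> `|a| <= (A + D + D)%N%:Z by clear; lia.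
exact: (abs_le _ _ _ _ _ h1 h2 h2').
Qed.

End Polygons.

(** * Thin triangles from the four point condition *)

Section FourPoint.
Variables (R : realType) (X : Type) (r : rel X) (d : X -> X -> R) (c0 : nat).
Hypothesis rS : symmetric r.
Hypothesis dS : forall x y, d x y = d y x.
Hypothesis d0 : forall x, d x x = 0.
Hypothesis dT : forall x y z, d x z <= d x y + d y z.
Hypothesis d1 : forall x y, r x y -> d x y <= 1.

Definition coarse_geodesic x p :=
  path r x p /\ (size p)%:R <= d x (last x p) + c0%:R.

Hypothesis geo : forall x y, exists2 p, coarse_geodesic x p & last x p = y.

Lemma dist_path x p : path r x p -> d x (last x p) <= (size p)%:R.
Proof.
elim: p x => [|y p IH] x /=; first by rewrite d0.
case/andP=> /d1 xy /IH yp; apply: (le_trans (dT _ y _)).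
by rewrite -natr1 addrC lerD.
Qed.

Lemma coarse_geodesic_rev x p :
  coarse_geodesic x p -> coarse_geodesic (last x p) (revwalk x p).
Proof.
move=> [px sp]; split; first exact: path_revwalk.
by rewrite size_revwalk last_revwalk dS.
Qed.

Lemma coarse_geodesic_product x p i : coarse_geodesic x p -> (i <= size p)%N ->
  i%:R - c0%:R <= gromov_product d x (last x (take i p)) (last x p).
Proof.
move=> [px sp] ip; have [p1 p2] := path_take_last i px.
have := dist_path p2; rewrite -last_cat cat_take_drop size_drop natrB // => h2.
have := dT x (last x (take i p)) (last x p); have := dist_path p1.
rewrite size_takel // /gromov_product => h1 h3.
rewrite (dS _ x) (dS _ x) ler_pdivlMr //; lra.
Qed.

Hypothesis hyp : hyperbolic_space d.

(** With base point [x], the products of [y] with the end of [p], of the two ends, and of the end of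
    [q] with [z] are all at least [i - c0]. Two applications of the four point condition give a
    product of [y] and [z] of at least [i - c0 - 2 * del], hence a distance of at most
    [2 * c0 + 4 * del]; the third [c0] is the defect of the connecting walk. *)
Lemma fellow_travel : exists k, forall x p q i,
  coarse_geodesic x p -> coarse_geodesic x q ->
  (i <= size p)%N -> (i <= size q)%N ->
  i%:R <= gromov_product d x (last x p) (last x q) ->
  near r k (last x (take i p)) (last x (take i q)).
Proof.
have [del del0 h4] := hyp.
exists (3 * c0 + Num.bound (4 * del))%N => x p q i gp gq ip iq ix.
have := coarse_geodesic_product gp ip; have := coarse_geodesic_product gq iq.
set y := last x (take i p); set z := last x (take i q) => hz hy.
have [w [pw sw] lw] := geo y z; exists w; split=> //.
have := h4 x y (last x p) (last x q); have := h4 x y (last x q) z.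
have hz' : i%:R - c0%:R <= gromov_product d x (last x q) z.
  by move: hz; rewrite /gromov_product (dS z (last x q)); lra.
have dyx : d y x <= i%:R.
  have [p1 _] := path_take_last i gp.1.
  by have := dist_path p1; rewrite size_takel // dS.
have dzx : d z x <= i%:R.
  have [p1 _] := path_take_last i gq.1.
  by have := dist_path p1; rewrite size_takel // dS.
have hb := archi_boundP (mulr_ge0 (ler0n R 4) del0).
have c0R : 0 <= c0%:R :> R by [].
move=> A B.
have B' : i%:R - c0%:R - del <= gromov_product d x y (last x q).
  apply: le_trans B; rewrite lerD2r le_min hy /=; lra.
have A' : i%:R - c0%:R - del - del <= gromov_product d x y z.
  by apply: le_trans A; rewrite lerD2r le_min B' /=; lra.
rewrite -(ler_nat R) natrD natrM; apply: (le_trans sw); rewrite lw.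
by move: A'; rewrite /gromov_product ler_pdivlMr //; lra.
Qed.

(** The Gromov products at the three corners cut the sides as in a tripod. Their integer parts [a],
    [b], [e] are the lengths of three corner strips, which [fellow_travel] makes thin, and what
    remains of the triangle has bounded length. *)
Lemma coarse_triangle : exists K : nat, forall c f g x p q t,
  lip r c f -> lip r c g ->
  coarse_geodesic x p -> coarse_geodesic x q -> coarse_geodesic (last x p) t ->
  last (last x p) t = last x q ->
  `|circ f g x p + circ f g (last x p) t - circ f g x q|
    <= (K * c ^ 2 * (size p + size q + size t).+1)%N%:Z.
Proof.
have [k fk] := fellow_travel.
exists (2 * (2 * k + 2) ^ 2 * 3 + 2 * ((2 * (c0 + 2) + k) + ((c0 + 2) + 2 * k)) ^ 2)%N.
move=> c f g x p q t fc gc gp gq gt; set y := last x p; set z := last x q => yz.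
have dxy := dist_path gp.1; have dxz := dist_path gq.1; have dyz := dist_path gt.1.
have [_ spx] := gp; have [_ sqx] := gq; have [_ stx] := gt.
rewrite -/y -/z yz in dxy dxz dyz spx sqx stx.
pose gx := gromov_product d x y z; pose gy := gromov_product d y x z.
pose gz := gromov_product d z x y.
have sxy := dS x y; have sxz := dS x z; have syz := dS y z.
have gx0 : 0 <= gx by have := dT y x z; rewrite /gx /gromov_product; lra.
have gy0 : 0 <= gy by have := dT x y z; rewrite /gy /gromov_product; lra.
have gz0 : 0 <= gz by have := dT x z y; rewrite /gz /gromov_product; lra.
have exy : gx + gy = d x y by rewrite /gx /gy /gromov_product; lra.
have exz : gx + gz = d x z by rewrite /gx /gz /gromov_product; lra.
have eyz : gy + gz = d y z by rewrite /gz /gy /gromov_product; lra.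
pose a := Num.truncn gx; pose b := Num.truncn gy; pose e := Num.truncn gz.
have /andP[a1 a2] := truncn_itv gx0; have /andP[b1 b2] := truncn_itv gy0.
have /andP[e1 e2] := truncn_itv gz0; rewrite -/a -/b -/e in a1 a2 b1 b2 e1 e2.
rewrite -!natr1 in a2 b2 e2.
have sp1 : (a + b <= size p)%N by rewrite -(ler_nat R) natrD; lra.
have sq1 : (a + e <= size q)%N by rewrite -(ler_nat R) natrD; lra.
have st1 : (b + e <= size t)%N by rewrite -(ler_nat R) natrD; lra.
have sp2 : (size p <= a + b + c0 + 2)%N by rewrite -(ler_nat R) !natrD; lra.
have sq2 : (size q <= a + e + c0 + 2)%N by rewrite -(ler_nat R) !natrD; lra.
have st2 : (size t <= b + e + c0 + 2)%N by rewrite -(ler_nat R) !natrD; lra.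
have strp : forall u v w i, coarse_geodesic u v -> coarse_geodesic u w ->
    (i <= size v)%N -> (i <= size w)%N ->
    i%:R <= gromov_product d u (last u v) (last u w) ->
    exists s, [/\ path r (last u (take i v)) s, (size s <= k)%N,
      last (last u (take i v)) s = last u (take i w) &
      `|circ f g u (take i v) + circ f g (last u (take i v)) s - circ f g u (take i w)|
      <= (i.+1 * (2 * c ^ 2 * (2 * k + 2) ^ 2))%N%:Z].
  move=> u v w i gv gw iv iw ig.
  have nr : forall j, (j <= i)%N -> near r k (last u (take j v)) (last u (take j w)).
    move=> j ji; apply: fk => //; [exact: leq_trans iv | exact: leq_trans iw |].
    by apply: le_trans ig; rewrite ler_nat.
  have [s [ps ls ss]] := nr i (leqnn i).
  exists s.
  split; first exact: ps.
  exact: ss.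
  exact: ls.
  have [pv _] := path_take_last i gv.1; have [pw _] := path_take_last i gw.1.
  have := @strip _ r c f g k (take i v) (take i w) u u [::] s rS fc gc.
  rewrite /= !size_takel // subr0 => /(_ erefl pv pw); apply; [|by []|by []|by []|exact: ps|exact: ls|exact: ss].
  move=> j ji; rewrite !nth_last_take ?size_takel //.
  by rewrite !take_takel //; apply: nr.
have [|||sx [psx ssx lsx hx]] := strp x p q a gp gq.
- by apply: leq_trans sp1; rewrite leq_addr.
- by apply: leq_trans sq1; rewrite leq_addr.
- exact: a1.
have gp' := coarse_geodesic_rev gp; rewrite -/y in gp'.
have gq' := coarse_geodesic_rev gq; rewrite -/z in gq'.
have gt' := coarse_geodesic_rev gt; rewrite -/y yz in gt'.
have [|||sy [psy ssy lsy hy]] := strp y (revwalk x p) t b gp' gt.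
- by rewrite size_revwalk (leq_trans _ sp1) ?leq_addl.
- by rewrite (leq_trans _ st1) ?leq_addr.
- by rewrite last_revwalk yz.
have [|||sz [psz ssz lsz hz]] := strp z (revwalk x q) (revwalk y t) e gq' gt'.
- by rewrite size_revwalk (leq_trans _ sq1) ?leq_addl.
- by rewrite size_revwalk (leq_trans _ st1) ?leq_addl.
- by rewrite last_revwalk -yz last_revwalk yz.
clear dxy dxz dyz spx sqx stx exy exz eyz gx0 gy0 gz0 a1 a2 b1 b2 e1 e2 sxy sxz syz strp.
exact: (@triangle_of_strips _ _ rS c f g x p q t a b e k c0 sx sy sz fc gc gp.1 gq.1
  gt.1 yz sp1 sq1 st1 sp2 sq2 st2 psx ssx lsx hx psy ssy lsy hy psz ssz lsz hz).
Qed.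

Lemma four_point_sq_hyperbolic : sq_hyperbolic r.
Proof.
have [K triK] := coarse_triangle.
pose w x y := s2val (cid2 (geo x y)).
have wg x y : coarse_geodesic x (w x y) by rewrite /w; case: (cid2 _).
have wl x y : last x (w x y) = y by rewrite /w; case: (cid2 _).
apply: (@polygon_sq_hyperbolic _ r rS w c0 K) => //.
- by move=> x y; case: (wg x y).
- move=> x p px; have [_] := wg x (last x p); rewrite wl => h.
  by rewrite -(ler_nat R) natrD (le_trans h) // lerD2r dist_path.
- move=> c f g x y z fc gc.
  have := triK c f g x (w x y) (w x z) (w y z) fc gc (wg _ _) (wg _ _).
  by rewrite !wl; apply.
Qed.

End FourPoint.

(** * Geodesics and quasigeodesics *)

Section GraphDistance.
Variables (X : Type) (r : rel X).
Hypothesis rS : symmetric r.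
Implicit Types (x y z : X) (p q : seq X).

Definition gdist x y : nat :=
  if pselect (exists k, `[< near r k x y >]) is left H then ex_minn H else 0.

Lemma gdist_le k x y : near r k x y -> (gdist x y <= k)%N.
Proof.
move=> nk; rewrite /gdist; case: pselect => // H.
by case: ex_minnP => m _; apply; apply/asboolP.
Qed.

Definition pt x p i := last x (take i p).

Lemma pt0 x p : pt x p 0 = x. Proof. by rewrite /pt take0. Qed.

Lemma pt_size x p : pt x p (size p) = last x p.
Proof. by rewrite /pt take_size. Qed.

Lemma pt_catl x p q i : (i <= size p)%N -> pt x (p ++ q) i = pt x p i.
Proof. by move=> ip; rewrite /pt takel_cat. Qed.

Lemma pt_catr x p q i : pt x (p ++ q) (size p + i) = pt (last x p) q i.
Proof. by rewrite /pt take_cat ltnNge leq_addr /= addKn last_cat. Qed.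

Lemma pt_rev x p i : (i <= size p)%N ->
  pt (last x p) (revwalk x p) i = pt x p (size p - i).
Proof.
move=> ip; set m := (size p - i)%N.
rewrite -{1 2}(cat_take_drop m p) revwalk_cat last_cat /pt.
have -> : i = size (revwalk (last x (take m p)) (drop m p)).
  by rewrite size_revwalk size_drop /m; lia.
by rewrite take_size_cat // last_revwalk.
Qed.

Definition subwalk p i j := drop i (take j p).

Lemma subwalkP x p i j : path r x p -> (i <= j <= size p)%N ->
  [/\ path r (pt x p i) (subwalk p i j), last (pt x p i) (subwalk p i j) = pt x p j,
      size (subwalk p i j) = (j - i)%N &
      forall k, (k <= j - i)%N -> pt (pt x p i) (subwalk p i j) k = pt x p (i + k)].
Proof.
move=> px /andP[ij jp].
have pj : path r x (take j p) by case: (path_take_last j px).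
have e : take i p = take i (take j p) by rewrite take_takel.
have s : size (subwalk p i j) = (j - i)%N by rewrite size_drop size_takel.
rewrite /pt e; split=> //.
- by case: (path_take_last i pj).
- by rewrite -last_cat cat_take_drop.
- move=> k kl; rewrite -last_cat; congr last.
  rewrite -(@take_takel _ (i + k) j p); last by lia.
  rewrite -[in RHS](cat_take_drop i (take j p)) take_cat size_takel; last by rewrite size_takel.
  by rewrite ltnNge leq_addr /= addKn.
Qed.

Lemma near_pt x p i j : path r x p -> (i <= j <= size p)%N ->
  near r (j - i) (pt x p i) (pt x p j).
Proof.
by move=> px ij; have [a b c _] := subwalkP px ij; exists (subwalk p i j); rewrite c.
Qed.

Lemma pt_step x p i : path r x p -> (i < size p)%N -> r (pt x p i) (pt x p i.+1).
Proof.
move=> px ip; have [|a b c _] := @subwalkP x p i i.+1 px; first by rewrite leqnSn.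
case: (subwalk p i i.+1) a b c => [|u [|v l]] //=; try lia.
by move=> /andP[+ _] <-.
Qed.

(** The lower bound is purely multiplicative, which is what geodesic words over an [undistorted]
    alphabet give. *)
Definition qgeod (lam : nat) x p := path r x p /\
  forall i j, (i <= j <= size p)%N -> (j - i <= lam * gdist (pt x p i) (pt x p j))%N.

Definition geod x p := path r x p /\ size p = gdist x (last x p).

Hypothesis conn : forall x y, exists k, near r k x y.

Lemma gdist_near x y : near r (gdist x y) x y.
Proof.
rewrite /gdist; case: pselect => [H|[]]; last first.
  by have [k nk] := conn x y; exists k; apply/asboolP.
by case: ex_minnP => m /asboolP.
Qed.

Lemma gdistxx x : gdist x x = 0%N.
Proof. by have := gdist_le (near0 r x); lia. Qed.

Lemma gdistC x y : gdist x y = gdist y x.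
Proof.
by apply/eqP; rewrite eqn_leq !gdist_le //; apply: near_sym => //; apply: gdist_near.
Qed.

Lemma gdist_tri y x z : (gdist x z <= gdist x y + gdist y z)%N.
Proof. by apply: gdist_le; apply: near_trans (gdist_near _ _) (gdist_near _ _). Qed.

Lemma gdist1 x y : r x y -> (gdist x y <= 1)%N.
Proof. by move=> xy; apply: gdist_le; exists [:: y]; rewrite /= xy. Qed.

Lemma gdist_eq0 x y : gdist x y = 0%N -> x = y.
Proof. by move=> e; have := gdist_near x y; rewrite e => -[[|u p] [_ <- //]]. Qed.

Lemma geod_ex x y : exists2 p, geod x p & last x p = y.
Proof.
have [p [px <- sp]] := gdist_near x y; exists p => //; split=> //.
by apply/eqP; rewrite eqn_leq sp; apply: gdist_le; exists p.
Qed.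

Lemma gdist_pt_le x p i j : path r x p -> (i <= j <= size p)%N ->
  (gdist (pt x p i) (pt x p j) <= j - i)%N.
Proof. by move=> px ij; apply: gdist_le; apply: near_pt. Qed.

Lemma geod_pt x p i j : geod x p -> (i <= j <= size p)%N ->
  gdist (pt x p i) (pt x p j) = (j - i)%N.
Proof.
move=> [px sp] ij; apply/eqP; rewrite eqn_leq gdist_pt_le //=.
have h1 := @gdist_pt_le x p 0 i px; have h2 := @gdist_pt_le x p j (size p) px.
rewrite pt0 pt_size in h1 h2.
have h3 := gdist_tri (pt x p i) x (last x p).
have h4 := gdist_tri (pt x p j) (pt x p i) (last x p).
case/andP: ij => ij jp.
have := h1 (leq_trans ij jp); have := h2; rewrite jp leqnn => /(_ isT).
by clear - h3 h4 ij jp sp; lia.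
Qed.

Lemma geod_rev x p : geod x p -> geod (last x p) (revwalk x p).
Proof.
move=> [px sp]; split; first exact: path_revwalk.
by rewrite size_revwalk last_revwalk gdistC.
Qed.

Lemma geod_sub x p i j : geod x p -> (i <= j <= size p)%N ->
  geod (pt x p i) (subwalk p i j).
Proof.
move=> gp ij; have [a b c _] := subwalkP gp.1 ij.
by split=> //; rewrite b c geod_pt.
Qed.

Lemma qgeod_sub lam x p i j : qgeod lam x p -> (i <= j <= size p)%N ->
  qgeod lam (pt x p i) (subwalk p i j).
Proof.
move=> [px qp] ij; have [a b c d] := subwalkP px ij.
split=> // k l; rewrite c => /andP[kl lj].
rewrite !d //; last by apply: leq_trans kl lj.
have := qp (i + k)%N (i + l)%N; rewrite subnDl; apply.
by case/andP: ij; clear - kl lj; lia.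
Qed.

Lemma sdist_ex (P : X -> Prop) (T : nat) x :
  exists k, (T <= k)%N || `[< exists2 y, P y & (gdist x y <= k)%N >].
Proof. by exists T; rewrite leqnn. Qed.

(** The distance to the set [P] truncated at [T]: a 1-Lipschitz coordinate function to integrate. *)
Definition sdist P T x : nat := ex_minn (sdist_ex P T x).

Lemma sdist0 P T x : P x -> sdist P T x = 0%N.
Proof.
move=> Px; rewrite /sdist; case: ex_minnP => m _ H.
apply/eqP; rewrite -leqn0; apply: H; apply/orP; right; apply/asboolP.
by exists x; rewrite ?gdistxx.
Qed.

Lemma sdistT (P : X -> Prop) T x :
  (forall y, P y -> (T <= gdist x y)%N) -> sdist P T x = T.
Proof.
move=> PT; apply/eqP; rewrite eqn_leq /sdist.
case: ex_minnP => m mP /(_ T); rewrite leqnn => -> //=.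
by case/orP: mP => // /asboolP[y /PT Ty]; apply: leq_trans.
Qed.

Lemma sdist_lip P T : lip r 1 (fun x => (sdist P T x)%:Z).
Proof.
have le x y : r x y -> (sdist P T y <= (sdist P T x).+1)%N.
  move=> xy; rewrite {2}/sdist; case: ex_minnP => m mP _.
  rewrite /sdist; case: ex_minnP => k _; apply.
  case/orP: mP => [Tm|/asboolP[z Pz xz]]; apply/orP; [by left; lia | right].
  apply/asboolP; exists z => //; have := gdist_tri x y z; rewrite (gdistC y x).
  by have := gdist1 xy; clear - xz; lia.
by move=> x y xy; have := le _ _ xy; rewrite rS in xy; have := le _ _ xy; clear; lia.
Qed.

Definition onwalk x p y := exists2 i, (i <= size p)%N & y = pt x p i.

Lemma circ_constl f g x p a : (forall y, onwalk x p y -> f y = a) ->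
  circ f g x p = 2 * a * (g (last x p) - g x).
Proof.
elim: p x => [|y p IH] x H /=; first by rewrite subrr mulr0.
rewrite IH => [|z [i ip ->]]; last by apply: H; exists i.+1.
have -> : f x = a by apply: H; exists 0%N.
have -> : f y = a by apply: H; exists 1%N => //; rewrite /pt /= take0.
by ring.
Qed.

Lemma circ_constr f g x p a : (forall y, onwalk x p y -> g y = a) ->
  circ f g x p = 0.
Proof.
elim: p x => [|y p IH] x H //=.
rewrite IH => [|z [i ip ->]]; last by apply: H; exists i.+1.
have -> : g x = a by apply: H; exists 0%N.
have -> : g y = a by apply: H; exists 1%N => //; rewrite /pt /= take0.
by ring.
Qed.

Lemma onwalk_first x p : onwalk x p x.
Proof. by exists 0%N; rewrite ?pt0. Qed.

Lemma onwalk_last x p : onwalk x p (last x p).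
Proof. by exists (size p); rewrite ?pt_size. Qed.

(* Besicovitch: truncated distances to two adjacent sides map a quadrilateral
   onto the boundary of a d1 x d2 rectangle. *)
Lemma besicovitch x a1 a2 a3 a4 d1 d2 :
  let y := last x a1 in let z := last y a2 in let t := last z a3 in
  last t a4 = x ->
  (forall u v, onwalk x a1 u -> onwalk z a3 v -> (d1 <= gdist u v)%N) ->
  (forall u v, onwalk y a2 u -> onwalk t a4 v -> (d2 <= gdist u v)%N) ->
  exists f g, [/\ lip r 1 f, lip r 1 g &
    circ f g x (a1 ++ a2 ++ a3 ++ a4) = (2 * d1 * d2)%N%:Z].
Proof.
move=> y z t tx h1 h2.
exists (fun u => (sdist (onwalk x a1) d1 u)%:Z), (fun u => (sdist (onwalk y a2) d2 u)%:Z).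
split; try exact: sdist_lip.
rewrite !circ_cat -/y -/z -/t.
(* Only the third side contributes, where [f] is [d1] while [g] goes from 0 to [d2]; on the first
   side [f] vanishes, on the second and fourth [g] is constant. *)
rewrite (@circ_constl _ _ x a1 0); last by move=> u hu; rewrite sdist0.
rewrite (@circ_constr _ _ y a2 0); last by move=> u hu; rewrite sdist0.
rewrite (@circ_constl _ _ z a3 d1%:Z); last first.
  by move=> u hu; rewrite sdistT // => v hv; rewrite gdistC; apply: h1.
rewrite (@circ_constr _ _ t a4 d2%:Z); last first.
  by move=> u hu; rewrite sdistT // => v hv; rewrite gdistC; apply: h2.
rewrite -/t [sdist _ _ z]sdist0; last exact: onwalk_last.
rewrite [sdist _ _ t]sdistT; last first.
  by move=> v hv; rewrite gdistC; apply: h2 => //; apply: onwalk_first.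
by rewrite !PoszM; ring.
Qed.

Hypothesis sq : sq_hyperbolic r.

(** The form in which hyperbolicity enters the stability of quasigeodesics: as [e] is arbitrary, a
    long quadrilateral cannot have both pairs of opposite sides at distances comparable with its
    length. *)
Lemma sq_quadrilateral e : exists K, forall x a1 a2 a3 a4 d1 d2,
  let y := last x a1 in let z := last y a2 in let t := last z a3 in
  let L := size (a1 ++ a2 ++ a3 ++ a4) in
  path r x (a1 ++ a2 ++ a3 ++ a4) -> last t a4 = x ->
  (forall u v, onwalk x a1 u -> onwalk z a3 v -> (d1 <= gdist u v)%N) ->
  (forall u v, onwalk y a2 u -> onwalk t a4 v -> (d2 <= gdist u v)%N) ->
  (e * (2 * d1 * d2) <= L ^ 2 + K * L)%N.
Proof.
have [K HK] := sq e 1; exists K => x a1 a2 a3 a4 d1 d2 y z t L px tx h1 h2.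
have [f [g [fl gl E]]] := besicovitch tx h1 h2.
have := HK f g fl gl x _ px; rewrite E !last_cat -/y -/z -/t tx => /(_ erefl).
by rewrite -/L; move: (2 * d1 * d2)%N (L ^ 2 + K * L)%N => u v; rewrite -PoszM lez_nat.
Qed.

End GraphDistance.

(** * Stability of quasigeodesics *)

Section Morse.
Variables (X : Type) (r : rel X).
Hypothesis rS : symmetric r.
Hypothesis conn : forall x y, exists k, near r k x y.
Hypothesis sq : sq_hyperbolic r.
Implicit Types (x y z : X) (p q : seq X).
Local Notation d := (gdist r).
Let dC := gdistC rS conn.
Let dT := gdist_tri conn.
Let dxx := gdistxx r.

Lemma argmax_nat (h : nat -> nat) n :
  exists2 i, (i <= n)%N & forall j, (j <= n)%N -> (h j <= h i)%N.
Proof.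
elim: n => [|n [i ni hi]]; first by exists 0%N => // j; rewrite leqn0 => /eqP->.
case: (leqP (h n.+1) (h i)) => H.
  exists i; first by lia.
  by move=> j; rewrite leq_eqVlt ltnS => /orP[/eqP->|/hi].
exists n.+1 => // j; rewrite leq_eqVlt ltnS => /orP[/eqP->|/hi] //.
by move=> h1; apply: leq_trans (ltnW H).
Qed.

Lemma argmin_nat (h : nat -> nat) n :
  exists2 i, (i <= n)%N & forall j, (j <= n)%N -> (h i <= h j)%N.
Proof.
elim: n => [|n [i ni hi]]; first by exists 0%N => // j; rewrite leqn0 => /eqP->.
case: (leqP (h i) (h n.+1)) => H.
  exists i; first by lia.
  by move=> j; rewrite leq_eqVlt ltnS => /orP[/eqP->|/hi].
exists n.+1 => // j; rewrite leq_eqVlt ltnS => /orP[/eqP->|/hi] //.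
by move=> h1; apply: leq_trans (ltnW H) _.
Qed.

Lemma walk_between x q i j : path r x q -> (i <= size q)%N -> (j <= size q)%N ->
  exists w, [/\ path r (pt x q i) w, last (pt x q i) w = pt x q j,
    size w = (i - j + (j - i))%N &
    forall u, onwalk (pt x q i) w u -> onwalk x q u].
Proof.
move=> qx iq jq.
have [ij|ji] := leqP i j.
  have [|a b c e] := @subwalkP X r x q i j qx; first by rewrite ij.
  exists (subwalk q i j); split=> //; first by rewrite c; lia.
  by move=> u [k]; rewrite c => kl ->; rewrite e //; exists (i + k)%N => //; lia.
have [|a b c e] := @subwalkP X r x q j i qx; first by rewrite ltnW.
exists (revwalk (pt x q j) (subwalk q j i)); rewrite -b; split.
- exact: path_revwalk.
- by rewrite last_revwalk.
- by rewrite size_revwalk c; lia.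
- move=> u [k]; rewrite size_revwalk => kl ->; rewrite pt_rev // e ?c; last by lia.
  by eexists; last reflexivity; rewrite c in kl; lia.
Qed.

Lemma onwalk_cat x p q u :
  onwalk x (p ++ q) u -> onwalk x p u \/ onwalk (last x p) q u.
Proof.
move=> [i]; rewrite size_cat => iq ->.
have [ip|ip] := leqP i (size p); first by left; exists i; rewrite ?pt_catl.
right; exists (i - size p)%N; first by lia.
by rewrite -pt_catr subnKC // ltnW.
Qed.

Lemma onwalk_geod_le x p u : geod r x p -> onwalk x p u ->
  (d x u + d u (last x p) = d x (last x p))%N.
Proof.
move=> gp [i ip ->].
have := @geod_pt _ _ conn x p 0 i gp ip; rewrite pt0 => ->.
have := @geod_pt _ _ conn x p i (size p) gp; rewrite ip leqnn pt_size => -> //.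
by rewrite -gp.2; lia.
Qed.

Lemma morse_arith e K L La del h : (8 * h >= del)%N -> (2 * (del - h) >= del)%N ->
  e = (4 * La ^ 2 + 1)%N -> (L <= La * del)%N ->
  (e * (2 * (del - h) * (2 * h)) <= L ^ 2 + K * L)%N -> (del <= 4 * K * La)%N.
Proof.
move=> h8 h2 -> LL; set S := (2 * (del - h) * (2 * h))%N => H.
have S4 : (del * del <= 4 * S)%N.
  by have := leq_mul h2 h8; rewrite /S; move: (del - h)%N => u; clear; nia.
have L2 : (L ^ 2 <= La ^ 2 * del ^ 2)%N by rewrite -expnMn leq_exp2r.
have KL : (K * L <= K * La * del)%N by rewrite -mulnA leq_mul2l LL orbT.
have L3 : (La ^ 2 * del ^ 2 <= La ^ 2 * (4 * S))%N by rewrite leq_mul2l S4 orbT.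
have SK : (S <= K * La * del)%N.
  by move: H; rewrite mulnDl mul1n -mulnA mulnCA; clear -L2 KL L3; lia.
case: (posnP del) => [->//|d0]; rewrite -(leq_pmul2r d0).
by apply: (leq_trans S4); rewrite -!mulnA leq_mul2l /= mulnA.
Qed.

(** Let [p i] be the point of [p] farthest from [q], at distance [del]. The segment of [p] of length
    about [del / 2] around [p i], a piece of [q] and two connections that leave [p] within [2 * del]
    of [p i] form a quadrilateral. Its opposite sides are at distances at least [del - t] and
    [2 * t], with [t] about [del / 4], and its length is at most [La * del]; so [sq_quadrilateral]
    bounds [del]. *)
Lemma morse lam : exists D, forall x p q, geod r x p -> qgeod r lam x q ->
  last x p = last x q -> forall i, (i <= size p)%N ->
  exists2 j, (j <= size q)%N & (d (pt x p i) (pt x q j) <= D)%N.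
Proof.
pose La := (6 + 6 * lam)%N.
have [K HK] := sq_quadrilateral rS conn sq (4 * La ^ 2 + 1).
exists (4 * K * La + 4)%N => x p q gp gq e.
have nst z : exists2 j, (j <= size q)%N &
    forall k, (k <= size q)%N -> (d z (pt x q j) <= d z (pt x q k))%N.
  by apply: argmin_nat.
pose s i := s2val (cid2 (nst (pt x p i))).
have sq1 i : (s i <= size q)%N by rewrite /s; case: cid2.
have sq2 i k : (k <= size q)%N -> (d (pt x p i) (pt x q (s i)) <= d (pt x p i) (pt x q k))%N.
  by rewrite /s; case: cid2 => /= j _; apply.
pose h i := d (pt x p i) (pt x q (s i)).
have [i ip hi] := argmax_nat h (size p).
suff Hd : (h i <= 4 * K * La + 4)%N.
  by move=> k kp; exists (s k) => //; apply: leq_trans (hi _ kp) Hd.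
have [|d4] := leqP (h i) 4; first by move/leq_trans; apply; rewrite leq_addl.
apply: leq_trans (leq_addr _ _).
set del := h i in d4 *; pose t := (del %/ 4)%N.
have far j : (j <= size q)%N -> (del <= d (pt x p i) (pt x q j))%N by exact: sq2.
have px0 : d (pt x p i) x = i.
  by have := @geod_pt _ _ conn x p 0 i gp ip; rewrite pt0 dC subn0.
have pxl : d (pt x p i) (last x q) = (size p - i)%N.
  by have := @geod_pt _ _ conn x p i (size p) gp; rewrite ip leqnn pt_size e => ->.
(* [a] lies [2 * del] before [i], or at the start of [p] if that is nearer. The inequality with
   [+ del <= i] keeps the whole connection from [p a] to [q ja] away from the other side of
   [p i]. *)
have [a [ja [jaq a1 a2 a3]]] : exists a ja, [/\ (ja <= size q)%N,
    (a + d (pt x p a) (pt x q ja) + del <= i)%N, (i <= a + 2 * del)%N &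
    (d (pt x p a) (pt x q ja) <= del)%N].
  have [i2|i2] := leqP (2 * del) i.
    have ha : (h (i - 2 * del) <= del)%N by apply: hi; lia.
    by exists (i - 2 * del)%N, (s (i - 2 * del))%N; split=> //; move: ha; rewrite /h; lia.
  exists 0%N, 0%N; rewrite !pt0 dxx; split=> //; last by lia.
  by have := far 0%N isT; rewrite pt0 px0; lia.
have [b [jb [jbq bp b1 b2 b3]]] : exists b jb, [/\ (jb <= size q)%N, (b <= size p)%N,
    (i + del + d (pt x p b) (pt x q jb) <= b)%N, (b <= i + 2 * del)%N &
    (d (pt x p b) (pt x q jb) <= del)%N].
  have [i2|i2] := leqP (i + 2 * del) (size p).
    have ha : (h (i + 2 * del) <= del)%N by apply: hi.
    by exists (i + 2 * del)%N, (s (i + 2 * del))%N; split=> //; move: ha; rewrite /h; lia.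
  exists (size p), (size q); rewrite !pt_size e dxx; split=> //; last by lia.
  by have := far (size q) (leqnn _); rewrite pt_size pxl; lia.
have [w [pw lw sw ow]] := walk_between gq.1 jbq jaq.
have sw' : (size w <= lam * (6 * del))%N.
  have dab : (d (pt x q ja) (pt x q jb) <= 6 * del)%N.
    have h1 := dT (pt x p a) (pt x q ja) (pt x q jb); have h2 := dT (pt x p b) (pt x p a) (pt x q jb).
    have h3 : d (pt x p a) (pt x p b) = (b - a)%N by apply: geod_pt => //; rewrite bp andbT; lia.
    by rewrite (dC (pt x q ja) (pt x p a)) in h1; clear - h1 h2 h3 a1 a2 a3 b1 b2 b3; lia.
  have [jab|jab] := leqP ja jb.
    have := gq.2 ja jb; rewrite jab jbq => /(_ isT) H; rewrite sw.
    apply: (@leq_trans (lam * d (pt x q ja) (pt x q jb))); first by lia.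
    by rewrite leq_mul2l dab orbT.
  have := gq.2 jb ja; rewrite ltnW // jaq => /(_ isT) H; rewrite sw.
  apply: (@leq_trans (lam * d (pt x q jb) (pt x q ja))); first by lia.
  by rewrite leq_mul2l dC dab orbT.
have [u gu lu] := geod_ex conn (pt x p b) (pt x q jb).
have [v gv lv] := geod_ex conn (pt x q ja) (pt x p a).
have t4 : (4 * t <= del)%N by rewrite mulnC leq_divM.
have [|A1 A2 A3 A4] := @subwalkP _ r x p (i - t) (i + t) gp.1; first by lia.
have [|B1 B2 B3 B4] := @subwalkP _ r x p (i + t) b gp.1; first by lia.
have [|C1 C2 C3 C4] := @subwalkP _ r x p a (i - t) gp.1; first by lia.
have := HK (pt x p (i - t)) (subwalk p (i - t) (i + t)) (subwalk p (i + t) b ++ u)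
  w (v ++ subwalk p a (i - t)) (del - t)%N (2 * t)%N.
rewrite /= A2 !last_cat B2 lu lw lv C2 !cat_path A1 A2 !last_cat B1 B2 gu.1 ?lu pw ?lw gv.1 ?lv C1.
move=> /(_ isT erefl); case/(_ _ _)/Wrap.
- move=> _ _ [k kA ->] /ow[j jq ->]; rewrite A3 in kA; rewrite A4 //.
  have h1 := dT (pt x p (i - t + k)) (pt x p i) (pt x q j); have h2 := far _ jq.
  have h3 : (d (pt x p i) (pt x p (i - t + k)) <= t)%N.
    have [ik|ik] := leqP i (i - t + k).
      by rewrite geod_pt //; [lia | rewrite ik; lia].
    by rewrite dC geod_pt //; lia.
  by clear - h1 h2 h3; lia.
- have RB u0 : onwalk (pt x p (i + t)) (subwalk p (i + t) b ++ u) u0 ->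
      exists2 k, (k <= size p)%N & (d u0 (pt x p k) + i + t <= k)%N.
    case/onwalk_cat; rewrite ?B2.
      move=> [k]; rewrite B3 => kb ->; rewrite B4 //.
      by exists (i + t + k)%N; rewrite ?dxx; lia.
    move=> hu; exists b => //; have := onwalk_geod_le gu hu; rewrite lu dC.
    by clear - b1 t4; lia.
  have RC u0 : onwalk (pt x q ja) (v ++ subwalk p a (i - t)) u0 ->
      exists2 k, (k <= size p)%N & (d u0 (pt x p k) + k + t <= i)%N.
    case/onwalk_cat; rewrite ?lv.
      move=> hv; exists a; first by lia.
      have := onwalk_geod_le gv hv; rewrite lv; rewrite (dC (pt x q ja) (pt x p a)).
      by clear - a1 t4; lia.
    move=> [k]; rewrite C3 => kb ->; rewrite C4 //.
    by exists (a + k)%N; rewrite ?dxx; lia.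
  move=> u0 v0 /RB[k kp hk] /RC[l lp hl].
  have : d (pt x p l) (pt x p k) = (k - l)%N by apply: geod_pt => //; rewrite kp andbT; lia.
  have h1 := dT u0 (pt x p l) (pt x p k); have h2 := dT v0 (pt x p l) u0.
  rewrite (dC (pt x p l) v0) (dC v0 u0) in h2.
  by clear - h1 h2 hk hl; lia.
case; rewrite -/La => H.
apply: (@morse_arith _ K _ La del t _ _ erefl _ H).
- by rewrite /t; lia.
- by clear - t4; lia.
- rewrite !size_cat A3 B3 C3 gu.2 lu gv.2 lv (dC (pt x q ja)).
  have -> : (La * del = 6 * del + lam * (6 * del))%N by rewrite /La; clear; ring.
  move: sw'; move: (lam * (6 * del))%N => u0.
  by clear - a1 a2 a3 b1 b2 b3 t4; lia.
Qed.

End Morse.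

(** * Slim triangles and projections *)

Section HyperbolicGraphs.
Variables (X : Type) (r : rel X).
Hypothesis rS : symmetric r.
Hypothesis conn : forall x y, exists k, near r k x y.
Hypothesis sq : sq_hyperbolic r.
Implicit Types (x y z : X) (p q : seq X).
Local Notation d := (gdist r).
Let dC := gdistC rS conn.
Let dT := gdist_tri conn.
Let dxx := gdistxx r.

Lemma crossing (t : nat -> nat) n j : (t 0 <= j < t n)%N ->
  exists2 i, (i < n)%N & (t i <= j < t i.+1)%N.
Proof.
elim: n => [|n IH]; first by lia.
case/andP=> t0 tn; have [H|H] := ltnP j (t n); last by exists n; rewrite ?H.
by have [|i ni ti] := IH; [rewrite t0 | exists i => //; apply: ltnW].
Qed.

(** Discrete continuity: [morse] assigns to each [p i] a time [t i] on [q], and any [j] lies between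
    two consecutive values [t i] and [t i.+1], which differ by at most [lam * (2 * D0 + 1)]. The
    ends of [p] are assigned the ends of [q] so that every [j] is reached. *)
Lemma morse_conv lam : exists D, forall x p q, geod r x p -> qgeod r lam x q ->
  last x p = last x q -> forall j, (j <= size q)%N ->
  exists2 i, (i <= size p)%N & (d (pt x q j) (pt x p i) <= D)%N.
Proof.
have [D0 HD] := morse rS conn sq lam.
exists (lam * (2 * D0 + 1) + D0)%N => x p q gp gq e j jq.
have ex i : exists k, (i <= size p)%N -> (k <= size q)%N /\ (d (pt x p i) (pt x q k) <= D0)%N.
  have [ip|_] := leqP i (size p); last by exists 0%N.
  by have [k kq kd] := HD _ _ _ gp gq e _ ip; exists k.
pose t i := if i == 0%N then 0%N else if i == size p then size q else projT1 (cid (ex i)).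
have tP i : (i <= size p)%N -> (t i <= size q)%N /\ (d (pt x p i) (pt x q (t i)) <= D0)%N.
  move=> ip; rewrite /t; case: eqP => [->|_]; first by rewrite !pt0 dxx.
  case: eqP => [->|_]; first by rewrite !pt_size e dxx.
  by case: (cid (ex i)) => k /= /(_ ip).
have [jq'|jq'] := leqP (size q) j.
  exists (size p) => //; have -> : j = size q by lia.
  by rewrite !pt_size e dxx.
have [p0|p0] := posnP (size p).
  have q0 : (size q <= lam * 0)%N.
    have := gq.2 0%N (size q); rewrite subn0 leqnn pt0 pt_size -e => /(_ isT).
    by rewrite -gp.2 p0.
  by lia.
have [i ip ti] : exists2 i, (i < size p)%N & (t i <= j < t i.+1)%N.
  have tn : t (size p) = size q by rewrite /t eqxx; case: eqP => // e0; rewrite e0 in p0.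
  by apply: crossing; rewrite tn.
exists i; first by lia.
have [a1 a2] := tP i (ltnW ip); have [b1 b2] := tP i.+1 ip.
have h1 := dT (pt x p i) (pt x q (t i)) (pt x q (t i.+1)).
have h2 := dT (pt x p i.+1) (pt x p i) (pt x q (t i.+1)).
have h3 := gdist1 (pt_step gp.1 ip).
have h4 := gq.2 (t i) (t i.+1); rewrite b1 andbT in h4.
have {}h4 : (t i.+1 - t i <= lam * (2 * D0 + 1))%N.
  apply: leq_trans (h4 _) _; first by lia.
  by rewrite leq_mul2l; apply/orP; right; move: h1; rewrite (dC (pt x q (t i)) (pt x p i)); clear - h2 h3 a2 b2; lia.
have h5 := @gdist_pt_le _ _ x q (t i) j gq.1; rewrite jq andbT in h5.
have h6 := dT (pt x q (t i)) (pt x q j) (pt x p i).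
have {}h5 := h5 (proj1 (andP ti)).
rewrite (dC (pt x q j) (pt x q (t i))) (dC (pt x q (t i)) (pt x p i)) in h6.
by move: h4; move: (lam * _)%N => u; clear - h5 h6 a2 ti; lia.
Qed.

Lemma geod_take x p m : geod r x p -> (m <= size p)%N -> geod r x (take m p).
Proof.
move=> gp mp; have := @geod_sub _ _ conn x p 0 m gp.
by rewrite pt0 /subwalk drop0; apply.
Qed.

(* Following a geodesic and then turning at the nearest point towards z is efficient. *)
Lemma corner_qgeod x p w : geod r x p -> geod r (last x p) w ->
  (forall i, (i <= size p)%N -> (size w <= d (pt x p i) (last (last x p) w))%N) ->
  qgeod r 3 x (p ++ w).
Proof.
move=> gp gw H; split; first by rewrite cat_path gp.1 gw.1.
move=> i j; rewrite size_cat => /andP[ij js].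
have [jp|jp] := leqP j (size p).
  rewrite !pt_catl // ?(leq_trans ij) // geod_pt ?ij //; lia.
rewrite -(subnKC (ltnW jp)) pt_catr; set k := (j - size p)%N.
have kw : (k <= size w)%N by rewrite /k; lia.
have [ip|ip] := leqP i (size p); last first.
  rewrite -(subnKC (ltnW ip)) pt_catr geod_pt //; rewrite /k; lia.
rewrite pt_catl //.
have h1 := H _ ip; have h2 := dT (pt (last x p) w k) (pt x p i) (last (last x p) w).
have h3 := @geod_pt _ _ conn _ w k (size w) gw; rewrite kw leqnn pt_size in h3.
have h4 := @geod_pt _ _ conn _ w 0 k gw; rewrite pt0 in h4.
have h5 := @geod_pt _ _ conn _ p i (size p) gp; rewrite ip leqnn pt_size in h5.
have h6 := dT (pt (last x p) w k) (pt x p i) (last x p).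
rewrite (dC (pt (last x p) w k) (last x p)) in h6.
have {}h3 := h3 isT; have {}h4 := h4 kw; have {}h5 := h5 isT.
by clear - h1 h2 h3 h4 h5 h6 kw ip; lia.
Qed.

(** Following [p] up to the point nearest to the end of [q], and then a geodesic to that end, is a
    quasigeodesic by [corner_qgeod]; hence it stays close to [q]. *)
Lemma half_slim : exists D, forall x p q m, geod r x p -> geod r x q ->
  (m <= size p)%N ->
  (forall i, (i <= size p)%N -> (d (pt x p m) (last x q) <= d (pt x p i) (last x q))%N) ->
  forall i, (i <= m)%N -> exists2 j, (j <= size q)%N & (d (pt x p i) (pt x q j) <= D)%N.
Proof.
have [D HD] := morse_conv 3; exists D => x p q m gp gq mp H i im.
have [w gw lw] := geod_ex conn (pt x p m) (last x q).
have gt := geod_take gp mp.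
have := @corner_qgeod x (take m p) w gt gw; case/(_ _)/Wrap => [k|gc].
  rewrite size_takel // => km; rewrite lw gw.2 lw.
  have := H k (leq_trans km mp); congr (_ <= d _ _)%N.
  by rewrite /pt take_takel.
have := HD x q _ gq gc; rewrite last_cat lw => /(_ erefl i).
rewrite size_cat size_takel // => /(_ (leq_trans im (leq_addr _ _))) [j jq jd].
exists j => //; move: jd; rewrite pt_catl ?size_takel // [pt x (take m p) i]/pt.
by rewrite take_takel.
Qed.

Lemma slim_triangles : exists D, forall x p q s, geod r x p -> geod r x q ->
  geod r (last x p) s -> last (last x p) s = last x q ->
  forall i, (i <= size p)%N ->
  (exists2 j, (j <= size q)%N & (d (pt x p i) (pt x q j) <= D)%N) \/
  (exists2 j, (j <= size s)%N & (d (pt x p i) (pt (last x p) s j) <= D)%N).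
Proof.
have [D HD] := half_slim; exists D => x p q s gp gq gs e i ip.
have [m mp mm] := argmin_nat (fun i => d (pt x p i) (last x q)) (size p).
have [im|im] := leqP i m; first by left; apply: HD mm _ im.
right; have gr := geod_rev rS conn gp.
have mr k : (k <= size (revwalk x p))%N ->
    (d (pt (last x p) (revwalk x p) (size p - m)) (last (last x p) s)
     <= d (pt (last x p) (revwalk x p) k) (last (last x p) s))%N.
  rewrite size_revwalk e => kp; rewrite !pt_rev ?leq_subr // subKn //.
  by apply: mm; apply: leq_subr.
have sm : (size p - m <= size (revwalk x p))%N by rewrite size_revwalk leq_subr.
have := HD _ _ s (size p - m)%N gr gs sm mr (size p - i)%N (leq_sub2l _ (ltnW im)).
by rewrite pt_rev ?leq_subr // subKn.
Qed.

(** Let [w'] be the point nearest to [w] on a geodesic from [x] to [z]. The distances from [w] to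
    [x] and to [z] are realised through [w'] up to a constant, and slimness puts [w'] near one of
    the sides from [y]. *)
Lemma four_point_nat : exists D, forall w x y z,
  (d x z + d y w <= maxn (d x y + d z w) (d y z + d x w) + D)%N.
Proof.
have [D1 H1] := half_slim; have [D2 H2] := slim_triangles.
exists (2 * D1 + 2 * D2)%N => w x y z.
have [p gp lp] := geod_ex conn x z.
have [m mp mm] := argmin_nat (fun i => d (pt x p i) w) (size p).
have [q gq lq] := geod_ex conn x w; have [s gs ls] := geod_ex conn z w.
have aux u t v : geod r u t -> onwalk u t v -> (d u v + d v (last u t) = d u (last u t))%N.
  by apply: onwalk_geod_le.
set w' := pt x p m.
have h1 : (d x w' + d w' w <= d x w + 2 * D1)%N.
  have := H1 x p q m gp gq mp; rewrite lq => /(_ mm m (leqnn m)) [j jq jd].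
  have := @aux _ _ _ gq; case/(_ (pt x q j) _)/Wrap; first by exists j.
  rewrite lq => h; have h2 := dT (pt x q j) x w'; have h3 := dT (pt x q j) w' w.
  by move: jd h h2 h3; rewrite -/w' (dC (pt x q j) w'); clear; lia.
have h2 : (d z w' + d w' w <= d z w + 2 * D1)%N.
  have gr := geod_rev rS conn gp; rewrite lp in gr.
  have mr k : (k <= size (revwalk x p))%N ->
      (d (pt z (revwalk x p) (size p - m)) (last z s) <= d (pt z (revwalk x p) k) (last z s))%N.
    rewrite size_revwalk ls -lp => kp; rewrite !pt_rev ?leq_subr // subKn //.
    by apply: mm; apply: leq_subr.
  have sm : (size p - m <= size (revwalk x p))%N by rewrite size_revwalk leq_subr.
  have [j js] := H1 _ _ s (size p - m)%N gr gs sm mr (size p - m)%N (leqnn _).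
  rewrite -{1}lp pt_rev ?leq_subr // subKn // -/w' => jd.
  have := @aux _ _ _ gs; case/(_ (pt z s j) _)/Wrap; first by exists j.
  rewrite ls => h; have h2 := dT (pt z s j) z w'; have h3 := dT (pt z s j) w' w.
  by move: jd h h2 h3; rewrite (dC (pt z s j) w'); clear; lia.
have [a ga la] := geod_ex conn x y; have [b gb lb] := geod_ex conn z y.
have := H2 x p a b gp ga; rewrite lp lb la => /(_ gb erefl m mp).
have h3 := dT w' x z; have hz := dC w' z.
case=> -[j jj jd].
  have := @aux _ _ _ ga; case/(_ (pt x a j) _)/Wrap; first by exists j.
  rewrite la => h4; have h5 := dT (pt x a j) x w'.
  have h6 := dT (pt x a j) y w; have h7 := dT w' (pt x a j) w.
  have : (d x z + d y w <= d x y + d z w + (2 * D1 + 2 * D2))%N.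
    move: jd h5 h6 h7 h4 h3; rewrite -/w' hz (dC y (pt x a j)) (dC w' (pt x a j)).
    by clear - h1 h2; lia.
  by move/leq_trans; apply; rewrite leq_add2r leq_maxl.
have := @aux _ _ _ gb; case/(_ (pt z b j) _)/Wrap; first by exists j.
rewrite lb => h4; have h5 := dT (pt z b j) z w'.
have h6 := dT (pt z b j) y w; have h7 := dT w' (pt z b j) w.
have : (d x z + d y w <= d y z + d x w + (2 * D1 + 2 * D2))%N.
  move: jd h5 h6 h7 h4 h3; rewrite -/w' hz (dC y (pt z b j)) (dC w' (pt z b j)) (dC y z).
  by clear - h1 h2; lia.
by move/leq_trans; apply; rewrite leq_add2r leq_maxr.
Qed.

(* If z and z' project far apart on a quasi-geodesic k, then k follows every
   quasi-geodesic from z to z' between the two projections. *)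
Lemma projection_follows lam : exists C D, forall x k z z' q t t',
  qgeod r lam x k -> qgeod r lam z q -> last z q = z' ->
  (t <= size k)%N -> (t' <= size k)%N ->
  (forall i, (i <= size k)%N -> (d z (pt x k t) <= d z (pt x k i))%N) ->
  (forall i, (i <= size k)%N -> (d z' (pt x k t') <= d z' (pt x k i))%N) ->
  forall i, (t + C <= i)%N -> (i + C <= t')%N ->
  exists2 j, (j <= size q)%N & (d (pt x k i) (pt z q j) <= D)%N.
Proof.
have [D1 H1] := morse_conv lam; have [D2 H2] := slim_triangles.
have [D3 H3] := morse rS conn sq lam.
pose Db := (D1 + 2 * D2)%N.
exists (lam * (2 * Db)).+1, (Db + D3)%N => x k z z' q t t' gk gq lq tk tk' nt nt' i ti it.
have tt : (t <= t')%N by lia.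
have ik : (i <= size k)%N by lia.
have tt' : (t <= t' <= size k)%N by rewrite tt.
(* A point of [k] close to a geodesic from [y] to its projection is close to the projection, since
   nothing on [k] is nearer to [y]. This excludes the two sides leading to the projections. *)
have contra y s u : (s <= size k)%N -> (lam * (2 * Db) < (i - s) + (s - i))%N ->
    (forall i, (i <= size k)%N -> (d y (pt x k s) <= d y (pt x k i))%N) ->
    (d (pt x k s) u + d u y = d (pt x k s) y)%N -> (d (pt x k i) u <= Db)%N -> False.
  move=> sk far ns su iu.
  have a1 := ns i ik; have a2 := dT u y (pt x k i); have a3 := dT u (pt x k i) (pt x k s).
  have a4 : (d (pt x k i) (pt x k s) <= 2 * Db)%N.
    move: a1 a2 a3 su iu; rewrite (dC y (pt x k s)) (dC y u) (dC u (pt x k i)) (dC u (pt x k s)).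
    by clear; lia.
  have a5 : (lam * d (pt x k i) (pt x k s) <= lam * (2 * Db))%N by rewrite leq_mul2l a4 orbT.
  have [si|si] := leqP s i.
    have := gk.2 s i; rewrite si ik dC => /(_ isT); clear - far a5 si.
    by move: (lam * _)%N (lam * _)%N far a5; lia.
  have := gk.2 i s; rewrite ltnW // sk => /(_ isT); clear - far a5 si.
  by move: (lam * _)%N (lam * _)%N far a5; lia.
have [s gs ls] := geod_ex conn (pt x k t) (pt x k t').
have [A1 A2 A3 A4] := subwalkP gk.1 tt'.
have := H1 _ s _ gs (qgeod_sub gk tt'); rewrite A2 => /(_ ls (i - t)%N).
rewrite A3 A4 ?subnKC; [|lia|lia].
case/(_ _)/Wrap; [lia | move=> [a as_ ad]].
have [g1 gg1 lg1] := geod_ex conn (pt x k t) z'.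
have [g2 gg2 lg2] := geod_ex conn (pt x k t') z'.
have := H2 _ s g1 g2 gs gg1; rewrite ls lg1 lg2 => /(_ gg2 erefl a as_).
case=> -[b bs bd]; last first.
  have e := @onwalk_geod_le _ _ conn _ g2 (pt (pt x k t') g2 b) gg2.
  have {e} := e (ex_intro2 _ _ b bs erefl); rewrite lg2 => e.
  exfalso; apply: (contra z' t' _ tk' _ nt' e); first by clear - it; lia.
  have := dT (pt (pt x k t) s a) (pt x k i) (pt (pt x k t') g2 b).
  by rewrite /Db; clear - ad bd; lia.
have [g3 gg3 lg3] := geod_ex conn (pt x k t) z.
have [g4 gg4 lg4] := geod_ex conn z z'.
have := H2 _ g1 g3 (revwalk z g4) gg1 gg3; rewrite lg1 lg3 -lg4.
move=> /(_ (geod_rev rS conn gg4)); rewrite last_revwalk => /(_ erefl b bs).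
case=> -[e es ed].
  have u := @onwalk_geod_le _ _ conn _ g3 (pt (pt x k t) g3 e) gg3.
  have {u} := u (ex_intro2 _ _ e es erefl); rewrite lg3 => u.
  exfalso; apply: (contra z t _ tk _ nt u); first by clear - ti; lia.
  have := dT (pt (pt x k t) s a) (pt x k i) (pt (pt x k t) g3 e).
  have := dT (pt (pt x k t) g1 b) (pt (pt x k t) s a) (pt (pt x k t) g3 e).
  by rewrite /Db; clear - ad bd ed; lia.
rewrite size_revwalk in es; rewrite pt_rev // in ed.
have [j jq jd] := H3 z g4 q gg4 gq (etrans lg4 (esym lq)) (size g4 - e)%N (leq_subr _ _).
exists j => //.
have := dT (pt (pt x k t) s a) (pt x k i) (pt z q j).
have := dT (pt (pt x k t) g1 b) (pt (pt x k t) s a) (pt z q j).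
have := dT (pt z g4 (size g4 - e)) (pt (pt x k t) g1 b) (pt z q j).
by rewrite /Db; clear - ad bd ed jd; lia.
Qed.

End HyperbolicGraphs.

(** * Words and balls in groups *)

Section Transfer.
Variables (X Y : Type) (r : rel X) (r' : rel Y) (phi : X -> Y) (psi : Y -> X).
Variables (A B D : nat).
Hypothesis phiP : forall x x', r x x' -> near r' A (phi x) (phi x').
Hypothesis psiP : forall y y', r' y y' -> near r B (psi y) (psi y').
Hypothesis psi_phi : forall x, near r D (psi (phi x)) x.

Lemma circ_map (f g : X -> int) y p :
  circ (f \o psi) (g \o psi) y p = circ f g (psi y) (map psi p).
Proof. by elim: p y => [|z p IH] y //=; rewrite IH. Qed.

Lemma lip_near c (f : X -> int) k x y : lip r c f -> near r k x y ->
  `|f x - f y| <= (c * k)%N%:Z.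
Proof.
move=> fc [p [px <- pk]]; have := lip_path fc px; rewrite distrC.
by move/le_trans; apply; rewrite lez_nat leq_mul2l pk orbT.
Qed.

(** Both functions are Lipschitz for the relation [r2] of pairs along which they vary by at most
    [J]. It contains the steps of [p], the images of steps under [psi] and the pairs of [x] with
    [psi (phi x)], so [p] and its image bound a ladder of loops of length at most [A + 3]. *)
Lemma transfer_walk c (f g : X -> int) x p : lip r c f -> lip r c g -> path r x p ->
  exists q, [/\ path r' (phi x) q, last (phi x) q = phi (last x p),
    (size q <= A * size p)%N &
    `|circ f g x p + circ f g (last x p) [:: psi (phi (last x p))]
      - circ f g x [:: psi (phi x)] - circ (f \o psi) (g \o psi) (phi x) q|
    <= (size p * (2 * (c * (1 + B + D)) ^ 2 * (2 + A.+1) ^ 2))%N%:Z].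
Proof.
move=> fc gc; set J := (c * (1 + B + D))%N.
pose r2 : rel X := fun x y => (`|f x - f y| <= J%:Z) && (`|g x - g y| <= J%:Z).
have r2S : symmetric r2 by move=> u v; rewrite /r2 distrC [`|g u - _|]distrC.
have f2 : lip r2 J f by move=> u v /andP[].
have g2 : lip r2 J g by move=> u v /andP[].
have nr k u v : (k <= 1 + B + D)%N -> near r k u v -> r2 u v.
  move=> kJ uv; have kc : ((c * k)%N%:Z <= J%:Z :> int) by rewrite lez_nat leq_mul2l kJ orbT.
  by rewrite /r2 !(le_trans (lip_near _ uv) kc).
have r2_psi y q : path r' y q -> path r2 (psi y) (map psi q).
  elim: q y => [|z q IH] y //= /andP[yz /IH ->]; rewrite andbT.
  by apply: (@nr B); [lia | apply: psiP].
have r2_c z : r2 z (psi (phi z)) by rewrite r2S; apply: (@nr D) => //; lia.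
elim: p x => [|x' p IH] x /=.
  by exists [::]; split=> //=; rewrite muln0 || idtac; lia.
case/andP=> xx' /IH[q [q1 q2 q3 q4]].
have [s [s1 s2 s3]] := phiP xx'.
exists (s ++ q); split.
- by rewrite cat_path s1 s2.
- by rewrite last_cat s2.
- by rewrite size_cat mulnS leq_add.
rewrite circ_cat s2 circ_map.
have x2 : r2 x x'.
  by apply: (@nr 1%N); [lia | exists [:: x']; rewrite /= xx'].
have := @circ_two_walks _ r2 J f g x [:: x'; psi (phi x')] (psi (phi x) :: map psi s)
  2 A.+1 r2S f2 g2.
rewrite /= x2 r2_c r2_c r2_psi // last_map s2 size_map.
move=> /(_ isT isT erefl isT s3); rewrite [((size p).+1 * _)%N]mulSn.
move: q4; rewrite circ_map /= !addr0.
move: (circ f g x' p) (circ f g (psi (phi x')) _) (circ f g (psi (phi x)) _).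
move: ((f (last x' p) + _) * _) ((f x + f (psi _)) * _) ((f x' + _) * _) ((f x + f x') * _).
move: (2 * J ^ 2 * _)%N => M; move: (size p * M)%N => N.
by clear; lia.
Qed.

(** The image loop is longer by a factor [A], so [e] is replaced by [e * (A ^ 2 + 1)]; the area of
    the ladder is linear and goes into [K]. *)
Lemma sq_hyperbolic_transfer : sq_hyperbolic r' -> sq_hyperbolic r.
Proof.
move=> sq e c; have [K HK] := sq (e * (A ^ 2 + 1))%N (c * B)%N.
pose M := (2 * (c * (1 + B + D)) ^ 2 * (2 + A.+1) ^ 2)%N.
exists (K * A + e * M)%N => f g fc gc x p px lx.
have [q [q1 q2 q3 q4]] := transfer_walk fc gc px.
have psl h : lip r c h -> lip r' (c * B) (h \o psi).
  by move=> hc y y' yy; apply: lip_near hc (psiP yy).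
have := HK _ _ (psl f fc) (psl g gc) _ _ q1; rewrite q2 lx => /(_ erefl).
move: q4; rewrite lx addrK -/M.
move: (circ f g x p) (circ _ _ _ q) => u v uv.
set L := size p in q3 uv *; set n := size q in q3 *.
have h1 : (n ^ 2 + K * n <= (A ^ 2 + 1) * (L ^ 2 + K * A * L))%N.
  have a1 : (n ^ 2 <= A ^ 2 * L ^ 2)%N by rewrite -expnMn leq_exp2r.
  have a2 : (K * n <= K * A * L)%N by rewrite -mulnA leq_mul2l q3 orbT.
  have -> : ((A ^ 2 + 1) * (L ^ 2 + K * A * L)
    = A ^ 2 * L ^ 2 + A ^ 2 * (K * A * L) + L ^ 2 + K * A * L)%N by clear; ring.
  by move: a1 a2; move: (K * A * L)%N (L ^ 2)%N (n ^ 2)%N (K * n)%N (A ^ 2 * _)%N (A ^ 2 * _)%N; clear; lia.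
move=> h2.
have {h1 h2} h3 : e%:Z * `|v| <= (L ^ 2 + K * A * L)%N%:Z.
  have A0 : 0 < (A ^ 2 + 1)%N%:Z :> int by rewrite ltz_nat addn1.
  rewrite -(ler_pM2l A0); apply: (@le_trans _ _ (n ^ 2 + K * n)%N%:Z); last by rewrite -PoszM lez_nat.
  by rewrite mulrA -PoszM (mulnC _ e); exact: h2.
have h4 : `|u| <= (L * M)%N%:Z + `|v| by move: uv; move: (L * M)%N; clear; lia.
have h5 : e%:Z * `|u| <= e%:Z * ((L * M)%N%:Z + `|v|) by apply: ler_wpM2l.
apply: (le_trans h5); rewrite mulrDr -PoszM.
have -> : (e * (L * M) = e * M * L)%N by rewrite (mulnC L) mulnA.
rewrite mulnDl; move: h3; move: (e%:Z * _) (K * A * L)%N (e * M * L)%N (L ^ 2)%N.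
by clear; lia.
Qed.

End Transfer.

Section Words.
Variable G : groupType.
Implicit Types (l : pred G) (g h x y : G) (w : seq G) (n k : nat).
Local Open Scope group_scope.

Lemma word_eval_nil : word_eval [::] = 1 :> G.
Proof. by rewrite /word_eval big_nil. Qed.

Lemma word_eval_cons g w : word_eval (g :: w) = g * word_eval w.
Proof. by rewrite /word_eval big_cons. Qed.

Lemma word_eval_cat w1 w2 : word_eval (w1 ++ w2) = word_eval w1 * word_eval w2.
Proof.
by elim: w1 => [|g w IH]; rewrite ?word_eval_nil ?mul1g //= !word_eval_cons IH mulgA.
Qed.

Lemma word_eval1 g : word_eval [:: g] = g.
Proof. by rewrite word_eval_cons word_eval_nil mulg1. Qed.

Definition inv_word w := rev (map (fun g => g^-1) w).

Lemma word_eval_inv w : word_eval (inv_word w) = (word_eval w)^-1.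
Proof.
elim: w => [|g w IH]; first by rewrite !word_eval_nil invg1.
by rewrite /inv_word /= rev_cons -cats1 word_eval_cat IH word_eval1 word_eval_cons invgM.
Qed.

Definition symm l := forall g, l g -> l g^-1.

(** Alphabets are predicates, as the union of all vertex groups may be an infinite one; [sgen S] is
    the symmetric alphabet of a finite list. *)
Definition ball l n g := exists w, [/\ all l w, (size w <= n)%N & word_eval w = g].

Definition gen l g := exists2 w, all l w & word_eval w = g.

Definition sgen (S : seq G) : pred G := fun s => (s \in S) || (s^-1 \in S).

Lemma sgen_symm S : symm (sgen S).
Proof. by move=> g; rewrite /sgen invgK orbC. Qed.

Lemma ball_gen l n g : ball l n g -> gen l g.
Proof. by move=> [w [lw _ <-]]; exists w. Qed.

Lemma gen_word l w : all l w -> gen l (word_eval w).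
Proof. by exists w. Qed.

Lemma gen_ball l g : gen l g -> exists n, ball l n g.
Proof. by move=> [w lw <-]; exists (size w), w. Qed.

Lemma ball1 l n : ball l n 1.
Proof. by exists [::]; rewrite word_eval_nil. Qed.

Lemma gen1 l : gen l 1. Proof. exact: ball_gen (ball1 l 0). Qed.

Lemma ballM l m n g h : ball l m g -> ball l n h -> ball l (m + n) (g * h).
Proof.
move=> [w [lw sw <-]] [v [lv sv <-]]; exists (w ++ v).
by rewrite all_cat lw lv size_cat leq_add // word_eval_cat.
Qed.

Lemma genM l g h : gen l g -> gen l h -> gen l (g * h).
Proof.
by move=> /gen_ball[m /ballM mh] /gen_ball[n /mh/ball_gen].
Qed.

Lemma all_inv_word l w : symm l -> all l w -> all l (inv_word w).
Proof.
move=> sl lw; rewrite /inv_word all_rev all_map.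
by apply: sub_all lw => s; apply: sl.
Qed.

Lemma ballV l n g : symm l -> ball l n g -> ball l n g^-1.
Proof.
move=> sl [w [lw sw <-]]; exists (inv_word w).
by rewrite all_inv_word // size_rev size_map word_eval_inv.
Qed.

Lemma genV l g : symm l -> gen l g -> gen l g^-1.
Proof. by move=> sl /gen_ball[n /(ballV sl)/ball_gen]. Qed.

Lemma ball_le l m n g : (m <= n)%N -> ball l m g -> ball l n g.
Proof. by move=> mn [w [? sw ?]]; exists w; split=> //; apply: leq_trans mn. Qed.

Lemma letter_ball l g : l g -> ball l 1 g.
Proof. by move=> lg; exists [:: g]; rewrite /= lg word_eval1. Qed.

Lemma letter_gen l g : l g -> gen l g.
Proof. by move/letter_ball/ball_gen. Qed.

Lemma ball_mul l l' k n g : (forall s, l s -> ball l' k s) ->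
  ball l n g -> ball l' (k * n) g.
Proof.
move=> H [w [lw sw <-]]; apply: (@ball_le _ (k * size w)); first by rewrite leq_mul2l sw orbT.
elim: w lw {sw} => [|s w IH] /=; first by rewrite word_eval_nil => _; apply: ball1.
by case/andP=> /H ls /IH; rewrite word_eval_cons mulnS; apply: ballM.
Qed.

Lemma gen_sub l l' g : (forall s, l s -> gen l' s) -> gen l g -> gen l' g.
Proof.
move=> H [w lw <-]; elim: w lw => [|s w IH] /=; first by rewrite word_eval_nil => _; apply: gen1.
by case/andP=> /H ls /IH; rewrite word_eval_cons; apply: genM.
Qed.

Lemma gen_seq_ball (S : seq G) l : symm l -> (forall s, s \in S -> gen l s) ->
  exists k, forall s, sgen S s -> ball l k s.
Proof.
move=> sl; elim: S => [|s S IH] H; first by exists 0%N.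
have [|k hk] := IH; first by move=> t tS; apply: H; rewrite inE tS orbT.
have [m hm] := gen_ball (H s (mem_head _ _)).
exists (m + k)%N => t; rewrite /sgen !inE -orbA.
case/or4P=> [/eqP->|tS|/eqP e|tS].
- by apply: ball_le hm; apply: leq_addr.
- by apply: (ball_le (leq_addl _ _)); apply: hk; rewrite /sgen tS.
- by rewrite -[t]invgK e; apply: ballV sl _; apply: ball_le hm; apply: leq_addr.
- by apply: (ball_le (leq_addl _ _)); apply: hk; rewrite /sgen tS orbT.
Qed.

Lemma ball_finite (S : seq G) n :
  exists s : seq G, forall g, ball (sgen S) n g -> g \in s.
Proof.
elim: n => [|n [s hs]].
  by exists [:: 1] => g [[|a w] [_ sw <-]] //; rewrite word_eval_nil inE.
exists (s ++ [seq a * b | a <- S ++ map (fun g => g^-1) S, b <- s]) => g.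
case=> -[|a w] [lw sw <-]; rewrite mem_cat.
  by rewrite hs //; exists [::].
apply/orP; right; rewrite word_eval_cons; move: lw => /= /andP[la lw].
apply/allpairsP; exists (a, word_eval w); split=> //=.
  rewrite mem_cat; case/orP: la => [->//|aS]; apply/orP; right.
  by apply/mapP; exists a^-1; rewrite ?invgK.
by apply: hs; exists w.
Qed.

Definition cay l : rel G := fun x y => l (x^-1 * y).

Lemma cay_symm l : symm l -> symmetric (cay l).
Proof.
by move=> sl x y; apply/idP/idP => /sl; rewrite invgM invgK.
Qed.

Definition walk x w := scanl (fun a b => a * b) x w.

Lemma path_walk l x w : path (cay l) x (walk x w) = all l w.
Proof. by elim: w x => [|s w IH] x //=; rewrite IH /cay mulKg. Qed.

Lemma last_walk x w : last x (walk x w) = x * word_eval w.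
Proof.
elim: w x => [|s w IH] x /=; first by rewrite word_eval_nil mulg1.
by rewrite IH word_eval_cons mulgA.
Qed.

Lemma size_walk x w : size (walk x w) = size w.
Proof. exact: size_scanl. Qed.

Lemma walk_take x w i : take i (walk x w) = walk x (take i w).
Proof. by elim: w x i => [|s w IH] x [|i] //=; rewrite IH. Qed.

Lemma walk_cat x w v : walk x (w ++ v) = walk x w ++ walk (x * word_eval w) v.
Proof.
elim: w x => [|s w IH] x /=; first by rewrite word_eval_nil mulg1.
by rewrite IH word_eval_cons mulgA.
Qed.

Lemma pt_walk x w i : pt x (walk x w) i = x * word_eval (take i w).
Proof. by rewrite /pt walk_take last_walk. Qed.

Lemma walk_ex l x p : path (cay l) x p -> exists2 w, all l w & p = walk x w.
Proof.
elim: p x => [|y p IH] x /=; first by exists [::].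
case/andP=> xy /IH[w lw ->]; exists (x^-1 * y :: w); first by rewrite /= lw andbT.
by rewrite /= mulVKg.
Qed.

Lemma near_cay l n x y : near (cay l) n x y <-> ball l n (x^-1 * y).
Proof.
split=> [[p [/walk_ex[w lw ->]]]|[w [lw sw e]]].
  by rewrite last_walk size_walk => <- sw; exists w; rewrite mulKg.
by exists (walk x w); rewrite path_walk lw last_walk size_walk sw e mulVKg.
Qed.

Lemma sq_hyperbolic_gens l l' A B : symm l -> symm l' ->
  (forall s, l s -> ball l' A s) -> (forall s, l' s -> ball l B s) ->
  sq_hyperbolic (cay l') -> sq_hyperbolic (cay l).
Proof.
move=> sl sl' h1 h2; apply: (@sq_hyperbolic_transfer _ _ _ _ id id A B 0).
- by move=> x y xy; apply/near_cay; apply: h1.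
- by move=> x y xy; apply/near_cay; apply: h2.
- by move=> x; apply: near0.
Qed.

Definition len l g : nat := gdist (cay l) 1 g.

Lemma len_le l n g : ball l n g -> (len l g <= n)%N.
Proof. by move=> b; apply: gdist_le; apply/near_cay; rewrite invg1 mul1g. Qed.

Lemma len_ball l g : gen l g -> ball l (len l g) g.
Proof.
move=> /gen_ball[n bn]; rewrite /len /gdist; case: pselect => [H|[]]; last first.
  by exists n; apply/asboolP/near_cay; rewrite invg1 mul1g.
by case: ex_minnP => m /asboolP/near_cay; rewrite invg1 mul1g.
Qed.

Lemma lenP l n g : gen l g -> ball l n g <-> (len l g <= n)%N.
Proof. by move=> gg; split=> [/len_le//|h]; apply: ball_le h (len_ball gg). Qed.

Definition geodw l w := all l w /\
  forall w', all l w' -> word_eval w' = word_eval w -> (size w <= size w')%N.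

Lemma geodw_ex l g : gen l g -> exists2 w, geodw l w & word_eval w = g.
Proof.
move=> gg; have [w [lw sw ew]] := len_ball gg; exists w => //; split=> // w' lw' e.
by apply: (leq_trans sw); apply: len_le; exists w'; rewrite e.
Qed.

Lemma geodw_sub l u v w : geodw l (u ++ v ++ w) -> geodw l v.
Proof.
move=> [lw H]; move: lw; rewrite !all_cat => /and3P[lu lv lw]; split=> // v' lv' e.
have := H (u ++ v' ++ w); rewrite !all_cat lu lv' lw !word_eval_cat e => /(_ isT erefl).
by rewrite !size_cat leq_add2l leq_add2r.
Qed.

Definition undistorted l l' := exists k, forall n g,
  gen l g -> ball l' n g -> ball l (k * n) g.

Lemma undistorted_trans l1 l2 l3 : (forall s, l1 s -> gen l2 s) ->
  undistorted l1 l2 -> undistorted l2 l3 -> undistorted l1 l3.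
Proof.
move=> l12 [k1 h1] [k2 h2]; exists (k1 * k2)%N => n g g1 b3.
by rewrite -mulnA; apply: h1 => //; apply: h2 => //; apply: gen_sub g1.
Qed.

End Words.

(** * Geodesic polygons with a side in a subgroup *)

Section Component.
Variables (G : groupType) (l : pred G).
Hypothesis sl : symm l.
Local Open Scope group_scope.

(** The Cayley graph of an alphabet that generates only a subgroup is disconnected. The results on
    connected graphs are applied to the component of 1. *)
Definition component := {x : G | `[< gen l x >]}.
Implicit Types (u v : component) (w : seq G) (p : seq component).

Definition cayc : rel component := relpre val (cay l).

Definition inc (g : G) : component := insubd (exist _ 1 (asboolT (gen1 l)) : component) g.

Lemma val_inc g : gen l g -> val (inc g) = g.
Proof. by move=> gg; rewrite insubdK //; apply/asboolP. Qed.

Lemma gen_val u : gen l (val u).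
Proof. by apply/asboolP; apply: (valP u). Qed.

Definition walkc u w := map inc (walk (val u) w).

Lemma gen_walk x w : gen l x -> all l w -> forall y, y \in walk x w -> gen l y.
Proof.
elim: w x => [|s w IH] x //= gx /andP[ls lw] y; rewrite inE.
have gs : gen l (x * s) by apply: genM gx (letter_gen ls).
by case/orP=> [/eqP->|/(IH _ gs lw)].
Qed.

Lemma val_walkc u w : all l w -> map val (walkc u w) = walk (val u) w.
Proof.
move=> lw; rewrite -map_comp -[RHS]map_id; apply/eq_in_map => y yw /=.
by rewrite val_inc //; apply: gen_walk yw; first exact: gen_val.
Qed.

Lemma val_pt u p i : val (pt u p i) = pt (val u) (map val p) i.
Proof. by rewrite /pt -map_take last_map. Qed.

Lemma pt_walkc u w i : all l w -> val (pt u (walkc u w) i) = val u * word_eval (take i w).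
Proof. by move=> lw; rewrite val_pt val_walkc // pt_walk. Qed.

Lemma size_walkc u w : size (walkc u w) = size w.
Proof. by rewrite size_map size_walk. Qed.

Lemma path_walkc u w : all l w -> path cayc u (walkc u w).
Proof. by move=> lw; rewrite /cayc -path_map val_walkc // path_walk. Qed.

Lemma last_walkc u w : all l w -> val (last u (walkc u w)) = val u * word_eval w.
Proof. by move=> lw; rewrite -last_map val_walkc // last_walk. Qed.

Lemma near_cayc n u v : near cayc n u v <-> ball l n ((val u)^-1 * val v).
Proof.
split=> [[p [pu <- sp]]|[w [lw sw e]]].
  apply/near_cay; exists (map val p); split; last by rewrite size_map.
  - by rewrite path_map.
  - by rewrite last_map.
exists (walkc u w); split; [exact: path_walkc | | by rewrite size_walkc].
by apply: val_inj; rewrite last_walkc // e mulVKg.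
Qed.

Lemma cayc_symm : symmetric cayc.
Proof. by move=> u v; apply: cay_symm. Qed.

Lemma cayc_conn u v : exists n, near cayc n u v.
Proof.
have [n b] : exists n, ball l n ((val u)^-1 * val v).
  by apply: gen_ball; apply: genM; [apply: genV => // |]; apply: gen_val.
by exists n; apply/near_cayc.
Qed.

Lemma gdist_cayc u v : gdist cayc u v = len l ((val u)^-1 * val v).
Proof.
have g : gen l ((val u)^-1 * val v) by apply: genM; [apply: genV => // |]; apply: gen_val.
apply/eqP; rewrite eqn_leq gdist_le ?len_le //; last by apply/near_cayc/len_ball.
by apply/near_cayc/gdist_near; apply: cayc_conn.
Qed.

Lemma ball_gdist n u v : (gdist cayc u v <= n)%N -> ball l n ((val u)^-1 * val v).
Proof.
by rewrite gdist_cayc => h; apply: ball_le h _; apply: len_ball; apply: genM;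
  [apply: genV => // |]; apply: gen_val.
Qed.

(** Functions on the component are extended by 0; they stay Lipschitz because no edge leaves the
    component. *)
Lemma sq_hyperbolic_component : sq_hyperbolic (cay l) -> sq_hyperbolic cayc.
Proof.
move=> sq e c; have [K HK] := sq e c; exists K => f g fc gc u p pu lu.
pose ext (h : component -> int) x := if insub x is Some v then h v else 0.
have extE h v : ext h (val v) = h v by rewrite /ext valK.
have ext_lip h : lip cayc c h -> lip (cay l) c (ext h).
  move=> hc x y xy; have [gx|gx] := pselect (gen l x).
    have gy : gen l y by rewrite -(mulVKg x y); apply: genM gx (@letter_gen _ l (x^-1 * y) xy).
    by rewrite -(val_inc gx) -(val_inc gy) !extE hc // /cayc /= !val_inc.
  have gy : ~ gen l y.
    move=> gy; apply: gx; rewrite -(mulVKg y x); apply: genM gy _.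
    by apply: letter_gen; have := sl xy; rewrite invgM invgK.
  rewrite /ext !insubF ?subrr ?normr0 //; by apply/asboolP.
have -> : circ f g u p = circ (ext f) (ext g) (val u) (map val p).
  elim: p u {pu lu} => [|v p IH] u //=.
  by rewrite IH !extE.
rewrite -(size_map val); apply: HK; [exact: ext_lip | exact: ext_lip | |].
- by rewrite path_map.
- by rewrite last_map lu.
Qed.

Lemma qgeod_walkc (lC : pred G) K u w : (forall s, lC s -> l s) ->
  (forall n g, gen lC g -> ball l n g -> ball lC (K * n) g) ->
  geodw lC w -> qgeod cayc K u (walkc u w).
Proof.
move=> lCl und [lw H]; have lw' := sub_all lCl lw; split; first exact: path_walkc.
rewrite size_walkc => i j /andP[ij jw].
have := @ball_gdist _ (pt u (walkc u w) i) (pt u (walkc u w) j) (leqnn _).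
rewrite !pt_walkc // invgM -mulgA mulKg.
set t := gdist _ _ _ => b.
have e : word_eval (take j w) = word_eval (take i w) * word_eval (drop i (take j w)).
  by rewrite -word_eval_cat -[in RHS](@take_takel _ i j w) // cat_take_drop.
rewrite e mulKg in b.
have gv : geodw lC (drop i (take j w)).
  apply: (@geodw_sub _ _ (take i w) _ (drop j w)); rewrite catA.
  by rewrite -(@take_takel _ i j w) // cat_take_drop cat_take_drop.
have := und _ _ (gen_word gv.1) b => -[w' [lw2 sw2 ew2]].
have := gv.2 _ lw2 ew2; rewrite size_drop size_takel // => h.
exact: leq_trans h sw2.
Qed.

End Component.

(** * Polygons and projections for undistorted subgroups of a hyperbolic group *)

Section LocalGeometry.
Variables (G : groupType) (S : seq G).
Local Open Scope group_scope.
Let lA := sgen S.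
Let sA : symm lA := @sgen_symm G S.

(* In a geodesic polygon one side of which is a geodesic of lC, all points of that
   side, up to a number proportional to the number of sides, are close to another
   lC-geodesic side. Items tagged true are single letters of S. *)
Definition flow_item (lC : pred G) (it : bool * seq G) : Prop :=
  if it.1 then exists2 s, lA s & it.2 = [:: s] else geodw lC it.2.

Definition items_word (its : seq (bool * seq G)) := flatten (map snd its).

Definition flow (lC : pred G) := exists C0 D : nat, forall kappa its,
  its != [::] -> geodw lC kappa -> (forall it, it \in its -> flow_item lC it) ->
  word_eval kappa = word_eval (items_word its) ->
  exists2 bad : seq G, (size bad <= C0 * size its)%N &
  forall t, (t <= size kappa)%N -> word_eval (take t kappa) \in bad \/
  exists n t', let it := nth (true, [::]) its n in
    [/\ (n < size its)%N, it.1 = false, (t' <= size it.2)%N &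
     ball lA D ((word_eval (take t kappa))^-1 *
       (word_eval (items_word (take n its)) * word_eval (take t' it.2)))].

Lemma items_word_cat a b : items_word (a ++ b) = items_word a ++ items_word b.
Proof. by rewrite /items_word map_cat flatten_cat. Qed.

Lemma gen_items (lC : pred G) its : (forall s, lC s -> lA s) ->
  (forall it, it \in its -> flow_item lC it) -> all lA (items_word its).
Proof.
move=> lCl; elim: its => [|it its IH] H //=.
rewrite all_cat IH ?andbT; last by move=> i ii; apply: H; rewrite inE ii orbT.
have := H it (mem_head _ _); rewrite /flow_item; case: it.1.
  by case=> s ls ->; rewrite /= ls.
by case=> lw _; apply: sub_all lw.
Qed.

(** The corners of the polygon are projected to [kappa], the first and last one to its ends. A point
    of [kappa] lies between two consecutive projections; unless it is within [C] of one of them,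
    [projection_follows] puts it near the side joining these two corners. If that side is a single
    letter, the point is near a corner and counts as bad. *)
Lemma flow_of_undistorted (lC : pred G) : (forall s, lC s -> lA s) -> undistorted lC lA ->
  sq_hyperbolic (cay lA) -> flow lC.
Proof.
move=> lCl [K0 und0] sq0; pose K := K0.+1.
have und n g : gen lC g -> ball lA n g -> ball lC (K * n) g.
  by move=> gg b; apply: (ball_le _ (und0 _ _ gg b)); rewrite leq_mul2r leqnSn orbT.
have sq := sq_hyperbolic_component sA sq0.
have rS := cayc_symm sA; have conn := cayc_conn sA.
have [C [D proj]] := projection_follows rS conn sq K.
have [bD hbD] := ball_finite S D.
(* The bad points of one side: those within [C] of the projections of its two corners, and those
   within [D] of the corners themselves. *)
pose N := ((2 * C).+1 + (2 * C).+1 + size bD + size bD)%N.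
exists N, D => kappa its its0 gk fit ek.
set m := size its; pose e n := word_eval (items_word (take n its)).
have lits := gen_items lCl fit.
have ge n : gen lA (e n).
  exists (items_word (take n its)) => //; move: lits.
  by rewrite -{1}(cat_take_drop n its) items_word_cat all_cat => /andP[].
pose z n := inc lA (e n); have zE n : val (z n) = e n by apply: val_inc.
pose one := inc lA 1; have oneE : val one = 1 by apply: val_inc; apply: gen1.
pose k := walkc one kappa.
have lk : all lA kappa by apply: sub_all gk.1.
have qk : qgeod (cayc (l := lA)) K one k.
  have Q := @qgeod_walkc G lA sA lC K one kappa lCl und gk.
  exact: Q.
have sk : size k = size kappa by apply: size_walkc.
have kE i : val (pt one k i) = word_eval (take i kappa).
  by rewrite pt_walkc // oneE mul1g.
have nst n : exists j, (j <= size k)%N /\ forall i, (i <= size k)%N ->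
    (gdist (cayc (l := lA)) (z n) (pt one k j) <= gdist (cayc (l := lA)) (z n) (pt one k i))%N.
  have [j jk hj] := argmin_nat (fun i => gdist (cayc (l := lA)) (z n) (pt one k i)) (size k).
  by exists j.
pose t n := if n == 0%N then 0%N else if n == m then size k else projT1 (cid (nst n)).
have tP n : (t n <= size k)%N /\ forall i, (i <= size k)%N ->
    (gdist (cayc (l := lA)) (z n) (pt one k (t n)) <= gdist (cayc (l := lA)) (z n) (pt one k i))%N.
  rewrite /t; case: eqP => [->|_].
    split=> // i _; have -> : z 0%N = pt one k 0; last by rewrite gdistxx.
    by apply: val_inj; rewrite zE kE !take0 /e take0.
  case: eqP => [->|_]; last by case: (cid (nst n)).
  split=> // i _; have -> : z m = pt one k (size k); last by rewrite gdistxx.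
  by apply: val_inj; rewrite zE kE sk !take_size /e take_size.
have m0 : (0 < m)%N by rewrite lt0n /m size_eq0.
have tm : t m = size kappa by rewrite /t eqxx (gtn_eqF m0) sk.
pose pts n := [seq word_eval (take (t n - C + i) kappa) | i <- iota 0 (2 * C).+1].
pose badn n := pts n ++ pts n.+1 ++ [seq e n * b | b <- bD] ++ [seq e n.+1 * b | b <- bD].
have sbn n : size (badn n) = N by rewrite !size_cat !size_map size_iota /N !addnA.
exists [seq nth 1 (badn n) i | n <- iota 0 m, i <- iota 0 N].
  by rewrite size_allpairs !size_iota mulnC.
have inbad n x : (n < m)%N -> x \in badn n ->
    x \in [seq nth 1 (badn n) i | n <- iota 0 m, i <- iota 0 N].
  move=> nm xb; apply/allpairsP; exists (n, index x (badn n)).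
  have i1 : n \in iota 0 m by rewrite mem_iota.
  have i2 : index x (badn n) \in iota 0 N by rewrite mem_iota -(sbn n) index_mem.
  by split; [exact: i1 | exact: i2 | rewrite nth_index].
have inpts n i : (t n <= i + C)%N -> (i <= t n + C)%N -> word_eval (take i kappa) \in pts n.
  move=> h1 h2; apply/mapP; exists (i - (t n - C))%N; first by rewrite mem_iota; lia.
  by congr (word_eval (take _ _)); lia.
move=> i; rewrite leq_eqVlt => /orP[/eqP ->|ik].
  left; apply: (inbad m.-1); first by rewrite prednK.
  have ip : word_eval (take (size kappa) kappa) \in pts m by apply: inpts; rewrite tm leq_addr.
  by rewrite !mem_cat prednK // ip orbT.
have [|n nm tn] := @crossing t m i; first by rewrite tm ik /t.
have [h1|h1] := leqP i (t n + C).
  left; apply: (inbad n) => //; rewrite !mem_cat; apply/orP; left; apply: inpts => //.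
  by case/andP: tn => tn _; apply: leq_trans tn (leq_addr _ _).
have [h2|h2] := leqP (i + C) (t n.+1); last first.
  left; apply: (inbad n) => //; rewrite !mem_cat; apply/orP; right; apply/orP; left.
  apply: inpts; first exact: ltnW.
  by case/andP: tn => _ tn; apply: leq_trans (ltnW tn) (leq_addr _ _).
pose it := nth (true, [::]) its n.
have fi : flow_item lC it by apply: fit; rewrite mem_nth.
have eS : e n.+1 = e n * word_eval it.2.
  rewrite /e (take_nth (true, [::])) // -cats1 items_word_cat word_eval_cat.
  by rewrite /items_word /= cats0.
have main q : qgeod (cayc (l := lA)) K (z n) q -> last (z n) q = z n.+1 ->
    exists2 j, (j <= size q)%N & ball lA D ((word_eval (take i kappa))^-1 * val (pt (z n) q j)).
  move=> qq lq; have := proj one k (z n) (z n.+1) q (t n) (t n.+1) qk qq lq.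
  case: (tP n) => a1 a2; case: (tP n.+1) => b1 b2.
  move=> /(_ a1 b1 a2 b2 i (ltnW h1) h2)[j jq jd]; exists j => //.
  by rewrite -kE; apply: ball_gdist.
move: fi; rewrite /flow_item; case e1 : it.1; last first.
  move=> gi; right; have lw : all lA it.2 by apply: sub_all gi.1.
  have [||j] := main (walkc (z n) it.2).
  - by have Q := @qgeod_walkc G lA sA lC K (z n) it.2 lCl und gi; exact: Q.
  - by apply: val_inj; rewrite last_walkc // !zE eS.
  rewrite size_walkc pt_walkc // zE => jq jd.
  by exists n, j; split.
case=> s ls e2; left; apply: (inbad n) => //.
have close y : ball lA D ((word_eval (take i kappa))^-1 * y) ->
    word_eval (take i kappa) \in [seq y * b | b <- bD].
  move=> b; apply/mapP; exists (y^-1 * word_eval (take i kappa)); last by rewrite mulVKg.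
  by apply: hbD; have := ballV sA b; rewrite invgM invgK.
(* The letter 1 does not move, so it labels no quasigeodesic; the empty walk takes its place. *)
rewrite !mem_cat; have [s1|s1] := eqVneq s 1.
  have [||j _] := main [::].
  - by split=> // i' j' /=; lia.
  - by apply: val_inj; rewrite !zE eS e2 s1 word_eval1 mulg1.
  by rewrite /pt /= zE => /close ->; rewrite !orbT.
have lz : last (z n) (walkc (z n) [:: s]) = z n.+1.
  by apply: val_inj; rewrite last_walkc /= ?ls // !zE eS e2.
have [||j] := main (walkc (z n) [:: s]) => //.
- split; first by apply: path_walkc; rewrite /= ls.
  move=> i' j'; rewrite size_walkc /= => /andP[ij j1].
  case: j' j1 ij => [|[|j']] // _; rewrite ?leqn0 ?sub0n //.
  case: i' => [|i'] _; last by rewrite subSS sub0n.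
  rewrite subn0 muln_gt0 /= lt0n; apply/eqP => /(gdist_eq0 conn) h.
  have := congr1 val h; rewrite !pt_walkc /= ?ls // ?take0 zE ?word_eval_nil mulg1 word_eval1.
  by rewrite -[in X in X = _ -> _](mulg1 (e n)) => /mulgI/esym/eqP; rewrite (negPf s1).
rewrite size_walkc /= => j1; rewrite pt_walkc /= ?ls // zE.
case: j j1 => [|[|//]] _ /=; rewrite ?word_eval_nil ?mulg1 ?take0 => /close.
  by move=> ->; rewrite !orbT.
by rewrite -e2 -eS => ->; rewrite !orbT.
Qed.

Definition closest (lC : pred G) (F : G -> Prop) c z :=
  F z /\ forall n f, F f -> ball lC n (c^-1 * f) -> ball lC n (c^-1 * z).

Lemma closest_ex (lC : pred G) (F : G -> Prop) c : symm lC -> gen lC c -> F 1 ->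
  exists z, closest lC F c z.
Proof.
move=> sC gc F1.
have ex : exists n, `[< exists2 f, F f & ball lC n (c^-1 * f) >].
  have [n b] := gen_ball (genV sC gc); exists n; apply/asboolP; exists 1 => //.
  by rewrite mulg1.
case: (ex_minnP ex) => n /asboolP[z Fz bz] mn; exists z; split=> // m f Ff bf.
by apply: ball_le bz; apply: mn; apply/asboolP; exists f.
Qed.

(** Why two subgroups that come close to each other do so near their intersection: only finitely
    many short differences [w] occur, and one bounded [c] per difference suffices. *)
Lemma coset_representatives (lC l0 : pred G) (s : seq G) :
  exists E, forall w, w \in s -> (exists2 c, gen lC c & gen l0 (c * w)) ->
    exists2 c, ball lC E c & gen l0 (c * w).
Proof.
elim: s => [|w s [E IH]]; first by exists 0%N.
have [[c gc cw]|no] := pselect (exists2 c, gen lC c & gen l0 (c * w)); last first.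
  by exists E => v; rewrite inE => /orP[/eqP-> /no|/IH].
have [n bn] := gen_ball gc; exists (n + E)%N => v; rewrite inE => /orP[/eqP->|vs] h.
  by exists c => //; apply: ball_le bn; apply: leq_addr.
by have [c' b' h'] := IH _ vs h; exists c' => //; apply: ball_le b'; apply: leq_addl.
Qed.

Section TwoSubgroups.
Variables lC l0 : pred G.
Hypotheses (sC : symm lC) (s0 : symm l0).
Hypotheses (CA : forall s, lC s -> lA s) (A0 : forall s, l0 s -> lA s).
Hypotheses (undC : undistorted lC lA) (und0 : undistorted l0 lA).
Hypothesis sq : sq_hyperbolic (cay lA).
Let F f := gen lC f /\ gen l0 f.

Local Notation dc := (gdist (cayc (l := lA))).

(** The point nearest to [z] on a geodesic from [c] to [a] is close to geodesics from [z] to [c] and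
    to [a], hence to some [c1] in the first subgroup and some [a1] in the second. Then
    [coset_representatives] gives a point of the intersection near [c1], and the minimality of [z]
    forces [c1] to be near [z]. *)
Lemma closest_gate : exists E, forall c z a, gen lC c -> closest lC F c z -> gen l0 a ->
  (len lA (c^-1 * z) + len lA (z^-1 * a) <= len lA (c^-1 * a) + E)%N.
Proof.
have sq' := sq_hyperbolic_component sA sq.
have rS := cayc_symm sA; have conn := cayc_conn sA.
have [K1 und1] := undC; have [K2 und2] := und0.
have [D1 H1] := half_slim rS conn sq'.
have [M1 HM1] := morse rS conn sq' K1; have [M2 HM2] := morse rS conn sq' K2.
have [bs hbs] := ball_finite S (M1 + D1 + (D1 + M2)).
have [E HE] := coset_representatives lC l0 bs.
exists (2 * (D1 + M1 + E))%N => c z a gc [[zC z0] zmin] ga.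
have gA g : gen lC g -> gen lA g by apply: gen_sub => s /CA/letter_gen.
have gA0 g : gen l0 g -> gen lA g by apply: gen_sub => s /A0/letter_gen.
pose uc := inc lA c; pose uz := inc lA z; pose ua := inc lA a.
have ucE : val uc = c by apply/val_inc/gA.
have uzE : val uz = z by apply/val_inc/gA.
have uaE : val ua = a by apply/val_inc/gA0.
rewrite -ucE -uzE -uaE -!gdist_cayc //.
have dC := gdistC rS conn; have dT := gdist_tri conn.
have [p gp lp] := geod_ex conn uc ua.
have [m mp mm] := argmin_nat (fun i => dc (pt uc p i) uz) (size p).
have [q gq lq] := geod_ex conn uc uz; have [s gs ls] := geod_ex conn ua uz.
set w := pt uc p m.
have [j jq jd] : exists2 j, (j <= size q)%N & (dc w (pt uc q j) <= D1)%N.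
  by have := H1 uc p q m gp gq mp; rewrite lq => /(_ mm m (leqnn m)).
have [j' js jd'] : exists2 j, (j <= size s)%N & (dc w (pt ua s j) <= D1)%N.
  have gr := geod_rev rS conn gp; rewrite lp in gr.
  have mr k : (k <= size (revwalk uc p))%N ->
      (dc (pt ua (revwalk uc p) (size p - m)) (last ua s) <= dc (pt ua (revwalk uc p) k) (last ua s))%N.
    rewrite size_revwalk ls -lp => kp; rewrite !pt_rev ?leq_subr // subKn //.
    by apply: mm; apply: leq_subr.
  have sm : (size p - m <= size (revwalk uc p))%N by rewrite size_revwalk leq_subr.
  have [j' js] := H1 _ _ s (size p - m)%N gr gs sm mr (size p - m)%N (leqnn _).
  by rewrite -{1}lp pt_rev ?leq_subr // subKn // -/w; exists j'.
have [k gk ek] := geodw_ex (genM (genV sC gc) zC).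
have [k0 gk0 ek0] := geodw_ex (genM (genV s0 ga) z0).
have lk : all lA k by apply: sub_all gk.1.
have lk0 : all lA k0 by apply: sub_all gk0.1.
have [||i ik id] := HM1 uc q (walkc uc k) gq _ _ j jq.
- by have Q := @qgeod_walkc G lA sA lC K1 uc k CA und1 gk; exact: Q.
- by apply: val_inj; rewrite lq last_walkc // ucE uzE ek mulVKg.
have [||i' ik' id'] := HM2 ua s (walkc ua k0) gs _ _ j' js.
- by have Q := @qgeod_walkc G lA sA l0 K2 ua k0 A0 und2 gk0; exact: Q.
- by apply: val_inj; rewrite ls last_walkc // uaE uzE ek0 mulVKg.
set c1 := pt uc _ i in id; set a1 := pt ua _ i' in id'.
have c1E : val c1 = c * word_eval (take i k) by rewrite pt_walkc // ucE.
have a1E : val a1 = a * word_eval (take i' k0) by rewrite pt_walkc // uaE.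
have gtake (l : pred G) w' n : all l w' -> gen l (word_eval (take n w')).
  by move=> lw'; exists (take n w') => //; move: lw'; rewrite -{1}(cat_take_drop n w') all_cat => /andP[].
have gc1 : gen lC (val c1) by rewrite c1E; apply: genM gc (gtake _ _ _ gk.1).
have ga1 : gen l0 (val a1) by rewrite a1E; apply: genM ga (gtake _ _ _ gk0.1).
have dca : (dc c1 a1 <= M1 + D1 + (D1 + M2))%N.
  have h1 := dT w c1 a1; have h2 := dT (pt uc q j) c1 w; have h3 := dT (pt ua s j') w a1.
  rewrite (dC c1 (pt uc q j)) (dC (pt uc q j) w) in h2.
  by clear - h1 h2 h3 id id' jd jd'; lia.
have [cw bcw acw] : exists2 x, ball lC E x & gen l0 (x * ((val c1)^-1 * val a1)).
  apply: HE; first by apply: hbs; apply: ball_gdist.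
  by exists (val c1); rewrite ?mulVKg.
have Ff : F (val c1 * cw^-1).
  split; first by apply: genM gc1 (genV sC (ball_gen bcw)).
  have -> : val c1 * cw^-1 = val a1 * (cw * ((val c1)^-1 * val a1))^-1.
    by rewrite !invgM invgK !mulgA mulgV mul1g.
  exact: genM ga1 (genV s0 acw).
have bE : ball lC E (cw^-1) by apply: ballV.
have zb : ball lC (i + E) (c^-1 * z).
  apply: zmin Ff _; rewrite c1E -mulgA mulKg; apply: ballM bE.
  exists (take i k); split=> //; last by rewrite size_take_min geq_minl.
  by move: gk.1; rewrite -{1}(cat_take_drop i k) all_cat => /andP[].
have kE : (size k - i <= E)%N.
  have [w' [lw' sw' ew']] := zb; have := gk.2 w' lw'; rewrite ew' ek => /(_ erefl).
  by clear - sw'; lia.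
have zc1 : (dc c1 uz <= E)%N.
  rewrite gdist_cayc // uzE c1E; apply: (leq_trans _ kE); rewrite -size_drop; apply: len_le.
  exists (drop i k); split=> //.
    by move: lk; rewrite -{1}(cat_take_drop i k) all_cat => /andP[].
  have ez : z = c * (word_eval (take i k) * word_eval (drop i k)).
    by rewrite -word_eval_cat cat_take_drop ek mulVKg.
  by rewrite ez invgM -!mulgA !mulKg.
have wz : (dc w uz <= D1 + M1 + E)%N.
  have h1 := dT c1 w uz; have h2 := dT (pt uc q j) w c1.
  by clear - h1 h2 jd id zc1; lia.
have h := @onwalk_geod_le _ _ conn uc p w gp (ex_intro2 _ _ m mp erefl).
rewrite lp in h; have h2 := dT w uc uz; have h3 := dT w uz ua.
rewrite (dC uz w) in h3.
by clear - h h2 h3 wz; lia.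
Qed.

(* The closest point projection of the cosets of <lC> to those of F is coarsely
   Lipschitz for the length of lA. *)
Lemma closest_lipschitz : exists K, forall c c1 a z z1,
  gen lC c -> gen lC c1 -> gen l0 a -> closest lC F c z -> closest lC F c1 z1 ->
  forall n, ball lA n (c^-1 * (a * c1)) -> ball l0 (K * n + K) (z^-1 * (a * z1)).
Proof.
have [E HE] := closest_gate; have [K2 und2] := und0.
have sq' := sq_hyperbolic_component sA sq.
have rS := cayc_symm sA; have conn := cayc_conn sA.
have [D HD] := four_point_nat rS conn sq'.
exists (K2 * (1 + 2 * E + D))%N => c c1 a z z1 gc gc1 ga zc zc1 n bn.
have gA g : gen lC g -> gen lA g by apply: gen_sub => s /CA/letter_gen.
have gA0 g : gen l0 g -> gen lA g by apply: gen_sub => s /A0/letter_gen.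
have gz0 : gen l0 z by case: zc => -[].
have gz10 : gen l0 z1 by case: zc1 => -[].
have gg : gen l0 (z^-1 * (a * z1)) by apply: genM (genV s0 gz0) (genM ga gz10).
have h1 := HE c z (a * z1) gc zc (genM ga gz10).
have h2 := HE c1 z1 (a^-1 * z) gc1 zc1 (genM (genV s0 ga) gz0).
pose vc := inc lA c; pose vz := inc lA z; pose vaz := inc lA (a * z1); pose vac := inc lA (a * c1).
have vcE : val vc = c by apply/val_inc/gA.
have vzE : val vz = z by apply/val_inc/gA0.
have vazE : val vaz = a * z1 := val_inc (gA0 _ (genM ga gz10)).
have vacE : val vac = a * c1 := val_inc (genM (gA0 _ ga) (gA _ gc1)).
(* By the gates, [c], [z], [a * z1] and [a * c1], [a * z1], [z] are nearly aligned in these orders.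
   The four point condition then bounds the distance from [z] to [a * z1] by the one from [c] to
   [a * c1], up to a constant. *)
have := HD vz vc vac vaz; rewrite !gdist_cayc // vcE vzE vazE vacE.
have e1 : (a * c1)^-1 * (a * z1) = c1^-1 * z1 by rewrite invgM -mulgA mulKg.
have e2 : (a * c1)^-1 * z = c1^-1 * (a^-1 * z) by rewrite invgM -mulgA.
have e3 : (a * z1)^-1 * z = z1^-1 * (a^-1 * z) by rewrite invgM -mulgA.
have lenV g : gen lA g -> len lA g^-1 = len lA g.
  move=> gg'; have gV := genV sA gg'; apply/eqP; rewrite eqn_leq.
  by apply/andP; split; apply: len_le; [|rewrite -{2}[g]invgK]; apply: ballV => //; apply: len_ball.
have e4 : len lA (z1^-1 * (a^-1 * z)) = len lA (z^-1 * (a * z1)).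
  have -> : z1^-1 * (a^-1 * z) = (z^-1 * (a * z1))^-1 by rewrite !invgM invgK mulgA.
  by apply/lenV/gA0.
rewrite e1 e2 e3 e4; rewrite e4 in h2.
have h3 := len_le bn.
set L := len lA (z^-1 * (a * z1)) in h1 h2 *.
move=> h4; have {h4} hL : (L <= n + 2 * E + D)%N.
  move: h4; set x1 := len lA (c^-1 * (a * z1)) in h1 *.
  set x2 := len lA (c1^-1 * (a^-1 * z)) in h2 *.
  set x3 := len lA (c^-1 * (a * c1)) in h3 *.
  move: (len lA (c^-1 * z)) (len lA (c1^-1 * z1)) h1 h2 => y1 y2 h1 h2.
  by clear - h1 h2 h3; rewrite /maxn; case: ifP; lia.
have b : ball l0 (K2 * L) (z^-1 * (a * z1)).
  by apply: und2 => //; apply: len_ball; apply: gA0.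
apply: ball_le b; rewrite -mulnA -mulnDr leq_mul2l; apply/orP; right.
have : (n <= (1 + 2 * E + D) * n)%N by rewrite -addnA leq_pmull.
by move: hL; move: ((1 + 2 * E + D) * n)%N; clear; lia.
Qed.

End TwoSubgroups.
End LocalGeometry.

(** * Alternating words *)

Section AlternatingWords.
Variables (G : groupType) (X : bool -> G -> Prop).
Local Open Scope group_scope.
Hypothesis X1 : forall b, X b 1.
Hypothesis XM : forall b x y, X b x -> X b y -> X b (x * y).
Hypothesis XV : forall b x, X b x -> X b x^-1.
Implicit Types (b : bool) (c g x y : G) (u v w : seq G).

Definition core g := X true g /\ X false g.

Fixpoint alt b w : Prop :=
  if w is x :: w' then [/\ X b x, ~ X (~~ b) x & alt (~~ b) w'] else True.

(** By the normal form theorem, this says that the two subgroups generate their amalgam over [core];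
    amalgams inside a group are used in this form. *)
Definition reduced_nontrivial := forall b w, w <> [::] -> alt b w -> word_eval w <> 1.

Lemma coreP b g : core g <-> X b g /\ X (~~ b) g.
Proof. by case: b; rewrite /core /=; tauto. Qed.

Lemma core1 : core 1. Proof. by split; apply: X1. Qed.

Lemma coreM x y : core x -> core y -> core (x * y).
Proof. by move=> [? ?] [? ?]; split; apply: XM. Qed.

Lemma coreV x : core x -> core x^-1.
Proof. by move=> [? ?]; split; apply: XV. Qed.

Lemma core_side b g : core g -> X b g.
Proof. by case=> ? ?; case: b. Qed.

Lemma alt_cat b u v : alt b (u ++ v) <-> alt b u /\ alt (b (+) odd (size u)) v.
Proof.
elim: u b => [|x u IH] b /=; first by rewrite addbF; tauto.
rewrite addbN -addNb; split=> [[h1 h2 /IH[h3 h4]]|[[h1 h2 h3] h4]]; first by split.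
by split=> //; apply/IH.
Qed.

Lemma alt_rcons b u x : alt b (rcons u x) <->
  [/\ alt b u, X (b (+) odd (size u)) x & ~ X (~~ (b (+) odd (size u))) x].
Proof.
rewrite -cats1; split; first by move/alt_cat => [h1 [h2 h3 _]].
by move=> [h1 h2 h3]; apply/alt_cat.
Qed.

Lemma coreMl b c x : core c -> X b (c * x) <-> X b x.
Proof.
move=> hc; split=> h; last by apply: XM => //; apply: core_side.
by rewrite -(mulKg c x); apply: XM => //; apply: core_side; apply: coreV.
Qed.

Lemma coreMr b c x : core c -> X b (x * c) <-> X b x.
Proof.
move=> hc; split=> h; last by apply: XM => //; apply: core_side.
by rewrite -(mulgK c x); apply: XM => //; apply: core_side; apply: coreV.
Qed.

Lemma alt_mulr b w c : core c -> w <> [::] -> alt b w ->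
  exists w', [/\ alt b w', size w' = size w & word_eval w' = word_eval w * c].
Proof.
move=> hc; case: (lastP w) => // u x _ /alt_rcons[h1 h2 h3].
exists (rcons u (x * c)); split; last 1 first.
- by rewrite -!cats1 !word_eval_cat !word_eval1 mulgA.
- apply/alt_rcons; split=> //; first by apply/coreMr.
  by move=> h; apply: h3; move/coreMr: h; apply.
- by rewrite !size_rcons.
Qed.

Lemma alt_mull b w c : core c -> w <> [::] -> alt b w ->
  exists w', [/\ alt b w', size w' = size w & word_eval w' = c * word_eval w].
Proof.
move=> hc; case: w => // x u _ [h1 h2 h3].
exists (c * x :: u); split=> //=.
- by split=> //; [apply/coreMl | move=> h; apply: h2; move/coreMl: h; apply].
- by rewrite !word_eval_cons mulgA.
Qed.

Lemma alt_inv b w : alt b w -> alt (~~ (b (+) odd (size w))) (inv_word w).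
Proof.
elim: w b => [|x w IH] b //= [h1 h2 h3].
rewrite /inv_word /= rev_cons; apply/alt_rcons; rewrite size_rev size_map.
have -> : ~~ (b (+) ~~ odd (size w)) (+) odd (size w) = b by case: b {h1 h2 h3}; case: odd.
split; [|exact: XV|].
- by have := IH _ h3; rewrite addNb addbN.
- by move=> h; apply: h2; rewrite -[x]invgK; apply: XV.
Qed.

Hypothesis red0 : reduced_nontrivial.

Lemma red b w : alt b w -> w <> [::] -> word_eval w = 1 -> False.
Proof. by move=> aw w0; apply: red0 aw. Qed.

Lemma alt_not_core b w : w <> [::] -> alt b w -> ~ core (word_eval w).
Proof.
move=> w0 aw hc; have [w' [aw' sw' ew']] := alt_mulr (coreV hc) w0 aw.
apply: (red aw'); last by rewrite ew' mulgV.
by move=> e; move: sw' w0; rewrite e; case: (w).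
Qed.

(** In the inverse of one word followed by the other, the two first letters meet. If they do not
    merge into a core element the result is alternating and not trivial; if they do, the core
    element is absorbed into the rest and induction applies. *)
Lemma alt_uniq b b' w w' : alt b w -> alt b' w' -> word_eval w = word_eval w' ->
  size w = size w' /\ (w <> [::] -> b = b').
Proof.
elim: w b b' w' => [|x u IH] b b' w' aw aw' e.
  by case: w' aw' e => // y v aw' e; case: (red aw') => //; rewrite -e word_eval_nil.
case: w' aw' e => [|x' u'] aw' e.
  by case: (red aw) => //; rewrite e word_eval_nil.
have [ebb|nbb] := eqVneq b b'; last first.
  have aa : alt (~~ (b (+) odd (size (x :: u)))) (inv_word (x :: u) ++ x' :: u').
    apply/alt_cat; split; first exact: alt_inv.
    rewrite size_rev size_map addNb -addbA addbb addbF.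
    by move: aw'; have -> : b' = ~~ b by case: b b' nbb {aw e} => -[].
  case: (red aa); first by move/(congr1 size)/eqP; rewrite size_cat addnC.
  by rewrite word_eval_cat word_eval_inv e mulVg.
subst b'; move: aw aw' => [h1 h2 h3] [h1' h2' h3'].
rewrite !word_eval_cons in e; set c := x^-1 * x'.
have hX : X b c by apply: XM => //; apply: XV.
have eu : word_eval u = c * word_eval u'.
  by rewrite -mulgA -e mulKg.
have [hN|hN] := pselect (X (~~ b) c); last first.
  have aa : alt (~~ (~~ b (+) odd (size u))) (inv_word u ++ c :: u').
    apply/alt_cat; split; first exact: alt_inv.
    by rewrite size_rev size_map addNb -addbA addbb addbF negbK.
  case: (red aa); first by move/(congr1 size)/eqP; rewrite size_cat addnC.
  by rewrite word_eval_cat word_eval_inv word_eval_cons -eu mulVg.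
have hc : core c by apply/(coreP b).
split=> //=; congr S; case: u' h3' eu {e} => [|y' v'] h3' eu.
  case: u h3 eu {IH} => // y v h3 eu; case: (@alt_not_core _ (y :: v) _ h3) => //.
  by rewrite eu word_eval_nil mulg1.
have n0 : y' :: v' <> [::] by [].
have [w'' [aw'' <- ew'']] := @alt_mull (~~ b) (y' :: v') c hc n0 h3'.
by case: (IH _ _ w'' h3 aw''); rewrite ?ew''.
Qed.

Lemma alt_mul_letter b w (c : bool) x : w <> [::] -> alt b w -> X c x ->
  core (word_eval w * x) \/
  exists w', [/\ alt b w', w' <> [::], (size w' <= (size w).+1)%N &
    word_eval w' = word_eval w * x].
Proof.
move=> w0 aw Xx.
have nil_rcons (u : seq G) y : rcons u y <> [::] by case: u.
have abs u y : core y -> alt b u -> core (word_eval u * y) \/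
    exists w', [/\ alt b w', w' <> [::], (size w' <= size u)%N & word_eval w' = word_eval u * y].
  move=> hy; case: u => [_|z u az]; first by left; rewrite word_eval_nil mul1g.
  have n0 : z :: u <> [::] by [].
  have [w' [aw' sw' ew']] := @alt_mulr b (z :: u) y hy n0 az.
  right; exists w'; split=> //; last by rewrite sw'.
  by move=> e0; rewrite e0 in sw'.
case/lastP: w w0 aw => // u y _ auy; set e := b (+) odd (size u).
have [h1 h2 h3] := (proj1 (alt_rcons _ _ _) auy).
have [ce|ce] := eqVneq c e; last first.
  have {}ce : c = ~~ e by case: c e ce {Xx h2 h3} => -[].
  have [hc|hc] := pselect (X e x).
    have hcx : core x by apply/(coreP e); rewrite -ce.
    case: (abs (rcons u y) x hcx auy) => [hh|[w' [? ? ? ?]]]; first by left.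
    by right; exists w'; split=> //; apply: leqW.
  right; exists (rcons (rcons u y) x); split=> //; last 2 first.
  - by rewrite size_rcons.
  - by rewrite -[rcons (rcons u y) x]cats1 word_eval_cat word_eval1.
  by apply/alt_rcons; rewrite size_rcons /= addbN -/e negbK -ce.
have exy : word_eval (rcons u y) * x = word_eval u * (y * x).
  by rewrite -cats1 word_eval_cat word_eval1 mulgA.
rewrite exy; have Xyx : X e (y * x) by apply: XM => //; rewrite -ce.
have [hc|hc] := pselect (X (~~ e) (y * x)).
  have hcx : core (y * x) by apply/(coreP e).
  case: (abs u (y * x) hcx h1) => [hh|[w' [? ? ? ?]]]; first by left.
  by right; exists w'; split=> //; rewrite size_rcons !leqW.
right; exists (rcons u (y * x)); split=> //; last 2 first.
- by rewrite !size_rcons.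
- by rewrite -[rcons u (y * x)]cats1 word_eval_cat word_eval1.
by apply/alt_rcons.
Qed.

Lemma alt_normal_form v : (forall x, x \in v -> exists b, X b x) ->
  core (word_eval v) \/ exists b w, [/\ alt b w, w <> [::], (size w <= size v)%N &
    word_eval w = word_eval v].
Proof.
elim/last_ind: v => [|v x IH] H; first by left; rewrite word_eval_nil; apply: core1.
have [c Xx] : exists b, X b x by apply: H; rewrite mem_rcons mem_head.
rewrite -cats1 word_eval_cat word_eval1 size_cat addn1.
have Hv y : y \in v -> exists b, X b y.
  by move=> yv; apply: H; rewrite mem_rcons inE yv orbT.
have [hc|[b [w [aw w0 sw <-]]]] := IH Hv.
- have [hx|hx] := pselect (core x); first by left; apply: coreM.
  right; exists c, [:: word_eval v * x]; rewrite /= word_eval1; split=> //; split=> //.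
  + by apply/coreMl.
  + by move/coreMl => /(_ hc) h; apply: hx; apply/(coreP c).
have [hc|[w' [? ? sw' ?]]] := alt_mul_letter w0 aw Xx; first by left.
by right; exists b, w'; split=> //; apply: leq_trans sw' _; rewrite ltnS.
Qed.

Lemma alt_size_le b w v : alt b w -> (forall x, x \in v -> exists b, X b x) ->
  word_eval w = word_eval v -> (size w <= size v)%N.
Proof.
move=> aw hv e; case: w aw e => // x w aw e.
case: (alt_normal_form hv) => [hc|[b' [w' [aw' _ sw' ew']]]].
  by case: (@alt_not_core b (x :: w) _ aw) => //; rewrite e.
by have [-> _] := alt_uniq aw aw' (etrans e (esym ew')).
Qed.

Lemma alt_not_side b w : w <> [::] -> alt (~~ b) w -> ~ X b (word_eval w).
Proof.
move=> w0 aw h; have nc := alt_not_core w0 aw.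
have a1 : alt b [:: word_eval w] by split=> // h'; apply: nc; apply/(coreP b).
have [_ /(_ w0)] := alt_uniq aw a1 (esym (word_eval1 _)).
by case: (b).
Qed.

End AlternatingWords.

(** * Excursions in the tree of an amalgam *)

Section Excursions.
Variables (G : groupType) (S : bool -> seq G) (lC : pred G).
Local Open Scope group_scope.
Implicit Types (b : bool) (g x y : G) (u v w : seq G).
Local Notation lS b := (sgen (S b)).
Local Notation X := (fun b g => gen (lS b) g).
Local Notation C := (core (fun b g => gen (lS b) g)).
Let lall := sgen (S true ++ S false).

(* A path in the tree of cosets spelled by a word, based at a coset of one side:
   single letters of that side, and excursions, first letter included, through a
   coset of the edge group into a coset of the other side. *)
Inductive item := Ltr of G | Exc of G & seq item.

Fixpoint Allp (P : item -> Prop) (l : seq item) : Prop :=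
  if l is i :: l' then P i /\ Allp P l' else True.

Lemma item_all_ind (P : item -> Prop) : (forall s, P (Ltr s)) ->
  (forall s l, Allp P l -> P (Exc s l)) -> forall i, P i.
Proof.
move=> h1 h2; fix IH 1; case=> [s|s l]; first exact: h1.
by apply: h2; elim: l => [|i l IHl] //=.
Qed.

Lemma Allp_cat P l1 l2 : Allp P (l1 ++ l2) <-> Allp P l1 /\ Allp P l2.
Proof. by elim: l1 => [|i l IH] /=; [tauto | rewrite IH; tauto]. Qed.

Fixpoint wd (i : item) : seq G :=
  match i with Ltr s => [:: s] | Exc s l => s :: flatten (map wd l) end.

Definition wds l := flatten (map wd l).

Lemma wds_cat l1 l2 : wds (l1 ++ l2) = wds l1 ++ wds l2.
Proof. by rewrite /wds map_cat flatten_cat. Qed.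

(* Excursions return to their edge coset for the first time at their end. *)
Fixpoint vd b (i : item) : Prop :=
  match i with
  | Ltr s => lS b s
  | Exc s l => [/\ lS (~~ b) s,
      (fix all_vd l := if l is i :: l' then vd (~~ b) i /\ all_vd l' else True) l,
      C (s * word_eval (wds l)) &
      forall l1 l2, l = l1 ++ l2 -> l2 <> [::] -> ~ C (s * word_eval (wds l1))]
  end.

Lemma vdE b s l : vd b (Exc s l) <->
  [/\ lS (~~ b) s, Allp (vd (~~ b)) l, C (s * word_eval (wds l)) &
      forall l1 l2, l = l1 ++ l2 -> l2 <> [::] -> ~ C (s * word_eval (wds l1))].
Proof.
rewrite /=; have -> // : (fix all_vd l := if l is i :: l' then vd (~~ b) i /\ all_vd l' else True) l
  = Allp (vd (~~ b)) l by elim: l => [|i l IH] //=; rewrite IH.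
Qed.

Lemma all_wd b i : vd b i -> forall g, gen (lS b) g -> gen (lS b) (g * word_eval (wd i)).
Proof.
case: i => [s ls|s l /vdE[_ _ hC _]] g gg /=.
  by rewrite word_eval1; apply: genM gg (letter_gen ls).
by rewrite word_eval_cons; apply: genM gg (core_side b hC).
Qed.

Lemma gen_wds b l : Allp (vd b) l -> gen (lS b) (word_eval (wds l)).
Proof.
elim/last_ind: l => [|l i IH]; first by rewrite word_eval_nil => _; apply: gen1.
rewrite -cats1 => /Allp_cat[h1 /= [h2 _]].
rewrite wds_cat word_eval_cat {2}/wds /= cats0.
exact: all_wd h2 _ (IH h1).
Qed.

(* Unfinished excursions, innermost first; b is the side of the outermost coset. *)
Definition tk_side b (tks : seq (G * seq item)) := b (+) odd (size tks).
Definition tk_word (t : G * seq item) := t.1 :: wds t.2.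

Fixpoint stack b (tks : seq (G * seq item)) : Prop :=
  if tks is t :: tks' then
    [/\ lS (tk_side b tks) t.1, Allp (vd (tk_side b tks)) t.2,
        (forall l1 l2, t.2 = l1 ++ l2 -> ~ C (t.1 * word_eval (wds l1))) & stack b tks']
  else True.

Definition stack_word l0 tks := wds l0 ++ flatten (rev (map tk_word tks)).

Lemma stack_add b l0 tks i : Allp (vd b) l0 -> stack b tks -> vd (tk_side b tks) i ->
  C (word_eval (wd i)) -> exists l1 tks', [/\ Allp (vd b) l1, stack b tks',
    size tks' = size tks & stack_word l1 tks' = stack_word l0 tks ++ wd i].
Proof.
case: tks => [|[s l] tks] hl0 /=.
  move=> _; rewrite /tk_side addbF => vi hi; exists (rcons l0 i), [::].
  rewrite -cats1 /stack_word wds_cat !cats0 /= {2}/wds /= cats0; split=> //.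
  by apply/Allp_cat.
move=> [h1 h2 h3 h4] vi hi; exists l0, ((s, rcons l i) :: tks); split=> //=.
- split=> //; first by rewrite -cats1; apply/Allp_cat.
  move=> l1 l2; case/lastP: l2 => [|l2 j].
    rewrite cats0 => <-; rewrite -cats1 wds_cat {2}/wds /= cats0 word_eval_cat mulgA.
    have := h3 l [::] (esym (cats0 l)).
    move=> nC hC; apply: nC; rewrite -[s * _](mulgK (word_eval (wd i))).
    apply: coreM (coreV _ hi) => //; [by move=> *; apply: genM | by move=> b' x; apply: genV; apply: sgen_symm].
  by rewrite -rcons_cat => /rcons_inj[/h3].
- rewrite /stack_word /= !rev_cons -!cats1 !flatten_cat /= !cats0 /tk_word /=.
  by rewrite !wds_cat /wds /= ?cats0 -!catA.
Qed.

Lemma C1 : C 1. Proof. by apply: core1 => b; apply: gen1. Qed.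

(** Greedy reading: a letter of the current side extends the innermost excursion, which is closed as
    soon as its value is in the core; any other letter opens a new excursion, closed at once if the
    letter is in the core. *)
Lemma scan b w : all lall w -> exists l0 tks,
  [/\ Allp (vd b) l0, stack b tks & stack_word l0 tks = w].
Proof.
have XM b' x y : X b' x -> X b' y -> X b' (x * y) by apply: genM.
have XV b' x : X b' x -> X b' x^-1 by apply: genV; apply: sgen_symm.
elim/last_ind: w => [|w s IH]; first by exists [::], [::].
rewrite all_rcons => /andP[ls /IH[l0 [tks [h1 h2 <-]]]].
set d := tk_side b tks.
have [lds|lds] := boolP (lS d s).
  case: tks h2 @d lds {IH} => [_|[t l] tks [k1 k2 k3 k4]] d lds.
    exists (rcons l0 (Ltr s)), [::]; split=> //.
      by rewrite -cats1; apply/Allp_cat; split=> //=; split=> //; move: lds; rewrite /d /tk_side addbF.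
    by rewrite /stack_word /= !cats0 -!cats1 wds_cat.
  have word_s : wds (rcons l (Ltr s)) = rcons (wds l) s by rewrite -!cats1 wds_cat.
  have all_s : Allp (vd d) (rcons l (Ltr s)) by rewrite -cats1; apply/Allp_cat.
  have [hC|hC] := pselect (C (t * word_eval (wds (rcons l (Ltr s))))).
    have vi : vd (tk_side b tks) (Exc t (rcons l (Ltr s))).
      have dE : d = ~~ tk_side b tks by rewrite /d /tk_side /= addbN.
      apply/vdE; rewrite -dE; split=> // l1 l2; case/lastP: l2 => // l2 j.
      by rewrite -rcons_cat => /rcons_inj[/k3].
    have [|l1 [tks' [q1 q2 _ q4]]] := stack_add h1 k4 vi.
      by rewrite /= word_eval_cons.
    exists l1, tks'; split=> //; rewrite q4 /stack_word /= rev_cons -!cats1.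
    by rewrite !flatten_cat !map_cat !flatten_cat /tk_word /wds /= ?cats0 -!catA.
  exists l0, ((t, rcons l (Ltr s)) :: tks); split=> //=.
    split=> // l1 l2; case/lastP: l2 => [|l2 j]; first by rewrite cats0 => <-.
    by rewrite -rcons_cat => /rcons_inj[/k3].
  rewrite /stack_word /= !rev_cons -!cats1 !flatten_cat /tk_word /= cats1 word_s.
  by rewrite -!cats1 /wds /= ?cats0 -!catA.
have lNs : lS (~~ d) s.
  move: ls lds; rewrite /lall /sgen !mem_cat; clear; case: d => /=.
    by case/orP => /orP[] ->; rewrite ?orbT.
  by case/orP => /orP[] ->; rewrite ?orbT.
have [hC|hC] := pselect (C s).
  have vi : vd d (Exc s [::]).
    by apply/vdE; split=> //; [by rewrite word_eval_nil mulg1 | by case=> [|i l1] [|j l2]].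
  have [|l1 [tks' [q1 q2 _ q4]]] := stack_add h1 h2 vi; first by rewrite /= word_eval1.
  by exists l1, tks'; split=> //; rewrite q4 /= cats1.
exists l0, ((s, [::]) :: tks); split=> //=.
  have dE : tk_side b ((s, [::]) :: tks) = ~~ d by rewrite /d /tk_side /= addbN.
  by rewrite dE; split=> // -[|i l1] [|j l2] // _; rewrite word_eval_nil mulg1.
by rewrite /stack_word /= rev_cons -cats1 flatten_cat /= catA cats1.
Qed.

Hypothesis red : reduced_nontrivial X.

(** Unfinished excursions would spell a nonempty alternating word that starts on the other side and
    has its value in side [b], against [alt_not_side]. *)
Lemma parse b w : all lall w -> gen (lS b) (word_eval w) ->
  exists2 l, Allp (vd b) l & wds l = w.
Proof.
have X1 b' : X b' 1 by apply: gen1.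
have XM b' x y : X b' x -> X b' y -> X b' (x * y) by apply: genM.
have XV b' x : X b' x -> X b' x^-1 by apply: genV; apply: sgen_symm.
case/(scan b) => l0 [tks [h1 h2 e]] gw.
case: (eqVneq (size tks) 0%N) => [/size0nil e0|st].
  by exists l0 => //; rewrite -e e0 /stack_word /= cats0.
pose ts := rev [seq word_eval (tk_word t) | t <- tks].
have at_ : alt X (~~ b) ts.
  rewrite /ts; elim: tks h2 {e st ts} => [|[s l] tks IH] //= [k1 k2 k3 k4].
  rewrite rev_cons; apply/alt_rcons; rewrite size_rev size_map.
  have dE : tk_side b ((s, l) :: tks) = ~~ b (+) odd (size tks) by rewrite /tk_side /= addbN addNb.
  rewrite -dE; have gs : gen (lS (tk_side b ((s, l) :: tks))) (word_eval (tk_word (s, l))).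
    by rewrite word_eval_cons; apply: genM (letter_gen k1) (gen_wds k2).
  split=> //; first exact: IH.
  move=> h; apply: (k3 l [::]); first by rewrite cats0.
  by apply/(coreP _ (tk_side b ((s, l) :: tks))); split; rewrite -?word_eval_cons.
have ets : word_eval ts = word_eval (flatten (rev (map tk_word tks))).
  rewrite /ts; elim: tks {e st ts h2 at_} => [|t tks IH] //=.
  by rewrite !rev_cons -!cats1 flatten_cat !word_eval_cat IH /= ?cats0 ?word_eval1 ?word_eval_cat ?word_eval_nil ?mulg1.
case: (@alt_not_side _ _ XM XV red b ts _ at_).
  by move/(congr1 size)/eqP; rewrite size_rev size_map (negPf st).
rewrite ets; have : gen (lS b) ((word_eval (wds l0))^-1 * word_eval w).
  by apply: XM gw; apply: XV; apply: gen_wds.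
by rewrite -e /stack_word word_eval_cat mulKg.
Qed.

End Excursions.

(** * Sums over the tree of excursions *)

Section Sums.
Variable G : groupType.
Implicit Types (i : item G) (l : seq (item G)) (phi psi : item G -> nat).

Definition is_exc i : bool := if i is Exc _ _ then true else false.

Fixpoint total phi i : nat :=
  if i is Exc s l then (phi i + sumn (map (total phi) l))%N else 0.

Definition node_size i : nat := if i is Exc s l then (size l).+1 else 0.

(** The [node_size] of all descendants in generations below [j], plus the number of excursions in
    generation [j]: what a point can meet when it is followed through [j] generations. *)
Fixpoint depth_size (j : nat) i : nat :=
  match j with
  | 0 => is_exc i
  | j'.+1 => if i is Exc s l then ((size l).+1 + sumn (map (depth_size j') l))%N else 0
  end.

Lemma sumn_map_le phi psi l : Allp (fun i => (phi i <= psi i)%N) l ->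
  (sumn (map phi l) <= sumn (map psi l))%N.
Proof. by elim: l => [|i l IH] //= [h1 /IH]; apply: leq_add. Qed.

Lemma total_le phi psi i : (forall i, is_exc i -> phi i <= psi i)%N ->
  (total phi i <= total psi i)%N.
Proof.
move=> H; elim/item_all_ind: i => [s|s l IH] //=.
by apply: leq_add; [apply: H | apply: sumn_map_le].
Qed.

Lemma sumnD phi psi l : sumn [seq (phi i + psi i)%N | i <- l] = (sumn (map phi l) + sumn (map psi l))%N.
Proof. by elim: l => [|i l IH] //=; rewrite IH; lia. Qed.

Lemma totalD phi psi i : total (fun i => phi i + psi i)%N i = (total phi i + total psi i)%N.
Proof.
elim/item_all_ind: i => [s|s l IH] //=.
have -> : map (total (fun i => phi i + psi i)%N) l = [seq (total phi i + total psi i)%N | i <- l].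
  by elim: l IH => [|i l IHl] //= [-> /IHl ->].
by rewrite sumnD; lia.
Qed.

Lemma total_children phi i :
  (total (fun i => if i is Exc s l then sumn (map phi (seq.filter (@is_exc) l)) else 0) i
   <= total phi i - (if i is Exc s l then phi i else 0))%N.
Proof.
elim/item_all_ind: i => [s|s l IH] //=.
rewrite addKn; elim: l IH => [|i l IHl] //= [h1 /IHl h2].
by case: i h1 => [t|t m] /=; lia.
Qed.

Lemma depth_size_Ltr j s : depth_size j (Ltr s) = 0%N.
Proof. by case: j. Qed.

(** An excursion is counted for itself and for its ancestors at most [j] generations above it. *)
Lemma total_depth_size j i : (total (depth_size j) i <= j.+1 * total node_size i)%N.
Proof.
elim: j => [|j IH].
  by rewrite mul1n; apply: total_le; case.
have e : (total (depth_size j.+1) i <= total node_size i + total (depth_size j) i)%N.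
  have h := total_children (depth_size j) i.
  have : (total (depth_size j.+1) i <= total (fun i => node_size i +
      (if i is Exc s l then sumn (map (depth_size j) (seq.filter (@is_exc) l)) else 0))%N i)%N.
    apply: total_le => -[//|s l] _ /=; rewrite leq_add2l.
    elim: l => [|[t|t m] l IHl] //=; first by rewrite depth_size_Ltr.
    by rewrite leq_add2l.
  by rewrite totalD; move: h; clear; lia.
by apply: (leq_trans e); rewrite mulSn leq_add2l.
Qed.

(** The successor makes the induction work: it pays for the place of the item in the [node_size] of
    its parent. *)
Lemma total_node_size i : ((total node_size i).+1 <= 2 * size (wd i))%N.
Proof.
elim/item_all_ind: i => [s|s l IH] //=.
have : (sumn (map (total node_size) l) + size l <= 2 * size (flatten (map (@wd G) l)))%N.
  by elim: l IH => [|i l IHl] //= [h1 /IHl]; rewrite size_cat; lia.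
by lia.
Qed.

Lemma sumn_total_node_size l :
  (sumn (map (total node_size) l) + size l <= 2 * size (wds l))%N.
Proof.
elim: l => [|i l IH] //=; rewrite /wds /= size_cat -/(wds l).
by have := total_node_size i; lia.
Qed.

End Sums.

(** * Combination over an acylindrical amalgam *)

Section Combination.
Variables (G : groupType) (S : bool -> seq G) (lC : pred G) (k : nat).
Local Open Scope group_scope.
Implicit Types (b : bool) (g x y : G) (u v w : seq G) (i : item G) (l : seq (item G)).
Local Notation lS b := (sgen (S b)).
Local Notation X := (fun b g => gen (lS b) g).
Local Notation C := (core (fun b g => gen (lS b) g)).
Local Notation vd := (vd S).
Let lall := sgen (S true ++ S false).

Hypothesis sC : symm lC.
Hypothesis CS : forall b s, lC s -> lS b s.
Hypothesis coreC : forall g, C g -> gen lC g.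
Hypothesis red : reduced_nontrivial X.
Hypothesis flows : forall b, flow (S b) lC.
Hypothesis k0 : (0 < k)%N.
Hypothesis acyl : forall b w, alt X b w -> size w = k ->
  exists s : seq G, forall c, C c -> C ((word_eval w)^-1 * (c * word_eval w)) -> c \in s.

Let X1 b : X b 1. Proof. exact: gen1. Qed.
Let XM b x y : X b x -> X b y -> X b (x * y). Proof. exact: genM. Qed.
Let XV b x : X b x -> X b x^-1. Proof. by apply: genV; apply: sgen_symm. Qed.
Let CM x y : C x -> C y -> C (x * y). Proof. exact: coreM. Qed.
Let CV x : C x -> C x^-1. Proof. exact: coreV. Qed.

Let lS_all b s : lS b s -> lall s.
Proof. by rewrite /lall /sgen !mem_cat; case: b => /orP[] ->; rewrite ?orbT. Qed.

Let ball_all b n g : ball (lS b) n g -> ball lall n g.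
Proof. by case=> w [lw sw ew]; exists w; split=> //; apply: sub_all lw; apply: lS_all. Qed.

Let genC_core g : gen lC g -> C g.
Proof. by move=> h; split; apply: gen_sub h => s ls; apply/letter_gen/CS. Qed.

Definition geo g : seq G :=
  if pselect (gen lC g) is left h then s2val (cid2 (geodw_ex h)) else [::].

Lemma geoP g : gen lC g -> geodw lC (geo g) /\ word_eval (geo g) = g.
Proof. by rewrite /geo; case: pselect => // h _; case: cid2. Qed.

(* The edge geodesic closing up an excursion. *)
Definition kap i : seq G :=
  match i with Ltr s => [:: s] | Exc s l => geo (word_eval (wd (Exc s l))) end.

Definition kaps l := flatten (map kap l).

Definition fit i : bool * seq G := (~~ is_exc i, kap i).

Lemma kapP b i : vd b i -> word_eval (kap i) = word_eval (wd i) /\ all (lS b) (kap i).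
Proof.
case: i => [s /= ->//|s l /vdE[h1 h2 h3 h4]].
have [gk ek] := geoP (coreC h3); rewrite word_eval_cons.
rewrite /= word_eval_cons -/(wds l) ek; split=> //.
by apply: sub_all gk.1 => t; apply: CS.
Qed.

Lemma kap_geodw b i : vd b i -> is_exc i -> geodw lC (kap i).
Proof.
case: i => // s l /vdE[h1 h2 h3 h4] _ /=; rewrite word_eval_cons.
by case: (geoP (coreC h3)).
Qed.

Lemma kapsP b l : Allp (vd b) l ->
  word_eval (kaps l) = word_eval (wds l) /\ all (lS b) (kaps l).
Proof.
rewrite /kaps /wds; elim: l => [|i l IH] //= [/kapP[e1 a1] /IH[e2 a2]].
by rewrite !word_eval_cat e1 e2 all_cat a1 a2.
Qed.

(** With its children replaced by their edge geodesics, an excursion becomes a polygon in a coset of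
    one factor. There [flows] applies, the edge geodesic of the excursion being the distinguished
    side and the letters the sides tagged true. *)
Lemma common_flow : exists C0 D : nat, forall b s l, vd b (Exc s l) ->
  exists2 bad : seq G, (size bad <= C0 * (size l).+1)%N &
  forall t, (t <= size (kap (Exc s l)))%N ->
    word_eval (take t (kap (Exc s l))) \in bad \/
    exists l1 i l2 t', [/\ l = l1 ++ i :: l2, is_exc i, (t' <= size (kap i))%N &
      ball lall D ((word_eval (take t (kap (Exc s l))))^-1 *
        (s * word_eval (wds l1) * word_eval (take t' (kap i))))].
Proof.
suff one b : exists C0 D : nat, forall s l, vd (~~ b) (Exc s l) ->
    exists2 bad : seq G, (size bad <= C0 * (size l).+1)%N &
    forall t, (t <= size (kap (Exc s l)))%N ->
      word_eval (take t (kap (Exc s l))) \in bad \/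
      exists l1 i l2 t', [/\ l = l1 ++ i :: l2, is_exc i, (t' <= size (kap i))%N &
        ball lall D ((word_eval (take t (kap (Exc s l))))^-1 *
          (s * word_eval (wds l1) * word_eval (take t' (kap i))))].
  have [C1 [D1 H1]] := one true; have [C2 [D2 H2]] := one false.
  exists (C1 + C2)%N, (D1 + D2)%N => b s l; rewrite -(negbK b); case: (~~ b) => h.
    have [bad sb hb] := H1 _ _ h; exists bad.
      by apply: leq_trans sb _; rewrite leq_mul2r leq_addr orbT.
    move=> t /hb[|[l1 [i [l2 [t' [h1 h2 h3 h4]]]]]]; [by left | right].
    by exists l1, i, l2, t'; split=> //; apply: ball_le h4; apply: leq_addr.
  have [bad sb hb] := H2 _ _ h; exists bad.
    by apply: leq_trans sb _; rewrite leq_mul2r leq_addl orbT.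
  move=> t /hb[|[l1 [i [l2 [t' [h1 h2 h3 h4]]]]]]; [by left | right].
  by exists l1, i, l2, t'; split=> //; apply: ball_le h4; apply: leq_addl.
have [C0 [D H]] := flows b; exists C0, D => s l vi.
have gk := kap_geodw vi isT; have [ek _] := kapP vi.
move: (vi) => /vdE; rewrite negbK => -[h1 h2 h3 h4].
have iw m : items_word (map fit m) = kaps m.
  by rewrite /items_word /kaps -map_comp.
have [] := H (kap (Exc s l)) ((true, [:: s]) :: map fit l) => //.
- move=> it; rewrite inE => /orP[/eqP->|]; first by exists s.
  elim: l h2 {vi gk ek h3 h4} => [|i l IH] //= [hi hl]; rewrite inE => /orP[/eqP->|]; last exact: IH.
  by case: i hi => [t|t m] hi; [exists t | apply: (kap_geodw hi)].
- rewrite ek /= word_eval_cons [in RHS]/items_word /= word_eval_cons -/(items_word _) iw.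
  by have [-> _] := kapsP h2.
move=> bad; rewrite /= size_map => sb hb; exists bad => // t /hb[|]; first by left.
case=> -[|n] [t' [n1 n2 n3 n4]] //=; right.
have n1' : (n < size l)%N by [].
move: n2 n3 n4; rewrite [nth _ _ n.+1]/= (nth_map (Ltr 1)) // => n2 n3 n4.
exists (take n l), (nth (Ltr 1) l n), (drop n.+1 l), t'; split=> //.
- by rewrite -drop_nth // cat_take_drop.
- by move: n2 => /= /negbFE.
- have hl : Allp (vd b) (take n l) by move: h2; rewrite -{1}(cat_take_drop n l) => /Allp_cat[].
  move: n4; rewrite /items_word /= word_eval_cons -/(items_word _) -map_take iw.
  by have [ekl _] := kapsP hl; rewrite word_eval_cons ekl; exact: ball_all.
Qed.

Lemma alt_conj_core w0 b a c : alt X b w0 -> size w0 = k -> C a -> C c ->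
  exists b w, [/\ alt X b w, size w = k & word_eval w = a * word_eval w0 * c].
Proof.
move=> aw sw ha hc.
have n0 : w0 <> [::] by move=> e; move: k0; rewrite -sw e.
have [w1 [aw1 sw1 ew1]] := alt_mull XM XV ha n0 aw.
have n1 : w1 <> [::] by move=> e; move: k0; rewrite -sw -sw1 e.
have [w2 [aw2 sw2 ew2]] := alt_mulr XM XV hc n1 aw1.
by exists b, w2; split=> //; rewrite ?sw2 ?sw1 ?sw ?ew2 ?ew1.
Qed.

(** By induction on [j], [claim] counts the points [p] of the edge coset of [y0] that are close to
    the edge geodesic of an excursion [k - j] generations further down. By [common_flow] such a
    point is near a bad point or near the edge geodesic of a child; after [k] generations
    acylindricity leaves boundedly many points for each of finitely many differences. The case
    [j = k] counts the points of the geodesic itself. *)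
Lemma edge_bounded : exists c, forall b i, vd b i -> is_exc i ->
  (size (kap i) <= c * depth_size k i)%N.
Proof.
have [C0 [D HD]] := common_flow.
have claim j : (j <= k)%N -> exists c, forall b i y y0 w0, vd b i -> is_exc i ->
    alt X (~~ b (+) odd (k - j)) w0 -> size w0 = (k - j)%N -> y0^-1 * y = word_eval w0 ->
    exists2 cov : seq G, (size cov <= c * depth_size j i)%N &
    forall p t, C (y0^-1 * p) -> (t <= size (kap i))%N ->
      ball lall ((k - j) * D) (p^-1 * (y * word_eval (take t (kap i)))) -> p \in cov.
  elim: j => [_|j IH jk].
    have [bs hbs] := ball_finite (S true ++ S false) (k * D); rewrite subn0.
    (* A finite set is attached to every [z], with no condition if [z] is not an alternating word of
       length [k]; thus one number bounds the sets of all [z] in the finite ball [bs]. *)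
    have Fex z : exists s : seq G, (exists b w, [/\ alt X b w, size w = k & word_eval w = z]) ->
        forall c, C c -> C (z^-1 * (c * z)) -> c \in s.
      have [[b [w [aw sw ew]]]|no] := pselect (exists b w, [/\ alt X b w, size w = k & word_eval w = z]).
        by have [s hs] := acyl aw sw; exists s => _; rewrite -ew.
      by exists [::] => /no.
    pose F z := projT1 (cid (Fex z)).
    have FP z := projT2 (cid (Fex z)); rewrite -/(F _) in FP.
    exists (size (flatten (map F bs))) => b i y y0 w0 vi ei aw0 sw0 ey.
    (* One reference point [q z] for each difference [z] that occurs. Any other point with this
       difference is a multiple of it by a core element that [z] conjugates into the core. *)
    have pex z : exists p, (exists p, C (y0^-1 * p) /\ C (y^-1 * (p * z))) ->
        C (y0^-1 * p) /\ C (y^-1 * (p * z)).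
      have [[p hp]|no] := pselect (exists p, C (y0^-1 * p) /\ C (y^-1 * (p * z))); first by exists p.
      by exists 1 => /no.
    pose q z := projT1 (cid (pex z)).
    have qP z := projT2 (cid (pex z)); rewrite -/(q _) in qP.
    exists (flatten [seq [seq q z * f | f <- F z] | z <- bs]).
      rewrite /= ei muln1; elim: (bs) => [|z s IHs] //=.
      by rewrite !size_cat size_map leq_add2l.
    move=> p t hp tk bp; set c' := word_eval (take t (kap i)) in bp.
    have hc' : C c'.
      apply: genC_core; exists (take t (kap i)) => //.
      by have [lk _] := kap_geodw vi ei; move: lk; rewrite -{1}(cat_take_drop t (kap i)) all_cat => /andP[].
    set z := p^-1 * (y * c') in bp.
    have zb : z \in bs by apply: hbs.
    have za : exists b w, [/\ alt X b w, size w = k & word_eval w = z].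
      have [b' [w [a1 a2 a3]]] := alt_conj_core aw0 sw0 (CV hp) hc'.
      by exists b', w; split=> //; rewrite a3 -ey invgM invgK -!mulgA mulVKg.
    have [q1 q2] : C (y0^-1 * q z) /\ C (y^-1 * (q z * z)).
      by apply: qP; exists p; rewrite /z mulVKg mulKg.
    apply/flatten_mapP; exists z => //; apply/mapP; exists ((q z)^-1 * p); last by rewrite mulVKg.
    apply: FP za _ _ _.
      have -> : (q z)^-1 * p = (y0^-1 * q z)^-1 * (y0^-1 * p) by rewrite invgM invgK -mulgA mulVKg.
      exact: CM (CV q1) hp.
    have conjE (y' q' p' z' : G) :
        z'^-1 * (q'^-1 * p' * z') = (y'^-1 * (q' * z'))^-1 * (y'^-1 * (p' * z')).
      by rewrite !invgM invgK -!mulgA mulVKg.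
    rewrite (conjE y).
    by apply: CM (CV q2) _; rewrite /z mulVKg mulKg.
  have [c Hc] := IH (ltnW jk).
  have [bs hbs] := ball_finite (S true ++ S false) ((k - j.+1) * D).
  exists (C0 * size bs + c)%N => b [//|s l] y y0 w0 vi _ aw0 sw0 ey.
  have [bad sbad hbad] := HD _ _ _ vi.
  move: (vi) => /vdE[h1 h2 h3 h4].
  have children l1 l2 : l = l1 ++ l2 -> exists2 cov : seq G,
      (size cov <= c * sumn (map (depth_size j) l2))%N &
      forall l3 i' l4 p t', l2 = l3 ++ i' :: l4 -> is_exc i' -> C (y0^-1 * p) ->
        (t' <= size (kap i'))%N ->
        ball lall ((k - j) * D)
          (p^-1 * (y * (s * word_eval (wds (l1 ++ l3))) * word_eval (take t' (kap i')))) ->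
        p \in cov.
    elim: l2 l1 => [|i' l2 IHl] l1 el; first by exists [::] => // -[|? ?] ?.
    have [cov1 s1 hcov1] := IHl (rcons l1 i') (etrans el (esym (cat_rcons _ _ _))).
    have vi' : vd (~~ b) i' by move: h2; rewrite el => /Allp_cat[_ []].
    have [ei'|ei'] := boolP (is_exc i'); last first.
      exists cov1; first by apply: leq_trans s1 _; rewrite leq_mul2l /= leq_addl orbT.
      move=> [|i3 l3] i4 l4 p t' [].
        by move=> <- _ e4; rewrite e4 in ei'.
      by move=> <- e4 e5 hp ht; have := hcov1 l3 i4 l4 p t' e4 e5 hp ht; rewrite cat_rcons.
    have nC : ~ C (s * word_eval (wds l1)) by apply: (h4 l1 (i' :: l2) el).
    have gX : X (~~ b) (s * word_eval (wds l1)).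
      apply: genM (letter_gen h1) _; apply: gen_wds.
      by move: h2; rewrite el => /Allp_cat[].
    have kj : (k - j = (k - j.+1).+1)%N by lia.
    have [|||cov2 s2 hcov2] := Hc (~~ b) i' (y * (s * word_eval (wds l1))) y0
      (rcons w0 (s * word_eval (wds l1))) vi' ei'.
    - rewrite kj; apply/alt_rcons; rewrite sw0 /= negbK.
      have -> : b (+) ~~ odd (k - j.+1) = ~~ b (+) odd (k - j.+1) by rewrite addbN addNb.
      split=> //; first by rewrite -addbA addbb addbF.
      by rewrite -addbA addbb addbF => h; apply: nC; apply/(coreP _ (~~ b)).
    - by rewrite size_rcons sw0 kj.
    - by rewrite -cats1 word_eval_cat word_eval1 -ey -!mulgA.
    exists (cov2 ++ cov1); first by rewrite size_cat /= mulnDr leq_add.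
    move=> [|i3 l3] i4 l4 p t' []; rewrite mem_cat.
      by move=> <- _ _ hp ht; rewrite cats0 => hb; rewrite (hcov2 p t').
    move=> <- e4 e5 hp ht hb; apply/orP; right; apply: (hcov1 l3 i4 l4 p t' e4 e5 hp ht).
    by rewrite cat_rcons.
  have [cov1 s1 hcov1] := children [::] l erefl.
  exists ([seq y * x * z^-1 | x <- bad, z <- bs] ++ cov1).
    rewrite size_cat size_allpairs /=.
    have a1 : (size bad * size bs <= C0 * (size l).+1 * size bs)%N by rewrite leq_mul2r sbad orbT.
    move: s1 a1; move: (sumn _) (size l).+1 => u v.
    have -> : ((C0 * size bs + c) * (v + u) = C0 * v * size bs + c * u + (C0 * size bs * u + c * v))%N.
      by clear; ring.
    by clear; lia.
  move=> p t hp tk bp; rewrite mem_cat; case: (hbad t tk) => [xb|].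
    apply/orP; left; apply/allpairsP.
    exists (word_eval (take t (kap (Exc s l))), p^-1 * (y * word_eval (take t (kap (Exc s l))))).
    split; [exact: xb | by apply: hbs | ].
    by rewrite /fst /snd [(p^-1 * _)^-1]invgM invgK mulVKg.
  case=> l1 [i' [l2 [t' [e1 e2 e3 e4]]]]; apply/orP; right.
  apply: (hcov1 l1 i' l2 p t' e1 e2 hp e3).
  have -> : ((k - j) * D = (k - j.+1) * D + D)%N.
    by have -> : (k - j = (k - j.+1).+1)%N; [lia | rewrite mulSn addnC].
  have := ballM bp e4.
  by rewrite -!mulgA mulVKg.
(* For [y = y0 = 1] the points counted include all vertices of [kap i], which are distinct because
   the word is geodesic. *)
have [c Hc] := claim k (leqnn k); exists c => b i vi ei.
have [|||cov sc hcov] := Hc b i 1 1 [::] vi ei.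
- by [].
- by rewrite subnn.
- by rewrite invg1 mul1g word_eval_nil.
have gk := kap_geodw vi ei.
have inj : uniq [seq word_eval (take t (kap i)) | t <- iota 0 (size (kap i)).+1].
  rewrite map_inj_in_uniq ?iota_uniq // => t t'; rewrite !mem_iota !add0n !ltnS /= => tk tk' e.
  have aux m n : (m < n)%N -> (n <= size (kap i))%N ->
      word_eval (take m (kap i)) = word_eval (take n (kap i)) -> False.
    move=> mn nk e'; have := gk.2 (take m (kap i) ++ drop n (kap i)).
    rewrite all_cat word_eval_cat e' -word_eval_cat cat_take_drop.
    have lk := gk.1; have := lk; rewrite -{1}(cat_take_drop m (kap i)) all_cat => /andP[-> _].
    have := lk; rewrite -{1}(cat_take_drop n (kap i)) all_cat => /andP[_ ->].
    by move=> /(_ isT erefl); rewrite size_cat size_takel ?size_drop; lia.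
  by case: (ltngtP t t') => // tt; [case: (aux _ _ tt tk' e) | case: (aux _ _ tt tk (esym e))].
have sub : {subset [seq word_eval (take t (kap i)) | t <- iota 0 (size (kap i)).+1] <= cov}.
  move=> p /mapP[t]; rewrite mem_iota add0n ltnS => /andP[_ tk] ->.
  apply: (hcov _ t) => //.
    rewrite invg1 mul1g; apply: genC_core; exists (take t (kap i)) => //.
    by have lk := gk.1; move: lk; rewrite -{1}(cat_take_drop t (kap i)) all_cat => /andP[].
  by rewrite subnn mul0n mul1g mulVg; apply: ball1.
have := uniq_leq_size inj sub; rewrite size_map size_iota => h.
exact: leq_trans (ltnW h) sc.
Qed.

Definition edge_size i : nat := size (kap i).

Lemma total_vd phi psi : (forall b i, vd b i -> is_exc i -> phi i <= psi i)%N ->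
  forall b i, vd b i -> (total phi i <= total psi i)%N.
Proof.
move=> H b i; elim/item_all_ind: i b => [s|s l IH] b // vi /=.
apply: leq_add; first exact: H vi isT.
move: vi => /vdE[_ h2 _ _]; elim: l h2 IH => [|i l IHl] //= [v1 v2] [h1 h2].
by apply: leq_add; [apply: h1 v1 | apply: IHl].
Qed.

Lemma totalM c phi i : total (fun i => c * phi i)%N i = (c * total phi i)%N.
Proof.
elim/item_all_ind: i => [s|s l IH] /=; first by rewrite muln0.
rewrite mulnDr; congr addn; elim: l IH => [|i l IHl] /=; first by rewrite muln0.
by case=> -> /IHl ->; rewrite mulnDr.
Qed.

Lemma total_edge_size : exists c, forall b i, vd b i ->
  (total edge_size i <= c * total (@node_size G) i)%N.
Proof.
have [c Hc] := edge_bounded; exists (c * k.+1)%N => b i vi.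
have h := @total_vd edge_size (fun i => c * depth_size k i)%N Hc b i vi.
apply: (leq_trans h); rewrite totalM -mulnA leq_mul2l; apply/orP; right.
exact: total_depth_size.
Qed.

Lemma sum_edge_size c l b : (forall b i, vd b i ->
  (total edge_size i <= c * total (@node_size G) i)%N) -> Allp (vd b) l ->
  (sumn (map (total edge_size) l) <= c * sumn (map (total (@node_size G)) l))%N.
Proof.
move=> H; elim: l => [|i l IH] //= [/H h1 /IH h2].
by rewrite mulnDr leq_add.
Qed.

Lemma size_kaps_le l : (size (kaps l) <= size l + sumn (map (total edge_size) l))%N.
Proof.
elim: l => [|i l IH] //; have -> : kaps (i :: l) = kap i ++ kaps l by [].
rewrite size_cat /=.
have : (size (kap i) <= 1 + total edge_size i)%N by case: i => [s|s m] //=; rewrite /edge_size /=; lia.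
by move: IH; lia.
Qed.

(** Replacing every outermost excursion by its edge geodesic turns the word into one over a single
    factor, whose length is linear by [total_edge_size]. *)
Theorem combination_undistorted b : undistorted (lS b) lall.
Proof.
have [c Hc] := total_edge_size; exists (2 + 2 * c)%N => n g gg [w [lw sw ew]].
have [|l vl el] := parse red lw (b := b); first by rewrite ew.
have [ek lk] := kapsP vl; exists (kaps l); split=> //; last by rewrite ek el.
have h1 := size_kaps_le l; have h2 := sum_edge_size Hc vl.
have h3 := sumn_total_node_size l; rewrite el in h3.
apply: (leq_trans h1); rewrite mulnDl.
have h4 : (c * sumn (map (total (@node_size G)) l) <= 2 * c * n)%N.
  by rewrite (mulnC 2%N) -mulnA leq_mul2l; apply/orP; right; clear - h3 sw; lia.
by move: h2 h4; move: (c * _)%N (2 * c * n)%N; clear - h3 sw; lia.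
Qed.

Hypothesis sqS : forall b, sq_hyperbolic (cay (lS b)).

Definition cell_size i : nat :=
  if i is Exc s l then (1 + size (kaps l) + size (kap i))%N else 0.

Lemma total_cell_size i :
  (total cell_size i <= total (@node_size G) i + 2 * total edge_size i)%N.
Proof.
have h1 : (total cell_size i <= total (fun i => node_size i + (edge_size i +
    (if i is Exc s l then sumn (map edge_size (seq.filter (@is_exc G) l)) else 0)))%N i)%N.
  apply: total_le => -[//|s l] _ /=; rewrite /edge_size /=.
  have : (size (kaps l) <= size l + sumn (map (fun i => size (kap i)) (seq.filter (@is_exc G) l)))%N.
    elim: l => [|a l IH] //; have -> : kaps (a :: l) = kap a ++ kaps l by [].
    by rewrite size_cat /=; case: a => [t|t m] /=; move: IH; [lia | rewrite /=; lia].
  by clear; lia.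
have := total_children edge_size i.
by move: h1; rewrite !totalD; move: (edge_size i); clear; case: i => *; lia.
Qed.

(** Superadditivity bounds the area of many loops by their total length alone. *)
Lemma quad_superadd K m n : (m ^ 2 + K * m + (n ^ 2 + K * n) <= (m + n) ^ 2 + K * (m + n))%N.
Proof. by rewrite sqrnD mulnDr; move: (K * m)%N (K * n)%N; clear; lia. Qed.

Lemma quad_add (e K m n : nat) (s t : int) :
  (e%:Z * `|s| <= (m ^ 2 + K * m)%N%:Z -> e%:Z * `|t| <= (n ^ 2 + K * n)%N%:Z ->
  e%:Z * `|s + t| <= ((m + n) ^ 2 + K * (m + n))%N%:Z)%R.
Proof.
move=> h1 h2; apply: (@le_trans _ _ (m ^ 2 + K * m + (n ^ 2 + K * n))%N%:Z); last first.
  by rewrite lez_nat quad_superadd.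
rewrite PoszD; apply: le_trans (lerD h1 h2); rewrite -mulrDr; apply: ler_wpM2l => //.
exact: ler_normD.
Qed.

Section Area.
Variables (e K c : nat) (f g : G -> int).
Hypothesis fl : lip (cay lall) c f.
Hypothesis gl : lip (cay lall) c g.
Hypothesis HK : forall b (f g : G -> int), lip (cay (lS b)) c f -> lip (cay (lS b)) c g ->
  forall x p, path (cay (lS b)) x p -> last x p = x ->
  (e%:Z * `|circ f g x p| <= (size p ^ 2 + K * size p)%N%:Z)%R.

Let lipS b h : lip (cay lall) c h -> lip (cay (lS b)) c h.
Proof. by move=> hl x y xy; apply: hl; apply: lS_all xy. Qed.

Lemma closed_words b x u v : all (lS b) u -> all (lS b) v -> word_eval u = word_eval v ->
  (e%:Z * `|circ f g x (walk x u) - circ f g x (walk x v)|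
    <= ((size u + size v) ^ 2 + K * (size u + size v))%N%:Z)%R.
Proof.
move=> lu lv euv.
have := HK (lipS (b := b) fl) (lipS (b := b) gl) (x := x) (p := walk x u ++ revwalk x (walk x v)).
have luv : last x (walk x u) = last x (walk x v) by rewrite !last_walk euv.
rewrite cat_path path_walk lu luv path_revwalk ?path_walk //; last first.
  by apply: cay_symm; apply: sgen_symm.
rewrite last_cat luv last_revwalk circ_cat luv circ_revwalk size_cat size_revwalk !size_walk.
by apply.
Qed.

(** The loop formed by an excursion and its edge geodesic is the sum of one loop in a factor, of
    length [cell_size], for every excursion of the tree. *)
Lemma area_cells b i x : vd b i ->
  (e%:Z * `|circ f g x (walk x (wd i)) - circ f g x (walk x (kap i))|
    <= (total cell_size i ^ 2 + K * total cell_size i)%N%:Z)%R.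
Proof.
elim/item_all_ind: i b x => [s|s l IH] b x vi; first by rewrite subrr normr0 mulr0.
move: (vi) => /vdE[h1 h2 h3 _].
have [ek lk] := kapsP h2; have [ei li] := kapP vi.
have hb : (e%:Z * `|circ f g x (walk x (s :: kaps l)) - circ f g x (walk x (kap (Exc s l)))|
    <= (cell_size (Exc s l) ^ 2 + K * cell_size (Exc s l))%N%:Z)%R.
  apply: (@closed_words (~~ b) x (s :: kaps l)).
  - by rewrite /= h1 lk.
  - by have [lg _] := kap_geodw vi isT; apply: sub_all lg => t; apply: CS.
  - by rewrite ei [wd _]/= -/(wds l) !word_eval_cons ek.
have hl : forall y, (e%:Z * `|circ f g y (walk y (wds l)) - circ f g y (walk y (kaps l))|
    <= (sumn (map (total cell_size) l) ^ 2 + K * sumn (map (total cell_size) l))%N%:Z)%R.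
  elim: l h2 IH {vi h3 ek lk ei li hb} => [|i l IHl] /=; first by move=> *; rewrite subrr normr0 mulr0.
  case=> vi vl [ai al] y; rewrite /wds /kaps /= !walk_cat !circ_cat -/(wds l) -/(kaps l).
  rewrite !last_walk; have [-> _] := kapP vi.
  have h4 := IHl vl al (y * word_eval (wd i)); have h5 := ai _ y vi.
  by have := quad_add h5 h4; rewrite addrACA -opprD.
have := quad_add hb (hl (x * s)); rewrite [wd _]/= -/(wds l).
have -> : forall u v w t : int, (u + v - w + (t - v) = u + t - w)%R by move=> *; ring.
by [].
Qed.

Lemma area_items b l x : Allp (vd b) l ->
  (e%:Z * `|circ f g x (walk x (wds l)) - circ f g x (walk x (kaps l))|
    <= (sumn (map (total cell_size) l) ^ 2 + K * sumn (map (total cell_size) l))%N%:Z)%R.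
Proof.
elim: l x => [|i l IHl] x /=; first by move=> *; rewrite subrr normr0 mulr0.
case=> vi vl; rewrite /wds /kaps /= !walk_cat !circ_cat -/(wds l) -/(kaps l).
rewrite !last_walk; have [-> _] := kapP vi.
have h4 := IHl (x * word_eval (wd i)) vl; have h5 := area_cells x vi.
by have := quad_add h5 h4; rewrite addrACA -opprD.
Qed.

End Area.

Theorem combination_sq_hyperbolic : sq_hyperbolic (cay lall).
Proof.
(* [A] bounds the total length of the loops in the factors relative to the word: the node sizes and
   outermost items contribute at most 2, and each edge geodesic occurs at most three times, their
   sum being at most [2 * c1] times the length. *)
move=> e c; have [c1 Hc1] := total_edge_size; pose A := (2 + 6 * c1)%N.
have [K1 HK1] := sqS true (e * (A ^ 2 + 1))%N c; have [K2 HK2] := sqS false (e * (A ^ 2 + 1))%N c.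
pose K := (K1 + K2)%N; exists (K * A)%N => f g fl gl x p px lx.
have HK b (f' g' : G -> int) : lip (cay (lS b)) c f' -> lip (cay (lS b)) c g' ->
    forall x p, path (cay (lS b)) x p -> last x p = x ->
    ((e * (A ^ 2 + 1))%N%:Z * `|circ f' g' x p| <= (size p ^ 2 + K * size p)%N%:Z)%R.
  move=> fl' gl' x' p' px' lx'; case: b fl' gl' px' => fl' gl' px'.
    apply: le_trans (HK1 _ _ fl' gl' _ _ px' lx') _.
    by rewrite lez_nat leq_add2l leq_mul2r leq_addr orbT.
  apply: le_trans (HK2 _ _ fl' gl' _ _ px' lx') _.
  by rewrite lez_nat leq_add2l leq_mul2r leq_addl orbT.
have [w lw pw] := walk_ex px; subst p; rewrite size_walk.
have ew : word_eval w = 1 by apply: (@mulgI _ x); rewrite -last_walk lx mulg1.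
have [|l vl el] := parse red lw (b := true); first by rewrite ew; apply: gen1.
have [ek lk] := kapsP vl.
have h1 := area_items fl gl HK x vl.
have h2 := @closed_words _ K c f g fl gl HK true x (kaps l) [::] lk isT.
rewrite ek el ew word_eval_nil /= subr0 addn0 in h2; have {}h2 := h2 erefl.
rewrite el in h1.
set N1 := sumn _ in h1; set N2 := size _ in h2.
have hN : (N1 + N2 <= A * size w)%N.
  have a1 := size_kaps_le l; have a2 := sum_edge_size Hc1 vl.
  have a3 := sumn_total_node_size l; rewrite el in a3.
  have a4 : (N1 <= sumn (map (total (@node_size G)) l) + 2 * sumn (map (total edge_size) l))%N.
    rewrite /N1; elim: (l) => [|i l' IH] //=; have := total_cell_size i; move: IH; clear; lia.
  have a5 : (c1 * sumn (map (total (@node_size G)) l) <= 2 * (c1 * size w))%N.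
    by rewrite mulnCA leq_mul2l; apply/orP; right; clear - a3; lia.
  rewrite -/N2 in a1; rewrite /A mulnDl -mulnA; move: a2 a5.
  by move: (c1 * size w)%N (c1 * _)%N; clear - a1 a3 a4; lia.
move: h1 h2; move: (circ f g x (walk x w)) (circ f g x (walk x (kaps l))) => s t h1 h2.
have h3 : ((e * (A ^ 2 + 1))%N%:Z * `|s| <= ((A * size w) ^ 2 + K * (A * size w))%N%:Z)%R.
  apply: (@le_trans _ _ ((N1 + N2) ^ 2 + K * (N1 + N2))%N%:Z); last first.
    by rewrite lez_nat leq_add // ?leq_exp2r // leq_mul2l hN orbT.
  by have := quad_add h1 h2; rewrite subrK.
have A0 : (0 < (A ^ 2 + 1)%N%:Z :> int)%R by rewrite ltz_nat addn1.
rewrite -(ler_pM2l A0) mulrA -PoszM (mulnC _ e); apply: (le_trans h3).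
rewrite -PoszM lez_nat; set L := size w.
have -> : ((A ^ 2 + 1) * (L ^ 2 + K * A * L)
    = (A * L) ^ 2 + K * (A * L) + (L ^ 2 + A ^ 2 * (K * A * L)))%N by clear; ring.
exact: leq_addr.
Qed.

End Combination.

(** * Subamalgams *)

Section Subamalgam.
Variables (G : groupType) (S : bool -> seq G) (lC : pred G) (l0 : bool -> pred G).
Local Open Scope group_scope.
Implicit Types (b : bool) (c g x y z : G) (u v w : seq G).
Local Notation lS b := (sgen (S b)).
Local Notation X := (fun b g => gen (lS b) g).
Local Notation Y := (fun b g => gen (l0 b) g).
Local Notation C := (core (fun b g => gen (lS b) g)).
Let lall := sgen (S true ++ S false).
Let lM : pred G := fun s => l0 true s || l0 false s.

Hypothesis sC : symm lC.
Hypothesis s0 : forall b, symm (l0 b).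
Hypothesis CS : forall b s, lC s -> lS b s.
Hypothesis l0S : forall b s, l0 b s -> lS b s.
Hypothesis coreC : forall g, C g -> gen lC g.
Hypothesis core_l0 : forall b g, C g -> gen (l0 b) g -> gen (l0 (~~ b)) g.
Hypothesis red : reduced_nontrivial X.
Hypothesis undC : forall b, undistorted lC (lS b).
Hypothesis und0 : forall b, undistorted (l0 b) (lS b).
Hypothesis undS : forall b, undistorted (lS b) lall.
Hypothesis sqS : forall b, sq_hyperbolic (cay (lS b)).

Let XM b x y : X b x -> X b y -> X b (x * y). Proof. exact: genM. Qed.
Let XV b x : X b x -> X b x^-1. Proof. by apply: genV; apply: sgen_symm. Qed.
Let genC_core g : gen lC g -> C g.
Proof. by move=> h; split; apply: gen_sub h => s ls; apply/letter_gen/CS. Qed.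

Let F f := gen lC f /\ gen (l0 true) f.

Let F_side b f : gen lC f /\ gen (l0 b) f <-> F f.
Proof.
case: b => //; split=> -[h1 h2]; split=> //.
- exact: (core_l0 (genC_core h1) h2).
- exact: (core_l0 (genC_core h1) h2).
Qed.

Let closest_side b c z : closest lC F c z -> closest lC (fun f => gen lC f /\ gen (l0 b) f) c z.
Proof.
by move=> [Fz H]; split=> [|n f /F_side Ff]; [apply/F_side | apply: H].
Qed.

Lemma uniform_lipschitz : exists K, forall b c c1 a z z1 n,
  C c -> C c1 -> gen (l0 b) a -> closest lC F c z -> closest lC F c1 z1 ->
  ball lall n (c^-1 * (a * c1)) -> ball (l0 b) (K * n + K) (z^-1 * (a * z1)).
Proof.
suff one b : exists K, forall c c1 a z z1 n,
    C c -> C c1 -> gen (l0 b) a -> closest lC F c z -> closest lC F c1 z1 ->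
    ball lall n (c^-1 * (a * c1)) -> ball (l0 b) (K * n + K) (z^-1 * (a * z1)).
  have [K1 H1] := one true; have [K2 H2] := one false; exists (K1 + K2)%N => b.
  move=> c c1 a z z1 n hc hc1 ha hz hz1 hb; rewrite mulnDl.
  case: b ha => ha.
    by apply: ball_le (H1 _ _ _ _ _ _ hc hc1 ha hz hz1 hb); lia.
  by apply: ball_le (H2 _ _ _ _ _ _ hc hc1 ha hz hz1 hb); lia.
have [K1 H1] := undS b.
have [K2 H2] := @closest_lipschitz G (S b) lC (l0 b) sC (@s0 b) (@CS b) (@l0S b) (undC b) (und0 b) (sqS b).
exists (K2 * K1 + K2)%N => c c1 a z z1 n hc hc1 ha hz hz1 hb.
have gX : gen (lS b) (c^-1 * (a * c1)).
  apply: genM; first by apply: XV; apply: (core_side b hc).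
  by apply: genM (core_side b hc1); apply: gen_sub ha => s ls; apply/letter_gen/l0S.
have := H2 c c1 a z z1 (coreC hc) (coreC hc1) ha (closest_side b hz) (closest_side b hz1) _ (H1 _ _ gX hb).
by apply: ball_le; rewrite mulnDl mulnA; lia.
Qed.

(* A path starting on one side of an edge of the tree and ending on the other side
   goes through that edge. *)
Lemma crossing_edge b v w : v <> [::] -> alt X b v -> all lall w ->
  (exists w1 w2, w = w1 ++ w2 /\ C (word_eval v * word_eval w1)) \/
  exists v', [/\ alt X b v', v' <> [::] & word_eval v' = word_eval v * word_eval w].
Proof.
elim: w v => [|s w IH] v v0 av /=; first by right; exists v; rewrite word_eval_nil mulg1.
case/andP=> ls lw.
have [c Xs] : exists c : bool, X c s.
  move: ls; rewrite /lall /sgen !mem_cat => h.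
  have [hT|hF] := boolP (lS true s); first by exists true; apply: letter_gen.
  exists false; apply: letter_gen; move: h hF; rewrite /sgen.
  by case: (s \in S true); case: (s^-1 \in S true); rewrite ?orbT.
have [hc|[v' [av' v'0 _ ev']]] := alt_mul_letter XM XV v0 av Xs.
  by left; exists [:: s], w; rewrite word_eval1.
have [[w1 [w2 [-> hw]]]|[v2 [a2 n2 e2]]] := IH v' v'0 av' lw.
  by left; exists (s :: w1), w2; rewrite word_eval_cons mulgA -ev'.
by right; exists v2; rewrite e2 ev' word_eval_cons mulgA.
Qed.

(** The path [w] passes through every edge coset between its ends by [crossing_edge]. At each of
    them the crossing point is projected to the coset of [F]; by [uniform_lipschitz], consecutive
    projections are joined by a word over [l0] that is linear in the piece of [w] between the
    crossings. *)
Lemma subamalgam_path : exists K, forall b xs c c' z z' w, xs <> [::] -> alt X b xs ->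
  alt Y b xs -> C c -> C c' -> closest lC F c z -> closest lC F c' z' -> all lall w ->
  c * word_eval w = word_eval xs * c' ->
  ball lM (K * size w + K * size xs) (z^-1 * (word_eval xs * z')).
Proof.
have [K HK] := uniform_lipschitz; exists K => b xs.
elim: xs b => // x xs IH b c c' z z' w _ [h1 h2 h3] [k1 k2 k3] hc hc' hz hz' lw e.
have toM b' n g : ball (l0 b') n g -> ball lM n g.
  move=> [v [lv sv ev]]; exists v; split=> //; apply: sub_all lv => s; rewrite /lM.
  by case: b' => ->; rewrite ?orbT.
have [xs0|xs0] := pselect (xs = [::]).
  subst xs; rewrite word_eval1 in e *; rewrite /= muln1.
  apply: (toM b); apply: HK hc hc' k1 hz hz' _.
  by exists w; split=> //; rewrite -e mulKg.
have nx : [:: x^-1 * c] <> [::] by [].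
have ax : alt X b [:: x^-1 * c].
  split=> //; first by apply: XM; [apply: XV | apply: (core_side b hc)].
  move=> h; apply: h2; rewrite -[x]invgK; apply: XV.
  by rewrite -(mulgK c x^-1); apply: XM h _; apply: XV; apply: (core_side (~~ b) hc).
have [[w1 [w2 [ew hw]]]|[v' [a1 a2 a3]]] := crossing_edge nx ax lw; last first.
  have [xs' [b1 b2 b3]] := alt_mulr XM XV hc' xs0 h3.
  have [] := alt_uniq XM XV red a1 b1 _.
    by rewrite a3 word_eval1 -mulgA e word_eval_cons -!mulgA mulKg b3.
  by move=> _ /(_ a2); case: (b).
rewrite word_eval1 in hw; set c1 := x^-1 * c * word_eval w1 in hw.
have F1 : F 1 by split; apply: gen1.
have [z1 hz1] := closest_ex sC (coreC hw) F1.
move: lw; rewrite ew all_cat => /andP[lw1 lw2].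
have e1 : c^-1 * (x * c1) = word_eval w1 by rewrite /c1 -!mulgA mulVKg mulKg.
have e2 : c1 * word_eval w2 = word_eval xs * c'.
  by rewrite /c1 -!mulgA -word_eval_cat -ew e word_eval_cons -mulgA mulKg.
have q1 := HK b c c1 x z z1 (size w1) hc hw k1 hz hz1.
have {}q1 : ball (l0 b) (K * size w1 + K) (z^-1 * (x * z1)).
  by apply: q1; rewrite e1; exists w1.
have q2 := IH (~~ b) c1 c' z1 z' w2 xs0 h3 k3 hw hc' hz1 hz' lw2 e2.
have := ballM (toM _ _ _ q1) q2.
have -> : z^-1 * (x * z1) * (z1^-1 * (word_eval xs * z')) = z^-1 * (word_eval (x :: xs) * z').
  by rewrite word_eval_cons -!mulgA mulVKg.
by apply: ball_le; rewrite size_cat /= mulnDr mulnS; lia.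
Qed.

Theorem subamalgam_undistorted : undistorted lM lall.
Proof.
have [K HK] := subamalgam_path; have [K1 H1] := undS true; have [K2 H2] := und0 true.
have YM b x y : Y b x -> Y b y -> Y b (x * y) by apply: genM.
have YV b x : Y b x -> Y b x^-1 by apply: genV; apply: s0.
have Y1 b : Y b 1 by apply: gen1.
have YX b x : Y b x -> X b x by apply: gen_sub => s ls; apply/letter_gen/l0S.
exists (K2 * K1 + (K + K))%N => n g gM bg; rewrite mulnDl.
have [v lv ev] := gM.
have hv x : x \in v -> exists b : bool, Y b x.
  move=> xv; have := allP lv x xv; rewrite /lM => /orP[] h.
    by exists true; apply: letter_gen.
  by exists false; apply: letter_gen.
have toM b' m h : ball (l0 b') m h -> ball lM m h.
  move=> [w [lw sw ew]]; exists w; split=> //; apply: sub_all lw => s; rewrite /lM.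
  by case: b' => ->; rewrite ?orbT.
have [hc|[b [xs [axs xs0 sxs exs]]]] := alt_normal_form Y1 YM YV hv.
  rewrite ev in hc; case: hc => h0 _.
  have := toM _ _ _ (H2 _ _ h0 (H1 _ _ (YX true _ h0) bg)).
  by apply: ball_le; rewrite mulnA leq_addr.
have aX b' xs' : alt Y b' xs' -> alt X b' xs'.
  elim: xs' b' => [|x xs' IH] b' //= [h1 h2 h3]; split; [exact: YX | | exact: IH].
  move=> h; apply: h2; have hx := YX _ _ h1; apply: core_l0 h1.
  exact: (proj2 (coreP X b' x) (conj hx h)).
have [w [lw sw ew]] := bg.
have F1 : F 1 by split; apply: gen1.
have c1 : closest lC F 1 1.
  by split=> // m f _ _; rewrite invg1 mul1g; apply: ball1.
have C1 : C 1 by split; apply: gen1.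
have := HK b xs 1 1 1 1 w xs0 (aX _ _ axs) axs C1 C1 c1 c1 lw.
rewrite mul1g mulg1 invg1 mul1g ew exs ev => /(_ erefl).
apply: ball_le.
have sxs' : (size xs <= size w)%N.
  apply: (alt_size_le (X := X)) (aX _ _ axs) _ _ => //; first by move=> b'; apply: gen1.
    move=> x xw; have := allP lw x xw; rewrite /lall /sgen !mem_cat => h.
    have [hT|hF] := boolP (lS true x); first by exists true; apply: letter_gen.
    exists false; apply: letter_gen; move: h hF; rewrite /sgen.
    by case: (x \in S true); case: (x^-1 \in S true); rewrite ?orbT.
  by rewrite exs ev ew.
rewrite mulnDl; have a1 : (K * size w <= K * n)%N by rewrite leq_mul2l sw orbT.
have a2 : (K * size xs <= K * n)%N by rewrite leq_mul2l (leq_trans sxs' sw) orbT.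
by apply: leq_trans (leq_addl _ _); apply: leq_add.
Qed.

End Subamalgam.

(** * Pushouts of groups *)

Section Morphisms.
Variables (G H : groupType) (f : {multiplicative G -> H}).
Local Open Scope group_scope.

Lemma mor1 : f 1 = 1.
Proof. by apply: (@mulgI _ (f 1)); rewrite -gmulfM !mulg1. Qed.

Lemma morV x : f x^-1 = (f x)^-1.
Proof. by apply: (@mulgI _ (f x)); rewrite -gmulfM !mulgV mor1. Qed.

Lemma mor_inj : (forall x, f x = 1 -> x = 1) -> injective f.
Proof.
move=> h x y e; apply: (@mulgI _ y^-1); rewrite mulVg; apply: h.
by rewrite gmulfM morV e mulVg.
Qed.

Lemma mor_eval w : f (word_eval w) = word_eval (map f w).
Proof.
elim: w => [|x w IH]; first by rewrite !word_eval_nil mor1.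
by rewrite /= !word_eval_cons gmulfM IH.
Qed.

End Morphisms.

(** Permutations with a chosen inverse; they form the group that acts on normal forms below. *)
Record bij (T : Type) :=
  Bij { bf : T -> T; bg : T -> T; bfK : cancel bf bg; bgK : cancel bg bf }.

HB.instance Definition _ T := gen_eqMixin (bij T).
HB.instance Definition _ T := gen_choiceMixin (bij T).

Section BijGroup.
Variable T : Type.
Implicit Types a b c : bij T.

Lemma bij_eq a b : bf a =1 bf b -> a = b.
Proof.
case: a b => f g fK gK [f' g' fK' gK'] /= e.
have ef : f = f' by apply/funext.
have eg : g = g' by apply/funext => x; rewrite -[g x]fK' -e gK.
by subst f' g'; congr Bij; apply: Prop_irrelevance.
Qed.

Definition bij1 := @Bij T id id (fun _ => erefl) (fun _ => erefl).
Definition bijV a := Bij (bgK a) (bfK a).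
Definition bijM a b : bij T := Bij (can_comp (bfK a) (bfK b)) (can_comp (bgK b) (bgK a)).

Lemma bijA : associative bijM. Proof. by move=> a b c; apply: bij_eq. Qed.
Lemma bij1l : left_id bij1 bijM. Proof. by move=> a; apply: bij_eq. Qed.
Lemma bij1r : right_id bij1 bijM. Proof. by move=> a; apply: bij_eq. Qed.
Lemma bijVl : left_inverse bij1 bijV bijM.
Proof. by move=> a; apply: bij_eq => x; apply: bfK. Qed.
Lemma bijVr : right_inverse bij1 bijV bijM.
Proof. by move=> a; apply: bij_eq => x; apply: bgK. Qed.

HB.instance Definition _ := isGroup.Build (bij T) bijA bij1l bij1r bijVl bijVr.

End BijGroup.

Section Pushout.
Variables (C : groupType) (X : bool -> groupType).
Variable i : forall b, {multiplicative C -> X b}.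
Hypothesis i_inj : forall b, injective (i b).
Local Open Scope group_scope.
Implicit Types (b : bool) (c : C).

Notation letter := {b : bool & (X b : Type)}.
Notation Lt b x := (@existT bool (fun b' => X b' : Type) b x).

Section NormalForms.

Definition in_core b (x : X b) : bool := `[< exists c, x = i b c >].

(** Depends only on the coset of [x], because [choose] gets extensionally equal predicates ([repM]).
    The core is represented by 1 and leaves no syllable in a normal form. *)
Definition rep b (x : X b) : X b :=
  if in_core x then 1 else choose (fun y => `[< exists c, y = i b c * x >]) x.

Lemma rep_coset b (x : X b) : exists c, x = i b c * rep x.
Proof.
rewrite /rep; case: ifPn => [/asboolP[c ->]|_]; first by exists c; rewrite mulg1.
pose P : pred (X b) := fun y => `[< exists c, y = i b c * x >].
have h : P x by apply/asboolP; exists 1; rewrite mor1 mul1g.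
by have /asboolP[c e] := chooseP h; exists c^-1; rewrite e morV mulKg.
Qed.

Definition cpart b (x : X b) : C := projT1 (cid (rep_coset x)).

Lemma cpartE b (x : X b) : x = i b (cpart x) * rep x.
Proof. exact: (projT2 (cid (rep_coset x))). Qed.

Lemma in_coreM b c (x : X b) : in_core (i b c * x) = in_core x.
Proof.
apply/asboolP/asboolP => -[d e]; last by exists (c * d); rewrite gmulfM e.
by exists (c^-1 * d); rewrite gmulfM -e morV mulKg.
Qed.

Lemma repM b c (x : X b) : rep (i b c * x) = rep x.
Proof.
rewrite /rep in_coreM; case: ifP => // _.
have e : (fun y => `[< exists d, y = i b d * (i b c * x) >]) =1
    (fun y => `[< exists d, y = i b d * x >]).
  move=> y; apply/asboolP/asboolP => -[d ->].
    by exists (d * c); rewrite gmulfM mulgA.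
  by exists (d * c^-1); rewrite gmulfM morV -mulgA mulKg.
rewrite (eq_choose e); apply: choose_id; apply/asboolP; first by exists c.
by exists 1; rewrite mor1 mul1g.
Qed.

Lemma cpartM b c (x : X b) : cpart (i b c * x) = c * cpart x.
Proof.
apply: (@i_inj b); apply: (@mulIg _ (rep x)).
by rewrite -{1}(repM c) -cpartE gmulfM -mulgA -cpartE.
Qed.

Lemma rep_rep b (x : X b) : rep (rep x) = rep x.
Proof. by rewrite [in RHS](cpartE x) repM. Qed.

Lemma in_core_rep b (x : X b) : in_core (rep x) = in_core x.
Proof. by rewrite [in RHS](cpartE x) in_coreM. Qed.

Definition tag_ne b (l : seq letter) : bool := if l is t :: _ then tag t != b else true.

Fixpoint valid (l : seq letter) : Prop :=
  if l is t :: l' then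
    [/\ ~~ in_core (tagged t), rep (tagged t) = tagged t, tag_ne (tag t) l' & valid l']
  else True.

Definition nforms := {p : C * seq letter | `[< valid p.2 >]}.

(** A normal form amounts to an element of [X b] followed by a normal form that does not start in
    [X b]; [join_nf] is the inverse. In these terms [X b] acts by left multiplication on the first
    component. *)
Definition split_nf b (p : C * seq letter) : X b * seq letter :=
  match p.2 with
  | [::] => (i b p.1, p.2)
  | t :: l => untag (i b p.1, p.2) (fun x : X b => (i b p.1 * x, l)) t
  end.

Definition join_nf b (q : X b * seq letter) : C * seq letter :=
  (cpart q.1, if in_core q.1 then q.2 else Lt b (rep q.1) :: q.2).

Lemma untag_ne (R : Type) (idx : R) b (F : X b -> R) (t : letter) : tag t != b ->
  untag idx F t = idx.
Proof. by rewrite /untag; case: eqP. Qed.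

Lemma cpart_core b (x : X b) : in_core x -> i b (cpart x) = x.
Proof. by move=> h; rewrite [RHS]cpartE /rep h mulg1. Qed.

Lemma split_join b q : valid q.2 -> tag_ne b q.2 -> split_nf b (join_nf q) = q.
Proof.
case: q => x l /= vl tl; rewrite /split_nf /join_nf /=; case: ifPn => hx /=.
  rewrite cpart_core //; case: l tl {vl} => // t l /= tl; exact: untag_ne.
by rewrite (untagE _ _ (erefl : tag (Lt b (rep x)) = b)) /= -cpartE.
Qed.

Lemma join_valid b q : valid q.2 -> tag_ne b q.2 -> valid (join_nf (b := b) q).2.
Proof.
case: q => x l /= vl tl; rewrite /join_nf /=; case: ifPn => //= hx.
by rewrite in_core_rep rep_rep; split.
Qed.

Lemma split_valid b p : valid p.2 -> valid (split_nf b p).2 /\ tag_ne b (split_nf b p).2.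
Proof.
case: p => c [|t l] //= [h1 h2 h3 h4]; rewrite /split_nf /=.
have [e|e] := eqVneq (tag t) b; last by rewrite untag_ne //= e.
by case: t e h1 h2 h3 => b' x /= e; subst b' => h1 h2 h3; rewrite (untagE _ _ (erefl : tag (Lt b x) = b)).
Qed.

Lemma cpart_i b c : cpart (i b c) = c.
Proof.
apply: (@i_inj b); rewrite cpart_core //; apply/asboolP; by exists c.
Qed.

Lemma join_split b p : valid p.2 -> join_nf (split_nf b p) = p.
Proof.
have ic c : in_core (i b c) by apply/asboolP; exists c.
case: p => c [|t l] /=; first by rewrite /join_nf /= cpart_i ic.
move=> [h1 h2 h3 h4]; rewrite /split_nf /=.
have [e|e] := eqVneq (tag t) b; last by rewrite untag_ne // /join_nf /= cpart_i ic.
case: t e h1 h2 h3 => b' x /= e; subst b' => h1 h2 h3.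
rewrite (untagE _ _ (erefl : tag (Lt b x) = b)) /join_nf /= in_coreM (negPf h1) repM h2.
congr (_, _); rewrite cpartM; apply: (@i_inj b); rewrite gmulfM.
by apply: (@mulIg _ (rep x)); rewrite -mulgA -cpartE h2.
Qed.

Lemma act_valid b (a : X b) (w : nforms) :
  `[< valid (join_nf (a * (split_nf b (val w)).1, (split_nf b (val w)).2)).2 >].
Proof.
apply/asboolP; have [v t] := @split_valid b _ (asboolW (valP w)).
exact: join_valid.
Qed.

(* Van der Waerden's trick: the factors act on the set of normal forms, which shows
   that distinct normal forms are distinct in the pushout. *)
Definition act b (a : X b) (w : nforms) : nforms :=
  exist (fun p => `[< valid p.2 >]) _ (act_valid a w).

Lemma act1 b w : act (1 : X b) w = w.
Proof.
apply: val_inj; rewrite /= mul1g -surjective_pairing join_split //.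
exact: asboolW (valP w).
Qed.

Lemma actM b (x y : X b) w : act (x * y) w = act x (act y w).
Proof.
apply: val_inj => /=; have [v t] := @split_valid b _ (asboolW (valP w)).
by rewrite split_join //= mulgA.
Qed.

Lemma act_core b c (w : nforms) : val (act (i b c) w) = (c * (val w).1, (val w).2).
Proof.
have v := asboolW (valP w); rewrite -(@join_split b (c * (val w).1, (val w).2)) //=.
rewrite [LHS]/=; congr (join_nf _); rewrite /split_nf /=.
case: (sval w) v => d [|t l] /=; first by rewrite gmulfM.
move=> _; have [e|e] := eqVneq (tag t) b; last by rewrite !untag_ne //= gmulfM.
case: t e => b' x /= e; subst b'.
by rewrite !(untagE _ _ (erefl : tag (Lt b x) = b)) /= gmulfM mulgA.
Qed.

Lemma actK b (x : X b) : cancel (act x) (act x^-1).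
Proof. by move=> w; rewrite -actM mulVg act1. Qed.

Lemma actVK b (x : X b) : cancel (act x^-1) (act x).
Proof. by move=> w; rewrite -actM mulgV act1. Qed.

Definition act_bij b (x : X b) : bij nforms := Bij (actK x) (actVK x).

Lemma act_bijM b : {morph @act_bij b : x y / x * y}.
Proof. by move=> x y; apply: bij_eq => w; apply: actM. Qed.

HB.instance Definition _ b := isMultiplicative.Build (X b) (bij nforms) (@act_bij b) (@act_bijM b).

Lemma act_bij_core c : act_bij (i true c) = act_bij (i false c).
Proof. by apply: bij_eq => w; apply: val_inj; rewrite !act_core. Qed.

Definition nf1 : nforms := exist (fun p => `[< valid p.2 >]) (1, [::]) (asboolT I).

Lemma act_push b (x : X b) (w : nforms) : ~~ in_core x -> tag_ne b (val w).2 ->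
  exists c y, val (act x w) = (c, Lt b y :: (val w).2).
Proof.
move=> hx tw /=; have -> : split_nf b (val w) = (i b (val w).1, (val w).2).
  rewrite /split_nf; case: (val w) tw => c [|t l] //= tl; exact: untag_ne.
rewrite /join_nf /=; have -> : in_core (x * i b (val w).1) = false.
  apply/negbTE/negP => /asboolP[c e]; move/negP: hx; apply; apply/asboolP.
  by exists (c * (val w).1^-1); rewrite gmulfM morV -e mulgK.
by eexists; eexists.
Qed.

End NormalForms.

Definition eval_letters (K : groupType) (f : forall b, {multiplicative X b -> K})
  (w : seq letter) : K := word_eval [seq f (tag t) (tagged t) | t <- w].

Definition compatible (K : groupType) (f : forall b, {multiplicative X b -> K}) :=
  forall c, f true (i true c) = f false (i false c).

(* Taking the universal property as the congruence on words avoids describing the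
   congruence by rewriting steps. *)
Definition same_word (u v : seq letter) : bool :=
  `[< forall (K : groupType) (f : forall b, {multiplicative X b -> K}),
      compatible f -> eval_letters f u = eval_letters f v >].

Lemma same_word_equiv : equiv_class_of same_word.
Proof.
split.
- by move=> u; apply/asboolP.
- by move=> u v; apply/asboolP/asboolP => h K f cf; rewrite h.
- by move=> u v w /asboolP h1 /asboolP h2; apply/asboolP => K f cf; rewrite h1 // h2.
Qed.

Canonical same_word_rel := EquivRelPack same_word_equiv.

Local Open Scope quotient_scope.

Definition pushout := {eq_quot same_word_rel}.
HB.instance Definition _ := Choice.on pushout.

Definition cls (w : seq letter) : pushout := \pi_({eq_quot same_word_rel}) w.

Lemma clsP u v : cls u = cls v <-> forall (K : groupType) (f : forall b, {multiplicative X b -> K}),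
  compatible f -> eval_letters f u = eval_letters f v.
Proof.
split; first by move/eqmodP/asboolP.
by move=> h; apply/eqmodP/asboolP.
Qed.

Lemma cls_repr (p : pushout) : cls (repr p) = p. Proof. exact: reprK. Qed.

Lemma eval_letters_cat (K : groupType) (f : forall b, {multiplicative X b -> K}) u v :
  eval_letters f (u ++ v) = eval_letters f u * eval_letters f v.
Proof. by rewrite /eval_letters map_cat word_eval_cat. Qed.

Definition inv_letters (w : seq letter) : seq letter :=
  rev [seq Lt (tag t) (tagged t)^-1 | t <- w].

Lemma eval_letters_inv (K : groupType) (f : forall b, {multiplicative X b -> K}) u :
  eval_letters f (inv_letters u) = (eval_letters f u)^-1.
Proof.
rewrite -word_eval_inv /eval_letters /inv_letters /inv_word map_rev -!map_comp.
by congr (word_eval (rev _)); apply: eq_map => t /=; rewrite morV.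
Qed.

Definition po_mul (p q : pushout) : pushout := cls (repr p ++ repr q).
Definition po_one : pushout := cls [::].
Definition po_inv (p : pushout) : pushout := cls (inv_letters (repr p)).

Lemma eval_repr (K : groupType) (f : forall b, {multiplicative X b -> K}) w :
  compatible f -> eval_letters f (repr (cls w)) = eval_letters f w.
Proof. by move=> cf; apply: (proj1 (clsP _ _)) => //; apply: cls_repr. Qed.

(** Equality in the pushout is tested in all targets at once, so each group law follows from the
    same law in the target. *)
Lemma po_eq (p q : pushout) : (forall (K : groupType) (f : forall b, {multiplicative X b -> K}),
  compatible f -> eval_letters f (repr p) = eval_letters f (repr q)) -> p = q.
Proof. by move=> h; rewrite -(cls_repr p) -(cls_repr q); apply/clsP. Qed.

Lemma po_mulA : associative po_mul.
Proof.
move=> p q r; apply: po_eq => K f cf.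
by rewrite !(eval_repr, eval_letters_cat) // mulgA.
Qed.

Lemma po_mul1 : left_id po_one po_mul.
Proof.
move=> p; apply: po_eq => K f cf.
by rewrite !(eval_repr, eval_letters_cat) // /eval_letters word_eval_nil mul1g.
Qed.

Lemma po_1mul : right_id po_one po_mul.
Proof.
move=> p; apply: po_eq => K f cf.
by rewrite !(eval_repr, eval_letters_cat) // /eval_letters word_eval_nil mulg1.
Qed.

Lemma po_mulV : left_inverse po_one po_inv po_mul.
Proof.
move=> p; apply: po_eq => K f cf.
by rewrite !(eval_repr, eval_letters_cat, eval_letters_inv) // mulVg /eval_letters word_eval_nil.
Qed.

Lemma po_Vmul : right_inverse po_one po_inv po_mul.
Proof.
move=> p; apply: po_eq => K f cf.
by rewrite !(eval_repr, eval_letters_cat, eval_letters_inv) // mulgV /eval_letters word_eval_nil.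
Qed.

HB.instance Definition _ := isGroup.Build pushout po_mulA po_mul1 po_1mul po_mulV po_Vmul.

Definition po_in b (x : X b) : pushout := cls [:: Lt b x].

Lemma po_inM b : {morph @po_in b : x y / x * y}.
Proof.
move=> x y; apply: po_eq => K f cf.
rewrite !(eval_repr, eval_letters_cat) // /eval_letters /=.
by rewrite !word_eval1 gmulfM.
Qed.

HB.instance Definition _ b := isMultiplicative.Build (X b) pushout (@po_in b) (@po_inM b).

Section Lift.
Variables (K : groupType) (f : forall b, {multiplicative X b -> K}).
Hypothesis cf : compatible f.

Definition po_lift (p : pushout) : K := eval_letters f (repr p).

Lemma po_liftM : {morph po_lift : x y / x * y}.
Proof. by move=> p q; rewrite /po_lift eval_repr // eval_letters_cat. Qed.

HB.instance Definition _ := isMultiplicative.Build pushout K po_lift po_liftM.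

Definition po_lift_mor : {multiplicative pushout -> K} := po_lift.

Lemma po_lift_in b x : po_lift (@po_in b x) = f b x.
Proof. by rewrite /po_lift eval_repr // /eval_letters /= word_eval1. Qed.

End Lift.

Lemma po_in_core c : po_in (i true c) = po_in (i false c).
Proof.
by apply: po_eq => K f cf; rewrite !eval_repr // /eval_letters /= !word_eval1.
Qed.

Lemma po_gen (p : pushout) : exists w : seq letter, p = word_eval [seq po_in (tagged t) | t <- w].
Proof.
exists (repr p); rewrite -{1}(cls_repr p); elim: (repr p) => [|t w IH].
  by rewrite word_eval_nil.
rewrite /= word_eval_cons -IH; apply: po_eq => K f cf.
rewrite !(eval_repr, eval_letters_cat) // -eval_letters_cat.
by case: t.
Qed.

Definition pushout_range b (g : pushout) := exists x : X b, g = po_in x.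

Let alpha b : {multiplicative X b -> bij nforms} := @act_bij b.

Let alpha_compat : compatible alpha. Proof. exact: act_bij_core. Qed.

Lemma not_in_core b (x : X b) : ~ pushout_range (~~ b) (po_in x) -> ~~ in_core x.
Proof.
move=> h; apply/negP => /asboolP[c e]; apply: h; exists (i (~~ b) c).
by rewrite e; case: b x e => x _; rewrite po_in_core.
Qed.

(** Each letter of an alternating word adds one syllable to the normal form of 1, which therefore
    ends up nonempty. *)
Lemma alt_act b (w : seq pushout) : w <> [::] -> alt pushout_range b w ->
  exists c y l, val (bf (po_lift alpha (word_eval w)) nf1) = (c, Lt b y :: l).
Proof.
elim: w b => // g w IH b _ [[x ->] h2 h3]; have hx := not_in_core h2.
rewrite word_eval_cons po_liftM // po_lift_in //=.
have tn : tag_ne b (val (bf (po_lift alpha (word_eval w)) nf1)).2.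
  case: w h3 IH => [|g' w] h3 IH.
    by rewrite word_eval_nil /po_lift eval_repr // /eval_letters word_eval_nil.
  have [|c [y [l ->]]] := IH (~~ b) _ h3; first by [].
  rewrite /=; have nb (b' : bool) : ~~ b' != b' by case: b'.
  exact: nb.
have [c [y e]] := act_push hx tn; exists c, y.
by eexists; exact: e.
Qed.

Lemma pushout_reduced : reduced_nontrivial pushout_range.
Proof.
move=> b w w0 aw e; have [c [y [l]]] := alt_act w0 aw.
by rewrite e /po_lift eval_repr // /eval_letters word_eval_nil.
Qed.

Lemma po_in_inj b : injective (@po_in b).
Proof.
apply: mor_inj => x e; have := po_lift_in alpha_compat x; rewrite e.
rewrite /po_lift eval_repr // {1}/eval_letters word_eval_nil => /(congr1 (fun h => bf h nf1)).
move/(congr1 val) => /= e'; have := congr1 (fun p => split_nf b p) e'.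
rewrite split_join //= /split_nf /= mor1 mulg1.
by case.
Qed.

Lemma pushout_core b (x : X b) : pushout_range (~~ b) (po_in x) -> exists c, x = i b c.
Proof.
move=> [y e]; apply/asboolP; apply/negPn/negP => hx.
have [c [z ez]] := @act_push b x nf1 hx isT.
have := po_lift_in alpha_compat x; rewrite e po_lift_in // => /(congr1 (fun h => bf h nf1)).
move/(congr1 (fun w => (val w).2)); rewrite [RHS](congr1 snd ez) /= => {ez}.
rewrite /join_nf /= /split_nf /=; case: ifP => //= _ [].
by case: b x y e hx z => x y e hx z; case/eqP.
Qed.

Theorem pushout_exists : exists (P : groupType) (j : forall b, {multiplicative X b -> P}),
  [/\ forall c, j true (i true c) = j false (i false c),
      forall (K : groupType) (f : forall b, {multiplicative X b -> K}), compatible f ->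
        exists h : {multiplicative P -> K}, forall b x, h (j b x) = f b x,
      forall p : P, exists w : seq {b : bool & (X b : Type)},
        p = word_eval [seq j (tag t) (tagged t) | t <- w],
      reduced_nontrivial (fun b g => exists x, g = j b x) &
      (forall b, injective (j b)) /\
      forall b x y, j b x = j (~~ b) y -> exists c, x = i b c].
Proof.
exists pushout, (fun b => @po_in b); split.
- exact: po_in_core.
- by move=> K f cf; exists (po_lift_mor cf) => b x; apply: po_lift_in.
- by move=> p; have [w ->] := po_gen p; exists w.
- exact: pushout_reduced.
- split; first exact: po_in_inj.
  by move=> b x y e; apply: pushout_core; exists y.
Qed.

End Pushout.

(** * Chains of groups *)

Section Spans.
Variable G : groupType.
Local Open Scope group_scope.
Implicit Types (Z Y : G -> Prop) (g : G).

Definition span Z : G -> Prop := gen (fun g => `[< Z g >]).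

Lemma mem_span Z g : Z g -> span Z g.
Proof. by move=> h; exists [:: g]; rewrite ?word_eval1 //= andbT; apply/asboolP. Qed.

Lemma span1 Z : span Z 1. Proof. exact: gen1. Qed.

Lemma spanM Z g h : span Z g -> span Z h -> span Z (g * h).
Proof. exact: genM. Qed.

Lemma spanV Z g : (forall h, Z h -> Z h^-1) -> span Z g -> span Z g^-1.
Proof. by move=> ZV; apply: genV => h /asboolP/ZV/asboolP. Qed.

Lemma span_ind Z Y : Y 1 -> (forall g h, Y g -> Y h -> Y (g * h)) -> (forall g, Z g -> Y g) ->
  forall g, span Z g -> Y g.
Proof.
move=> Y1 YM ZY _ [w lw <-]; elim: w lw => [|s w IH] /=; first by rewrite word_eval_nil.
by case/andP=> /asboolP/ZY hs /IH; rewrite word_eval_cons; apply: YM.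
Qed.

Lemma span_sub Z Y g : (forall g, Z g -> span Y g) -> span Z g -> span Y g.
Proof. by move=> h; apply: span_ind => //; [apply: span1 | apply: spanM]. Qed.

Definition two (Y Z : G -> Prop) (b : bool) : G -> Prop := if b then Y else Z.

End Spans.

Definition img (A : Type) (B : Type) (f : A -> B) (y : B) : Prop := exists x, y = f x.

Section Images.
Variables (G K : groupType) (f : {multiplicative G -> K}).
Local Open Scope group_scope.

Lemma img1 : img f 1. Proof. by exists 1; rewrite mor1. Qed.

Lemma imgM x y : img f x -> img f y -> img f (x * y).
Proof. by move=> [a ->] [b ->]; exists (a * b); rewrite gmulfM. Qed.

Lemma imgV x : img f x -> img f x^-1.
Proof. by move=> [a ->]; exists a^-1; rewrite morV. Qed.

Lemma mor_span (Z : G -> Prop) (Y : K -> Prop) g : (forall g, Z g -> Y (f g)) ->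
  span Z g -> span Y (f g).
Proof.
move=> ZY; move: g; apply: (span_ind (Y := fun g => span Y (f g))) => [|g h|g /ZY].
- by rewrite mor1; apply: span1.
- by rewrite gmulfM; apply: spanM.
- exact: mem_span.
Qed.

Lemma mor_span_eq (f' : {multiplicative G -> K}) (Z : G -> Prop) g :
  (forall g, Z g -> f g = f' g) -> span Z g -> f g = f' g.
Proof.
move=> ZE; move: g; apply: (span_ind (Y := fun g => f g = f' g)) => [|g h e1 e2|g /ZE //].
  by rewrite !mor1.
by rewrite !gmulfM e1 e2.
Qed.

Lemma reduced_pull (X : bool -> G -> Prop) (Y : bool -> K -> Prop) :
  (forall b g, X b g -> Y b (f g)) -> (forall b g, X b g -> Y (~~ b) (f g) -> X (~~ b) g) ->
  reduced_nontrivial Y -> reduced_nontrivial X.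
Proof.
move=> XY YX rY b w w0 aw e; apply: (rY b (map f w)); last by rewrite -mor_eval e mor1.
  by case: (w) w0.
by elim: w b aw {w0 e} => //= x w IH b [h1 h2 h3]; split; [exact: XY | move/(YX _ _ h1) | exact: IH].
Qed.

Lemma reduced_push (X : bool -> G -> Prop) (Y : bool -> K -> Prop) : injective f ->
  (forall b y, Y b y <-> exists2 g, X b g & y = f g) ->
  reduced_nontrivial X -> reduced_nontrivial Y.
Proof.
move=> fI YX rX b v v0 av e.
have [w aw ev] : exists2 w, alt X b w & v = map f w.
  elim: v b av {v0 e} => [|y v IH] b /=; first by exists [::].
  move=> [/YX[g hg ->] h2 /IH[w aw ->]]; exists (g :: w) => //; split => // h.
  by apply: h2; apply/YX; exists g.
apply: (rX b w) => //; first by move=> e'; apply: v0; rewrite ev e'.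
by apply: fI; rewrite mor_eval mor1 -ev.
Qed.

End Images.

Lemma reduced_swap (G : groupType) (Y Z : G -> Prop) :
  reduced_nontrivial (two Y Z) -> reduced_nontrivial (two Z Y).
Proof.
move=> h b w w0 aw; apply: (h (~~ b)) => //.
by elim: w b aw {w0} => //= x w IH b [h1 h2 h3]; split; [case: (b) h1 | case: (b) h2 | exact: IH].
Qed.

(** * Amalgams given by homomorphisms *)

Section Amalgams.
Local Open Scope group_scope.

Definition amalgam (E L1 L2 : groupType) (i1 : E -> L1) (i2 : E -> L2) (P : groupType)
    (j1 : {multiplicative L1 -> P}) (j2 : {multiplicative L2 -> P}) : Prop :=
  [/\ forall c, j1 (i1 c) = j2 (i2 c),
      forall (K : groupType) (f1 : {multiplicative L1 -> K}) (f2 : {multiplicative L2 -> K}),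
        (forall c, f1 (i1 c) = f2 (i2 c)) -> exists h : {multiplicative P -> K},
          (forall x, h (j1 x) = f1 x) /\ (forall x, h (j2 x) = f2 x),
      forall p, span (fun p => img j1 p \/ img j2 p) p,
      reduced_nontrivial (two (img j1) (img j2)) &
      [/\ injective j1, injective j2 &
          forall x y, j1 x = j2 y -> exists c, x = i1 c /\ y = i2 c]].

Lemma amalgam_exists (E L1 L2 : groupType) (i1 : {multiplicative E -> L1})
    (i2 : {multiplicative E -> L2}) : injective i1 -> injective i2 ->
  exists (P : groupType) (j1 : {multiplicative L1 -> P}) (j2 : {multiplicative L2 -> P}),
    amalgam i1 i2 j1 j2.
Proof.
move=> I1 I2; pose X (b : bool) := if b then L1 else L2.
pose i (b : bool) : {multiplicative E -> X b} :=
  if b as b' return {multiplicative E -> X b'} then i1 else i2.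
have iI b : injective (i b) by case: b.
have [P [j [h1 h2 h3 h4 [h5 h6]]]] := pushout_exists iI.
exists P, (j true), (j false); split => //.
- move=> K f1 f2 cf.
  pose f (b : bool) : {multiplicative X b -> K} :=
    if b as b' return {multiplicative X b' -> K} then f1 else f2.
  have [h hE] := h2 K f cf.
  by exists h; split => x; [apply: (hE true) | apply: (hE false)].
- move=> p; have [w ->] := h3 p; elim: w => [|[b x] w IH] /=.
    by rewrite word_eval_nil; apply: span1.
  rewrite word_eval_cons; apply: spanM => //; apply: mem_span.
  by case: b x => x; [left | right]; exists x.
- move=> b w w0 aw; apply: (h4 b) => //.
  by elim: w b aw {w0} => //= x w IH b [h1' h2' h3']; split; [case: (b) h1' | case: (b) h2' | exact: IH].
- split; [exact: (h5 true) | exact: (h5 false) |].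
  move=> x y e; have [c ec] := h6 true x y e; exists c; split => //.
  by apply: (h5 false); rewrite -e ec; apply: h1.
Qed.

Section One.
Variables (E L1 L2 : groupType) (i1 : {multiplicative E -> L1}) (i2 : {multiplicative E -> L2}).
Variables (P : groupType) (j1 : {multiplicative L1 -> P}) (j2 : {multiplicative L2 -> P}).
Hypothesis am : amalgam i1 i2 j1 j2.

(** A map back to the amalgam [P] that agrees with its inclusions on both factors detects nontrivial
    alternating words; so the two subgroups of [G] inherit the structure of [P]. *)
Lemma amalgam_pullback (G : groupType) (v1 : {multiplicative L1 -> G})
    (v2 : {multiplicative L2 -> G}) (u : {multiplicative G -> P}) :
  (forall x, u (v1 x) = j1 x) -> (forall x, u (v2 x) = j2 x) ->
  (forall c, v1 (i1 c) = v2 (i2 c)) ->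
  [/\ reduced_nontrivial (two (img v1) (img v2)), injective v1, injective v2 &
      forall x y, v1 x = v2 y -> exists c, x = i1 c /\ y = i2 c].
Proof.
case: am => [_ _ _ rP [I1 I2 cP]] e1 e2 cv; split.
- apply: (reduced_pull (f := u)) rP => -[] g [x ->] /=; rewrite ?e1 ?e2.
  + by exists x.
  + by exists x.
  + by move=> [y /cP[c [-> _]]]; exists (i2 c).
  + by move=> [y /esym/cP[c [_ ->]]]; exists (i1 c).
- by move=> x y /(congr1 u); rewrite !e1 => /I1.
- by move=> x y /(congr1 u); rewrite !e2 => /I2.
- by move=> x y /(congr1 u); rewrite e1 e2 => /cP.
Qed.

(** An element of [P] is either in the core, where [f1] is injective, or alternating; its image is
    then alternating too, since the images of the factors meet only in the image of [E]. *)
Lemma amalgam_embed (K : groupType) (u : {multiplicative P -> K})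
    (f1 : {multiplicative L1 -> K}) (f2 : {multiplicative L2 -> K}) :
  (forall x, u (j1 x) = f1 x) -> (forall x, u (j2 x) = f2 x) ->
  injective f1 -> injective f2 ->
  reduced_nontrivial (two (img f1) (img f2)) ->
  (forall x y, f1 x = f2 y -> exists c, x = i1 c /\ y = i2 c) -> injective u.
Proof.
move=> e1 e2 I1 I2 rK cK; case: am => [jc _ jg rP _].
have X1 b : two (img j1) (img j2) b 1 by case: b; apply: img1.
have XM b x y : two (img j1) (img j2) b x -> two (img j1) (img j2) b y ->
  two (img j1) (img j2) b (x * y) by case: b; apply: imgM.
have XV b x : two (img j1) (img j2) b x -> two (img j1) (img j2) b x^-1.
  by case: b; apply: imgV.
apply: mor_inj => p ep; have [w lw ew] := jg p.
have hw x : x \in w -> exists b, two (img j1) (img j2) b x.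
  by move=> xw; have /asboolP[h|h] := allP lw x xw; [exists true | exists false].
case: (alt_normal_form X1 XM XV hw) => [[[x ex] _]|[b [v [av v0 _ ev]]]].
  rewrite ew in ex; have : f1 x = f1 1 by rewrite -e1 -ex ep mor1.
  by move/I1 => x1; rewrite ex x1 mor1.
exfalso; have /(_ b (map u v)) := rK; apply; first by case: (v) v0.
  elim: v b av {v0 ev} => //= x v IH b [h1 h2 h3]; split; last exact: IH.
    by case: b h1 {h2 h3} => -[y ->]; exists y.
  move=> h; apply: h2; case: b h1 h {h3} => -[y ->] [z]; rewrite ?e1 ?e2.
    by move/cK => [c [-> _]]; rewrite jc; exists (i2 c).
  by move/esym/cK => [c [_ ->]]; rewrite -jc; exists (i1 c).
by rewrite -mor_eval ev ew ep.
Qed.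

End One.
End Amalgams.

(** * Cyclic positions and arcs of vertices *)

Section Arcs.
Variables (n : nat).
Implicit Types (a j e : 'I_n).

Definition pos a j : nat := (j + (n - a)) %% n.

Definition arc a (i1 i2 : nat) : pred 'I_n := fun j => (i1 <= pos a j < i2)%N.

Lemma ltn_pos a j : (pos a j < n)%N.
Proof. by rewrite /pos ltn_mod; case: n j => // -[]. Qed.

Lemma pos_small a j : pos a j = if (a <= j)%N then (j - a)%N else (j + n - a)%N.
Proof.
have := ltn_ord a; have := ltn_ord j; rewrite /pos; case: ifP => h1 h2 h3.
  have -> : (j + (n - a) = (j - a) + n)%N by lia.
  by rewrite modnDr modn_small //; lia.
by rewrite modn_small; lia.
Qed.

Lemma pos_base a : pos a a = 0. Proof. by rewrite pos_small leqnn subnn. Qed.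

Lemma pos_inj a : injective (pos a).
Proof.
move=> i j; rewrite !pos_small => e; apply: val_inj => /=; move: e.
by have := ltn_ord a; have := ltn_ord j; have := ltn_ord i; do 2 case: ifP; lia.
Qed.

Lemma pos_surj a i : (i < n)%N -> exists j, pos a j = i.
Proof.
move=> hi; have := ltn_ord a => ha; have [h|h] := ltnP (a + i) n.
  by exists (Ordinal h); rewrite pos_small /= leq_addr; lia.
have h' : (a + i - n < n)%N by lia.
exists (Ordinal h'); rewrite pos_small /=.
by case: ifP; lia.
Qed.

Lemma val_ordS j : val (ordS j) = if j.+1 == n then 0 else j.+1.
Proof.
rewrite /=; case: eqP => [->|h]; first by rewrite modnn.
by rewrite modn_small //; have := ltn_ord j; lia.
Qed.

Lemma pos_ordS a j : pos a (ordS j) = if (pos a j).+1 == n then 0 else (pos a j).+1.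
Proof.
have := val_ordS j; rewrite !pos_small => /= ->.
by have := ltn_ord a; have := ltn_ord j; do ! case: ifP; lia.
Qed.

Lemma arc_all a j : arc a 0 n j. Proof. by rewrite /arc ltn_pos. Qed.

End Arcs.

(** * Colimits of vertex groups along arcs *)

Section Chains.
Variables (n : nat) (C : polygon_of_groups n).
Hypothesis n1 : (1 < n)%N.
Local Open Scope group_scope.
Implicit Types (e j : 'I_n) (A : pred 'I_n).

Fact edge_left e : proper_face (Vertex e) (Edge e). Proof. by rewrite /= eqxx. Qed.
Fact edge_right e : proper_face (Vertex (ordS e)) (Edge e).
Proof. by rewrite /= eqxx orbT. Qed.

Notation V j := (C (Vertex j)).
Definition lm e : {multiplicative C (Edge e) -> V e} := local_map C (edge_left e).
Definition rm e : {multiplicative C (Edge e) -> V (ordS e)} := local_map C (edge_right e).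
Definition vp j : {multiplicative C Polygon -> V j} :=
  @local_map _ _ C Polygon (Vertex j) isT.
Definition ep e : {multiplicative C Polygon -> C (Edge e)} :=
  @local_map _ _ C Polygon (Edge e) isT.

Lemma lm_inj e : injective (lm e). Proof. exact: local_map_inj. Qed.
Lemma rm_inj e : injective (rm e). Proof. exact: local_map_inj. Qed.
Lemma ep_inj e : injective (ep e). Proof. exact: local_map_inj. Qed.

Lemma lm_ep e x : lm e (ep e x) = vp e x. Proof. exact: local_map_comp. Qed.
Lemma rm_ep e x : rm e (ep e x) = vp (ordS e) x. Proof. exact: local_map_comp. Qed.

Lemma ordS_neq e : ordS e != e.
Proof.
apply/eqP => /(congr1 val); have := val_ordS e => /= ->.
by have := ltn_ord e; case: eqP => /=; lia.
Qed.

(** Families are indexed by all vertices and predicates select arcs, the value elsewhere being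
    arbitrary; gluing arcs then needs no dependent families. *)
Definition vfam (K : groupType) := forall j, {multiplicative V j -> K}.

Definition compat A (K : groupType) (f : vfam K) := forall e, A e -> A (ordS e) ->
  forall x, f e (lm e x) = f (ordS e) (rm e x).

Definition hull A (K : groupType) (f : vfam K) : K -> Prop :=
  span (fun g => exists2 j, A j & img (f j) g).

Definition colim A (L : groupType) (h : vfam L) : Prop :=
  [/\ compat A h,
      forall (K : groupType) (f : vfam K), compat A f -> exists u : {multiplicative L -> K},
        forall j, A j -> forall x, u (h j x) = f j x,
      forall p, hull A h p & forall j, A j -> injective (h j)].

Lemma hull_mem A (K : groupType) (f : vfam K) j x : A j -> hull A f (f j x).
Proof. by move=> Aj; apply: mem_span; exists j => //; exists x. Qed.

Lemma hull_sub A A' (K : groupType) (f : vfam K) g :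
  (forall j, A j -> A' j) -> hull A f g -> hull A' f g.
Proof. by move=> s; apply: span_sub => {}g [j Aj h]; apply: mem_span; exists j => //; apply: s. Qed.

Lemma hullV A (K : groupType) (f : vfam K) g : hull A f g -> hull A f g^-1.
Proof. by apply: spanV => h [j Aj /imgV ?]; exists j. Qed.

Lemma hull_img A (L K : groupType) (h : vfam L) (f : vfam K) (u : {multiplicative L -> K}) :
  (forall p, hull A h p) -> (forall j, A j -> forall x, u (h j x) = f j x) ->
  forall g, hull A f g <-> img u g.
Proof.
move=> gen ue g; split; last first.
  move=> [p ->]; apply: (mor_span _ (gen p)) => _ [j Aj [x ->]].
  by exists j => //; rewrite ue //; exists x.
move: g; apply: span_ind; [exact: img1 | exact: imgM |].
by move=> g [j Aj [x ->]]; exists (h j x); rewrite ue.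
Qed.

Lemma hull_eq A (L K : groupType) (h : vfam L) (u u' : {multiplicative L -> K}) p :
  hull A h p -> (forall j, A j -> forall x, u (h j x) = u' (h j x)) -> u p = u' p.
Proof. by move=> hp ue; apply: (mor_span_eq _ hp) => _ [j Aj [x ->]]; apply: ue. Qed.

Definition mcast a j (E : a = j) : {multiplicative V j -> V a} :=
  match E in _ = j return {multiplicative V j -> V a} with erefl => idfun end.

Definition trivial_mor (K K' : groupType) : {multiplicative K -> K'} := @one_fun K K'.

Lemma colim_single a : exists (L : groupType) (h : vfam L), colim (pred1 a) h.
Proof.
pose h : vfam (V a) := fun j => if eqP is ReflectT E then mcast E else trivial_mor (V j) (V a).
have ha x : h a x = x by rewrite /h; case: eqP => // E; rewrite (eq_irrelevance E erefl).
exists (V a), h; split.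
- by move=> e /= /eqP-> /eqP ?; have /eqP[] := ordS_neq a.
- by move=> K f _; exists (f a) => j /eqP-> x; rewrite ha.
- by move=> p; rewrite -(ha p); apply: hull_mem => /=.
- by move=> j /eqP-> x y; rewrite !ha.
Qed.

(** Two disjoint pieces joined by the single edge [m], running from [A1] to [A2]; the colimit over
    [A] is then an amalgam over the group of [m]. *)
Definition cut_at A A1 A2 m :=
  [/\ forall j, A j = A1 j || A2 j, forall j, A1 j -> ~~ A2 j, A1 m /\ A2 (ordS m),
      forall e, A1 e -> A2 (ordS e) -> e = m & forall e, A2 e -> ~~ A1 (ordS e)].

Section Glue.
Variables (A A1 A2 : pred 'I_n) (m : 'I_n).
Hypothesis cut : cut_at A A1 A2 m.
Variables (L1 L2 : groupType) (h1 : vfam L1) (h2 : vfam L2).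
Hypotheses (c1 : colim A1 h1) (c2 : colim A2 h2).

Definition glue_fam (P : groupType) (j1 : {multiplicative L1 -> P})
    (j2 : {multiplicative L2 -> P}) : vfam P :=
  fun j => if A1 j then (j1 \o h1 j : {multiplicative V j -> P})
           else (j2 \o h2 j : {multiplicative V j -> P}).

Lemma glue_fam1 (P : groupType) (j1 : {multiplicative L1 -> P}) (j2 : {multiplicative L2 -> P})
  j x : A1 j -> glue_fam j1 j2 j x = j1 (h1 j x).
Proof. by rewrite /glue_fam => ->. Qed.

Lemma glue_fam2 (P : groupType) (j1 : {multiplicative L1 -> P}) (j2 : {multiplicative L2 -> P})
  j x : A2 j -> glue_fam j1 j2 j x = j2 (h2 j x).
Proof. by case: cut => _ d _ _ _; rewrite /glue_fam; case: ifP => // /d/negP. Qed.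

Lemma glue_exists : exists (P : groupType) (j1 : {multiplicative L1 -> P})
    (j2 : {multiplicative L2 -> P}),
  amalgam (h1 m \o lm m) (h2 (ordS m) \o rm m) j1 j2 /\ colim A (glue_fam j1 j2).
Proof.
case: cut => AE d [m1 m2] only back; case: c1 c2 => [k1 u1 g1 I1] [k2 u2 g2 I2].
have J1 : injective (h1 m \o lm m) by move=> x y /I1 => /(_ m1)/lm_inj.
have J2 : injective (h2 (ordS m) \o rm m) by move=> x y /I2 => /(_ m2)/rm_inj.
have [P [j1 [j2 am]]] := amalgam_exists J1 J2.
exists P, j1, j2; split=> //; case: am => [jc uP gP _ [i1 i2 _]].
split.
- move=> e; rewrite !AE; case e1: (A1 e); case e2: (A1 (ordS e)) => /=.
  + by move=> _ _ x; rewrite !glue_fam1 // k1.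
  + move=> _ e3 x; rewrite glue_fam1 // glue_fam2 //.
    by have em := only _ e1 e3; subst e; apply: jc.
  + by move=> e3; have := back _ e3; rewrite e2.
  + by move=> e3 e4 x; rewrite !glue_fam2 // k2.
- move=> K f kf.
  have [f1 e1] : exists f1 : {multiplicative L1 -> K}, forall j, A1 j -> forall x, f1 (h1 j x) = f j x.
    by apply: u1 => e a b x; apply: kf; rewrite AE ?a ?b.
  have [f2 e2] : exists f2 : {multiplicative L2 -> K}, forall j, A2 j -> forall x, f2 (h2 j x) = f j x.
    by apply: u2 => e a b x; apply: kf; rewrite AE ?a ?b orbT.
  have [|u [ue1 ue2]] := uP K f1 f2.
    by move=> c; rewrite /= e1 // e2 // kf ?AE ?m1 ?m2 ?orbT.
  exists u => j; rewrite AE; case a1: (A1 j) => /=; [move=> _ x|move=> a2 x].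
    by rewrite glue_fam1 // ue1 e1.
  by rewrite glue_fam2 // ue2 e2.
- move=> p; apply: span_sub (gP p) => _ [[y ->]|[y ->]].
    have e1 j : A1 j -> forall x, j1 (h1 j x) = glue_fam j1 j2 j x.
      by move=> a x; rewrite glue_fam1.
    have /(hull_img g1 e1) : img j1 (j1 y) by exists y.
    by apply: hull_sub => j aj; rewrite AE aj.
  have e2 j : A2 j -> forall x, j2 (h2 j x) = glue_fam j1 j2 j x.
    by move=> a x; rewrite glue_fam2.
  have /(hull_img g2 e2) : img j2 (j2 y) by exists y.
  by apply: hull_sub => j aj; rewrite AE aj orbT.
- move=> j; rewrite AE; case a1: (A1 j) => /=; [move=> _ x y|move=> a2 x y].
    by rewrite !glue_fam1 // => /i1/I1; apply.
  by rewrite !glue_fam2 // => /i2/I2; apply.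
Qed.

Section Split.
Variables (L : groupType) (h : vfam L).
Hypothesis c : colim A h.

(** The given colimit maps to the glued amalgam by its universal property, and [amalgam_pullback]
    reads the splitting off this map. *)
Lemma colim_split : exists (v1 : {multiplicative L1 -> L}) (v2 : {multiplicative L2 -> L}),
  [/\ forall j, A1 j -> forall x, v1 (h1 j x) = h j x,
      forall j, A2 j -> forall x, v2 (h2 j x) = h j x,
      injective v1 /\ injective v2,
      reduced_nontrivial (two (hull A1 h) (hull A2 h)) &
      forall g, hull A1 h g -> hull A2 h g -> img (h m \o lm m) g].
Proof.
case: (cut) => AE d [m1 m2] only back; case: c1 c2 c => [k1 u1 g1 I1] [k2 u2 g2 I2] [k u g I].
have [P [j1 [j2 [am [kP _ _ _]]]]] := glue_exists.
have [v1 e1] : exists v1 : {multiplicative L1 -> L}, forall j, A1 j -> forall x, v1 (h1 j x) = h j x.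
  by apply: u1 => e a b x; apply: k; rewrite AE ?a ?b.
have [v2 e2] : exists v2 : {multiplicative L2 -> L}, forall j, A2 j -> forall x, v2 (h2 j x) = h j x.
  by apply: u2 => e a b x; apply: k; rewrite AE ?a ?b orbT.
have [w ew] := u P _ kP.
have w1 x : w (v1 x) = j1 x.
  have := @hull_eq A1 _ _ h1 (w \o v1) j1 x (g1 x); apply => j a y /=.
  by rewrite e1 // ew ?AE ?a // glue_fam1.
have w2 x : w (v2 x) = j2 x.
  have := @hull_eq A2 _ _ h2 (w \o v2) j2 x (g2 x); apply => j a y /=.
  by rewrite e2 // ew ?AE ?a ?orbT // glue_fam2.
have [|rv iv1 iv2 cv] := amalgam_pullback am w1 w2.
  by move=> x /=; rewrite e1 // e2 // k // AE ?m1 ?m2 ?orbT.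
exists v1, v2; split=> //.
  have -> : hull A1 h = img v1 by apply/funext => x; apply/propext; apply: hull_img.
  by have -> : hull A2 h = img v2 by apply/funext => x; apply/propext; apply: hull_img.
move=> x /(hull_img g1 e1)[a ->] /(hull_img g2 e2)[b /cv[y [-> _]]].
by exists y => /=; rewrite e1.
Qed.

End Split.
End Glue.

Variable a : 'I_n.

Lemma arc_cut i1 i2 i3 m : (i1 < i2)%N -> (i2 < i3)%N -> (i3 <= n)%N -> (i3 - i1 < n)%N ->
  pos a m = i2.-1 -> cut_at (arc a i1 i3) (arc a i1 i2) (arc a i2 i3) m.
Proof.
move=> h1 h2 h3 h4 pm; rewrite /arc; split.
- by move=> j; lia.
- by move=> j; lia.
- by split; [lia | rewrite pos_ordS; case: eqP; lia].
- by move=> e; rewrite pos_ordS => h5 h6; apply: (@pos_inj _ a); move: h6; case: eqP; lia.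
- by move=> e; rewrite pos_ordS => h5; case: eqP; lia.
Qed.

Lemma arc_colim k i1 : (i1 + k < n)%N -> (k.+1 < n)%N ->
  exists (L : groupType) (h : vfam L), colim (arc a i1 (i1 + k.+1)) h.
Proof.
elim: k => [|k IH] hk hk'.
  have [j pj] : exists j, pos a j = i1 by apply: pos_surj; lia.
  have -> : arc a i1 (i1 + 1) = (pred1 j : pred 'I_n); last exact: colim_single.
  apply/funext => j'; rewrite /arc /=; apply/idP/eqP => [h|->]; last by lia.
  by apply: (@pos_inj _ a); lia.
have [||L1 [h1 c1]] := IH; [by lia | by lia |].
have [j pj] : exists j, pos a j = (i1 + k.+1)%N by apply: pos_surj; lia.
have [L2 [h2 c2]] := colim_single j.
have e2 : (pred1 j : pred 'I_n) = arc a (i1 + k.+1) (i1 + k.+2).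
  apply/funext => j'; rewrite /arc /=; apply/eqP/idP => [->|h]; first by lia.
  by apply: (@pos_inj _ a); lia.
rewrite e2 in c2.
have [m pm] : exists m, pos a m = (i1 + k)%N by apply: pos_surj; lia.
have cut : cut_at (arc a i1 (i1 + k.+2)) (arc a i1 (i1 + k.+1)) (arc a (i1 + k.+1) (i1 + k.+2)) m.
  by apply: arc_cut; lia.
have [P [j1 [j2 [_ c]]]] := glue_exists cut c1 c2.
by eexists; eexists; exact: c.
Qed.

Lemma arc_colim_ex i1 i2 : (i1 < i2)%N -> (i2 <= n)%N -> (i2 - i1 < n)%N ->
  exists (L : groupType) (h : vfam L), colim (arc a i1 i2) h.
Proof.
move=> h1 h2 h3; have := @arc_colim (i2 - i1).-1 i1.
have -> : (i1 + (i2 - i1).-1.+1 = i2)%N by lia.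
by move=> H; apply: H; lia.
Qed.

(** The face group passes from one vertex to the next through the edge between them, so
    compatibility along the edges of an arc identifies all its images. *)
Lemma compat_face A (K : groupType) (f : vfam K) i1 i2 j j' z : (i2 <= n)%N ->
  (forall e, arc a i1 i2 e -> A e) -> compat A f ->
  arc a i1 i2 j -> arc a i1 i2 j' -> f j (vp j z) = f j' (vp j' z).
Proof.
move=> hi sA kf; suff H k j1 j2 : pos a j1 = i1 -> pos a j2 = (i1 + k)%N -> (i1 + k < i2)%N ->
    f j1 (vp j1 z) = f j2 (vp j2 z).
  rewrite /arc => hj hj'; have [j0 p0] : exists j0, pos a j0 = i1 by apply: pos_surj; lia.
  rewrite -(H (pos a j - i1)%N j0 j) ?(H (pos a j' - i1)%N j0 j') //; lia.
elim: k j2 => [|k IH] j2 p1 p2 hk.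
  by have -> : j1 = j2 by apply: (@pos_inj _ a); lia.
have [j3 p3] : exists j3, pos a j3 = (i1 + k)%N by apply: pos_surj; lia.
have e23 : j2 = ordS j3 by apply: (@pos_inj _ a); rewrite pos_ordS p3; case: eqP; lia.
rewrite (IH j3) //; last by lia.
subst j2; rewrite -lm_ep -rm_ep; apply: kf; apply: sA; rewrite /arc; lia.
Qed.

Hypothesis Hx : edge_groups_intersect_in_face C.

Lemma edges_meet (v e1 : 'I_n) (E : ordS e1 = v) x y : e1 <> v ->
  local_map C (edge_right e1) x = local_map C (edge_left (ordS e1)) y ->
  exists z, x = ep e1 z /\ y = ep (ordS e1) z.
Proof.
move=> ne e.
have hx : range (local_map C (edge_left (ordS e1))) (rm e1 x) by exists y.
have ne' : e1 <> ordS e1 by rewrite E.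
have := Hx (edge_right e1) (edge_left (ordS e1)) (isT : proper_face (Vertex (ordS e1)) Polygon) ne'.
move=> Hq; have : range (vp (ordS e1)) (rm e1 x) by rewrite -[range _]Hq; split=> //; exists x.
move=> [z _ ez]; exists z; split.
  by apply: (@rm_inj e1); rewrite -ez rm_ep.
by apply: (@lm_inj (ordS e1)); rewrite lm_ep ez.
Qed.

(** Splitting off the first vertex puts a common element into the group of the first inner edge. By
    the intersection condition at that vertex it comes from the face group, and induction carries
    this along the rest of the arc. *)
Lemma outer_meet k i1 i2 (L : groupType) (h : vfam L) e1 w x y :
  (i2 - i1 = k.+1)%N -> (i2 <= n)%N -> (k.+1 < n)%N -> colim (arc a i1 i2) h ->
  pos a (ordS e1) = i1 -> pos a w = i2.-1 ->
  h (ordS e1) (rm e1 x) = h w (lm w y) -> exists z, x = ep e1 z /\ y = ep w z.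
Proof.
elim: k i1 L h e1 x => [|k IH] i1 L h e1 x hk hn hk' ch p1 p2 e.
  have ew : ordS e1 = w by apply: (@pos_inj _ a); lia.
  subst w; case: ch => _ _ _ I; apply: (@edges_meet (ordS e1)) => //.
    by move=> E; have := ordS_neq e1; rewrite -E eqxx.
  by apply: (I (ordS e1)) => //; rewrite /arc; lia.
set v := ordS e1 in p1 e *.
have [|||L1 [h1 c1]] := @arc_colim_ex i1 i1.+1; [by lia | by lia | by lia |].
have [|||L2 [h2 c2]] := @arc_colim_ex i1.+1 i2; [by lia | by lia | by lia |].
have cut : cut_at (arc a i1 i2) (arc a i1 i1.+1) (arc a i1.+1 i2) v by apply: arc_cut; lia.
have [v1 [v2 [E1 E2 [I1 I2] rL cL]]] := colim_split cut c1 c2 ch.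
have pSv : pos a (ordS v) = i1.+1 by rewrite pos_ordS p1; case: eqP; lia.
have [] := cL (h v (rm e1 x)).
- by apply: hull_mem; rewrite /arc; lia.
- by rewrite e; apply: hull_mem; rewrite /arc; lia.
move=> c /= ec; have [_ _ _ I] := ch.
have Av : arc a i1 i2 v by rewrite /arc; lia.
have [z [ex cz]] : exists z, x = ep e1 z /\ c = ep v z.
  apply: (@edges_meet (ordS e1)) => //; first by move=> E; have := ordS_neq e1; rewrite -E eqxx.
  exact: (I v Av).
have : h2 (ordS v) (rm v c) = h2 w (lm w y).
  apply: I2; rewrite !E2 ?/arc; try lia.
  rewrite -e ec; case: ch => kh _ _ _; rewrite kh // /arc; lia.
have q1 : (i2 - i1.+1 = k.+1)%N by lia.
move=> E0; have [z' [cz' ->]] := IH i1.+1 L2 h2 v c q1 hn (ltnW hk') c2 pSv p2 E0.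
 exists z'; split=> //; rewrite ex; congr (ep _ _).
by apply: (@ep_inj v); rewrite -cz -cz'.
Qed.

(** The outer edge groups lie on different sides of the split after the first vertex and meet the
    other side only in the face group, so their reduced words are reduced for the split. An arc with
    one vertex has no such split. *)
Lemma outer_reduced i1 i2 (L : groupType) (h : vfam L) e1 w :
  (i1.+1 < i2)%N -> (i2 <= n)%N -> (i2 - i1 < n)%N -> colim (arc a i1 i2) h ->
  pos a (ordS e1) = i1 -> pos a w = i2.-1 ->
  reduced_nontrivial (two (img (h (ordS e1) \o rm e1)) (img (h w \o lm w))).
Proof.
move=> hi hn hi' ch p1 p2; set v := ordS e1 in p1 *.
have [|||L1 [h1 c1]] := @arc_colim_ex i1 i1.+1; [by lia | by lia | by lia |].
have [|||L2 [h2 c2]] := @arc_colim_ex i1.+1 i2; [by lia | by lia | by lia |].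
have cut : cut_at (arc a i1 i2) (arc a i1 i1.+1) (arc a i1.+1 i2) v by apply: arc_cut; lia.
have [v1 [v2 [E1 E2 [I1 I2] rL cL]]] := colim_split cut c1 c2 ch.
have pSv : pos a (ordS v) = i1.+1 by rewrite pos_ordS p1; case: eqP; lia.
have Av : arc a i1 i2 v by rewrite /arc; lia.
have A1v : arc a i1 i1.+1 v by rewrite /arc; lia.
have A2w : arc a i1.+1 i2 w by rewrite /arc; lia.
have Aw : arc a i1 i2 w by rewrite /arc; lia.
have [kh _ _ I] := ch.
have hvw z : h v (vp v z) = h w (vp w z).
  exact: (compat_face z hn (fun e => id) kh).
apply: (reduced_pull (f := idfun)) rL => -[] g [x ->] /=.
- exact: hull_mem.
- exact: hull_mem.
- move=> hg; have [] := cL _ (hull_mem h (rm e1 x) A1v) hg.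
  move=> c /= /(I v Av) ec.
  have [z [-> _]] : exists z, x = ep e1 z /\ c = ep v z.
    apply: (@edges_meet (ordS e1)) => //; by move=> E; have := ordS_neq e1; rewrite -E eqxx.
  by exists (ep w z); rewrite /= lm_ep rm_ep hvw.
- move=> hg; have [] := cL _ hg (hull_mem h (lm w x) A2w).
  move=> c /= ec.
  have [] := @outer_meet (i2 - i1.+1).-1 i1.+1 i2 _ h2 v w c x; [lia | lia | lia | done | done | done | |].
    apply: I2; rewrite !E2 ?ec // ?/arc; try lia.
    by rewrite kh // /arc; lia.
  by move=> z [_ ->]; exists (ep e1 z); rewrite /= lm_ep rm_ep -hvw.
Qed.

Lemma outer_side_left i1 m i2 (L : groupType) (h : vfam L) e1 g :
  (i1 < m)%N -> (m < i2)%N -> (i2 <= n)%N -> (i2 - i1 < n)%N -> colim (arc a i1 i2) h ->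
  pos a (ordS e1) = i1 -> img (h (ordS e1) \o rm e1) g -> hull (arc a m i2) h g ->
  img (h (ordS e1) \o vp (ordS e1)) g.
Proof.
move=> h1' h2' hn hi ch p1 [x ->] hg.
have [|||L1 [h1 c1]] := @arc_colim_ex i1 m; [by lia | by lia | by lia |].
have [|||L2 [h2 c2]] := @arc_colim_ex m i2; [by lia | by lia | by lia |].
have [w pw] : exists w, pos a w = m.-1 by apply: pos_surj; lia.
have cut : cut_at (arc a i1 i2) (arc a i1 m) (arc a m i2) w by apply: arc_cut; lia.
have [v1 [v2 [E1 E2 [I1 I2] rL cL]]] := colim_split cut c1 c2 ch.
have A1 : arc a i1 m (ordS e1) by rewrite /arc; lia.
have A2 : arc a i1 m w by rewrite /arc; lia.
have [y /= ey] := cL _ (hull_mem h (rm e1 x) A1) hg.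
have q : (m - i1 = (m - i1).-1.+1)%N by lia.
have q1 : ((m - i1).-1.+1 < n)%N by lia.
have q2 : (m <= n)%N by lia.
have e0 : h1 (ordS e1) (rm e1 x) = h1 w (lm w y) by apply: I1; rewrite !E1.
have [z [-> _]] := outer_meet q q2 q1 c1 p1 pw e0.
by exists z; rewrite /= rm_ep.
Qed.

Lemma outer_side_right i1 m i2 (L : groupType) (h : vfam L) w g :
  (i1 < m)%N -> (m < i2)%N -> (i2 <= n)%N -> (i2 - i1 < n)%N -> colim (arc a i1 i2) h ->
  pos a w = i2.-1 -> img (h w \o lm w) g -> hull (arc a i1 m) h g ->
  img (h w \o vp w) g.
Proof.
move=> h1' h2' hn hi ch pw [y ->] hg.
have [|||L1 [h1 c1]] := @arc_colim_ex i1 m; [by lia | by lia | by lia |].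
have [|||L2 [h2 c2]] := @arc_colim_ex m i2; [by lia | by lia | by lia |].
have [e1 p1] : exists e1, pos a e1 = m.-1 by apply: pos_surj; lia.
have cut : cut_at (arc a i1 i2) (arc a i1 m) (arc a m i2) e1 by apply: arc_cut; lia.
have [v1 [v2 [E1 E2 [I1 I2] rL cL]]] := colim_split cut c1 c2 ch.
have pS : pos a (ordS e1) = m by rewrite pos_ordS p1; case: eqP; lia.
have A2 : arc a m i2 w by rewrite /arc; lia.
have A1 : arc a m i2 (ordS e1) by rewrite /arc; lia.
have [x /= ex] := cL _ hg (hull_mem h (lm w y) A2).
have q : (i2 - m = (i2 - m).-1.+1)%N by lia.
have q1 : ((i2 - m).-1.+1 < n)%N by lia.
have e0 : h2 (ordS e1) (rm e1 x) = h2 w (lm w y).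
  apply: I2; rewrite !E2 // ex; case: ch => kh _ _ _; rewrite kh // /arc; lia.
have [z [_ ->]] := outer_meet q hn q1 c2 pS pw e0.
by exists z; rewrite /= lm_ep.
Qed.

End Chains.

(** * Cuts of the polygon *)

Section PolygonGroup.
Variables (n : nat) (C : polygon_of_groups n).
Hypothesis n3 : (3 < n)%N.
Hypothesis Hx : edge_groups_intersect_in_face C.
Variables (G : groupType) (phi : cocone C G).
Hypothesis lim : is_direct_limit phi.
Local Open Scope group_scope.
Implicit Types (e j : 'I_n) (A : pred 'I_n).

Let n1 : (1 < n)%N. Proof. by apply: leq_trans n3. Qed.

Definition vleg : vfam C G := fun j => phi (Vertex j).
Definition eset e : G -> Prop := img (phi (Edge e)).
Definition fset : G -> Prop := img (phi Polygon).
Definition bset e e' : G -> Prop := span (fun g => eset e g \/ eset e' g).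

Lemma leg_left e x : phi (Vertex e) (lm C e x) = phi (Edge e) x. Proof. exact: legE. Qed.
Lemma leg_right e x : phi (Vertex (ordS e)) (rm C e x) = phi (Edge e) x. Proof. exact: legE. Qed.
Lemma leg_face j x : phi (Vertex j) (vp C j x) = phi Polygon x. Proof. exact: legE. Qed.
Lemma leg_edge_face e x : phi (Edge e) (ep C e x) = phi Polygon x. Proof. exact: legE. Qed.

Lemma vleg_compat A : compat A vleg.
Proof. by move=> e _ _ x; rewrite /vleg leg_left leg_right. Qed.

Definition face_leg (K : groupType) (f : vfam C K) (a : 'I_n) (s : face n) :
    {multiplicative C s -> K} :=
  match s with
  | Polygon => f a \o vp C a
  | Edge e => f e \o lm C e
  | Vertex j => f j
  end.

(** The face group is sent through the vertex 0, and by [compat_face] any other vertex gives the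
    same map. *)
Lemma cocone_of_vfam (K : groupType) (f : vfam C K) : compat predT f ->
  exists psi : cocone C K, forall j x, psi (Vertex j) x = f j x.
Proof.
move=> kf; pose a : 'I_n := Ordinal (ltnW n1).
have fa j z : f a (vp C a z) = f j (vp C j z).
  by apply: (compat_face (a := a) n1 z (leqnn n) _ kf) => //; apply: arc_all.
have H s s' (h : proper_face s' s) x : face_leg f a s' (local_map C h x) = face_leg f a s x.
  case: s s' h x => [|e|j] [|e'|j'] h x //=.
  - have -> : local_map C h x = ep C e' x by rewrite /ep; congr (local_map C _ x); apply: bool_irrelevance.
    by rewrite lm_ep -fa.
  - have -> : local_map C h x = vp C j' x by rewrite /vp; congr (local_map C _ x); apply: bool_irrelevance.
    by rewrite -fa.
  - have [E|E] := eqVneq j' e.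
      subst j'; have -> : local_map C h x = lm C e x.
        by rewrite /lm; congr (local_map C _ x); apply: bool_irrelevance.
      by [].
    have E' : j' = ordS e by apply/eqP; move: h; rewrite /= (negPf E).
    subst j'; have -> : local_map C h x = rm C e x.
      by rewrite /rm; congr (local_map C _ x); apply: bool_irrelevance.
    by rewrite kf.
by exists (Cocone H).
Qed.

Lemma limit_map (K : groupType) (f : vfam C K) : compat predT f ->
  exists u : {multiplicative G -> K}, forall j x, u (vleg j x) = f j x.
Proof.
move=> /cocone_of_vfam[psi hpsi]; have [u hu _] := lim psi.
by exists u => j x; rewrite hu hpsi.
Qed.

Lemma limit_ext (u : {multiplicative G -> G}) :
  (forall j x, u (vleg j x) = vleg j x) -> forall g, u g = g.
Proof.
move=> hu; have [w _ hw] := lim phi.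
have huP s x : u (phi s x) = phi s x.
  case: s x => [|e|j] x; last exact: hu.
    by rewrite -(leg_face (Ordinal (ltnW n1))) hu.
  by rewrite -leg_left hu.
move=> g; rewrite (hw u huP); symmetry.
by have := hw (idfun : {multiplicative G -> G}) (fun _ _ => erefl) g.
Qed.

Section Cut.
Variables (a : 'I_n) (k : nat).
Hypotheses (k1 : (1 < k)%N) (k2 : (k.+1 < n)%N).
Variables b c : 'I_n.
Hypotheses (pb : pos a b = k.-1) (pc : pos a c = n.-1).

Let pSb : pos a (ordS b) = k. Proof. by rewrite pos_ordS pb; case: eqP; lia. Qed.
Let pSc : pos a (ordS c) = 0. Proof. by rewrite pos_ordS pc; case: eqP; lia. Qed.

(** [M] is the abstract amalgam of the two crossed edge groups over the face group. By
    [outer_reduced] and [outer_meet] it embeds in the colimits [L1] and [L2] of both arcs, so their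
    amalgam [P] over [M] exists. The universal property of [G] gives a map to [P], and
    [amalgam_pullback] makes [G] an internal amalgam. *)
Lemma total_cut :
  [/\ forall g, hull predT vleg g,
      reduced_nontrivial (two (hull (arc a 0 k) vleg) (hull (arc a k n) vleg)),
      forall g, hull (arc a 0 k) vleg g -> hull (arc a k n) vleg g -> bset b c g &
      exists (L : groupType) (h : vfam C L) (v : {multiplicative L -> G}),
        [/\ colim (arc a 0 k) h, injective v & forall j, arc a 0 k j -> forall x, v (h j x) = vleg j x]].
Proof.
have [|||L1 [h1 c1]] := @arc_colim_ex n C n1 a 0 k; [by lia | by lia | by lia |].
have [|||L2 [h2 c2]] := @arc_colim_ex n C n1 a k n; [by lia | by lia | by lia |].
have Ab1 : arc a 0 k b by rewrite /arc; lia.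
have Ac1 : arc a 0 k (ordS c) by rewrite /arc; lia.
have Ab2 : arc a k n (ordS b) by rewrite /arc; lia.
have Ac2 : arc a k n c by rewrite /arc; lia.
have [kh1 u1 g1 I1] := c1; have [kh2 u2 g2 I2] := c2.
have [M [m1 [m2 am]]] := amalgam_exists (@ep_inj n C b) (@ep_inj n C c).
have [mc um gm rM [Im1 Im2 cM]] := am.
have f1 z : h1 b (vp C b z) = h1 (ordS c) (vp C (ordS c) z).
  exact: (compat_face n1 z (ltnW (ltnW k2)) (fun e => id) kh1).
have f2 z : h2 (ordS b) (vp C (ordS b) z) = h2 c (vp C c z).
  exact: (compat_face n1 z (leqnn n) (fun e => id) kh2).
have [|i1 [i1b i1c]] := um L1 (h1 b \o lm C b) (h1 (ordS c) \o rm C c).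
  by move=> z /=; rewrite lm_ep rm_ep f1.
have [|i2 [i2b i2c]] := um L2 (h2 (ordS b) \o rm C b) (h2 c \o lm C c).
  by move=> z /=; rewrite lm_ep rm_ep f2.
have Ii1 : injective i1.
  apply: (amalgam_embed am i1b i1c).
  - by move=> x y /(I1 b Ab1)/lm_inj.
  - by move=> x y /(I1 _ Ac1)/rm_inj.
  - apply: reduced_swap.
    by apply: (outer_reduced n1 Hx _ _ _ c1) => //; lia.
  - move=> x y /esym e.
    have [|||z [-> ->]] := @outer_meet n C n1 a Hx k.-1 0 k _ h1 c b y x _ _ _ c1 pSc pb e; try lia.
    by exists z.
have Ii2 : injective i2.
  apply: (amalgam_embed am i2b i2c).
  - by move=> x y /(I2 _ Ab2)/rm_inj.
  - by move=> x y /(I2 _ Ac2)/lm_inj.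
  - by apply: (outer_reduced n1 Hx _ _ _ c2) => //; lia.
  - move=> x y e.
    have [|||z [-> ->]] := @outer_meet n C n1 a Hx (n - k).-1 k n _ h2 b c x y _ _ _ c2 pSb pc e; try lia.
    by exists z.
have [P [j1 [j2 amP]]] := amalgam_exists Ii1 Ii2.
have [jc uP gP _ _] := amP.
pose f := glue_fam (arc a 0 k) h1 h2 j1 j2.
have fE1 j x : arc a 0 k j -> f j x = j1 (h1 j x) by exact: glue_fam1.
have fE2 j x : arc a k n j -> f j x = j2 (h2 j x).
  by rewrite /f /glue_fam /arc => h; case: ifP => //; lia.
have sideE j : arc a 0 k j \/ arc a k n j.
  by have := ltn_pos a j; rewrite /arc; case: (ltnP (pos a j) k) => h1' h2'; [left | right]; lia.
(* The edges not inside one of the arcs are [b] and [c]; there the relation is the one imposed by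
   amalgamating over [M]. *)
have kf : compat predT f.
  move=> e _ _ x; have [he|he] := sideE e; have [hs|hs] := sideE (ordS e).
  - by rewrite !fE1 // kh1.
  - have E : e = b.
      apply: (@pos_inj _ a); move: he hs; rewrite /arc pos_ordS pb; case: eqP; lia.
    subst e; rewrite fE1 // fE2 //.
    by have := jc (m1 x); rewrite i1b i2b.
  - have E : e = c.
      apply: (@pos_inj _ a); move: he hs; have := ltn_pos a e.
      by rewrite /arc pos_ordS pc; case: eqP; lia.
    subst e; rewrite fE2 // fE1 //.
    by have := jc (m2 x); rewrite i1c i2c.
  - by rewrite !fE2 // kh2.
have [th hth] := limit_map kf.
have va A : compat A vleg by exact: vleg_compat.
have [v1 ev1] := u1 G vleg (va _).
have [v2 ev2] := u2 G vleg (va _).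
have tv1 x : th (v1 x) = j1 x.
  have := @hull_eq n C (arc a 0 k) _ _ h1 (th \o v1) j1 x (g1 x); apply => j aj y /=.
  by rewrite ev1 // hth fE1.
have tv2 x : th (v2 x) = j2 x.
  have := @hull_eq n C (arc a k n) _ _ h2 (th \o v2) j2 x (g2 x); apply => j aj y /=.
  by rewrite ev2 // hth fE2.
have vc y : v1 (i1 y) = v2 (i2 y).
  apply: (@mor_span_eq _ _ (v1 \o i1) (v2 \o i2) _ y _ (gm y)) => _ [[x ->]|[x ->]] /=.
    by rewrite i1b i2b /= ev1 // ev2 // /vleg leg_left leg_right.
  by rewrite i1c i2c /= ev1 // ev2 // /vleg leg_left leg_right.
have [rv Iv1 Iv2 cv] := amalgam_pullback amP tv1 tv2 vc.
have E1 := hull_img g1 ev1; have E2 := hull_img g2 ev2.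
split.
- move=> g; have [rho [r1 r2]] := uP G v1 v2 vc.
  have <- : (rho \o th) g = g.
    apply: limit_ext => j x /=; rewrite hth; have [hj|hj] := sideE j.
      by rewrite fE1 // r1 ev1.
    by rewrite fE2 // r2 ev2.
  move: (gP (th g)) => /=; set p := th g; move: (p).
  apply: (span_ind (Y := fun p => hull predT vleg (rho p))) => [|p1 p2 q1 q2|_ [[x ->]|[x ->]]].
  + by rewrite mor1; apply: span1.
  + by rewrite gmulfM; apply: spanM.
  + by rewrite r1; apply: (@hull_sub _ _ (arc a 0 k)) => //; apply/E1; exists x.
  + by rewrite r2; apply: (@hull_sub _ _ (arc a k n)) => //; apply/E2; exists x.
- have -> : hull (arc a 0 k) vleg = img v1 by apply/funext => x; apply/propext; apply: E1.
  by have -> : hull (arc a k n) vleg = img v2 by apply/funext => x; apply/propext; apply: E2.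
- move=> g /E1[x ->] /E2[y /cv[z [-> _]]].
  apply: (mor_span (f := v1 \o i1) _ (gm z)) => _ [[t ->]|[t ->]].
    by left; exists t; rewrite /= i1b /= ev1 // /vleg leg_left.
  by right; exists t; rewrite /= i1c /= ev1 // /vleg leg_right.
- by exists L1, h1, v1.
Qed.

Lemma arc_vertex_inj j : arc a 0 k j -> injective (phi (Vertex j)).
Proof.
have [_ _ _ [L [h [v [[_ _ _ I] Iv ev]]]]] := total_cut.
by move=> aj x y; rewrite -/(vleg j) -!ev // => /Iv/(I j aj).
Qed.

Let push (L : groupType) (h : vfam C L) (v : {multiplicative L -> G}) (B : pred 'I_n) :
  injective v -> (forall j, B j -> forall x, v (h j x) = vleg j x) ->
  forall g, hull B vleg g <-> exists2 p, hull B h p & g = v p.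
Proof.
move=> Iv ev g; split.
  move: g; apply: span_ind => [|g g' [p hp ->] [q hq ->]|g [j bj [x ->]]].
  - by exists 1; [apply: span1 | rewrite mor1].
  - by exists (p * q); [apply: spanM | rewrite gmulfM].
  - by exists (h j x); [apply: hull_mem | rewrite ev].
move=> [p hp ->]; apply: (mor_span _ hp) => _ [j bj [x ->]].
by exists j => //; exists x; rewrite ev.
Qed.

Lemma arc_split m e : (0 < m < k)%N -> pos a e = m.-1 ->
  reduced_nontrivial (two (hull (arc a 0 m) vleg) (hull (arc a m k) vleg)) /\
  forall g, hull (arc a 0 m) vleg g -> hull (arc a m k) vleg g -> eset e g.
Proof.
move=> hm pe; have [_ _ _ [L [h [v [ch Iv ev]]]]] := total_cut.
have [|||L1 [h1 c1]] := @arc_colim_ex n C n1 a 0 m; [by lia | by lia | by lia |].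
have [|||L2 [h2 c2]] := @arc_colim_ex n C n1 a m k; [by lia | by lia | by lia |].
have cut : cut_at (arc a 0 k) (arc a 0 m) (arc a m k) e by apply: arc_cut => //; lia.
have [_ [_ [_ _ _ rL cL]]] := colim_split cut c1 c2 ch.
have ev1 j : arc a 0 m j -> forall x, v (h j x) = vleg j x.
  by move=> hj; apply: ev; move: hj; rewrite /arc; lia.
have ev2 j : arc a m k j -> forall x, v (h j x) = vleg j x.
  by move=> hj; apply: ev; move: hj; rewrite /arc; lia.
split.
  by apply: (reduced_push Iv _ rL) => -[] y /=; apply: push.
move=> g /(push Iv ev1)[p hp ->] /(push Iv ev2)[q hq /Iv epq].
rewrite -epq in hq; have [x ->] := cL _ hp hq.
by exists x; rewrite /= ev /vleg ?leg_left // /arc; lia.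
Qed.

Lemma boundary_reduced : reduced_nontrivial (two (eset c) (eset b)).
Proof.
have [_ _ _ [L [h [v [ch Iv ev]]]]] := total_cut.
have := outer_reduced n1 Hx k1 (ltnW (ltnW k2)) _ ch pSc pb.
rewrite subn0 => /(_ (ltnW k2)); apply: (reduced_push Iv) => -[] y /=; split.
- by move=> [x ->]; exists (h (ordS c) (rm C c x)); [exists x | rewrite ev /arc ?/vleg ?leg_right //; lia].
- by move=> [_ [x ->] ->]; exists x; rewrite /= ev /arc ?/vleg ?leg_right //; lia.
- by move=> [x ->]; exists (h b (lm C b x)); [exists x | rewrite ev /arc ?/vleg ?leg_left //; lia].
- by move=> [_ [x ->] ->]; exists x; rewrite /= ev /arc ?/vleg ?leg_left //; lia.
Qed.

Lemma boundary_meet m g : (0 < m < k)%N ->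
  (eset c g -> hull (arc a m k) vleg g -> fset g) /\
  (eset b g -> hull (arc a 0 m) vleg g -> fset g).
Proof.
move=> hm; have [_ _ _ [L [h [v [ch Iv ev]]]]] := total_cut.
have Ac : arc a 0 k (ordS c) by rewrite /arc; lia.
have Ab : arc a 0 k b by rewrite /arc; lia.
have hk : (k - 0 < n)%N by lia.
have hk' : (k <= n)%N by lia.
have [m0 mk] := andP hm.
have ev1 j : arc a 0 m j -> forall x, v (h j x) = vleg j x.
  by move=> hj; apply: ev; move: hj; rewrite /arc; lia.
have ev2 j : arc a m k j -> forall x, v (h j x) = vleg j x.
  by move=> hj; apply: ev; move: hj; rewrite /arc; lia.
split.
  move=> [x ->] /(push Iv ev2)[q hq]; rewrite -leg_right -/(vleg (ordS c)) -ev // => /Iv eq.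
  have [|z] := outer_side_left n1 Hx m0 mk hk' hk ch pSc (g := q) _ hq; first by exists x.
  by rewrite -eq => ->; exists z; rewrite /= ev // /vleg leg_face.
move=> [x ->] /(push Iv ev1)[q hq]; rewrite -leg_left -/(vleg b) -ev // => /Iv eq.
have [|z] := outer_side_right n1 Hx m0 mk hk' hk ch pb (g := q) _ hq; first by exists x.
by rewrite -eq => ->; exists z; rewrite /= ev // /vleg leg_face.
Qed.

End Cut.

Lemma fset_eset e g : fset g -> eset e g.
Proof. by move=> [x ->]; exists (ep C e x); rewrite leg_edge_face. Qed.

Lemma eset_hull_left A e g : A e -> eset e g -> hull A vleg g.
Proof. by move=> Ae [x ->]; rewrite -leg_left; apply: (@hull_mem _ _ _ _ vleg). Qed.

Lemma eset_hull_right A e g : A (ordS e) -> eset e g -> hull A vleg g.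
Proof. by move=> Ae [x ->]; rewrite -leg_right; apply: (@hull_mem _ _ _ _ vleg). Qed.

End PolygonGroup.

(** * The universal cover *)

Section Hats.
Variables (R : realType) (n : nat) (r : R).
Hypotheses (n3 : (3 < n)%N) (hr : 0 < r).
Implicit Types (i j e : 'I_n) (x y : R * R) (s : face n).

Notation vx j := (vertex_point r j).

Definition inner x j : R := x.1 * (vx j).1 + x.2 * (vx j).2.
Definition theta : R := 2 * pi / n%:R.
(** A bump at the vertex [j]: it vanishes beyond the line through the two neighbouring vertices,
    where the inner product is [r ^+ 2 * cos theta], and is linear before it. *)
Definition hat j x : R := Num.max 0 (inner x j - r ^+ 2 * cos theta).
Definition hat_top : R := r ^+ 2 * (1 - cos theta).

Let n0 : (n%:R : R) != 0. Proof. by rewrite pnatr_eq0; lia. Qed.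
Let ngt0 : 0 < (n%:R : R). Proof. by rewrite ltr0n; lia. Qed.
Let pi0 : 0 < (pi : R). Proof. exact: pi_gt0. Qed.

Lemma inner_vertex i j :
  inner (vx i) j = r ^+ 2 * cos (2 * pi * i%:R / n%:R - 2 * pi * j%:R / n%:R).
Proof. by rewrite /inner /vertex_point /= cosB; ring. Qed.

Lemma theta_bounds : 0 < theta <= pi.
Proof.
rewrite /theta divr_gt0 ?mulr_gt0 //= ler_pdivrMr //.
have : (2 : R) <= n%:R by rewrite ler_nat; lia.
by move=> h; rewrite mulrC ler_wpM2l // ltW.
Qed.

Lemma cos_theta_lt1 : cos theta < 1.
Proof.
have /andP[h1 h2] := theta_bounds; rewrite -cos0 ltr_cos // in_itv /=.
  by rewrite lexx ltW.
by rewrite (ltW h1).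
Qed.

Lemma hat_top_gt0 : 0 < hat_top.
Proof. by rewrite mulr_gt0 ?exprn_gt0 // subr_gt0 cos_theta_lt1. Qed.

Lemma cos_multiple (k : nat) : (0 < k < n)%N -> cos (2 * pi * k%:R / n%:R) <= cos theta.
Proof.
move=> /andP[k0 kn]; have /andP[t0 tp] := theta_bounds.
have key (l : nat) : (0 < l)%N -> (l.*2 <= n)%N -> cos (2 * pi * l%:R / n%:R) <= cos theta.
  move=> l0 ln; have E : 2 * pi * l%:R / n%:R = theta * l%:R by rewrite /theta; field.
  have l1 : (1 : R) <= l%:R by rewrite ler1n.
  have ht : theta <= theta * l%:R by rewrite ler_peMr // ltW.
  have hp : theta * l%:R <= pi.
    have ln' : (l%:R * 2 : R) <= n%:R by rewrite -natrM ler_nat muln2.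
    have -> : theta * l%:R = pi * (l%:R * 2) / n%:R by rewrite /theta; field.
    by rewrite ler_pdivrMr // ler_wpM2l // ltW.
  rewrite E leNgt ltr_cos ?in_itv /= -?leNgt ?hp ?tp ?(ltW t0) ?(le_trans (ltW t0) ht) //.
have [h|h] := leqP k.*2 n; first exact: key.
have E : 2 * pi * k%:R / n%:R = - (2 * pi * (n - k)%N%:R / n%:R) + pi *+ 2 :> R.
  by rewrite natrB ?(ltnW kn) //; field.
by rewrite E cosD2pi cosN; apply: key; lia.
Qed.

Lemma inner_vertex_le i j : i != j -> inner (vx i) j <= r ^+ 2 * cos theta.
Proof.
move=> ne; rewrite inner_vertex ler_wpM2l ?sqr_ge0 //.
have hi := ltn_ord i; have hj := ltn_ord j; have : (i != j :> nat) by [].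
rewrite neq_ltn => /orP[h|h].
  have -> : 2 * pi * i%:R / n%:R - 2 * pi * j%:R / n%:R = - (2 * pi * (j - i)%N%:R / n%:R) :> R.
    by rewrite natrB ?(ltnW h) //; field.
  by rewrite cosN; apply: cos_multiple; lia.
have -> : 2 * pi * i%:R / n%:R - 2 * pi * j%:R / n%:R = 2 * pi * (i - j)%N%:R / n%:R :> R.
  by rewrite natrB ?(ltnW h) //; field.
by apply: cos_multiple; lia.
Qed.

Lemma inner_vertex_diag j : inner (vx j) j = r ^+ 2.
Proof. by rewrite inner_vertex subrr cos0 mulr1. Qed.

Lemma inner_vertex_next e : inner (vx (ordS e)) e = r ^+ 2 * cos theta /\
  inner (vx e) (ordS e) = r ^+ 2 * cos theta.
Proof.
rewrite !inner_vertex; have -> : 2 * pi * e%:R / n%:R - 2 * pi * (ordS e)%:R / n%:R =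
  - (2 * pi * (ordS e)%:R / n%:R - 2 * pi * e%:R / n%:R) :> R by ring.
rewrite cosN; suff -> : cos (2 * pi * (ordS e)%:R / n%:R - 2 * pi * e%:R / n%:R) = cos theta :> R by [].
have := val_ordS e; rewrite /= => ->; case: eqP => h.
  have -> : (e : nat) = n.-1 by lia.
  have -> : 2 * pi * 0%:R / n%:R - 2 * pi * n.-1%:R / n%:R = theta - pi *+ 2 :> R.
    have -> : (n.-1%:R : R) = n%:R - 1 by rewrite -subn1 natrB //; lia.
    by rewrite /theta; field.
  by rewrite -[LHS]cosD2pi subrK.
by congr cos; rewrite /theta -natr1; field.
Qed.

Lemma inner_sum (t : 'I_n -> R) j :
  inner (\sum_i t i * (vx i).1, \sum_i t i * (vx i).2) j = \sum_i t i * inner (vx i) j.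
Proof.
rewrite /inner /= !mulr_suml -big_split /=; apply: eq_bigr => i _; ring.
Qed.

Lemma hat_ge0 j x : 0 <= hat j x. Proof. by rewrite /hat le_max lexx. Qed.

Lemma hat_le j x s : cell r s x -> hat j x <= hat_top.
Proof.
move=> [t [t0 _ t1] ->]; rewrite /hat ge_max (ltW hat_top_gt0) /= inner_sum.
rewrite /hat_top mulrBr mulr1 lerB // -[leRHS]mul1r -t1 mulr_suml; apply: ler_sum => i _.
rewrite ler_wpM2l // inner_vertex ler_piMr ?sqr_ge0 //; exact: cos_le1.
Qed.

Lemma hat_far j x s : cell r s x -> ~~ subface (Vertex j) s -> hat j x = 0.
Proof.
move=> [t [t0 ts t1] ->] js; rewrite /hat; apply/max_idPl; rewrite subr_le0 inner_sum.
rewrite -[leRHS]mul1r -t1 mulr_suml; apply: ler_sum => i _.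
have [->|ne] := eqVneq i j; first by rewrite ts // !mul0r.
by rewrite ler_wpM2l // inner_vertex_le.
Qed.

Lemma cell_sub s s' x : (forall j, subface (Vertex j) s -> subface (Vertex j) s') ->
  cell r s x -> cell r s' x.
Proof.
move=> h [t [t0 ts t1] ->]; exists t => //; split=> // j js; apply: ts.
by apply: contra js; apply: h.
Qed.

Lemma vertex_point_cell j s : subface (Vertex j) s -> cell r s (vx j).
Proof.
move=> js; exists (fun i => (i == j)%:R).
  split=> [i|i|]; first by rewrite ler0n.
    by case: eqP => // ->; rewrite js.
  by rewrite (bigD1 j) //= eqxx big1 ?addr0 // => i /negPf->.
rewrite [vx j]surjective_pairing; congr (_, _).
  by rewrite (bigD1 j) //= eqxx mul1r big1 ?addr0 // => i /negPf->; rewrite mul0r.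
by rewrite (bigD1 j) //= eqxx mul1r big1 ?addr0 // => i /negPf->; rewrite mul0r.
Qed.

Lemma subface_edge j e : subface (Vertex j) (Edge e) = (j == e) || (j == ordS e).
Proof. by []. Qed.

(** On an edge only the hats of its two ends can be nonzero, and they are [hat_top] times the
    barycentric coordinates. *)
Lemma hat_sum x e : cell r (Edge e) x -> \sum_j hat j x = hat_top.
Proof.
move=> cx; have ne : ordS e != e.
  by apply/eqP => /(congr1 val); have := val_ordS e => /= ->; have := ltn_ord e; case: eqP => /=; lia.
rewrite (bigD1 e) //= (bigD1 (ordS e)) //= big1 ?addr0; last first.
  by move=> j /andP[j1 j2]; apply: (hat_far cx); rewrite subface_edge (negPf j1) (negPf j2).
case: cx => t [t0 ts t1] ->; rewrite /hat !inner_sum.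
have sum2 (f : 'I_n -> R) : \sum_i t i * f i = t e * f e + t (ordS e) * f (ordS e).
  rewrite (bigD1 e) //= (bigD1 (ordS e)) //= big1 ?addr0 // => j /andP[j1 j2].
  by rewrite ts ?mul0r // subface_edge (negPf j1) (negPf j2).
have [e1 e2] := inner_vertex_next e.
have t2 : t e + t (ordS e) = 1.
  by have := sum2 (fun _ => 1); rewrite -mulr_suml t1 !mulr1.
rewrite !sum2 !inner_vertex_diag e1 e2.
have h0 := t0 e; have h1 := t0 (ordS e); have m0 := hat_top_gt0.
have E1 : t e * r ^+ 2 + t (ordS e) * (r ^+ 2 * cos theta) - r ^+ 2 * cos theta = t e * hat_top.
  by rewrite (_ : t (ordS e) = 1 - t e) /hat_top; [ring | rewrite -t2; ring].
have E2 : t e * (r ^+ 2 * cos theta) + t (ordS e) * r ^+ 2 - r ^+ 2 * cos theta = t (ordS e) * hat_top.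
  by rewrite (_ : t e = 1 - t (ordS e)) /hat_top; [ring | rewrite -t2; ring].
have p1 : 0 <= t e * hat_top by rewrite mulr_ge0 // ltW.
have p2 : 0 <= t (ordS e) * hat_top by rewrite mulr_ge0 // ltW.
rewrite E1 E2 (max_idPr p1) (max_idPr p2).
by rewrite -mulrDl t2 mul1r.
Qed.

Lemma hat_lip j x y : `|hat j x - hat j y| <= r * euclidean_dist x y.
Proof.
have mx (a b : R) : `|Num.max 0 a - Num.max 0 b| <= `|a - b|.
  have h1 := ler_norm (a - b); have := ler_norm (b - a); rewrite distrC => h2.
  by rewrite ler_norml /Num.max; do 2 case: ltP => ?; lra.
apply: le_trans (mx _ _) _.
have -> : inner x j - r ^+ 2 * cos theta - (inner y j - r ^+ 2 * cos theta) =
  r * ((x.1 - y.1) * cos (2 * pi * j%:R / n%:R) + (x.2 - y.2) * sin (2 * pi * j%:R / n%:R)).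
  by rewrite /inner /vertex_point /=; ring.
rewrite normrM (gtr0_norm hr) ler_wpM2l ?(ltW hr) //.
rewrite -[leLHS]sqrtr_sqr; apply: ler_wsqrtr.
set c := cos _; set s := sin _; have cs : c ^+ 2 + s ^+ 2 = 1 by apply: cos2Dsin2.
set u := x.1 - y.1; set v := x.2 - y.2.
have -> : u ^+ 2 + v ^+ 2 = (u * c + v * s) ^+ 2 + (u * s - v * c) ^+ 2.
  by rewrite -[u ^+ 2]mulr1 -[v ^+ 2]mulr1 -cs; ring.
by rewrite lerDl sqr_ge0.
Qed.

End Hats.

Definition nat_min (P : nat -> Prop) : nat :=
  if pselect (exists k, `[<P k>]) is left h then ex_minn h else 0%N.

Lemma nat_minP (P : nat -> Prop) : (exists k, P k) ->
  P (nat_min P) /\ forall k, P k -> (nat_min P <= k)%N.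
Proof.
move=> [k hk]; rewrite /nat_min; case: pselect => [h|[]]; last by exists k; apply/asboolP.
by case: ex_minnP => m /asboolP hm H; split=> // j hj; apply: H; apply/asboolP.
Qed.

(** * Strings and the upper bound for distances in the universal cover *)

Section Cover.
Variables (R : realType) (n : nat) (r : R) (C : polygon_of_groups n).
Variables (G : groupType) (phi : cocone C G).
Hypotheses (n3 : (3 < n)%N) (hr : 0 < r).
Hypothesis gen_vertices : forall g, hull predT (vleg phi) g.
Implicit Types (i j : 'I_n) (s : face n) (g h : G) (k : nat).

Local Notation B := (universal_cover r phi).
Local Notation cp := (cover_point phi).
Local Notation str := (@string R n r C G phi).

Definition lstar : pred G := fun g => `[< exists j, img (phi (Vertex j)) g >].

Lemma lstar_symm : symm lstar.
Proof. by move=> g /asboolP[j /imgV h]; apply/asboolP; exists j. Qed.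

Lemma gen_lstar g : gen lstar g.
Proof.
apply: gen_sub (gen_vertices g) => s /asboolP[j _ h].
by apply: ball_gen (letter_ball _); apply/asboolP; exists j.
Qed.

Section Strings.
Implicit Types (b c d : B) (l : R).

Lemma cover_point_eq g s (x : cell r s) g' s' (x' : cell r s') :
  gluing phi (pre_point g x) (pre_point g' x') -> cp g x = cp g' x'.
Proof. by move=> h; apply/eqmodP/asboolP; apply: rst_step. Qed.

Lemma cover_pointP b : exists g s (x : cell r s), b = cp g x /\ (repr b).1 = g.
Proof.
exists (repr b).1, (tag (repr b).2), (tagged (repr b).2); split=> //.
rewrite /cover_point /pre_point -[LHS]reprK.
by case: (repr b) => g [s x].
Qed.

Lemma string_ge0 b c l : str b c l -> 0 <= l.
Proof. by elim=> // g s x y l' _ h; rewrite addr_ge0 // sqrtr_ge0. Qed.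

Lemma string_step g s (x y : cell r s) : str (cp g x) (cp g y) (euclidean_dist (val x) (val y)).
Proof. by rewrite -[euclidean_dist _ _]add0r; apply: StringRcons; apply: StringNil. Qed.

Lemma string_trans b c d l l' : str b c l -> str c d l' -> str b d (l + l').
Proof.
move=> h; elim=> [|g s x y l1 _ IH]; first by rewrite addr0.
by rewrite addrA; apply: StringRcons.
Qed.

Lemma euclidean_distC (x y : R * R) : euclidean_dist x y = euclidean_dist y x.
Proof. by rewrite /euclidean_dist; congr Num.sqrt; ring. Qed.

Lemma string_sym b c l : str b c l -> str c b l.
Proof.
elim=> [|g s x y l1 _ IH]; first exact: StringNil.
by rewrite addrC euclidean_distC; apply: string_trans (string_step g y x) IH.
Qed.

Lemma cell_convex s (x y : R * R) (t : R) : 0 <= t <= 1 -> cell r s x -> cell r s y ->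
  cell r s (x.1 + t * (y.1 - x.1), x.2 + t * (y.2 - x.2)).
Proof.
move=> /andP[t0 t1] [u [u0 us u1] ->] [v [v0 vs v1] ->].
exists (fun j => u j + t * (v j - u j)).
  split.
  - move=> j; have -> : u j + t * (v j - u j) = (1 - t) * u j + t * v j by ring.
    by rewrite addr_ge0 ?mulr_ge0 // subr_ge0.
  - by move=> j js; rewrite us // vs // subrr mulr0 addr0.
  - by rewrite big_split /= -mulr_sumr sumrB u1 v1 subrr mulr0 addr0.
by congr (_, _) => /=; rewrite -sumrB mulr_sumr -big_split; apply: eq_bigr => j _ /=; ring.
Qed.

(** Cells are convex, so a string can be cut at any length; this yields the walks of unit steps that
    serve as coarse geodesics. *)
Lemma string_split b c l t : str b c l -> 0 <= t <= l ->
  exists2 d, str b d t & str d c (l - t).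
Proof.
move=> h; elim: h t => [|g s x y l1 h1 IH] t.
  move=> /andP[t0 t1]; have -> : t = 0 by apply/eqP; rewrite eq_le t1 t0.
  by exists b; rewrite ?subr0; apply: StringNil.
set D := euclidean_dist _ _; have [h|h] := leP t l1.
  move=> /andP[t0 _]; have [|d hd1 hd2] := IH t; first by rewrite t0.
  by exists d => //; rewrite addrAC; apply: StringRcons.
move=> /andP[t0 t1]; have D0 : 0 < D by move: h t1; lra.
pose u := (t - l1) / D.
have u01 : 0 <= u <= 1.
  have tl : 0 <= t - l1 by move: h; lra.
  by rewrite /u divr_ge0 ?(ltW D0) //= ler_pdivrMr // mul1r; move: t1; lra.
have cx : cell r s (val x) by apply: set_mem; apply: valP.
have cy : cell r s (val y) by apply: set_mem; apply: valP.
pose z : cell r s := SigSub (mem_set (cell_convex u01 cx cy)).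
have uD : u * D = t - l1 by rewrite /u mulfVK // gt_eqF.
have e1 : euclidean_dist (val x) (val z) = t - l1.
  rewrite /euclidean_dist /= -uD /D /euclidean_dist.
  have u0 := (andP u01).1; rewrite -[X in _ = X * _](ger0_norm u0) -(sqrtr_sqr u) -sqrtrM ?sqr_ge0 //.
  by congr Num.sqrt => /=; ring.
have e2 : euclidean_dist (val z) (val y) = l1 + D - t.
  have -> : l1 + D - t = (1 - u) * D by rewrite mulrBl mul1r uD; ring.
  rewrite /euclidean_dist /= /D /euclidean_dist.
  have u1 := (andP u01).2; rewrite -[X in _ = X * _](ger0_norm (x := 1 - u)) ?subr_ge0 //.
  rewrite -(sqrtr_sqr (1 - u)) -sqrtrM ?sqr_ge0 //.
  by congr Num.sqrt => /=; ring.
exists (cp g z).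
  have -> : t = l1 + (t - l1) by ring.
  by rewrite -e1; apply: StringRcons.
by rewrite -e2; apply: string_step.
Qed.

Lemma cover_dist_le b c l : str b c l -> cover_dist r phi b c <= l.
Proof. by move=> h; apply: ge_inf => //; exists 0 => l' /string_ge0. Qed.

End Strings.

Section Distances.

Fact vertex_cell_subproof j : vertex_point r j \in cell r (Vertex j).
Proof. by apply: mem_set; apply: vertex_point_cell; rewrite /subface eqxx. Qed.

Definition vcell j : cell r (Vertex j) := SigSub (vertex_cell_subproof j).

Lemma cell_polygon s x : cell r s x -> cell r (@Polygon n) x.
Proof. exact: cell_sub. Qed.

Lemma cover_polygon g s (x : cell r s) :
  exists2 y : cell r Polygon, val y = val x & cp g x = cp g y.
Proof.
have hy : val x \in cell r (@Polygon n) by exact: mem_set (cell_polygon (set_mem (valP x))).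
case: s x hy => [|e|j] x hy; first by exists x.
  exists (SigSub hy) => //; symmetry; apply: cover_point_eq; exact: GlueFace.
exists (SigSub hy) => //; symmetry; apply: cover_point_eq; exact: GlueFace.
Qed.

Lemma cell_bound s x : cell r s x -> `|x.1| <= r /\ `|x.2| <= r.
Proof.
have H (f : 'I_n -> R) (t : 'I_n -> R) : (forall j, 0 <= t j) -> \sum_j t j = 1 ->
    (forall j, `|f j| <= 1) -> `|\sum_j t j * (r * f j)| <= r.
  move=> t0 t1 f1; apply: le_trans (ler_norm_sum _ _ _) _.
  rewrite -[leRHS]mul1r -t1 mulr_suml; apply: ler_sum => j _.
  by rewrite !normrM (ger0_norm (t0 j)) (gtr0_norm hr) ler_wpM2l // ler_piMr // ltW.
move=> [t [t0 _ t1] ->] /=; split; apply: H => // j; rewrite ler_norml.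
  by rewrite cos_geN1 cos_le1.
by rewrite sin_geN1 sin_le1.
Qed.

Lemma euclidean_dist_cell s s' x y : cell r s x -> cell r s' y -> euclidean_dist x y <= 4 * r.
Proof.
move=> /cell_bound[x1 x2] /cell_bound[y1 y2].
have r4 : 0 <= 4 * r by rewrite mulr_ge0 // ltW.
rewrite -[leRHS](ger0_norm r4) -sqrtr_sqr; apply: ler_wsqrtr.
have sq (a b : R) : `|a| <= r -> `|b| <= r -> (a - b) ^+ 2 <= 4 * r ^+ 2.
  move=> ha hb; have : `|a - b| <= 2 * r.
    by apply: le_trans (ler_normB _ _) _; move: ha hb; lra.
  move=> h; rewrite -real_normK ?num_real // (_ : 4 * r ^+ 2 = (2 * r) ^+ 2); last by ring.
  by rewrite lerXn2r // nnegrE ?normr_ge0 // mulr_ge0 // ltW.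
have := sq _ _ x1 y1; have := sq _ _ x2 y2; have := sqr_ge0 r; rewrite exprMn.
by move=> h1 h2 h3; lra.
Qed.

Lemma string_same g s (x : cell r s) s' (y : cell r s') :
  exists2 l, str (cp g x) (cp g y) l & l <= 4 * r.
Proof.
have [x' ex ->] := cover_polygon g x; have [y' ey ->] := cover_polygon g y.
eexists; first exact: string_step.
by apply: (@euclidean_dist_cell (@Polygon n) Polygon); apply: set_mem; apply: valP.
Qed.

Lemma cover_vertex g j v : img (phi (Vertex j)) v ->
  cp (g * v)%g (vcell j) = cp g (vcell j).
Proof. by move=> [x ->]; apply: cover_point_eq; apply: GlueGroup. Qed.

(** The copies of the polygon for [g] and [g * v] share the vertex whose group contains [v], so each
    letter costs at most one crossing of a polygon, whose diameter is at most [4 * r]. *)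
Lemma string_ball k g g' s (x : cell r s) s' (y : cell r s') : ball lstar k (g^-1 * g')%g ->
  exists2 l, str (cp g x) (cp g' y) l & l <= 4 * r * k.+1%:R.
Proof.
move=> [w [lw sw ew]].
have r4 : 0 <= 4 * r by rewrite mulr_ge0 // ltW.
suff [l h1 h2] : exists2 l, str (cp g x) (cp g' y) l & l <= 4 * r * (size w).+1%:R.
  by exists l => //; apply: le_trans h2 _; rewrite ler_wpM2l // ler_nat ltnS.
elim: w g s x lw ew {sw} => [|v w IH] g s x /=.
  move=> _; rewrite word_eval_nil => /esym e.
  have -> : g' = g by rewrite -(mulVKg g g') e mulg1.
  by rewrite mulr1; apply: string_same.
case/andP=> /asboolP[j hv] lw; rewrite word_eval_cons => e.
have [|l h1 h2] := IH (g * v)%g _ (vcell j) lw; first by rewrite invgM -mulgA -e mulKg.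
have [l' h3 h4] := string_same g x (vcell j).
exists (l' + l); first by apply: string_trans h3 _; rewrite -(cover_vertex g hv).
move: h2 h4; rewrite -[(size w).+2%:R]natr1; move: (_%:R : R) => q; lra.
Qed.

Lemma string_near b c (eps : R) : 0 < eps -> exists2 l, str b c l & l < cover_dist r phi b c + eps.
Proof.
move=> e0; have [g [s [x [-> _]]]] := cover_pointP b; have [g' [s' [x' [-> _]]]] := cover_pointP c.
have [k hk] := gen_ball (gen_lstar (g^-1 * g')%g).
have [l0 hl0 _] := string_ball x x' hk.
have [|l hl1 hl2] := @inf_adherent R [set l | str (cp g x) (cp g' x') l]%classic eps e0.
  by split; [exists l0 | exists 0 => l /string_ge0].
by exists l.
Qed.

Lemma cover_distC b c : cover_dist r phi b c = cover_dist r phi c b.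
Proof. by rewrite /cover_dist; congr inf; apply/seteqP; split=> l; apply: string_sym. Qed.

Lemma cover_distxx b : cover_dist r phi b b = 0.
Proof.
apply/eqP; rewrite eq_le; apply/andP; split; first exact: cover_dist_le (StringNil _).
by apply: lb_le_inf => [|l /string_ge0 //]; exists 0; apply: StringNil.
Qed.

Lemma cover_dist_tri b c d :
  cover_dist r phi b d <= cover_dist r phi b c + cover_dist r phi c d.
Proof.
apply/ler_addgt0Pr => eps e0.
have [|l1 h1 h1'] := @string_near b c (eps / 2); first by rewrite divr_gt0.
have [|l2 h2 h2'] := @string_near c d (eps / 2); first by rewrite divr_gt0.
by apply: le_trans (cover_dist_le (string_trans h1 h2)) _; move: h1' h2'; lra.
Qed.

Definition unit_step : rel B := fun b c => cover_dist r phi b c <= 1.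

Lemma unit_steps k b c l : str b c l -> l <= k.+1%:R ->
  exists p, [/\ path unit_step b p, last b p = c & size p = k.+1].
Proof.
elim: k b l => [|k IH] b l h lk.
  by exists [:: c]; rewrite /= /unit_step (le_trans (cover_dist_le h)).
pose t := Num.min 1 l; have l0 := string_ge0 h.
have [|d h1 h2] := @string_split b c l t h; first by rewrite /t /Num.min; case: ltP => ?; lra.
have [|p [p1 p2 p3]] := IH d _ h2.
  by move: lk; rewrite -natr1 /t /Num.min; case: ltP => ?; move: (ler0n R k.+1); lra.
exists (d :: p); split=> //=; last by rewrite p3.
rewrite p1 andbT /unit_step (le_trans (cover_dist_le h1)) //.
by rewrite /t ge_min lexx.
Qed.

Lemma unit_step_symm : symmetric unit_step.
Proof. by move=> b c; rewrite /unit_step cover_distC. Qed.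

Lemma cover_coarse_geodesic b c :
  exists2 p, coarse_geodesic unit_step (cover_dist r phi) 2 b p & last b p = c.
Proof.
have [l h hl] := @string_near b c 1 ltr01.
have /truncn_itv/andP[t1 t2] := string_ge0 h.
have [p [p1 p2 p3]] := unit_steps h (ltW t2).
(* A string shorter than the distance plus 1 is cut into one step more than its integer part, whence
   the defect 2. *)
exists p => //; split=> //; rewrite p2 p3 -natr1; lra.
Qed.

End Distances.
End Cover.

(** * The lower bound for distances in the universal cover *)

Section CoverLowerBound.
Variables (R : realType) (n : nat) (r : R) (C : polygon_of_groups n).
Variables (G : groupType) (phi : cocone C G).
Hypotheses (n3 : (3 < n)%N) (hr : 0 < r).
Hypothesis gen_vertices : forall g, hull predT (vleg phi) g.
Implicit Types (i j : 'I_n) (s : face n) (g h : G) (k : nat).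

Local Notation B := (universal_cover r phi).
Local Notation cp := (cover_point phi).
Local Notation str := (@string R n r C G phi).
Local Notation star := (lstar phi).

(** Vertices of the universal cover are cosets of vertex groups; this measures how far the coset of
    [g] is from 1 in the length given by all vertex groups. *)
Definition coset_ball g j k : Prop :=
  exists2 v, img (phi (Vertex j)) v & ball star k (g * v)%g.

Definition coset_dist g j : nat := nat_min (coset_ball g j).

Lemma coset_distP g j : coset_ball g j (coset_dist g j) /\
  forall k, coset_ball g j k -> (coset_dist g j <= k)%N.
Proof.
apply: nat_minP; have [k hk] := gen_ball (gen_lstar gen_vertices g).
by exists k, 1%g; rewrite ?mulg1 //; apply: img1.
Qed.

Lemma coset_dist_mul g j v : img (phi (Vertex j)) v -> coset_dist (g * v)%g j = coset_dist g j.
Proof.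
move=> hv; congr nat_min; apply/funext => k; apply/propext; split=> -[w hw].
  by rewrite -mulgA; exists (v * w)%g => //; apply: imgM.
by move=> hb; exists (v^-1 * w)%g; rewrite ?mulgA ?mulgK //; apply: imgM => //; apply: imgV.
Qed.

Lemma coset_dist_ball g j : ball star (coset_dist g j).+1 g.
Proof.
have [[v hv hb] _] := coset_distP g j.
have hs : star v^-1%g by apply: lstar_symm; apply/asboolP; exists j.
by have := ballM hb (letter_ball hs); rewrite mulgK addn1.
Qed.

Lemma coset_dist_le g i j : (coset_dist g i <= (coset_dist g j).+1)%N.
Proof.
apply: (proj2 (coset_distP g i)); exists 1%g; first exact: img1.
by rewrite mulg1; apply: coset_dist_ball.
Qed.

Let a0 : 'I_n := Ordinal (leq_trans (isT : 0 < 4)%N n3).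

(* The hats add up to [hat_top] on the edges, so there the term in a0 cancels and only the
   cosets of the vertices of the carrier of a point contribute: the potential is invariant
   under the gluing. *)
Definition potential g0 (p : precover n r G) : R :=
  \sum_j hat r j (val (tagged p.2)) *
    ((coset_dist (g0^-1 * p.1)%g j)%:R - (coset_dist (g0^-1 * p.1)%g a0)%:R) +
  hat_top n r * (coset_dist (g0^-1 * p.1)%g a0)%:R.

Lemma val_cell s (x : cell r s) : cell r s (val x). Proof. exact: set_mem (valP x). Qed.

Lemma face_in_vertex j s x : subface (Vertex j) s -> img (phi (Vertex j)) (phi s x).
Proof.
move=> /orP[/eqP e|h]; first by subst s; exists x.
by exists (local_map C h x); rewrite legE.
Qed.

Lemma potential_glue g0 p q : gluing phi p q -> potential g0 p = potential g0 q.
Proof.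
case=> [g s v x|g s s' x x' _ /= e]; last by rewrite /potential /= e.
rewrite /potential /= mulgA; set g1 := (g0^-1 * g)%g.
have cx := val_cell x.
have E j : hat r j (val x) * (coset_dist (g1 * phi s v)%g j)%:R = hat r j (val x) * (coset_dist g1 j)%:R.
  have [h|h] := boolP (subface (Vertex j) s); last by rewrite (hat_far n3 hr cx h) !mul0r.
  by rewrite coset_dist_mul //; apply: face_in_vertex.
have [es|es] := eqVneq s Polygon.
  subst s; have D j : coset_dist (g1 * phi Polygon v)%g j = coset_dist g1 j.
    by rewrite coset_dist_mul //; apply: face_in_vertex.
  by rewrite D; congr (_ + _); apply: eq_bigr => j _; rewrite D.
have [e ce] : exists e : 'I_n, cell r (Edge e) (val x).
  case: s x cx es {E v} => [|e|j] x cx es //; first by exists e.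
  exists j; apply: cell_sub cx => i; rewrite /subface /= orbF => /eqP[->].
  by rewrite eqxx.
have H (f : 'I_n -> R) : \sum_j hat r j (val x) * (f j - f a0) + hat_top n r * f a0 =
    \sum_j hat r j (val x) * f j.
  under eq_bigr do rewrite mulrBr.
  by rewrite sumrB -mulr_suml (hat_sum n3 hr ce) subrK.
rewrite (H (fun j => (coset_dist (g1 * phi s v)%g j)%:R)) (H (fun j => (coset_dist g1 j)%:R)).
by apply: eq_bigr => j _; apply: E.
Qed.

Lemma coset_dist_diff g i j : `|(coset_dist g i)%:R - (coset_dist g j)%:R| <= 1 :> R.
Proof.
have h1 : ((coset_dist g i)%:R : R) <= (coset_dist g j)%:R + 1 by rewrite natr1 ler_nat coset_dist_le.
have h2 : ((coset_dist g j)%:R : R) <= (coset_dist g i)%:R + 1 by rewrite natr1 ler_nat coset_dist_le.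
by rewrite ler_norml; apply/andP; split; lra.
Qed.

Lemma potential_near g0 p :
  `|potential g0 p - hat_top n r * (coset_dist (g0^-1 * p.1)%g a0)%:R| <= n%:R * hat_top n r.
Proof.
rewrite /potential addrK; apply: le_trans (ler_norm_sum _ _ _) _.
have -> : n%:R * hat_top n r = \sum_(j < n) hat_top n r by rewrite sumr_const card_ord mulr_natl.
apply: ler_sum => j _; have cx := val_cell (tagged p.2).
rewrite normrM (ger0_norm (hat_ge0 _ _ _)) -[leRHS]mulr1; apply: ler_pM.
- exact: hat_ge0.
- exact: normr_ge0.
- exact: (hat_le n3 hr _ cx).
- exact: coset_dist_diff.
Qed.

Lemma potential_step g0 g s (x y : cell r s) :
  `|potential g0 (pre_point g x) - potential g0 (pre_point g y)| <=
  n%:R * r * euclidean_dist (val x) (val y).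
Proof.
rewrite /potential /= opprD addrACA subrr addr0 -sumrB.
apply: le_trans (ler_norm_sum _ _ _) _.
have -> : n%:R * r * euclidean_dist (val x) (val y) =
    \sum_(j < n) r * euclidean_dist (val x) (val y) by rewrite sumr_const card_ord -mulrA mulr_natl.
apply: ler_sum => j _; rewrite -mulrBl normrM -[leRHS]mulr1; apply: ler_pM.
- exact: normr_ge0.
- exact: normr_ge0.
- exact: (hat_lip hr).
- exact: coset_dist_diff.
Qed.

Lemma potential_repr g0 g s (x : cell r s) :
  potential g0 (repr (cp g x)) = potential g0 (pre_point g x).
Proof.
have : glued phi (repr (cp g x)) (pre_point g x).
  by have /eqmodP : \pi_({eq_quot glued_equiv_rel r phi})%qT (repr (cp g x)) = cp g x by apply: reprK.
move/asboolP; elim=> [p q|p|p q _ ->|p q t _ -> _ ->] //; exact: potential_glue.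
Qed.

Lemma potential_string g0 b c l : str b c l ->
  `|potential g0 (repr c) - potential g0 (repr b)| <= n%:R * r * l.
Proof.
elim=> [|g s x y l1 _ IH]; first by rewrite subrr normr0 mulr0.
move: IH; rewrite !potential_repr => IH.
apply: le_trans (ler_distD (potential g0 (pre_point g x)) _ _) _.
by rewrite mulrDr addrC lerD // distrC; apply: potential_step.
Qed.

(** The potential varies by at most [n * r] times the length of a string, and it equals [hat_top]
    times the coset distance up to a bounded error. The summand 1 of the first constant leads from
    the coset distance back to the element. *)
Lemma string_lower : exists c1 c2 : R, [/\ 0 <= c1, 0 <= c2 &
  forall g g' s (x : cell r s) s' (x' : cell r s') l, str (cp g x) (cp g' x') l ->
  exists2 k, ball star k (g^-1 * g')%g & k%:R <= c1 + c2 * l].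
Proof.
have m0 := hat_top_gt0 n3 hr; set m := hat_top n r in m0.
exists (n%:R * 2 + 1), (n%:R * r / m); split.
- by rewrite addr_ge0 // mulr_ge0 // ler0n.
- by apply: divr_ge0; [apply: mulr_ge0; [exact: ler0n | exact: ltW] | exact: ltW].
move=> g g' s x s' x' l h; exists (coset_dist (g^-1 * g')%g a0).+1; first exact: coset_dist_ball.
have := potential_string g h; rewrite !potential_repr.
have := potential_near g (pre_point g x); have := potential_near g (pre_point g' x').
rewrite /= -/m mulVg.
have -> : coset_dist 1%g a0 = 0%N.
  by apply/eqP; rewrite -leqn0; apply: (proj2 (coset_distP _ _)); exists 1%g; [apply: img1 | rewrite mulg1; apply: ball1].
set P := potential _ _; set Q := potential _ _; set D := coset_dist _ _.
rewrite mulr0 subr0 !ler_norml => /andP[h1 _] /andP[h2 h3] /andP[h4 h5].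
have : m * D%:R <= m * (n%:R * 2 + n%:R * r / m * l).
  have -> : m * (n%:R * 2 + n%:R * r / m * l) = n%:R * m * 2 + n%:R * r * l.
    by field; rewrite gt_eqF.
  lra.
rewrite ler_pM2l // -natr1; lra.
Qed.

Lemma cover_act_point h g s (x : cell r s) :
  cover_act h (cp g x : B) = cp (h * g)%g x.
Proof.
apply/eqmodP/asboolP.
have : glued phi (repr (cp g x)) (pre_point g x).
  by have /eqmodP : \pi_({eq_quot glued_equiv_rel r phi})%qT (repr (cp g x)) = cp g x by apply: reprK.
move/asboolP; pose tr (p : precover n r G) : precover n r G := ((h * p.1)%g, p.2).
rewrite -/(tr (repr (cp g x))) -[pre_point (h * g)%g x]/(tr (pre_point g x)).
elim=> [p q pq|p|p q _ IH|p q t _ h1 _ h2].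
- apply: rst_step; case: pq => [g1 s1 v y|g1 s1 s2 y y' hs e].
    by rewrite /tr /= mulgA; apply: GlueGroup.
  exact: GlueFace.
- exact: rst_refl.
- exact: rst_sym.
- exact: rst_trans h1 h2.
Qed.

Lemma nat_above (x : R) : exists k : nat, x <= k%:R.
Proof.
have [h|h] := leP 0 x; last by exists 0%N; apply: ltW.
by have /truncn_itv/andP[_ h2] := h; exists (Num.truncn x).+1; apply: ltW.
Qed.

(** An element goes to its copy of the vertex [a0], a point to the group component of its chosen
    representative. Both maps are coarsely Lipschitz by [string_ball] and [string_lower], and their
    composite on [G] moves elements by a bounded amount. *)
Lemma cover_sq : hyperbolic_space (cover_dist r phi) -> sq_hyperbolic (cay star).
Proof.
move=> hyp; have geo := cover_coarse_geodesic hr gen_vertices (r := r).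
have sq : sq_hyperbolic (@unit_step R n r C G phi).
  apply: (four_point_sq_hyperbolic _ _ _ _ _ geo hyp).
  - exact: unit_step_symm.
  - exact: cover_distC.
  - exact: cover_distxx.
  - exact: (cover_dist_tri hr gen_vertices).
  - by [].
have [c1 [c2 [hc1 hc2 lower]]] := string_lower.
have [A hA] := nat_above (4 * r * 2 + 2).
have [K hK] := nat_above (c1 + c2 * 2).
apply: (@sq_hyperbolic_transfer _ _ _ _ (fun g => cp g (vcell r a0)) (fun b => (repr b).1) A K K) sq.
- move=> g g' gg'; have hb : ball star 1 (g^-1 * g')%g.
    by apply/near_cay; exists [:: g'] => /=; rewrite gg'.
  have [l h1 h2] := string_ball hr (vcell r a0) (vcell r a0) hb.
  have [p [p1 p2] p3] := geo (cp g (vcell r a0)) (cp g' (vcell r a0)).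
  exists p; split=> //; rewrite -(ler_nat R); apply: le_trans p2 _.
  rewrite p3; have := cover_dist_le h1; move: h2 hA; lra.
- move=> b b' hb; have [l h1 h2] := string_near hr gen_vertices b b' ltr01.
  have [g [s [x [eb eg]]]] := cover_pointP b; have [g' [s' [x' [eb' eg']]]] := cover_pointP b'.
  rewrite eg eg'; apply/near_cay; rewrite eb eb' in h1.
  have [k hk1 hk2] := lower _ _ _ _ _ _ _ h1; apply: ball_le hk1.
  rewrite -(ler_nat R); apply: le_trans hk2 _; apply: le_trans hK.
  rewrite lerD2l ler_wpM2l //; apply: ltW; apply: lt_le_trans h2 _.
  by move: hb; rewrite /unit_step; lra.
- move=> g; have [g' [s' [x' [eb eg]]]] := cover_pointP (cp g (vcell r a0)).
  rewrite eg; apply/near_cay.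
  have h1 : str (cp g' x') (cp g (vcell r a0)) 0 by rewrite -eb; apply: StringNil.
  have [k hk1 hk2] := lower _ _ _ _ _ _ _ h1; apply: ball_le hk1.
  rewrite -(ler_nat R); apply: le_trans hk2 _; apply: le_trans hK.
  by rewrite lerD2l ler_wpM2l.
Qed.

(** Such an [h] fixes the vertex [i] of the copy of 1 and the vertex [j] of the copy of [g]. For
    long [g] these two points are at distance at least [A] by [string_lower], and acylindricity
    applies to the pair. *)
Lemma cover_acyl : acylindrical_action r phi -> exists N, forall i j g, ~ ball star N g ->
  exists s : seq G, forall h, img (phi (Vertex i)) h ->
    img (phi (Vertex j)) (g^-1 * h * g)%g -> h \in s.
Proof.
move=> [A A0 hA]; have [c1 [c2 [hc1 hc2 lower]]] := string_lower.
have [N hN] := nat_above (c1 + c2 * (A + 1)).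
exists N => i j g ng; pose D : set B := [set cp 1%g (vcell r i); cp g (vcell r j)]%classic.
have dD : (A%:E <= diameter (cover_dist r phi) D)%E.
  apply: (@le_trans _ _ (cover_dist r phi (cp 1%g (vcell r i)) (cp g (vcell r j)))%:E).
    rewrite lee_fin leNgt; apply/negP => hlt; apply: ng.
    have [l h1 h2] := string_near hr gen_vertices (cp 1%g (vcell r i)) (cp g (vcell r j)) ltr01.
    have [k hk1 hk2] := lower _ _ _ _ _ _ _ h1.
    move: hk1; rewrite invg1 mul1g; apply: ball_le.
    rewrite -(ler_nat R); apply: le_trans hk2 _; apply: le_trans hN.
    by rewrite lerD2l ler_wpM2l //; move: h2 hlt; lra.
  apply: ereal_sup_ubound; exists (cp 1%g (vcell r i), cp g (vcell r j)) => //=.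
  by split=> /=; [left | right].
have [s hs] := (finite_seqP _).1 (hA D dD).
exists s => h hi hj.
have : pointwise_stabilizer D h.
  move=> _ [->|->]; rewrite cover_act_point.
    by rewrite mulg1 -{1}[h]mul1g cover_vertex.
  have -> : (h * g = g * (g^-1 * h * g))%g by rewrite !mulgA mulgV mul1g.
  exact: cover_vertex.
by rewrite hs.
Qed.

End CoverLowerBound.

(** * Word metrics *)

Section WordMetrics.
Variables (K : groupType).
Local Open Scope group_scope.
Implicit Types (S T : seq K) (g h x y : K).

Lemma generates_gen S : generates S -> forall g, gen (sgen S) g.
Proof. by move=> h g; have [w ? ?] := h g; exists w. Qed.

Lemma cay_conn (l : pred K) : (forall g, gen l g) -> forall x y, exists k, near (cay l) k x y.
Proof. by move=> gl x y; have [k hk] := gen_ball (gl (x^-1 * y)); exists k; apply/near_cay. Qed.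

Lemma gdist_cay (l : pred K) x y : (forall g, gen l g) ->
  gdist (cay l) x y = len l (x^-1 * y).
Proof.
move=> gl; apply/eqP; rewrite eqn_leq; apply/andP; split.
  by apply: gdist_le; apply/near_cay; apply: len_ball.
by apply: len_le; apply/near_cay; apply: gdist_near; apply: cay_conn.
Qed.

Lemma word_distE (R : realType) S g h : generates S ->
  word_dist R S g h = (len (sgen S) (g^-1 * h))%:R.
Proof.
move=> /generates_gen gS; rewrite /word_dist; set A := (X in inf X).
have [w [lw sw ew]] := len_ball (gS (g^-1 * h)).
have lb : lbound A ((len (sgen S) (g^-1 * h))%:R : R).
  move=> _ [v [lv ev] <-]; rewrite ler_nat; apply: len_le; exists v; split=> //.
  by rewrite -ev mulKg.
have Aw : A (size w)%:R by exists w => //; split=> //; rewrite ew mulVKg.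
apply/eqP; rewrite eq_le; apply/andP; split; last first.
  by apply: lb_le_inf => //; exists (size w)%:R.
apply: le_trans (_ : (size w)%:R <= _); last by rewrite ler_nat.
by apply: ge_inf => //; exists (len (sgen S) (g^-1 * h))%:R.
Qed.

Lemma hyperbolic_group_sq (R : realType) : hyperbolic_group R K ->
  exists2 S : seq K, generates S & sq_hyperbolic (cay (sgen S)).
Proof.
move=> [S gS hyp]; exists S => //; have gl := generates_gen gS.
have conn := cay_conn gl; have rS := cay_symm (sgen_symm (S := S)).
have dE x y : word_dist R S x y = (gdist (cay (sgen S)) x y)%:R.
  by rewrite gdist_cay // word_distE.
apply: (@four_point_sq_hyperbolic R _ _ (word_dist R S) 0 rS _ _ _ _ _ hyp).
- by move=> x y; rewrite !dE gdistC.
- by move=> x; rewrite dE gdistxx.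
- by move=> x y z; rewrite !dE -natrD ler_nat gdist_tri.
- move=> x y xy; rewrite dE (ler_nat _ _ 1); apply: gdist_le.
  by exists [:: y]; rewrite /= xy.
- move=> x y; have [p [p1 p2 p3]] := gdist_near conn x y; exists p => //; split=> //.
  by rewrite addr0 dE ler_nat p2.
Qed.

Lemma sq_hyperbolic_group (R : realType) S : generates S ->
  sq_hyperbolic (cay (sgen S)) -> hyperbolic_group R K.
Proof.
move=> gS sq; exists S => //; have gl := generates_gen gS.
have conn := cay_conn gl; have rS := cay_symm (sgen_symm (S := S)).
have [D hD] := four_point_nat rS conn sq.
exists D%:R => // w x y z; have := hD w x y z.
have dE u v : word_dist R S u v = (gdist (cay (sgen S)) u v)%:R.
  by rewrite gdist_cay // word_distE.
rewrite /gromov_product !dE addn_maxl leq_max -!(ler_nat R) !natrD.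
set a := (gdist _ x w)%:R; set b := (gdist _ y w)%:R; set c := (gdist _ z w)%:R.
set p := (gdist _ x y)%:R; set q := (gdist _ y z)%:R; set s := (gdist _ x z)%:R.
have D0 : 0 <= D%:R :> R by [].
by case/orP => ?; rewrite /Num.min; case: ltP => ?; lra.
Qed.

Lemma undistorted_change (l l1 l' l1' : pred K) a b :
  (forall s, l s -> ball l1 a s) -> (forall s, l1 s -> gen l s) -> (forall s, l1' s -> ball l' b s) ->
  undistorted l l' -> undistorted l1 l1'.
Proof.
move=> h1 h2 h3 [k hk]; exists (a * (k * b))%N => n g gg hg.
rewrite -!mulnA; apply: (ball_mul h1); apply: hk; first exact: gen_sub gg.
exact: ball_mul hg.
Qed.

End WordMetrics.

(** * Transport along injective homomorphisms *)

Section Push.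
Variables (K G : groupType) (f : {multiplicative K -> G}).
Hypothesis fI : injective f.
Local Open Scope group_scope.
Implicit Types (S T : seq K).

Lemma sgen_map S g : sgen (map f S) g <-> exists2 s, sgen S s & g = f s.
Proof.
split.
  rewrite /sgen => /orP[/mapP[s hs ->]|/mapP[s hs e]]; first by exists s; rewrite ?hs.
  exists s^-1; first by rewrite /= invgK hs orbT.
  by rewrite morV -e invgK.
move=> [s /orP[h|h] ->]; rewrite /sgen; first by rewrite map_f.
by rewrite -morV (map_f f h) orbT.
Qed.

Lemma ball_map S n g : ball (sgen (map f S)) n g <-> exists2 x, ball (sgen S) n x & g = f x.
Proof.
split; last first.
  move=> [x [w [lw sw <-]] ->]; exists (map f w); rewrite size_map mor_eval; split=> //.
  by rewrite all_map; apply: sub_all lw => s hs /=; apply/sgen_map; exists s.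
move=> [w [lw sw <-]].
suff [v lv ev] : exists2 v, all (sgen S) v & w = map f v.
  exists (word_eval v); last by rewrite mor_eval ev.
  by exists v; split=> //; rewrite -(size_map f) -ev.
elim: w lw {sw} => [|g' w IH] /=; first by exists [::].
case/andP=> /sgen_map[s hs ->] /IH[v lv ->].
by exists (s :: v) => //=; rewrite hs.
Qed.

Lemma gen_map S g : gen (sgen (map f S)) g <-> exists2 x, gen (sgen S) x & g = f x.
Proof.
split; first by move=> /gen_ball[n /ball_map[x /ball_gen h ->]]; exists x.
by move=> [x /gen_ball[n h] ->]; apply: ball_gen (n) _ _; apply/ball_map; exists x.
Qed.

Lemma sq_hyperbolic_push S : sq_hyperbolic (cay (sgen S)) -> sq_hyperbolic (cay (sgen (map f S))).
Proof.
move=> sq e c; have [L hL] := sq e c; exists L => u v lu lv x p pp lp.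
have [w lw pw] := walk_ex pp.
have [w' lw' ew] : exists2 w', all (sgen S) w' & w = map f w'.
  elim: w lw {pp lp pw} => [|g' w IH] /=; first by exists [::].
  case/andP=> /sgen_map[s hs ->] /IH[v' lv' ->].
  by exists (s :: v') => //=; rewrite hs.
pose psi y := x * f y.
have wE : forall y, walk (psi y) (map f w') = map psi (walk y w').
  rewrite /walk => y; elim: w' y {ew lw'} => //= s w' IH y.
  by rewrite -IH /psi gmulfM mulgA.
have psi1 : psi 1 = x by rewrite /psi mor1 mulg1.
have pE : p = map psi (walk 1 w') by rewrite -wE psi1 -ew.
have lpsi h : lip (cay (sgen (map f S))) c h -> lip (cay (sgen S)) c (h \o psi).
  move=> hh y z yz; apply: hh; rewrite /cay /psi; apply/sgen_map; exists (y^-1 * z) => //.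
  by rewrite invgM gmulfM morV -mulgA mulKg.
have := hL _ _ (lpsi _ lu) (lpsi _ lv) 1 (walk 1 w').
rewrite path_walk lw' circ_map psi1 -pE pE size_map => /(_ isT); apply.
rewrite last_walk mul1g; apply: fI; apply: (@mulgI _ x); rewrite mor1 mulg1 -[RHS]lp.
by rewrite pE -{2}psi1 last_map last_walk mul1g.
Qed.

Lemma undistorted_push S T : undistorted (sgen S) (sgen T) ->
  undistorted (sgen (map f S)) (sgen (map f T)).
Proof.
move=> [k hk]; exists k => n g /gen_map[x gx ->] /ball_map[y hy /fI e].
by apply/ball_map; exists x => //; apply: hk => //; rewrite e.
Qed.

End Push.

Lemma qi_undistorted (K G : groupType) (f : {multiplicative K -> G}) (R : realType)
    (S : seq K) (T : seq G) : injective f -> group_qi_embedding R f -> generates S -> generates T ->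
  undistorted (sgen (map f S)) (sgen T).
Proof.
move=> fI [S0 [T0 [gS0 gT0 [L [eps [L1 eps0 hqi]]]]]] gS gT.
have [a ha] := gen_seq_ball (sgen_symm (S := S)) (fun s _ => generates_gen gS s) (S := S0).
have [b hb] := gen_seq_ball (sgen_symm (S := T0)) (fun s _ => generates_gen gT0 s) (S := T).
have [A hA] : exists A : nat, L * (b%:R + eps) <= A%:R :> R.
  have h0 : 0 <= L * (b%:R + eps) by rewrite mulr_ge0 ?addr_ge0 // (le_trans ler01).
  by have /truncn_itv/andP[_ /ltW ?] := h0; eexists; eassumption.
exists (a * A)%N => n g /gen_map[x _ ->] hg.
(* For positive [n] the additive constant [eps] is absorbed into a multiple of [n]; for [n = 0] the
   element is trivial. *)
have [n0|n0] := posnP n.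
  case: hg => w [_]; rewrite n0 leqn0 muln0 => /nilP->; rewrite word_eval_nil => <-.
  exact: ball1.
apply/ball_map; exists x => //; rewrite -mulnA; apply: (ball_mul ha).
apply/(lenP _ (generates_gen gS0 x)); rewrite -(ler_nat R).
have := hqi 1%g x; rewrite !word_distE // mor1 !invg1 !mul1g => /andP[h1 _].
have h2 : (len (sgen T0) (f x) <= b * n)%N by apply: len_le; apply: ball_mul hb hg.
have h3 : ((len (sgen T0) (f x))%:R : R) <= b%:R * n%:R by rewrite -natrM ler_nat.
have L0 : 0 < L by apply: lt_le_trans L1.
have n1 : (1 : R) <= n%:R by rewrite ler1n.
have h4 : L^-1 * (len (sgen S0) x)%:R <= (b%:R + eps) * n%:R.
  apply: (@le_trans _ _ (b%:R * n%:R + eps)); first by move: h1 h3; lra.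
  by rewrite mulrDl lerD2l ler_peMr.
rewrite natrM; apply: (@le_trans _ _ (L * ((b%:R + eps) * n%:R))).
  by rewrite -ler_pdivrMl.
by rewrite mulrA ler_wpM2r.
Qed.

(** * Intersections of conjugates *)

Section BoundedSubgroups.
Variables (G : groupType) (X : bool -> G -> Prop).
Local Open Scope group_scope.
Hypothesis X1 : forall b, X b 1.
Hypothesis XM : forall b x y, X b x -> X b y -> X b (x * y).
Hypothesis XV : forall b x, X b x -> X b x^-1.
Hypothesis red : reduced_nontrivial X.
Implicit Types (b : bool) (c g s x y : G) (u v w : seq G) (P : G -> Prop).

Definition short T g := core X g \/ exists b w, [/\ alt X b w, (size w <= T)%N & word_eval w = g].

Lemma short_side T b g : X b g -> short T.+1 g.
Proof.
move=> h; case: (pselect (X (~~ b) g)) => h'; first by left; apply/(coreP _ b).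
by right; exists b, [:: g]; rewrite word_eval1.
Qed.

Lemma short_size T b w : w <> [::] -> alt X b w -> short T (word_eval w) -> (size w <= T)%N.
Proof.
move=> w0 aw [hc|[b' [w' [aw' sw' ew]]]]; first by case: (alt_not_core XM XV red w0 aw).
by have [<- _] := alt_uniq XM XV red aw' aw ew.
Qed.

Definition subgroup P := [/\ P 1, forall x y, P x -> P y -> P (x * y) & forall x, P x -> P x^-1].

(** A group is not the union of two proper subgroups: the product of an element outside one side and
    an element outside the other is alternating of length 2. *)
Lemma bounded_conj1 P : subgroup P -> (forall s, P s -> short 1 s) ->
  exists b, forall s, P s -> X b s.
Proof.
move=> [P1 PM PV] sh.
have side s : P s -> exists b, X b s.
  move=> /sh[[h _]|[b [[|x [|y w]] [aw sw <-]]]] //; first by exists true.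
    by exists true; rewrite word_eval_nil.
  by exists b; rewrite word_eval1; case: aw.
case: (pselect (forall s, P s -> X true s)) => h; first by exists true.
exists false => s Ps; apply: contrapT => ns.
have [s0 /not_implyP[Ps0 n0]] := (existsNP _).2 h.
have h0 : X false s0 by have [[]] := side _ Ps0.
have h1 : X true s by have [[]] := side _ Ps.
have : (size [:: s; s0] <= 1)%N; last by [].
apply: (@short_size _ true) => //; rewrite word_eval_cons word_eval1.
exact: sh (PM _ _ _ _).
Qed.

(* A longest element of the subgroup and any other element must start with the same
   letter up to the core, since their quotient is not longer; conjugating by that letter
   shortens every element. *)
Lemma bounded_conj T P : subgroup P -> (forall s, P s -> short T.+1 s) ->
  exists m b, span (fun g => exists b, X b g) m /\ forall s, P s -> X b (m^-1 * s * m).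
Proof.
elim: T P => [|T IH] P sP sh.
  have [b hb] := bounded_conj1 sP sh; exists 1, b; split; first exact: span1.
  by move=> s /hb; rewrite invg1 mul1g mulg1.
case: (pselect (forall s, P s -> short T.+1 s)) => h; first exact: IH h.
have [s0 /not_implyP[Ps0 n0]] := (existsNP _).2 h.
have [P1 PM PV] := sP.
case: (sh _ Ps0) => [hc|[b [[|x1 w1] [aw sw ew]]]]; first by case: n0; left.
  by case: n0; left; rewrite -ew word_eval_nil; apply: (core1 X1).
have sw1 : size w1 = T.+1.
  apply/eqP; rewrite eqn_leq -ltnS sw /= ltnNge; apply/negP => sle.
  by apply: n0; right; exists b, (x1 :: w1).
have [X1b X1n aw1] := aw.
(* If the first letters of [s0] and [s] did not match, [s0^-1 * s] would be reduced and longer than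
   the bound [T.+2], unless [s] is a single letter of the same side. *)
have key s b' y1 (y' : seq G) : P s -> alt X b' (y1 :: y') -> word_eval (y1 :: y') = s ->
    b' = b /\ (y' = [::] \/ core X (x1^-1 * y1)).
  move=> Ps ay ey; have Pq : short T.+2 (s0^-1 * s) by apply/sh/PM => //; apply: PV.
  have bb : b' = b.
    apply: contrapT => /eqP nb; have eb : b' = ~~ b by move: nb; case: (b) (b') => -[].
    have : alt X (~~ (b (+) odd (size (x1 :: w1)))) (inv_word (x1 :: w1) ++ y1 :: y').
      apply/alt_cat; split; first exact: (alt_inv XV aw).
      rewrite size_rev size_map -addNb -addbA addbb addbF -eb; exact: ay.
    move/short_size => /(_ T.+2); rewrite word_eval_cat word_eval_inv ew ey size_cat size_rev size_map /=.
    rewrite sw1 => H; suff: (T.+2 + (size y').+1 <= T.+2)%N by lia.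
    apply: H => //; by move/(congr1 size); rewrite size_cat size_rev /=; lia.
  split=> //; subst b'; case: (pselect (core X (x1^-1 * y1))) => hc; first by right.
  left; have [Y1 Y2 ay'] := ay.
  have : alt X (~~ (~~ b (+) odd (size w1))) (inv_word w1 ++ x1^-1 * y1 :: y').
    apply/alt_cat; split; first exact: (alt_inv XV aw1).
    rewrite size_rev size_map -addNb negbK -addbA addbb addbF; split=> //.
      by apply: XM => //; apply: XV.
    by move=> h'; apply: hc; apply/(coreP _ b); split=> //; apply: XM => //; apply: XV.
  move/short_size => /(_ T.+2); rewrite word_eval_cat word_eval_inv word_eval_cons.
  rewrite size_cat size_rev size_map /= sw1 => H.
  have {H} : (T.+1 + (size y').+1 <= T.+2)%N.
    apply: H; first by move/(congr1 size); rewrite size_cat size_rev /=; lia.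
    move: Pq; rewrite -ew -ey !word_eval_cons invgM.
    by rewrite !mulgA.
  by case: y' {ay ey ay'} => //= z y'; lia.
have [||m [b' [hm hb']]] := IH (fun s => P (x1 * s * x1^-1)).
- split=> [|x y px py|x px].
  + by rewrite mulg1 mulgV.
  + have -> : x1 * (x * y) * x1^-1 = (x1 * x * x1^-1) * (x1 * y * x1^-1) by rewrite !mulgA mulgVK.
    exact: PM.
  + have -> : x1 * x^-1 * x1^-1 = (x1 * x * x1^-1)^-1 by rewrite !invgM invgK mulgA.
    exact: PV.
- move=> t; set s := x1 * t * x1^-1 => Ps.
  have -> : t = x1^-1 * s * x1 by rewrite /s !mulgA mulVg mul1g mulgVK.
  have in_side : X b s -> short T.+1 (x1^-1 * s * x1).
    by move=> hs; apply: (@short_side _ b); apply: XM => //; apply: XM => //; apply: XV.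
  case: (sh _ Ps) => [hc|[b' [[|y1 y] [ay sy ey]]]].
  + exact/in_side/(core_side _ hc).
  + by apply: in_side; rewrite -ey word_eval_nil.
  + have [bb hy] := key _ _ _ _ Ps ay ey; subst b'.
    case: (lastP y) ay sy ey hy => [|mid z] ay sy ey hy.
      by apply: in_side; rewrite -ey word_eval1; case: ay.
    have hc1 : core X (x1^-1 * y1) by case: hy => // /(congr1 size); rewrite size_rcons.
    have ei : inv_word (y1 :: rcons mid z) = z^-1 :: inv_word (y1 :: mid).
      by rewrite /inv_word -rcons_cons map_rcons rev_rcons.
    have := alt_inv XV ay; rewrite ei => ai.
    (* The inverse of [s] gives the same for its last letter, so conjugation by [x1] turns both end
       letters into core elements and only [mid] remains. *)
    have [||_ [e0|hc2]] := key s^-1 _ _ _ _ ai.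
    * exact: PV.
    * by rewrite -ei word_eval_inv ey.
    * by move: e0 => /(congr1 size); rewrite size_rev.
    have [_ _ /alt_rcons[am _ _]] := ay.
    have ee : x1^-1 * s * x1 = (x1^-1 * y1) * word_eval mid * (x1^-1 * z^-1)^-1.
      by rewrite -ey word_eval_cons -cats1 word_eval_cat word_eval1 invgM !invgK !mulgA.
    case: mid am sy {ay ey hy ei ai} ee => [|z1 mid] am sy ee.
      by left; rewrite ee word_eval_nil mulg1; apply: (coreM XM) => //; apply: (coreV XV).
    have [//|w2 [a2 s2 e2]] := alt_mull XM XV hc1 _ am.
    have w20 : w2 <> [::] by move=> e; move: s2; rewrite e.
    have [w3 [a3 s3 e3]] := alt_mulr XM XV (coreV XV hc2) w20 a2.
    right; exists (~~ b), w3; split=> //; last by rewrite e3 e2 ee.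
    by rewrite s3 s2; move: sy; rewrite /= size_rcons /=; lia.
exists (x1 * m), b'; split.
  by apply: spanM => //; apply: mem_span; exists b.
move=> s Ps; have := hb' (x1^-1 * s * x1).
have -> : x1 * (x1^-1 * s * x1) * x1^-1 = s by rewrite !mulgA mulgV mul1g mulgK.
by move=> /(_ Ps); rewrite invgM !mulgA.
Qed.

End BoundedSubgroups.

(** * Conjugates of an amalgam whose reduced words are geodesic *)

Section ConjugateIntersection.
Variables (G : groupType) (l : pred G) (D : nat).
Local Open Scope group_scope.
Hypothesis l_symm : symm l.
Hypothesis l_gen : forall g, gen l g.
Hypothesis four : forall w x y z,
  (len l (x^-1 * z) + len l (y^-1 * w) <=
   maxn (len l (x^-1 * y) + len l (z^-1 * w)) (len l (y^-1 * z) + len l (x^-1 * w)) + D)%N.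
Variable (Y : bool -> G -> Prop).
Hypothesis Y1 : forall b, Y b 1.
Hypothesis YM : forall b x y, Y b x -> Y b y -> Y b (x * y).
Hypothesis YV : forall b x, Y b x -> Y b x^-1.
Hypothesis red : reduced_nontrivial Y.
Hypothesis Yl : forall b g, Y b g -> l g.
Hypothesis alt_len : forall b w, alt Y b w -> (size w <= len l (word_eval w))%N.
Implicit Types (b : bool) (c g u v x y : G) (t : nat).

Local Notation M := (span (fun g => exists b, Y b g)).

Definition syllables t c := (core Y c /\ t = 0%N) \/
  exists b w, [/\ alt Y b w, size w = t & word_eval w = c].

Lemma M_inv c : M c -> M c^-1.
Proof. by apply: spanV => h [b hb]; exists b; apply: YV. Qed.

Lemma syllables_ex c : M c -> exists t, syllables t c.
Proof.
move=> [w /allP lw ew]; have hw x : x \in w -> exists b, Y b x by move=> /lw/asboolP.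
have [hc|[b [v [av v0 _ ev]]]] := alt_normal_form Y1 YM YV hw.
  by exists 0%N; left; rewrite -ew.
by exists (size v); right; exists b, v; split=> //; rewrite ev ew.
Qed.

Lemma syllables_short t T c : syllables t c -> (t <= T)%N -> short Y T c.
Proof.
move=> [[hc _] _|[b [w [aw sw ew]]] tT]; [by left | right].
by exists b, w; rewrite sw.
Qed.

Lemma alt_M b w : alt Y b w -> M (word_eval w).
Proof.
elim: w b => [|x w IH] b /=; first by rewrite word_eval_nil => _; apply: span1.
move=> [h _ /IH h']; rewrite word_eval_cons; apply: spanM => //.
by apply: mem_span; exists b.
Qed.

Lemma alt_len_le b w : alt Y b w -> (len l (word_eval w) <= size w)%N.
Proof.
move=> aw; apply: len_le; exists w; split=> //.
by elim: w b aw => //= x w IH b [/Yl-> _ /IH].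
Qed.

Lemma syllables_inv t c : syllables t c -> syllables t c^-1.
Proof.
move=> [[hc ->]|[b [w [aw sw ew]]]]; first by left; split=> //; apply: (coreV YV).
right; exists (~~ (b (+) odd (size w))), (inv_word w).
by rewrite size_rev size_map word_eval_inv ew; split=> //; apply: (alt_inv YV).
Qed.

Lemma syllables_len t c : syllables t c -> (len l c <= t.+1)%N.
Proof.
move=> [[[hc _] ->]|[b [w [aw <- <-]]]]; first by apply/len_le/letter_ball/(Yl hc).
by apply: leq_trans (alt_len_le aw) _.
Qed.

Lemma len_inv g : len l g^-1 = len l g.
Proof.
have H h : (len l h^-1 <= len l h)%N by apply/len_le/(ballV l_symm)/len_ball.
by apply/eqP; rewrite eqn_leq H /= -{1}[g]invgK H.
Qed.

Section Minimal.
Variable v : G.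
Hypothesis minv : forall m, M m -> (len l v <= len l (m * v))%N.

(* A point m of M at distance D + 1 from 1 on the way to c is not closer to v than 1,
   so the four point inequality pushes v away from c. *)
Lemma push_away t c : M c -> syllables t c -> (len l v + t <= len l (c^-1 * v) + D.*2.+1)%N.
Proof.
move=> Mc st; have := minv (M_inv Mc).
have [tD|tD] := leqP t D.*2.+1; first by move: (len l v) (len l (c^-1 * v)) tD; clear; lia.
move=> _; case: st tD => [[_ ->] //|[b [w [aw <- ew]]]] tD.
have iw : (D.+1 <= size w)%N by clear - tD; lia.
have := cat_take_drop D.+1 w; set p := take _ w; set q := drop _ w => epq.
have [ap aq] : alt Y b p /\ alt Y (b (+) odd (size p)) q by apply/alt_cat; rewrite epq.
have sp : size p = D.+1 by rewrite size_takel.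
have sq : size q = (size w - D.+1)%N by rewrite size_drop.
have ec : c = word_eval p * word_eval q by rewrite -word_eval_cat epq.
have h1 := alt_len_le ap; have h2 := alt_len_le aq; have h3 := alt_len aw.
have := four v 1 (word_eval p) c.
have := minv (M_inv (alt_M ap)).
have -> : (word_eval p)^-1 * c = word_eval q by rewrite ec mulKg.
rewrite invg1 !mul1g.
rewrite ew in h3; rewrite sp in h1; rewrite sq in h2.
move: (len l v) (len l c) (len l (word_eval p)) (len l (word_eval q)) (len l (c^-1 * v))
  (len l ((word_eval p)^-1 * v)) (size w) h1 h2 h3 iw tD.
clear; lia.
Qed.

(** In the quadrilateral 1, [c], [c * v = v * u], [v], [push_away] makes both diagonals at least
    [len l v + t] up to a constant. In the four point condition they are compared either with the
    two sides of length [len l v], which bounds [t], or with the sides [c] and [u]. *)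
Lemma four_sides t t' c u : M c -> syllables t c -> syllables t' u -> c * v = v * u ->
  (t.*2 <= 5 * D + 2)%N \/ ((len l v).*2 + t <= t' + 5 * D + 4)%N.
Proof.
move=> Mc sc su e.
have p1 := push_away Mc sc; have p2 := push_away (M_inv Mc) (syllables_inv sc).
rewrite invgK in p2; have q1 := syllables_len sc; have q2 := syllables_len (syllables_inv su).
have := four v 1 c (c * v); rewrite invg1 !mul1g mulKg.
have -> : (c * v)^-1 * v = u^-1 by rewrite e invgM -mulgA mulVg mulg1.
move: (len l v) (len l c) (len l (c * v)) (len l (c^-1 * v)) (len l u^-1) p1 p2 q1 q2.
clear; lia.
Qed.

End Minimal.

(** Applied to [v] and to [v^-1], [four_sides] bounds the syllables of [c] and of [v^-1 * c * v]:
    the other alternatives are impossible for [v] of length at least [6 * D + 6]. Then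
    [bounded_conj] conjugates the intersection, seen from either end of [v], into one side. *)
Lemma conjugate_intersection v : (6 * D + 6 <= len l v)%N ->
  (forall m m', M m -> M m' -> (len l v <= len l (m * v * m'))%N) ->
  exists m b m' b', [/\ M m, M m' & forall c, M c -> M (v^-1 * c * v) ->
    Y b (m^-1 * c * m) /\ Y b' (m'^-1 * (v^-1 * c * v) * m')].
Proof.
move=> lv minv.
have min1 m : M m -> (len l v <= len l (m * v))%N.
  by move=> hm; have := minv m 1 hm (span1 _); rewrite mulg1.
have min2 m : M m -> (len l v^-1 <= len l (m * v^-1))%N.
  move=> hm; have := minv 1 m^-1 (span1 _) (M_inv hm).
  by rewrite mul1g -[len l (v * m^-1)]len_inv invgM invgK -len_inv.
have bound c u : M c -> M u -> c * v = v * u -> short Y (5 * D + 2).+1 c /\ short Y (5 * D + 2).+1 u.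
  move=> Mc Mu e; have [t st] := syllables_ex Mc; have [t' st'] := syllables_ex Mu.
  have e' : u * v^-1 = v^-1 * c by rewrite -[c](mulgK v) e !mulgA mulVg mul1g.
  have h1 := four_sides min1 Mc st st' e; have h2 := four_sides min2 Mu st' st e'.
  rewrite len_inv in h2.
  have [k1 k2] : (t <= (5 * D + 2).+1)%N /\ (t' <= (5 * D + 2).+1)%N.
    by move: (len l v) lv h1 h2; clear; lia.
  by split; apply: syllables_short; eassumption.
pose P c := M c /\ M (v^-1 * c * v).
have sP : subgroup P.
  split=> [|x y [x1 x2] [y1 y2]|x [x1 x2]].
  - by split; rewrite ?mulg1 ?mulVg; apply: span1.
  - split; first exact: spanM.
    have -> : v^-1 * (x * y) * v = (v^-1 * x * v) * (v^-1 * y * v) by rewrite !mulgA mulgK.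
    exact: spanM.
  - split; first exact: M_inv.
    have -> : v^-1 * x^-1 * v = (v^-1 * x * v)^-1 by rewrite !invgM invgK mulgA.
    exact: M_inv.
pose Q u := P (v * u * v^-1).
have sQ : subgroup Q.
  case: sP => P1 PM PV; split=> [|x y hx hy|x hx]; rewrite /Q.
  - by rewrite mulg1 mulgV.
  - have -> : v * (x * y) * v^-1 = (v * x * v^-1) * (v * y * v^-1) by rewrite !mulgA mulgVK.
    exact: PM.
  - have -> : v * x^-1 * v^-1 = (v * x * v^-1)^-1 by rewrite !invgM invgK mulgA.
    exact: PV.
have cK u : v^-1 * (v * u * v^-1) * v = u by rewrite !mulgA mulVg mul1g mulgVK.
have [|m [b [Mm hb]]] := bounded_conj Y1 YM YV red (T := (5 * D + 2)%N) sP.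
  by move=> c [h1 h2]; have [] := bound c (v^-1 * c * v) h1 h2; rewrite // !mulgA mulgV mul1g.
have [|m' [b' [Mm' hb']]] := bounded_conj Y1 YM YV red (T := (5 * D + 2)%N) sQ.
  move=> u [h1]; rewrite cK => h2; have [] := bound _ _ h1 h2; rewrite ?mulgVK //.
exists m, b, m', b'; split=> // c h1 h2; split; first exact: hb.
apply: hb'; rewrite /Q.
have -> : v * (v^-1 * c * v) * v^-1 = c by rewrite !mulgA mulgV mul1g mulgK.
by split.
Qed.

End ConjugateIntersection.

(** * Groups of arcs *)

Section Rebase.
Variable n : nat.
Implicit Types (a j : 'I_n).

Lemma pos_rebase a a' j : pos a' j = if (pos a a' <= pos a j)%N then (pos a j - pos a a')%N
  else (pos a j + n - pos a a')%N.
Proof.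
have := ltn_ord a; have := ltn_ord a'; have := ltn_ord j.
by rewrite !pos_small; do ! case: ifP; lia.
Qed.

End Rebase.

Lemma alt_weaken (G : groupType) (X Y : bool -> G -> Prop) b w :
  (forall b g, X b g -> Y b g) -> (forall b g, X b g -> Y (~~ b) g -> X (~~ b) g) ->
  alt X b w -> alt Y b w.
Proof.
move=> XY YX; elim: w b => //= x w IH b [h1 h2 h3].
by split; [exact: XY | move/(YX _ _ h1) | exact: IH].
Qed.

(* An element of the subgroup generated by Y0 and Y1 lying in X0 is a reduced word in
   Y0 and Y1, hence in X0 and X1, so it has a single letter. *)
Lemma span_side (G : groupType) (X0 X1 Y0 Y1 : G -> Prop) :
  (forall g, Y0 g -> X0 g) -> (forall g, Y1 g -> X1 g) ->
  (forall g, Y0 g -> X1 g -> Y1 g) -> (forall g, Y1 g -> X0 g -> Y0 g) ->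
  subgroup X0 -> subgroup X1 -> subgroup Y0 -> subgroup Y1 ->
  reduced_nontrivial (two X0 X1) ->
  forall g, span (fun g => Y0 g \/ Y1 g) g -> X0 g -> Y0 g.
Proof.
move=> YX0 YX1 Y01 Y10 [a1 aM aV] [b1 bM bV] [c1 cM cV] [d1 dM dV] rX g [w /allP lw ew] hg.
have rY : reduced_nontrivial (two Y0 Y1).
  by apply: (reduced_pull (f := idfun)) rX => -[] x /=; auto.
have XM b x y : two X0 X1 b x -> two X0 X1 b y -> two X0 X1 b (x * y)%g by case: b => /=; auto.
have XV b x : two X0 X1 b x -> two X0 X1 b x^-1%g by case: b => /=; auto.
have Y1' b : two Y0 Y1 b 1%g by case: b.
have YM b x y : two Y0 Y1 b x -> two Y0 Y1 b y -> two Y0 Y1 b (x * y)%g by case: b => /=; auto.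
have YV b x : two Y0 Y1 b x -> two Y0 Y1 b x^-1%g by case: b => /=; auto.
have hw x : x \in w -> exists b, two Y0 Y1 b x.
  by move=> /lw/asboolP[h|h]; [exists true | exists false].
have [[hc _]|[b [v [av v0 _ ev]]]] := alt_normal_form Y1' YM YV hw; first by rewrite -ew.
have wk b' u : alt (two Y0 Y1) b' u -> alt (two X0 X1) b' u.
  by apply: alt_weaken => -[] x /=; auto.
rewrite -ew -ev in hg *; case: b av => av; last first.
  by case: (@alt_not_side _ _ XM XV rX true v v0 (wk _ _ av)).
case: v v0 av hg {ev} => // x v _ [hx _ av] hg.
case: v av hg => [|y v] av; first by rewrite word_eval1.
rewrite word_eval_cons => hg; exfalso.
have n0 : y :: v <> [::] by [].
have H := alt_not_side XM XV rX (b := true) n0 (wk (~~ true) (y :: v) av).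
apply: H => /=; by rewrite -[word_eval _](mulKg x); apply: aM => //; apply/aV/YX0.
Qed.

(** * Intersections across a cut *)

Section CutSides.
Variables (n : nat) (C : polygon_of_groups n).
Hypothesis n3 : (3 < n)%N.
Hypothesis Hx : edge_groups_intersect_in_face C.
Variables (G : groupType) (phi : cocone C G).
Hypothesis lim : is_direct_limit phi.
Implicit Types (a b c e j : 'I_n) (g : G) (k m : nat).

Lemma img_subgroup (K : groupType) (f : {multiplicative K -> G}) : subgroup (img f).
Proof. by split; [apply: img1 | move=> x y; apply: imgM | move=> x; apply: imgV]. Qed.

Lemma hull_subgroup (A : pred 'I_n) : subgroup (hull A (vleg phi)).
Proof. by split; [apply: span1 | move=> x y; apply: spanM | move=> x; apply: hullV]. Qed.

(** An element of both arcs lies in the subgroup generated by the two crossed edge groups, which is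
    an amalgam compatible with the splitting of the first arc at [m]; [span_side] then extracts one
    edge group. *)
Lemma cut_sides a k m b c : (1 < k)%N -> (k.+1 < n)%N -> (0 < m < k)%N ->
  pos a b = k.-1 -> pos a c = n.-1 -> forall g, hull (arc a k n) (vleg phi) g ->
  (hull (arc a 0 m) (vleg phi) g -> eset phi c g) /\
  (hull (arc a m k) (vleg phi) g -> eset phi b g).
Proof.
move=> k1 k2 hm pb pc g hg.
have pSc : pos a (ordS c) = 0 by rewrite pos_ordS pc; case: eqP; lia.
have [_ _ core _] := total_cut n3 Hx lim k1 k2 pb pc.
have [e pe] : exists e, pos a e = m.-1 by apply: pos_surj; lia.
have [rd cr] := arc_split n3 Hx lim k1 k2 pb pc hm pe.
have bm := boundary_meet n3 Hx lim k1 k2 pb pc _ hm.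
have Y0 x : eset phi c x -> hull (arc a 0 m) (vleg phi) x.
  by apply: eset_hull_right; rewrite /arc pSc; lia.
have Y1 x : eset phi b x -> hull (arc a m k) (vleg phi) x.
  by apply: eset_hull_left; rewrite /arc pb; lia.
have Y01 x : eset phi c x -> hull (arc a m k) (vleg phi) x -> eset phi b x.
  by move=> h1 h2; apply: fset_eset; apply: (proj1 (bm x)).
have Y10 x : eset phi b x -> hull (arc a 0 m) (vleg phi) x -> eset phi c x.
  by move=> h1 h2; apply: fset_eset; apply: (proj2 (bm x)).
have H := hull_subgroup; have I e' : subgroup (eset phi e') by apply: img_subgroup.
have sp x : bset phi b c x -> span (fun g => eset phi c g \/ eset phi b g) x.
  by apply: span_sub => {}x h; apply: mem_span; case: h; [right | left].
split=> h.
  have hk : hull (arc a 0 k) (vleg phi) g by apply: hull_sub h => j; rewrite /arc; lia.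
  exact: (span_side Y0 Y1 Y01 Y10 (H _) (H _) (I _) (I _) rd (sp _ (core _ hk hg))).
have hk : hull (arc a 0 k) (vleg phi) g by apply: hull_sub h => j; rewrite /arc; lia.
exact: (span_side Y1 Y0 Y10 Y01 (H _) (H _) (I _) (I _) (reduced_swap rd) (core _ hk hg)).
Qed.

Lemma vertex_hull (A : pred 'I_n) j g : A j -> img (phi (Vertex j)) g -> hull A (vleg phi) g.
Proof. by move=> Aj [x ->]; apply: (@hull_mem _ _ _ _ (vleg phi)). Qed.

Lemma all_vertices_gen g : hull predT (vleg phi) g.
Proof.
pose a : 'I_n := Ordinal (leq_trans (isT : (0 < 4)%N) n3).
have [b pb] : exists b, pos a b = 1%N by apply: pos_surj; lia.
have [c pc] : exists c, pos a c = n.-1 by apply: pos_surj; lia.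
have [gen _ _ _] := @total_cut n C n3 Hx G phi lim a 2 isT n3 b c pb pc.
exact: gen.
Qed.

Lemma vertex_inj j : injective (phi (Vertex j)).
Proof.
have [b pb] : exists b, pos j b = 1%N by apply: pos_surj; lia.
have [c pc] : exists c, pos j c = n.-1 by apply: pos_surj; lia.
by apply: (@arc_vertex_inj n C n3 Hx G phi lim j 2 isT n3 b c pb pc); rewrite /arc pos_base.
Qed.

Lemma cut_alt_size a k (b : bool) w : (1 < k)%N -> (k.+1 < n)%N ->
  alt (two (hull (arc a k n) (vleg phi)) (hull (arc a 0 k) (vleg phi))) b w ->
  forall N, ball (lstar phi) N (word_eval w) -> (size w <= N)%N.
Proof.
move=> k1 k2 aw N [v [lv sv ev]].
have [b' pb] : exists b', pos a b' = k.-1 by apply: pos_surj; lia.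
have [c pc] : exists c, pos a c = n.-1 by apply: pos_surj; lia.
have [_ rd _ _] := total_cut n3 Hx lim k1 k2 pb pc.
apply: leq_trans sv; apply: (alt_size_le _ _ _ (reduced_swap rd) aw) => //.
- by case; apply: span1.
- by case=> x y; apply: spanM.
- by case=> x; apply: hullV.
move=> x /(allP lv)/asboolP[j hj]; have := ltn_pos a j.
by case: (ltnP (pos a j) k) => h1 h2; [exists false | exists true];
  apply: (@vertex_hull _ j) => //; rewrite /arc; lia.
Qed.

End CutSides.

(** * Iterated amalgams along an arc *)

Section Chain.
Variables (n : nat) (C : polygon_of_groups n).
Hypothesis n3 : (3 < n)%N.
Hypothesis Hx : edge_groups_intersect_in_face C.
Variables (G : groupType) (phi : cocone C G).
Hypothesis lim : is_direct_limit phi.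
Variables (S0 : forall j, seq (C (Vertex j))) (T0 : forall e, seq (C (Edge e))).
Hypothesis S0_gen : forall j, generates (S0 j).
Hypothesis S0_sq : forall j, sq_hyperbolic (cay (sgen (S0 j))).
Hypothesis T0_gen : forall e, generates (T0 e).
Hypothesis T0_left : forall e, undistorted (sgen (map (lm C e) (T0 e))) (sgen (S0 e)).
Hypothesis T0_right : forall e, undistorted (sgen (map (rm C e) (T0 e))) (sgen (S0 (ordS e))).
Variable N : nat.
Hypothesis acyl : forall i j g, ~ ball (lstar phi) N g ->
  exists s : seq G, forall h, img (phi (Vertex i)) h ->
    img (phi (Vertex j)) (g^-1 * h * g)%g -> h \in s.
Local Open Scope group_scope.
Implicit Types (a e j : 'I_n) (g : G) (k m : nat) (S : seq G).

Local Notation vset j := (img (phi (Vertex j))).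
Local Notation aset a i1 i2 := (hull (arc a i1 i2) (vleg phi)).

Definition te e : seq G := map (phi (Edge e)) (T0 e).
(** The generators of both adjacent edge groups are added, so that an edge alphabet is contained in
    the alphabets of both vertices, as the combination theorem requires. *)
Definition sv j : seq G := map (phi (Vertex j)) (S0 j) ++ te j ++ te (ord_pred j).

Lemma sgen_sub S S' : {subset S <= S'} -> forall s, sgen S s -> sgen S' s.
Proof. by move=> h s /orP[/h h'|/h h']; rewrite /sgen h' ?orbT. Qed.

Lemma te_left e : {subset te e <= sv e}.
Proof. by move=> s hs; rewrite !mem_cat hs orbT. Qed.

Lemma te_right e : {subset te e <= sv (ordS e)}.
Proof. by move=> s hs; rewrite !mem_cat ordSK hs !orbT. Qed.

Lemma gen_te e g : gen (sgen (te e)) g <-> eset phi e g.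
Proof.
split; first by move=> /gen_map[x _ ->]; exists x.
by move=> [x ->]; apply/gen_map; exists x => //; apply: generates_gen.
Qed.

Lemma gen_te_vertex e g : gen (sgen (te e)) g -> vset e g /\ vset (ordS e) g.
Proof.
move=> /gen_te[x ->]; split.
  by exists (lm C e x); rewrite leg_left.
by exists (rm C e x); rewrite leg_right.
Qed.

Lemma gen_v0 j g : gen (sgen (map (phi (Vertex j)) (S0 j))) g <-> vset j g.
Proof.
split; first by move=> /gen_map[x _ ->]; exists x.
by move=> [x ->]; apply/gen_map; exists x => //; apply: generates_gen.
Qed.

Lemma letter_gen_v0 j s : s \in sv j -> gen (sgen (map (phi (Vertex j)) (S0 j))) s.
Proof.
rewrite !mem_cat => h; apply/gen_v0.
have lt e s' : s' \in te e -> gen (sgen (te e)) s'.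
  by move=> h'; apply: ball_gen (letter_ball _); rewrite /sgen h'.
case/or3P: h => [h|/lt/gen_te_vertex[] //|/lt/gen_te_vertex[]]; last by rewrite ord_predK.
by apply/gen_v0; apply: ball_gen (letter_ball _); rewrite /sgen h.
Qed.

Lemma v0_sv j : {subset map (phi (Vertex j)) (S0 j) <= sv j}.
Proof. by move=> s hs; rewrite mem_cat hs. Qed.

Lemma sv_ball j : exists k, forall s, sgen (sv j) s -> ball (sgen (map (phi (Vertex j)) (S0 j))) k s.
Proof. by apply: gen_seq_ball; [apply: sgen_symm | apply: letter_gen_v0]. Qed.

Lemma v0_ball j s : sgen (map (phi (Vertex j)) (S0 j)) s -> ball (sgen (sv j)) 1 s.
Proof. by move=> h; apply: letter_ball; apply: sgen_sub h; apply: v0_sv. Qed.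

Lemma gen_sv j g : gen (sgen (sv j)) g <-> vset j g.
Proof.
have [k hk] := sv_ball j; split.
  by move=> h; apply/gen_v0; apply: gen_sub h => s /hk/ball_gen.
by move/gen_v0; apply: gen_sub => s /v0_ball/ball_gen.
Qed.

Lemma sq_sv j : sq_hyperbolic (cay (sgen (sv j))).
Proof.
have [k hk] := sv_ball j.
apply: (sq_hyperbolic_gens (sgen_symm (S := _)) (sgen_symm (S := _)) hk (@v0_ball j)).
exact: (sq_hyperbolic_push (vertex_inj n3 Hx lim (j := j)) (S0_sq j)).
Qed.

Lemma und_vertex j e : undistorted (sgen (te e)) (sgen (map (phi (Vertex j)) (S0 j))) ->
  undistorted (sgen (te e)) (sgen (sv j)).
Proof.
have [k hk] := sv_ball j => h; apply: (undistorted_change _ _ hk h) => s hs.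
  exact: letter_ball hs.
by apply: ball_gen (letter_ball _).
Qed.

Lemma und_left e : undistorted (sgen (te e)) (sgen (sv e)).
Proof.
apply: und_vertex; have -> : te e = map (phi (Vertex e)) (map (lm C e) (T0 e)).
  by rewrite -map_comp; apply: eq_map => x /=; rewrite leg_left.
exact: (undistorted_push (vertex_inj n3 Hx lim (j := e)) (T0_left e)).
Qed.

Lemma und_right e : undistorted (sgen (te e)) (sgen (sv (ordS e))).
Proof.
apply: und_vertex; have -> : te e = map (phi (Vertex (ordS e))) (map (rm C e) (T0 e)).
  by rewrite -map_comp; apply: eq_map => x /=; rewrite leg_right.
exact: (undistorted_push (vertex_inj n3 Hx lim (j := ordS e)) (T0_right e)).
Qed.

Definition contains_vertex S j : Prop :=
  {subset sv j <= S} /\ undistorted (sgen (sv j)) (sgen S).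

(** The end vertices are recorded because the next vertex is glued to the first one and the boundary
    edges lie in both. *)
Definition arc_gens a m k S : Prop :=
  [/\ forall g, gen (sgen S) g <-> aset a m k g, sq_hyperbolic (cay (sgen S)),
      forall j, pos a j = m -> contains_vertex S j &
      forall j, pos a j = k.-1 -> contains_vertex S j].

Lemma undistorted_refl (l : pred G) : undistorted l l.
Proof. by exists 1%N => i g _; rewrite mul1n. Qed.

Lemma arc_gens_single a m j : pos a j = m -> arc_gens a m m.+1 (sv j).
Proof.
move=> pj; split.
- move=> g; split; first by move/gen_sv; apply: vertex_hull; rewrite /arc; lia.
  move=> h; apply/gen_sv; move: g h; apply: span_ind.
  + exact: img1.
  + exact: imgM.
  + move=> g [i hi]; have -> // : i = j.
    by apply: (@pos_inj _ a); move: hi; rewrite /arc; lia.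
- exact: sq_sv.
- move=> i pi; have -> : i = j by apply: (@pos_inj _ a); rewrite pi pj.
  by split=> //; apply: undistorted_refl.
- move=> i pi; have -> : i = j by apply: (@pos_inj _ a); rewrite pi pj.
  by split=> //; apply: undistorted_refl.
Qed.

Section Step.
Variables (a j q : 'I_n) (m k : nat) (S' : seq G).
Hypotheses (k2 : (k.+1 < n)%N) (mk : (m.+1 < k)%N) (pj : pos a j = m) (pq : pos a q = k.-1).
Hypothesis S'P : arc_gens a m.+1 k S'.

Let S (b : bool) := if b then sv j else S'.
Let X (b : bool) := gen (sgen (S b)).

Let k1 : (1 < k)%N. Proof. by lia. Qed.
Let pSj : pos a (ordS j) = m.+1. Proof. by rewrite pos_ordS pj; case: eqP; lia. Qed.

Let XE b g : X b g <-> two (vset j) (aset a m.+1 k) b g.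
Proof. by case: b; [apply: gen_sv | case: S'P => h _ _ _; apply: h]. Qed.

Let first_S' : contains_vertex S' (ordS j). Proof. by case: S'P => _ _ h _; apply: h. Qed.
Let last_S' : contains_vertex S' q. Proof. by case: S'P => _ _ _ h; apply: h. Qed.

Lemma step_letters b s : sgen (te j) s -> sgen (S b) s.
Proof.
case: b; apply: sgen_sub; first exact: te_left.
by move=> s' /te_right; case: first_S' => h _; apply: h.
Qed.

Lemma step_split : reduced_nontrivial (two (aset a 0 m.+1) (aset a m.+1 k)) /\
  forall g, aset a 0 m.+1 g -> aset a m.+1 k g -> eset phi j g.
Proof.
have [c pc] : exists c, pos a c = n.-1 by apply: pos_surj; lia.
have hm : (0 < m.+1 < k)%N by rewrite /= mk.
exact: (arc_split n3 Hx lim k1 k2 pq pc hm pj).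
Qed.

Lemma step_core g : core X g -> gen (sgen (te j)) g.
Proof.
move=> [/XE h1 /XE h2]; apply/gen_te; apply: (proj2 step_split) => //.
by apply: (vertex_hull _ h1); rewrite /arc; lia.
Qed.

Let edge_core b g : eset phi j g -> X b g.
Proof. by move=> /gen_te; apply: gen_sub => s /(step_letters b) h; apply: ball_gen (letter_ball h). Qed.

Lemma step_reduced : reduced_nontrivial X.
Proof.
have [rd cr] := step_split; apply: (reduced_pull (f := idfun)) rd => -[] g /XE /=.
- by move=> h; apply: (vertex_hull _ h); rewrite /arc; lia.
- by [].
- move=> h1 h2; apply: edge_core; apply: cr => //.
  by apply: (vertex_hull _ h1); rewrite /arc; lia.
- by move=> h1 h2; apply: edge_core; apply: cr.
Qed.

Lemma step_flow b : flow (S b) (sgen (te j)).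
Proof.
apply: flow_of_undistorted; first exact: step_letters.
  case: b; first exact: und_left.
  case: first_S' => h1 h2; apply: (undistorted_trans _ (und_right j) h2) => s hs.
  by apply: ball_gen (letter_ball _); apply: sgen_sub hs; apply: te_right.
by case: b; [apply: sq_sv | case: S'P].
Qed.

Lemma step_sq b : sq_hyperbolic (cay (sgen (S b))).
Proof. by case: b; [apply: sq_sv | case: S'P]. Qed.

(* The cut through the edges j and n - 2 separates the vertex j from the rest of the arc
   and meets neither side in more than the edge group j. *)
Lemma step_acyl b w : alt X b w -> size w = N.+1 -> exists s : seq G, forall c, core X c ->
  core X ((word_eval w)^-1 * (c * word_eval w)) -> c \in s.
Proof.
move=> aw sw; set a1 := ordS j.
have [a2 pa2] : exists a2, pos a a2 = n.-1 by apply: pos_surj; lia.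
pose k' := (n - 2 - m)%N.
have p1 i : pos a1 i = if (m.+1 <= pos a i)%N then (pos a i - m.+1)%N else (pos a i + n - m.+1)%N.
  by rewrite (pos_rebase a) pSj.
have p2 i : pos a2 i = if (n.-1 <= pos a i)%N then (pos a i - n.-1)%N else (pos a i + n - n.-1)%N.
  by rewrite (pos_rebase a) pa2.
(* The same cut is read from [a1] and from [a2], with its arcs exchanged, because [cut_sides]
   controls pieces of the first arc only. *)
have eA i : arc a2 0 m.+2 i = arc a1 k' n i.
  rewrite /arc p1 p2 /k'; have := ltn_pos a i; do 2 case: ifP; lia.
have eB i : arc a2 m.+2 n i = arc a1 0 k' i.
  rewrite /arc p1 p2 /k'; have := ltn_pos a i; do 2 case: ifP; lia.
have eR i : arc a1 0 (k - m.+1) i = arc a m.+1 k i.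
  rewrite /arc p1; have := ltn_pos a i; case: ifP; lia.
have [d pd] : exists d, pos a1 d = k'.-1 by apply: pos_surj; lia.
have [d2 pd2] : exists d2, pos a2 d2 = n.-1 by apply: pos_surj; lia.
have p1j : pos a1 j = n.-1 by rewrite p1 pj; case: ifP; lia.
have p2j : pos a2 j = m.+1 by rewrite p2 pj; case: ifP; lia.
have hk' : (1 < k')%N by rewrite /k'; lia.
have hk'' : (k'.+1 < n)%N by rewrite /k'; lia.
have Aj : arc a1 k' n j by rewrite /arc p1j /k'; lia.
have aw2 : alt (two (aset a1 k' n) (aset a1 0 k')) b w.
  apply: alt_weaken aw => -[] g /XE /=.
  - exact: vertex_hull.
  - by apply: hull_sub => i; rewrite -eR /arc /k'; lia.
  - move=> h1 h2; apply: edge_core.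
    apply: (proj2 (@cut_sides n C n3 Hx G phi lim a2 m.+2 m.+1 j d2 _ _ _ p2j pd2 g _)) => //.
    + by lia.
    + by lia.
    + by apply: hull_sub h2 => i; rewrite eB.
    + by apply: (vertex_hull _ h1); rewrite /arc p2j; lia.
  - move=> h1 h2; apply: edge_core.
    apply: (proj1 (@cut_sides n C n3 Hx G phi lim a1 k' (k - m.+1) d j _ _ _ pd p1j g h2)) => //.
    + by rewrite /k'; lia.
    + by apply: hull_sub h1 => i; rewrite eR.
have nb : ~ ball (lstar phi) N (word_eval w).
  by move/(cut_alt_size n3 Hx lim hk' hk'' aw2); rewrite sw ltnn.
have [s hs] := acyl j j nb; exists s => c [/XE h1 _] [/XE h2 _]; apply: hs => //.
by rewrite -mulgA.
Qed.

Lemma step_undistorted b : undistorted (sgen (S b)) (sgen (sv j ++ S')).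
Proof.
exact: (combination_undistorted step_letters step_core step_reduced step_flow
  (ltn0Sn N) step_acyl b).
Qed.

Lemma arc_gens_step : arc_gens a m k (sv j ++ S').
Proof.
have sub b : {subset S b <= sv j ++ S'} by case: b => s hs; rewrite mem_cat hs ?orbT.
split.
- move=> g; split.
    apply: gen_sub => s; rewrite /sgen !(mem_cat _ (sv j) S') => hs.
    change (aset a m k s).
    have [b hb] : exists b, sgen (S b) s.
      by case/orP: hs => /orP[h|h]; [exists true | exists false | exists true | exists false];
        rewrite /sgen h ?orbT.
    have /XE : X b s by apply: ball_gen (letter_ball hb).
    case: (b) => /= h; first by apply: (vertex_hull _ h); rewrite /arc; lia.
    by apply: hull_sub h => i; rewrite /arc; lia.
  apply: span_ind; first exact: gen1.
    exact: genM.
  move=> x [i hi hx].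
  have [b hb] : exists b, X b x.
    have [e|e] := eqVneq i j; first by subst i; exists true; apply/XE.
    exists false; apply/XE => /=; apply: (vertex_hull _ hx).
    have ne : pos a i <> m by rewrite -pj => /pos_inj/eqP; apply/negP.
    by move: hi; rewrite /arc; lia.
  by apply: gen_sub hb => s hs; apply: ball_gen (letter_ball _); apply: sgen_sub hs.
- exact: (combination_sq_hyperbolic step_letters step_core step_reduced step_flow
    (ltn0Sn N) step_acyl step_sq).
- move=> i pi; have -> : i = j by apply: (@pos_inj _ a); rewrite pi pj.
  by split; [apply: (sub true) | apply: (step_undistorted true)].
- move=> i pi; have -> : i = q by apply: (@pos_inj _ a); rewrite pi pq.
  have [h1 h2] := last_S'; split; first by move=> s /h1 hs; apply: (sub false).
  apply: (undistorted_trans _ h2 (step_undistorted false)) => s hs.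
  by apply: ball_gen (letter_ball _); apply: sgen_sub hs.
Qed.

(** The two boundary edge groups lie in different factors and each meets the other factor only in
    the face group, so they form a subamalgam. *)
Lemma step_boundary : m = 0%N ->
  undistorted (fun s => sgen (te (ord_pred j)) s || sgen (te q) s) (sgen (sv j ++ S')).
Proof.
move=> m0; pose l0 (b : bool) := if b then sgen (te (ord_pred j)) else sgen (te q).
have pc : pos a (ord_pred j) = n.-1.
  have : pos a (ordS (ord_pred j)) = 0%N by rewrite ord_predK pj.
  by rewrite pos_ordS; have := ltn_pos a (ord_pred j); case: eqP; lia.
have l0S b s : l0 b s -> sgen (S b) s.
  case: b; apply: sgen_sub; first by have := @te_right (ord_pred j); rewrite ord_predK.
  by move=> s' /te_left; case: last_S' => h _; apply: h.
have hm : (0 < m.+1 < k)%N by rewrite /= mk.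
have bm := boundary_meet n3 Hx lim k1 k2 pq pc _ hm.
apply: (@subamalgam_undistorted G S (sgen (te j)) l0).
- exact: sgen_symm.
- by case; apply: sgen_symm.
- exact: step_letters.
- exact: l0S.
- exact: step_core.
- move=> [] g [/XE g1 /XE g2] /gen_te he; apply/gen_te; apply: fset_eset.
    exact: (proj1 (bm g)).
  apply: (proj2 (bm g)) => //; apply: (vertex_hull _ g1); rewrite /arc; lia.
- exact: step_reduced.
- case; first exact: und_left.
  case: first_S' => h1 h2; apply: (undistorted_trans _ (und_right j) h2) => s hs.
  by apply: ball_gen (letter_ball _); apply: sgen_sub hs; apply: te_right.
- case; first by have := und_right (ord_pred j); rewrite ord_predK.
  case: last_S' => h1 h2; apply: (undistorted_trans _ (und_left q) h2) => s hs.
  by apply: ball_gen (letter_ball _); apply: sgen_sub hs; apply: te_left.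
- exact: step_undistorted.
- exact: step_sq.
Qed.

End Step.

Lemma arc_gens_ex a k m : (k.+1 < n)%N -> (m < k)%N -> exists S, arc_gens a m k S.
Proof.
move=> k2; move Ed : (k - m.+1)%N => d; elim: d m Ed => [|d IH] m Ed mk.
  have [j pj] : exists j, pos a j = m by apply: pos_surj; lia.
  have -> : k = m.+1 by lia.
  by exists (sv j); apply: arc_gens_single.
have [||S' hS'] := IH m.+1; [by lia | by lia |].
have [j pj] : exists j, pos a j = m by apply: pos_surj; lia.
have [q pq] : exists q, pos a q = k.-1 by apply: pos_surj; lia.
have mk' : (m.+1 < k)%N by lia.
by exists (sv j ++ S'); apply: (arc_gens_step k2 mk' pj pq hS').
Qed.

Lemma arc_hyperbolic a q k : (1 < k)%N -> (k.+1 < n)%N -> pos a q = k.-1 ->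
  exists S, [/\ forall g, gen (sgen S) g <-> aset a 0 k g, sq_hyperbolic (cay (sgen S)),
    forall s, sgen (te (ord_pred a)) s || sgen (te q) s -> sgen S s &
    undistorted (fun s => sgen (te (ord_pred a)) s || sgen (te q) s) (sgen S)].
Proof.
move=> k1 k2 pq; have [S' hS'] := @arc_gens_ex a k 1%N k2 k1.
have [h1 h2 h3 h4] := arc_gens_step k2 k1 (pos_base a) pq hS'.
exists (sv a ++ S'); split=> //.
  move=> s /orP[|].
    apply: sgen_sub => s' hs'; apply: (proj1 (h3 a (pos_base a))).
    by have := @te_right (ord_pred a) s' hs'; rewrite ord_predK.
  by apply: sgen_sub => s' /te_left; apply: (proj1 (h4 q pq)).
exact: (step_boundary k2 k1 (pos_base a) pq hS').
Qed.

End Chain.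

(** * The cut next to an edge *)

Section Top.
Variables (n : nat) (C : polygon_of_groups n).
Hypothesis n3 : (3 < n)%N.
Hypothesis Hx : edge_groups_intersect_in_face C.
Variables (G : groupType) (phi : cocone C G).
Hypothesis lim : is_direct_limit phi.
Variable N : nat.
Hypothesis acyl : forall i j g, ~ ball (lstar phi) N g ->
  exists s : seq G, forall h, img (phi (Vertex i)) h ->
    img (phi (Vertex j)) (g^-1 * h * g)%g -> h \in s.
Hypothesis star_sq : sq_hyperbolic (cay (lstar phi)).
Variable e : 'I_n.
Local Open Scope group_scope.
Implicit Types (i j : 'I_n) (g h v m : G) (k : nat) (S : seq G).

Local Notation aset a i1 i2 := (hull (arc a i1 i2) (vleg phi)).
Let b := ordS e.
Let c := ord_pred e.
Let Y := two (eset phi c) (eset phi b).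
Let Z := two (aset e 0 2) (aset e 2 n).
Local Notation M := (bset phi b c).

Let pe : pos e e = 0. Proof. exact: pos_base. Qed.
Let pb : pos e b = 1%N. Proof. by rewrite /b pos_ordS pe; case: eqP; lia. Qed.
Let pc : pos e c = n.-1.
Proof.
have : pos e (ordS c) = 0 by rewrite /c ord_predK.
by rewrite pos_ordS; have := ltn_pos e c; case: eqP; lia.
Qed.

Lemma edges_disjoint g : (eset phi c g -> eset phi e g -> fset phi g) /\
  (eset phi b g -> eset phi e g -> fset phi g).
Proof.
have [h1 h2] := @boundary_meet n C n3 Hx G phi lim e 2 isT n3 b c pb pc 1 g isT.
split=> ?; [move/(@eset_hull_right n C G phi (arc e 1 2) e g); move=> h; apply: h1 => //; apply: h
  | move/(@eset_hull_left n C G phi (arc e 0 1) e g); move=> h; apply: h2 => //; apply: h];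
  rewrite /arc -?/b ?pb ?pe //.
Qed.

Let Y1 s : Y s 1. Proof. by case: s; apply: img1. Qed.
Let YM s x y : Y s x -> Y s y -> Y s (x * y). Proof. by case: s; apply: imgM. Qed.
Let YV s x : Y s x -> Y s x^-1. Proof. by case: s; apply: imgV. Qed.
Let Yred : reduced_nontrivial Y.
Proof. exact: (@boundary_reduced n C n3 Hx G phi lim e 2 isT n3 b c pb pc). Qed.

Let Yl s g : Y s g -> lstar phi g.
Proof.
by case: s => -[x ->]; apply/asboolP; eexists; rewrite -leg_left; eexists.
Qed.

Let ME g : M g <-> span (fun g => exists s, Y s g) g.
Proof.
split; apply: span_sub => {}g; last by move=> [[] h]; apply: mem_span; [right | left].
by move=> [h|h]; apply: mem_span; [exists false | exists true].
Qed.

(* Both boundary edges lie on different sides of the cut through e and e + 2. *)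
Lemma boundary_alt_len s w : alt Y s w -> (size w <= len (lstar phi) (word_eval w))%N.
Proof.
move=> aw; have gl := gen_lstar (all_vertices_gen n3 Hx lim).
have [d pd] : exists d, pos b d = 1%N by apply: pos_surj; lia.
have pSe : pos b (ordS e) = 0 by exact: pos_base.
have pbe : pos b e = n.-1.
  by move: pSe; rewrite pos_ordS; have := ltn_pos b e; case: eqP; lia.
have [a3 pa3] : exists a3, pos b a3 = 2%N by apply: pos_surj; lia.
have [d3 pd3] : exists d3, pos a3 d3 = n.-1 by apply: pos_surj; lia.
have p3 i : pos a3 i = if (2 <= pos b i)%N then (pos b i - 2)%N else (pos b i + n - 2)%N.
  by rewrite (pos_rebase b) pa3.
have p3e : pos a3 e = (n - 2).-1 by rewrite p3 pbe; case: ifP; lia.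
have pbb : pos b b = 0 by exact: pos_base.
have pbc : ordS c = e by rewrite /c ord_predK.
suff aw2 : alt (two (aset b 2 n) (aset b 0 2)) s w.
  by apply: (cut_alt_size n3 Hx lim _ _ aw2) (len_ball (gl _)).
apply: alt_weaken aw => -[] g /=.
- by apply: eset_hull_right; rewrite pbc /arc pbe; lia.
- by apply: eset_hull_left; rewrite /arc pbb.
- move=> h1 h2; apply: fset_eset; apply: (proj1 (edges_disjoint g)) => //.
  apply: (proj2 (@cut_sides n C n3 Hx G phi lim a3 (n - 2) (n - 3) e d3 _ _ _ p3e pd3 g _)).
  + by lia.
  + by lia.
  + by lia.
  + apply: hull_sub h2 => i; rewrite /arc p3; have := ltn_pos b i; case: ifP; lia.
  + by apply: (eset_hull_right _ h1); rewrite pbc /arc p3e; lia.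
- move=> h1 h2; apply: fset_eset; apply: (proj2 (edges_disjoint g)) => //.
  apply: (proj1 (@cut_sides n C n3 Hx G phi lim b 2 1 d e isT n3 isT pd pbe g h2)).
  by apply: (eset_hull_left _ h1); rewrite /arc pbb.
Qed.

Lemma boundary_sub g : M g -> core Z g.
Proof.
have pSb : pos e (ordS b) = 2%N by rewrite pos_ordS pb; case: eqP; lia.
have pSc : pos e (ordS c) = 0 by rewrite /c ord_predK.
move=> h; split; move: h; apply: span_sub => {}g [h|h].
- by apply: (eset_hull_left _ h); rewrite /arc pb.
- by apply: (eset_hull_right _ h); rewrite /arc pSc.
- by apply: (eset_hull_right _ h); rewrite /arc pSb; lia.
- by apply: (eset_hull_left _ h); rewrite /arc pc; lia.
Qed.

Lemma top_cut : reduced_nontrivial Z /\ forall g, core Z g -> M g.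
Proof.
have [_ rd h _] := @total_cut n C n3 Hx G phi lim e 2 isT n3 b c pb pc.
by split=> // g [h1 h2]; apply: h.
Qed.

Let Z1 s : Z s 1. Proof. by case: s; apply: span1. Qed.
Let ZM s x y : Z s x -> Z s y -> Z s (x * y). Proof. by case: s; apply: spanM. Qed.
Let ZV s x : Z s x -> Z s x^-1. Proof. by case: s; apply: hullV. Qed.

(** A shortest element [v'] of the double coset of [v] modulo [M] is still long, since its reduced
    length is the same. [conjugate_intersection] conjugates the common elements into edge groups by
    elements of [M]; by minimality [m1^-1 * v' * m2] stays long enough for the finiteness coming
    from the universal cover. *)
Lemma top_acyl : exists2 k, (0 < k)%N & forall s w, alt Z s w -> size w = k ->
  exists l : seq G, forall x, core Z x -> core Z ((word_eval w)^-1 * (x * word_eval w)) -> x \in l.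
Proof.
have gl := gen_lstar (all_vertices_gen n3 Hx lim); have sl := lstar_symm (phi := phi).
have [rZ cZ] := top_cut.
have [D hD] := four_point_nat (cay_symm sl) (cay_conn gl) star_sq.
have four w x y z : (len (lstar phi) (x^-1 * z) + len (lstar phi) (y^-1 * w) <=
   maxn (len (lstar phi) (x^-1 * y) + len (lstar phi) (z^-1 * w))
    (len (lstar phi) (y^-1 * z) + len (lstar phi) (x^-1 * w)) + D)%N.
  by rewrite -!gdist_cay.
(* [6 * D + 6] is the length that [conjugate_intersection] asks for, and [N.+1] exceeds the radius
   in [acyl]. *)
exists (6 * D + 6 + N.+1)%N => [|s w aw sw]; first by lia.
set v := word_eval w; have w0 : w <> [::] by move=> e0; move: sw; rewrite e0 /=; lia.
pose P k := exists m m', [/\ M m, M m' & len (lstar phi) (m * v * m') = k].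
have M1 : M 1 by exact: span1.
have MM x y : M x -> M y -> M (x * y) by exact: spanM.
have MV x : M x -> M x^-1 by apply: spanV => g [] /imgV; [left | right].
have [[m [m' [Mm Mm' ev]]] minP] : P (nat_min P) /\ forall k, P k -> (nat_min P <= k)%N.
  by apply: nat_minP; exists (len (lstar phi) (1 * v * 1)), 1, 1.
set v' := m * v * m' in ev.
have minv x y : M x -> M y -> (len (lstar phi) v' <= len (lstar phi) (x * v' * y))%N.
  move=> Mx My; rewrite ev; apply: minP; exists (x * m), (m' * y); split; [exact: MM | exact: MM |].
  by rewrite /v' !mulgA.
have lv : (6 * D + 6 + N.+1 <= len (lstar phi) v')%N.
  have [w1 [a1 s1 e1]] := alt_mull ZM ZV (boundary_sub Mm) w0 aw.
  have w10 : w1 <> [::] by move=> e0; move: s1; rewrite e0 sw /=; lia.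
  have [w2 [a2 s2 e2]] := alt_mulr ZM ZV (boundary_sub Mm') w10 a1.
  rewrite -sw -s1 -s2 /v' /v -e1 -e2.
  have [u [lu su eu]] := len_ball (gl (word_eval w2)).
  apply: leq_trans su; apply: (alt_size_le Z1 ZM ZV rZ a2) => // x /(allP lu)/asboolP[j hj].
  have := ltn_pos e j.
  by case: (ltnP (pos e j) 2) => h1 h2; [exists true | exists false];
    apply: (@vertex_hull _ _ _ _ _ j) => //; rewrite /arc; lia.
have lv6 : (6 * D + 6 <= len (lstar phi) v')%N by apply: leq_trans lv; apply: leq_addr.
have [|m1 [s1 [m2 [s2 [Mm1 Mm2 hconj]]]]] :=
  conjugate_intersection sl gl four Y1 YM YV Yred Yl boundary_alt_len lv6.
  by move=> x y /ME Mx /ME My; apply: minv.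
move/ME in Mm1; move/ME in Mm2.
have vert t g : Y t g -> img (phi (Vertex (if t then c else b))) g.
  by case: t => -[x ->]; rewrite -leg_left; eexists.
have nb : ~ ball (lstar phi) N (m1^-1 * v' * m2).
  move/len_le => h; have := minv _ _ (MV _ Mm1) Mm2; move: lv h.
  move: (len _ v') (len _ (m1^-1 * v' * m2)); clear; lia.
have [l hl] := acyl (if s1 then c else b) (if s2 then c else b) nb.
exists [seq m^-1 * (m1 * h * m1^-1) * m | h <- l] => x /cZ Mx /cZ Mx'.
have Mc : M (m * x * m^-1) by apply: (MM _ _ _ (MV _ Mm)); apply: (MM).
have ec : v'^-1 * (m * x * m^-1) * v' = m'^-1 * (v^-1 * (x * v)) * m'.
  by rewrite /v' !invgM !mulgA !mulgVK.
have [h1 h2] : Y s1 (m1^-1 * (m * x * m^-1) * m1) /\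
    Y s2 (m2^-1 * (v'^-1 * (m * x * m^-1) * v') * m2).
  apply: hconj; apply/ME => //; rewrite ec.
  by apply: (MM _ _ _ Mm'); apply: (MM) => //; apply: MV.
apply/mapP; exists (m1^-1 * (m * x * m^-1) * m1).
  apply: hl; first exact: vert.
  have -> : (m1^-1 * v' * m2)^-1 * (m1^-1 * (m * x * m^-1) * m1) * (m1^-1 * v' * m2) =
      m2^-1 * (v'^-1 * (m * x * m^-1) * v') * m2.
    by rewrite !invgM invgK !mulgA !mulgK.
  exact: vert.
by rewrite !mulgA !mulgK mulVg mul1g mulgVK.
Qed.

Section Gens.
Variables (T0 : forall j, seq (C (Edge j))).
Hypothesis T0_gen : forall j, generates (T0 j).
Local Notation tt := (te phi T0).
Let lM : pred G := fun s => sgen (tt c) s || sgen (tt b) s.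

Lemma gen_boundary g : M g <-> gen lM g.
Proof.
have sub j : (forall s, sgen (tt j) s -> lM s) -> forall h, eset phi j h -> gen lM h.
  move=> hj h /(gen_te phi T0_gen); apply: gen_sub => s hs.
  by apply: ball_gen (letter_ball _); apply: hj.
have lt j s : sgen (tt j) s -> eset phi j s.
  by move=> hs; apply/(gen_te phi T0_gen); apply: ball_gen (letter_ball hs).
split.
  move: g; apply: span_ind; [exact: gen1 | exact: genM | move=> g [|]; apply: sub => s hs].
    by rewrite /lM hs orbT.
  by rewrite /lM hs.
by apply: gen_sub => s /orP[/lt h|/lt h]; apply: (@mem_span _ _ s); [right | left].
Qed.

Variable S : bool -> seq G.
Hypothesis SE : forall s g, gen (sgen (S s)) g <-> Z s g.
Hypothesis S_sq : forall s, sq_hyperbolic (cay (sgen (S s))).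
Hypothesis S_letters : forall s x, lM x -> sgen (S s) x.
Hypothesis S_und : forall s, undistorted lM (sgen (S s)).

Lemma top_combination : undistorted (sgen (S true)) (sgen (S true ++ S false)) /\
  sq_hyperbolic (cay (sgen (S true ++ S false))).
Proof.
have XZ : (fun s => gen (sgen (S s))) = Z.
  by apply/funext => s; apply/funext => g; apply/propext.
have [rZ cZ] := top_cut; have [k k0 hk] := top_acyl.
have coreC g : core (fun s => gen (sgen (S s))) g -> gen lM g.
  by move=> hg; apply/gen_boundary/cZ; rewrite -XZ.
have rS : reduced_nontrivial (fun s => gen (sgen (S s))) by rewrite XZ.
have fl s : flow (S s) lM by exact: (flow_of_undistorted (@S_letters s) (S_und s) (S_sq s)).
have ac s w : alt (fun s => gen (sgen (S s))) s w -> size w = k -> exists l : seq G,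
    forall x, core (fun s => gen (sgen (S s))) x ->
    core (fun s => gen (sgen (S s))) ((word_eval w)^-1 * (x * word_eval w)) -> x \in l.
  by rewrite XZ; apply: hk.
split; first exact: (combination_undistorted S_letters coreC rS fl k0 ac true).
exact: (combination_sq_hyperbolic S_letters coreC rS fl k0 ac S_sq).
Qed.

End Gens.
End Top.

(** * Quasiconvexity *)

Section Quasiconvexity.
Variable G : groupType.
Local Open Scope group_scope.
Implicit Types (g h x : G) (S T : seq G).

Lemma qgeod_walk (l lC : pred G) K x (w : seq G) : (forall g, gen l g) ->
  (forall s, lC s -> l s) -> (forall n g, gen lC g -> ball l n g -> ball lC (K * n) g) ->
  geodw lC w -> qgeod (cay l) K x (walk x w).
Proof.
move=> gl lCl und [lw H]; split; first by rewrite path_walk (sub_all lCl).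
rewrite size_walk => i j /andP[ij jw]; rewrite !pt_walk gdist_cay // invgM -mulgA mulKg.
have e : word_eval (take j w) = word_eval (take i w) * word_eval (drop i (take j w)).
  by rewrite -word_eval_cat -[in RHS](@take_takel _ i j w) // cat_take_drop.
rewrite e mulKg.
have gv : geodw lC (drop i (take j w)).
  apply: (@geodw_sub _ _ (take i w) _ (drop j w)); rewrite catA.
  by rewrite -(@take_takel _ i j w) // cat_take_drop cat_take_drop.
have := und _ _ (gen_word gv.1) (len_ball (gl _)) => -[w' [lw2 sw2 ew2]].
have := gv.2 _ lw2 ew2; rewrite size_drop size_takel // => h.
exact: leq_trans h sw2.
Qed.

(* Add the generators T of the subgroup to S: then geodesic words in S and in T both
   label quasigeodesics, which stay close to a common geodesic. *)
Lemma undistorted_quasiconvex (R : realType) S0 S T : generates S0 -> generates S ->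
  sq_hyperbolic (cay (sgen S0)) -> undistorted (sgen T) (sgen S0) ->
  quasiconvex_subset R S [set g | gen (sgen T) g]%classic.
Proof.
move=> gS0 gS sq0 und; pose S2 := S ++ T.
have gl := generates_gen gS; have gl0 := generates_gen gS0.
have SS2 s : sgen S s -> sgen S2 s by rewrite /sgen !mem_cat => /orP[->|->]; rewrite ?orbT.
have TS2 s : sgen T s -> sgen S2 s by rewrite /sgen !mem_cat => /orP[->|->]; rewrite ?orbT.
have gl2 g : gen (sgen S2) g.
  by apply: gen_sub (gl g) => s /SS2 h; apply: ball_gen (letter_ball h).
have [A hA] := gen_seq_ball (sgen_symm (S := S0)) (fun s _ => gl0 s) (S := S2).
have [B hB] := gen_seq_ball (sgen_symm (S := S2)) (fun s _ => gl2 s) (S := S0).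
have [lam hlam] := gen_seq_ball (sgen_symm (S := S)) (fun s _ => gl s) (S := S2).
have sq2 : sq_hyperbolic (cay (sgen S2)).
  exact: (sq_hyperbolic_gens (sgen_symm (S := S2)) (sgen_symm (S := S0)) hA hB sq0).
have [k hk] : undistorted (sgen T) (sgen S2).
  apply: (undistorted_change _ _ hA und) => s hs; first exact: letter_ball hs.
  exact: ball_gen (letter_ball hs).
have rS := cay_symm (sgen_symm (S := S2)); have conn := cay_conn gl2.
have [D1 hD1] := morse rS conn sq2 k.
have [D2 hD2] := morse_conv rS conn sq2 lam.
exists (lam * (D2 + D1))%N%:R => g h w /= Ag Ah [lw ew sw] i iw.
have swl : geodw (sgen S) w.
  split=> // w' lw' e'; rewrite -(ler_nat R) sw word_distE // ler_nat.
  by apply: len_le; exists w'; split=> //; rewrite e' -ew mulKg.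
have gd : gen (sgen T) (g^-1 * h).
  by apply: genM Ah; apply: genV Ag; apply: sgen_symm.
have [v vl ev] := geodw_ex gd.
have qw : qgeod (cay (sgen S2)) lam g (walk g w).
  by apply: (qgeod_walk g gl2 SS2) swl => n x _ hx; apply: ball_mul hlam hx.
have qv : qgeod (cay (sgen S2)) k g (walk g v) by apply: (qgeod_walk g gl2 TS2 hk) vl.
have [p pg pl] := geod_ex conn g h.
have lw' : last g p = last g (walk g w) by rewrite last_walk pl ew.
have lv' : last g p = last g (walk g v) by rewrite last_walk pl ev mulVKg.
have [|i' i'p d2] := hD2 g p (walk g w) pg qw lw' i; first by rewrite size_walk.
have [j' j'v d1] := hD1 g p (walk g v) pg qv lv' i' i'p.
rewrite !pt_walk in d1 d2; exists (g * word_eval (take j' v)).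
  apply: genM Ag _; apply: gen_word; apply/allP => s /mem_take; exact: (allP vl.1).
rewrite word_distE // ler_nat; apply: len_le; apply: (ball_mul hlam).
apply/near_cay; have [q [q1 q2 q3]] := gdist_near conn (g * word_eval (take i w)) (g * word_eval (take j' v)).
exists q; split=> //; apply: leq_trans q3 _.
apply: leq_trans (gdist_tri conn (pt g p i') _ _) _; exact: leq_add.
Qed.

End Quasiconvexity.

(** * The group of an edge inside the direct limit *)

Section EdgeSubgroup.
Variables (n : nat) (C : polygon_of_groups n).
Hypothesis n3 : (3 < n)%N.
Hypothesis Hx : edge_groups_intersect_in_face C.
Variables (G : groupType) (phi : cocone C G).
Hypothesis lim : is_direct_limit phi.
Variables (e : 'I_n) (H : groupType) (phiH : cocone (edge_restriction C e) H).
Hypothesis limH : is_direct_limit phiH.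
Implicit Types (j : 'I_n).

Lemma arc_edge j : arc e 0 2 j = subface (Vertex j) (Edge e).
Proof.
have n1 : (1 < n)%N by lia.
have pe := pos_base e; have pSe : pos e (ordS e) = 1%N by rewrite pos_ordS pe; case: eqP; lia.
rewrite /arc /subface /=; apply/idP/orP => [h|[/eqP->|/eqP->]]; last 2 first.
- by rewrite pe.
- by rewrite pSe.
have [h0|h0] : pos e j = 0 \/ pos e j = 1%N by lia.
  by left; apply/eqP/(@pos_inj _ e); rewrite h0 pe.
by right; apply/eqP/(@pos_inj _ e); rewrite h0 pSe.
Qed.

Definition edge_fam : vfam C H := fun j =>
  match pselect (subface (Vertex j) (Edge e)) with
  | left p => phiH (exist (fun s => subface s (Edge e)) (Vertex j) p)
  | right _ => trivial_mor (C (Vertex j)) H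
  end.

Lemma edge_famE j (p : subface (Vertex j) (Edge e)) x :
  edge_fam j x = phiH (exist (fun s => subface s (Edge e)) (Vertex j) p) x.
Proof. by rewrite /edge_fam; case: pselect => [p'|[] //]; rewrite (bool_irrelevance p' p). Qed.

Lemma edge_face (p : subface (Edge e) (Edge e)) x :
  edge_fam e (lm C e x) = phiH (exist (fun s => subface s (Edge e)) (Edge e) p) x /\
  edge_fam (ordS e) (rm C e x) = phiH (exist (fun s => subface s (Edge e)) (Edge e) p) x.
Proof.
have p1 : subface (Vertex e) (Edge e) by rewrite /subface /= eqxx.
have p2 : subface (Vertex (ordS e)) (Edge e) by rewrite /subface /= eqxx orbT.
split.
  rewrite (edge_famE p1).
  exact: (@legE _ _ _ _ phiH (exist (fun s => subface s (Edge e)) (Edge e) p)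
    (exist (fun s => subface s (Edge e)) (Vertex e) p1) (edge_left e) x).
rewrite (edge_famE p2).
exact: (@legE _ _ _ _ phiH (exist (fun s => subface s (Edge e)) (Edge e) p)
  (exist (fun s => subface s (Edge e)) (Vertex (ordS e)) p2) (edge_right e) x).
Qed.

(** [H] and the colimit [L] over the two endpoints map to each other, and [t] after [w] is the
    identity by uniqueness. So [iota], which is [w] followed by the embedding of [L], is
    injective. *)
Lemma edge_subgroup_embeds : exists iota : {multiplicative H -> G},
  [/\ forall s x, iota (phiH s x) = phi (val s) x, injective iota &
      forall g, range iota g <-> hull (arc e 0 2) (vleg phi) g].
Proof.
have n1 : (1 < n)%N by lia.
have [b pb] : exists b, pos e b = 1%N by apply: pos_surj; lia.
have [c pc] : exists c, pos e c = n.-1 by apply: pos_surj; lia.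
have [_ _ _ [L [h [v [[kh uh gh _] vI vh]]]]] := @total_cut n C n3 Hx G phi lim e 2 isT n3 b c pb pc.
have psiE (s s' : {s | subface s (Edge e)}) (hs : relpre val (@proper_face n) s' s) x :
    phi (val s') (local_map (edge_restriction C e) hs x) = phi (val s) x by exact: legE.
pose psi : cocone (edge_restriction C e) G := Cocone psiE.
have [iota hiota iotaU] := limH psi.
have vface s x : subface s (Edge e) -> v (face_leg h e s x) = phi s x.
  case: s x => [|e'|j] x // hs; last by rewrite /= vh // arc_edge.
  have E : e' = e by move: hs; rewrite /subface /= orbF => /eqP[].
  by subst e'; rewrite /= vh ?arc_edge /subface /= ?eqxx // /vleg leg_left.
have legL (s s' : {s | subface s (Edge e)}) (hs : relpre val (@proper_face n) s' s) x :
    face_leg h e (val s') (local_map (edge_restriction C e) hs x) = face_leg h e (val s) x.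
  by apply: vI; rewrite !vface ?(valP s) ?(valP s') //; apply: legE.
have [w hw _] := limH (Cocone legL).
have iw y : iota y = v (w y).
  symmetry; apply: (iotaU (v \o w)) => s x /=; rewrite hw /= vface //; exact: (valP s).
have kH : compat (arc e 0 2) edge_fam.
  move=> e' h1 h2 x; have E : e' = e.
    apply: (@pos_inj _ e); move: h1 h2; rewrite /arc pos_ordS pos_base; case: eqP; lia.
  subst e'; have p : subface (Edge e) (Edge e) by rewrite /subface eqxx.
  by have [-> ->] := edge_face p x.
have [t ht] := uh H edge_fam kH.
have [idH _ idU] := limH phiH.
have tw y : t (w y) = y.
  have h1 : idfun =1 idH by apply: (idU (idfun : {multiplicative H -> H})).
  rewrite -[RHS]/(idfun y) h1; apply: (idU (t \o w)) => -[[|e'|j] p] x //=.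
  - have E : e' = e by have := p; rewrite /subface /= orbF => /eqP[].
    subst e'; rewrite hw /= ht; last by rewrite arc_edge /subface /= eqxx.
    by have [-> _] := edge_face p x.
  - by rewrite hw /= ht ?arc_edge // (edge_famE p).
exists iota; split=> //.
  by move=> x y; rewrite !iw => /vI e0; rewrite -(tw x) e0 tw.
move=> g; split.
  move=> [y _ <-]; rewrite iw; apply/(hull_img gh vh); by exists (w y).
move: g; apply: span_ind.
- by exists 1%g => //; rewrite mor1.
- by move=> x y [x' _ <-] [y' _ <-]; exists (x' * y')%g => //; rewrite gmulfM.
- move=> _ [j hj [x ->]]; rewrite arc_edge in hj.
  by exists (phiH (exist (fun s => subface s (Edge e)) (Vertex j) hj) x) => //; rewrite hiota.
Qed.

End EdgeSubgroup.

Theorem theorem5p1 (R : realType) (n : nat) (r : R) (hn : (4 <= n)%N)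
    (hr : 0 < r) (C : polygon_of_groups n)
    (G : groupType) (phi : cocone C G) (hG : is_direct_limit phi)
    (hC : complex_of_hyperbolic_groups r phi)
    (h1 : edge_groups_intersect_in_face C)
    (h2 : hyperbolic_space (cover_dist r phi))
    (h3 : acylindrical_action r phi)
    (e : 'I_n) (H : groupType) (phiH : cocone (edge_restriction C e) H)
    (hH : is_direct_limit phiH) :
  hyperbolic_group R G /\
  exists2 iota : {multiplicative H -> G},
    forall s x, iota (phiH s x) = phi (val s) x &
    quasiconvex_subgroup R iota.
Proof.
have [hyp qi _] := hC; have genv := all_vertices_gen hn h1 hG.
(* From here on the universal cover enters only through these two facts about the length given by
   all vertex groups. *)
have star_sq := cover_sq hn hr genv h2; have [N hN] := cover_acyl hn hr genv h3.
have vgens j : {S : seq (C (Vertex j)) | generates S & sq_hyperbolic (cay (sgen S))}.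
  by apply: cid2; apply: hyperbolic_group_sq (hyp _).
have egens i : {S : seq (C (Edge i)) | generates S & sq_hyperbolic (cay (sgen S))}.
  by apply: cid2; apply: hyperbolic_group_sq (hyp _).
pose S0 j := s2val (vgens j); pose T0 i := s2val (egens i).
have gS0 j : generates (S0 j) := s2valP (vgens j).
have sS0 j : sq_hyperbolic (cay (sgen (S0 j))) := s2valP' (vgens j).
have gT0 i : generates (T0 i) := s2valP (egens i).
have uL i : undistorted (sgen (map (lm C i) (T0 i))) (sgen (S0 i)).
  exact: (qi_undistorted (@lm_inj n C i) (qi _ _ (edge_left i)) (gT0 i) (gS0 i)).
have uR i : undistorted (sgen (map (rm C i) (T0 i))) (sgen (S0 (ordS i))).
  exact: (qi_undistorted (@rm_inj n C i) (qi _ _ (edge_right i)) (gT0 i) (gS0 _)).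
have arcs := arc_hyperbolic hn h1 hG gS0 sS0 gT0 uL uR hN.
(* The cut separates the endpoints of [e] from the other vertices, so that [H] is one of its sides;
   it crosses the edges [b] and [c], and the second arc starts at [a]. *)
pose b := ordS e; pose c := ord_pred e; pose a := ordS b.
have pe : pos e e = 0 by exact: pos_base.
have pb : pos e b = 1%N by rewrite /b pos_ordS pe; case: eqP; lia.
have pa : pos e a = 2%N by rewrite /a pos_ordS pb; case: eqP; lia.
have pc : pos e c = n.-1.
  have : pos e (ordS c) = 0 by rewrite /c ord_predK.
  by rewrite pos_ordS; have := ltn_pos e c; case: eqP; lia.
have pac : pos a c = (n - 2).-1 by rewrite (pos_rebase e) pa pc; case: ifP; lia.
have [SL [gL sL lL uSL]] := arcs e b 2 isT hn pb.
have [||SR [gR sR lR uSR]] := arcs a c (n - 2)%N _ _ pac; [by lia | by lia |].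
have eR : arc a 0 (n - 2) = arc e 2 n.
  by apply/funext => j; rewrite /arc (pos_rebase e) pa; have := ltn_pos e j; case: ifP; lia.
rewrite eR in gR; rewrite /a ordSK in lR uSR.
(* Seen from [a], the two boundary edges come in the opposite order. *)
have swap : (fun s => sgen (te phi T0 b) s || sgen (te phi T0 c) s) =
  (fun s => sgen (te phi T0 c) s || sgen (te phi T0 b) s) by apply/funext => s; rewrite orbC.
rewrite swap in uSR; have lR' s : sgen (te phi T0 c) s || sgen (te phi T0 b) s -> sgen SR s.
  by rewrite orbC; apply: lR.
pose S (s : bool) := if s then SL else SR.
have [und sq] : undistorted (sgen (S true)) (sgen (S true ++ S false)) /\
    sq_hyperbolic (cay (sgen (S true ++ S false))).
  apply: (top_combination hn h1 hG hN star_sq gT0 (e := e)).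
  - by case.
  - by case.
  - by case.
  - by case.
have gSG : generates (SL ++ SR).
  move=> g; suff [w lw ew] : gen (sgen (SL ++ SR)) g by exists w.
  move: g {genv} (genv g); apply: span_ind; [exact: gen1 | exact: genM |].
  move=> g [j _ hj]; have := ltn_pos e j; case: (ltnP (pos e j) 2) => h4 h5.
    have /gL : hull (arc e 0 2) (vleg phi) g by apply: (vertex_hull _ hj); rewrite /arc; lia.
    apply: gen_sub => s hs; apply: ball_gen (letter_ball _).
    by move: hs; rewrite /sgen !mem_cat => /orP[->|->]; rewrite ?orbT.
  have /gR : hull (arc e 2 n) (vleg phi) g by apply: (vertex_hull _ hj); rewrite /arc; lia.
  apply: gen_sub => s hs; apply: ball_gen (letter_ball _).
  by move: hs; rewrite /sgen !mem_cat => /orP[->|->]; rewrite ?orbT.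
split; first exact: sq_hyperbolic_group gSG sq.
have [iota [hi iI ir]] := edge_subgroup_embeds hn h1 hG hH.
exists iota => //; split=> // S1 gS1.
have -> : range iota = [set g | gen (sgen SL) g]%classic.
  by apply/funext => g; apply/propext; split; [move/ir/gL | move/gL/ir].
exact: undistorted_quasiconvex gSG gS1 sq und.
Qed.
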